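(* Let $f$ be a transcendental entire function, $z_0$ a repelling or parabolic fixed point of $f$, and assume that there is an admissible expansion domain $U$ of $f$ at $z_0$. Suppose that for every periodic external address $\underline s$ there exists a periodic ray of $f$ with external address $\underline s$. Then there is a periodic ray of $f$ landing at $z_0$.
   Context: $S(f)$ is the closure of the set of finite critical and asymptotic values; $P(f)=\overline{\bigcup_{n\ge0}f^n(S(f))}$; $I(f)=\{z: f^n(z)\to\infty\}$. Admissible expansion domain of $f$ at $z_0$: a domain $U\subset\mathbb C$ with (a) $U\subset\mathbb C\setminus(P(f)\cup\{z_0\})$ and $\infty$ an isolated boundary point of $U$; (b) $f^{-1}(U)\subsetneq U$; (c) $U$ finitely connected and $U\ne\mathbb C\setminus P(f)$; (d) $z_0\in\partial U$ accessible from $U$, and $K_0\setminus\{z_0\}$ has finitely many components where $K_0$ is the component of $\mathbb C\setminus U$ containing $z_0$. (In particular $P(f)$ is bounded.) Tracts and fundamental domains: fix a Jordan domain $D\supset P(f)$, put $A=\mathbb C\setminus\overline D$; the components of $f^{-1}(A)$ are the tracts; fix a curve $\alpha\subset A$ from $\partial D$ to $\infty$ disjoint from all tracts; the components of $T\setminus f^{-1}(\alpha)$, $T$ a tract, are fundamental domains. A ray tail is an injective curve $g:[t_0,\infty)\to I(f)$ ($t_0>0$) with $f^n(g(t))\to\infty$ as $t\to\infty$ for each $n$, and $f^n\circ g\to\infty$ uniformly in $t$ as $n\to\infty$. A dynamic ray is a maximal injective curve $g:(0,\infty)\to I(f)$ whose restriction to $[t_0,\infty)$ is a ray tail for every $t_0>0$;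 its external address is the sequence $F_0F_1F_2\dots$ of fundamental domains with $f^n(g([t_0,\infty)))\subset F_n$ for all $n\ge0$ and some $t_0$. An external address is periodic if it is fixed by some iterate $\sigma^n$, $n\ge1$, of the shift $\sigma(F_0F_1F_2\dots)=F_1F_2\dots$. A periodic ray is an injective curve $g:(0,\infty)\to\mathbb C$ with $g(t)\to\infty$ as $t\to\infty$ and $g(2t)=f^n(g(t))$ for some $n\ge1$ and all $t$ (it is a dynamic ray); it lands at $z_0$ if $\lim_{t\to0}g(t)=z_0$. *)

(* Defs.v *)
From Stdlib Require Import Reals Lra List.
Open Scope R_scope.

Definition Cplx : Type := (R * R)%type.
Definition Cadd (z w : Cplx) : Cplx := (fst z + fst w, snd z + snd w).
Definition Csub (z w : Cplx) : Cplx := (fst z - fst w, snd z - snd w).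
Definition Cmul (z w : Cplx) : Cplx :=
  (fst z * fst w - snd z * snd w, fst z * snd w + snd z * fst w).
Definition C0 : Cplx := (0, 0).
Definition C1 : Cplx := (1, 0).
Definition Cnorm (z : Cplx) : R := sqrt (fst z ^ 2 + snd z ^ 2).
Fixpoint Cpow (z : Cplx) (n : nat) : Cplx :=
  match n with O => C1 | S k => Cmul z (Cpow z k) end.

Fixpoint poly_eval (l : list Cplx) (z : Cplx) : Cplx :=
  match l with nil => C0 | a :: l' => Cadd a (Cmul z (poly_eval l' z)) end.

Fixpoint iter (n : nat) (f : Cplx -> Cplx) (z : Cplx) : Cplx :=
  match n with O => z | S k => f (iter k f z) end.

Definition has_cderiv (f : Cplx -> Cplx) (z L : Cplx) : Prop :=
  forall eps, eps > 0 -> exists delta, delta > 0 /\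
    forall h, 0 < Cnorm h < delta ->
      Cnorm (Csub (Csub (f (Cadd z h)) (f z)) (Cmul L h)) <= eps * Cnorm h.

Definition entire (f : Cplx -> Cplx) : Prop := forall z, exists L, has_cderiv f z L.

Definition transcendental_entire (f : Cplx -> Cplx) : Prop :=
  entire f /\ ~ (exists l : list Cplx, forall z, f z = poly_eval l z).

Definition repelling_fixed_point (f : Cplx -> Cplx) (z0 : Cplx) : Prop :=
  f z0 = z0 /\ exists L, has_cderiv f z0 L /\ Cnorm L > 1.

Definition parabolic_fixed_point (f : Cplx -> Cplx) (z0 : Cplx) : Prop :=
  f z0 = z0 /\ exists L, has_cderiv f z0 L /\
    exists q : nat, (q >= 1)%nat /\ Cpow L q = C1.

Definition CSet := Cplx -> Prop.

Definition open_set (A : CSet) : Prop :=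
  forall z, A z -> exists r, r > 0 /\ forall w, Cnorm (Csub w z) < r -> A w.

Definition closure (A : CSet) : CSet :=
  fun z => forall r, r > 0 -> exists w, A w /\ Cnorm (Csub w z) < r.

Definition boundary (A : CSet) : CSet :=
  fun z => closure A z /\ closure (fun w => ~ A w) z.

Definition connected (A : CSet) : Prop :=
  ~ exists O1 O2 : CSet, open_set O1 /\ open_set O2 /\
      (forall z, A z -> O1 z \/ O2 z) /\
      (forall z, A z -> O1 z -> O2 z -> False) /\
      (exists z, A z /\ O1 z) /\ (exists z, A z /\ O2 z).

Definition domain (U : CSet) : Prop :=
  open_set U /\ connected U /\ exists z, U z.

Definition bounded (A : CSet) : Prop := exists M, forall z, A z -> Cnorm z <= M.

Definition comp (A : CSet) (x : Cplx) : CSet :=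
  fun z => exists B : CSet, connected B /\ (forall w, B w -> A w) /\ B x /\ B z.

Definition is_component (A K : CSet) : Prop :=
  exists x, A x /\ forall z, K z <-> comp A x z.

Definition finitely_many_components (A : CSet) : Prop :=
  exists xs : list Cplx, (forall x, In x xs -> A x) /\
    forall z, A z -> exists x, In x xs /\ comp A x z.

Definition cont_on (I : R -> Prop) (g : R -> Cplx) : Prop :=
  forall t, I t -> forall eps, eps > 0 -> exists delta, delta > 0 /\
    forall s, I s -> Rabs (s - t) < delta -> Cnorm (Csub (g s) (g t)) < eps.

Definition inj_on (I : R -> Prop) (g : R -> Cplx) : Prop :=
  forall s t, I s -> I t -> g s = g t -> s = t.

Definition tends_to_infty (g : R -> Cplx) : Prop :=
  forall M, exists T, forall t, t >= T -> Cnorm (g t) > M.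

Definition critical_value (f : Cplx -> Cplx) (a : Cplx) : Prop :=
  exists c, f c = a /\ has_cderiv f c C0.

Definition asymptotic_value (f : Cplx -> Cplx) (a : Cplx) : Prop :=
  exists g : R -> Cplx, cont_on (fun t => t >= 0) g /\ tends_to_infty g /\
    forall eps, eps > 0 -> exists T, forall t, t >= T -> Cnorm (Csub (f (g t)) a) < eps.

Definition S_f (f : Cplx -> Cplx) : CSet :=
  closure (fun a => critical_value f a \/ asymptotic_value f a).

Definition P_f (f : Cplx -> Cplx) : CSet :=
  closure (fun w => exists n s, S_f f s /\ w = iter n f s).

Definition I_f (f : Cplx -> Cplx) : CSet :=
  fun z => forall M, exists N, forall n, (n >= N)%nat -> Cnorm (iter n f z) > M.

Definition admissible_expansion_domain (f : Cplx -> Cplx) (z0 : Cplx) (U : CSet) : Prop :=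
  domain U /\
  (forall z, U z -> ~ P_f f z /\ z <> z0) /\
  (exists R0, forall z, Cnorm z > R0 -> U z) /\      (* infinity is an isolated boundary point *)
  (forall z, U (f z) -> U z) /\ (exists z, U z /\ ~ U (f z)) /\
  finitely_many_components (fun z => ~ U z) /\
  (exists z, ~ (U z <-> ~ P_f f z)) /\
  boundary U z0 /\
  (exists gam : R -> Cplx, cont_on (fun t => 0 <= t <= 1) gam /\
     (forall t, 0 <= t < 1 -> U (gam t)) /\ gam 1 = z0) /\
  finitely_many_components (fun z => comp (fun w => ~ U w) z0 z /\ z <> z0).

Definition jordan_domain (D : CSet) : Prop :=
  exists gam : R -> Cplx, cont_on (fun t => 0 <= t <= 1) gam /\ gam 0 = gam 1 /\
    inj_on (fun t => 0 <= t < 1) gam /\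
    is_component (fun z => ~ exists t, 0 <= t <= 1 /\ z = gam t) D /\
    bounded D.

Definition outer (D : CSet) : CSet := fun z => ~ closure D z.

Definition tract (f : Cplx -> Cplx) (D : CSet) (T : CSet) : Prop :=
  is_component (fun z => outer D (f z)) T.

Definition admissible_alpha (f : Cplx -> Cplx) (D : CSet) (alpha : R -> Cplx) : Prop :=
  cont_on (fun t => t >= 0) alpha /\ inj_on (fun t => t >= 0) alpha /\
  boundary D (alpha 0) /\ (forall t, t > 0 -> outer D (alpha t)) /\
  tends_to_infty alpha /\
  (forall t, t >= 0 -> ~ outer D (f (alpha t))).

Definition fundamental_domain (f : Cplx -> Cplx) (D : CSet) (alpha : R -> Cplx) (F : CSet) : Prop :=
  exists T, tract f D T /\
    is_component (fun z => T z /\ ~ exists t, t >= 0 /\ f z = alpha t) F.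

Definition external_address (f : Cplx -> Cplx) (D : CSet) (alpha : R -> Cplx)
  (s : nat -> CSet) : Prop :=
  forall n, fundamental_domain f D alpha (s n).

Definition periodic_address (s : nat -> CSet) : Prop :=
  exists n, (n >= 1)%nat /\ forall k z, s (k + n)%nat z <-> s k z.

Definition periodic_ray (f : Cplx -> Cplx) (g : R -> Cplx) : Prop :=
  cont_on (fun t => t > 0) g /\ inj_on (fun t => t > 0) g /\ tends_to_infty g /\
  exists n, (n >= 1)%nat /\ forall t, t > 0 -> g (2 * t) = iter n f (g t).

Definition ray_has_address (f : Cplx -> Cplx) (g : R -> Cplx) (s : nat -> CSet) : Prop :=
  exists t0, t0 > 0 /\ forall n t, t >= t0 -> s n (iter n f (g t)).

Definition lands_at (g : R -> Cplx) (z0 : Cplx) : Prop :=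
  forall eps, eps > 0 -> exists delta, delta > 0 /\
    forall t, 0 < t < delta -> Cnorm (Csub (g t) z0) < eps.

(* Main.v *)
(* Write p0 + e^w for points far from a point p0 of D. No iterate of f has a singular value in the
   exterior of D, so a backward orbit starting there extends to a tower of inverse branches of the
   iterates over a half-plane of the variable w. All branches omit z0; by Koebe distortion, convergence
   of the tower to z0 does not depend on w, and comparison with an escaping point (whose iterates never
   return) shows that the branches of large order contract uniformly.

   Start with a backward orbit that converges to z0 inside a repelling sector, and repeat: move its first
   entry outwards to a large circle and drop the first entry. By contraction the orbits keep entering the
   sector at a bounded index, so by compactness two of them, the i-th and the j-th, belong to the same
   tower. The fundamental domains met in between form a periodic address; let g be its ray. Since D and
   alpha together join p0 to infinity, the logarithms along g are determined, and running down the address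
   identifies g(t / 2^(pk)), p = j - i, with the entry of index npk of the tower over the logarithm of
   g(t), n being the period of g. These entries tend to z0 uniformly on compact sets. *)
From Stdlib Require Import Reals Lra Lia List ZArith Bool Permutation Classical ClassicalEpsilon FunctionalExtensionality.
From Coquelicot Require Import Coquelicot.
Require Import Defs.
Open Scope R_scope.

(** * Complex derivatives *)

(** Fundamental domains come as connected sets, not as paths with a homotopy class, so the delicate
    point is that a logarithm or an inverse branch carried through such a set is single valued.
    Connectedness is converted into finite chains of small steps at uniform depth. A closed chain
    has trivial monodromy as soon as every obstruction to lifting is joined to infinity by short
    steps through obstructions; this is proved by pushing closed walks on a fine square lattice. The
    principle is applied to logarithms in the complement of D and alpha, and to f over the
    logarithmic plane. Contraction alone does not bound the index of entry into the sector: at a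
    parabolic point an orbit may hesitate near the side of the sector. Only points whose orbit later
    gets away from z0 matter, and when such points leave the sector they do so with a margin
    depending on the sector alone. An orbit that has moved little can then afford to lose q entries
    in q steps. The escaping point used for the contraction is itself obtained from the assumption
    on rays, applied to a constant address. *)

Lemma Cmod_tri (a b c : C) : Cmod (a - c) <= Cmod (a - b) + Cmod (b - c).
Proof.
  replace (a - c)%C with ((a - b) + (b - c))%C by ring. apply Cmod_triangle.
Qed.

Lemma Cmod_sym (a b : C) : Cmod (a - b) = Cmod (b - a).
Proof. rewrite <- Cmod_opp. f_equal. ring. Qed.

Lemma Cmod_sub_eq (a : C) : Cmod (a - a) = 0.
Proof. replace (a - a)%C with (RtoC 0) by ring. apply Cmod_0. Qed.

Lemma Cmod_sub_0 (a b : C) : Cmod (a - b) = 0 -> a = b.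
Proof.
  intros H. apply Cmod_eq_0 in H.
  replace a with ((a - b) + b)%C by ring. rewrite H. ring.
Qed.

Lemma Cmod_sub_pos (a b : C) : a <> b -> 0 < Cmod (a - b).
Proof.
  intros H. destruct (Cmod_ge_0 (a - b)) as [h|h]; [exact h|].
  symmetry in h. apply Cmod_sub_0 in h. contradiction.
Qed.

Lemma Cmod_sub_neq (a b : C) : 0 < Cmod (a - b) -> a <> b.
Proof. intros H E. rewrite E, Cmod_sub_eq in H. lra. Qed.

Lemma Cmod_le_add (a b : C) : Cmod a <= Cmod (a - b) + Cmod b.
Proof. replace a with ((a - b) + b)%C at 1 by ring. apply Cmod_triangle. Qed.

Lemma Cmod_small_eq (a b : C) : (forall e, e > 0 -> Cmod (a - b) <= e) -> a = b.
Proof.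
  intros H. apply Cmod_sub_0. destruct (Cmod_ge_0 (a - b)) as [h|h]; [|auto].
  specialize (H (Cmod (a - b) / 2)). lra.
Qed.

Lemma Csub_neq_0 (a b : C) : a <> b -> (a - b)%C <> 0%C.
Proof. intros H E. apply H. replace a with ((a - b) + b)%C by ring. rewrite E. ring. Qed.

(** * Continuity relative to a set *)

Definition dC (a b : C) : R := Cmod (a - b).
Definition dR (a b : R) : R := Rabs (a - b).

(** The distance is a parameter so that the same rules serve curves, with [dR], and maps of the
    plane, with [dC]; [x] need not belong to [K]. *)
Definition cwi {X : Type} (d : X -> X -> R) (K : X -> Prop) (f : X -> C) (x : X) : Prop :=
  forall e, e > 0 -> exists r, r > 0 /\
    forall y, K y -> d y x < r -> Cmod (f y - f x) < e.

Definition full {X : Type} : X -> Prop := fun _ => True.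
Notation cts f z := (cwi dC full f z).

Section Continuity.
Context {X : Type} (d : X -> X -> R) (K : X -> Prop).

Lemma cwi_const c x : cwi d K (fun _ => c) x.
Proof. intros e he. exists 1. split; [lra|]. intros. rewrite Cmod_sub_eq. lra. Qed.

Lemma cwi_plus f g x : cwi d K f x -> cwi d K g x -> cwi d K (fun y => f y + g y)%C x.
Proof.
  intros hf hg e he. destruct (hf (e/2)) as [r1 [h1 H1]]; [lra|].
  destruct (hg (e/2)) as [r2 [h2 H2]]; [lra|].
  exists (Rmin r1 r2). split; [apply Rmin_pos; lra|]. intros y Ky Hy.
  specialize (H1 y Ky (Rlt_le_trans _ _ _ Hy (Rmin_l _ _))).
  specialize (H2 y Ky (Rlt_le_trans _ _ _ Hy (Rmin_r _ _))).
  replace (f y + g y - (f x + g x))%C with ((f y - f x) + (g y - g x))%C by ring.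
  eapply Rle_lt_trans; [apply Cmod_triangle|]. lra.
Qed.

Lemma cwi_mult f g x : cwi d K f x -> cwi d K g x -> cwi d K (fun y => f y * g y)%C x.
Proof.
  intros hf hg e he.
  set (A := Cmod (f x)). set (B := Cmod (g x)).
  assert (hA : 0 <= A) by apply Cmod_ge_0. assert (hB : 0 <= B) by apply Cmod_ge_0.
  assert (pa : 0 < e / (2 * (A + 1))) by (apply Rdiv_lt_0_compat; lra).
  assert (pb : 0 < e / (2 * (B + 1))) by (apply Rdiv_lt_0_compat; lra).
  destruct (hf (Rmin 1 (e / (2 * (B + 1))))) as [r1 [h1 H1]]; [apply Rmin_pos; lra|].
  destruct (hg (e / (2 * (A + 1)))) as [r2 [h2 H2]]; [lra|].
  exists (Rmin r1 r2). split; [apply Rmin_pos; lra|]. intros y Ky Hy.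
  specialize (H1 y Ky (Rlt_le_trans _ _ _ Hy (Rmin_l _ _))).
  specialize (H2 y Ky (Rlt_le_trans _ _ _ Hy (Rmin_r _ _))).
  assert (H1a := Rlt_le_trans _ _ _ H1 (Rmin_l _ _)).
  assert (H1b := Rlt_le_trans _ _ _ H1 (Rmin_r _ _)).
  replace (f y * g y - f x * g x)%C with (f y * (g y - g x) + (f y - f x) * g x)%C by ring.
  eapply Rle_lt_trans; [apply Cmod_triangle|]. rewrite !Cmod_mult.
  assert (Cmod (f y) <= A + 1).
  { pose proof (Cmod_le_add (f y) (f x)). unfold A. lra. }
  assert (e1 : (A + 1) * (e / (2 * (A + 1))) = e / 2) by (field; lra).
  assert (e2 : (B + 1) * (e / (2 * (B + 1))) = e / 2) by (field; lra).
  fold B. pose proof (Cmod_ge_0 (f y)). pose proof (Cmod_ge_0 (f y - f x)).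
  pose proof (Cmod_ge_0 (g y - g x)).
  assert (Cmod (f y) * Cmod (g y - g x) <= (A + 1) * Cmod (g y - g x))
    by (apply Rmult_le_compat_r; lra).
  assert ((A + 1) * Cmod (g y - g x) < (A + 1) * (e / (2 * (A + 1))))
    by (apply Rmult_lt_compat_l; lra).
  assert (Cmod (f y - f x) * B <= (B + 1) * (e / (2 * (B + 1)))).
  { apply Rle_trans with ((e / (2 * (B + 1))) * B).
    - apply Rmult_le_compat_r; lra.
    - nra. }
  lra.
Qed.

Lemma cwi_ext f g x : (forall y, f y = g y) -> cwi d K f x -> cwi d K g x.
Proof.
  intros E H e he. destruct (H e he) as [r [hr Hr]]. exists r. split; auto.
  intros y. rewrite <- !E. auto.
Qed.

Lemma cwi_opp f x : cwi d K f x -> cwi d K (fun y => - f y)%C x.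
Proof.
  intros H. apply cwi_ext with (fun y => (RtoC (-1)) * f y)%C.
  { intros; apply injective_projections; simpl; ring. }
  apply cwi_mult; auto using cwi_const.
Qed.

Lemma cwi_minus f g x : cwi d K f x -> cwi d K g x -> cwi d K (fun y => f y - g y)%C x.
Proof. intros. apply cwi_plus; auto. apply cwi_opp; auto. Qed.

Lemma cwi_inv f x : cwi d K f x -> f x <> 0%C -> cwi d K (fun y => / f y)%C x.
Proof.
  intros H h0 e he. assert (p := proj1 (Cmod_gt_0 _) h0). set (A := Cmod (f x)) in *.
  destruct (H (Rmin (A/2) (e * (A * A) / 2))) as [r [hr Hr]].
  { apply Rmin_pos; [lra|]. assert (0 < A * A) by nra. nra. }
  exists r. split; auto. intros y Ky Hy. specialize (Hr y Ky Hy).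
  assert (Ha := Rlt_le_trans _ _ _ Hr (Rmin_l _ _)).
  assert (Hb := Rlt_le_trans _ _ _ Hr (Rmin_r _ _)).
  assert (hy : A / 2 < Cmod (f y)).
  { pose proof (Cmod_le_add (f x) (f y)). rewrite Cmod_sym in H0. fold A in H0. lra. }
  assert (n0 : f y <> 0%C) by (apply Cmod_gt_0; lra).
  replace (/ f y - / f x)%C with ((f x - f y) / (f y * f x))%C by (field; auto).
  rewrite Cmod_div by (apply Cmult_neq_0; auto). rewrite Cmod_mult. fold A.
  rewrite Cmod_sym. apply Rmult_lt_reg_r with (Cmod (f y) * A); [nra|].
  unfold Rdiv at 1. rewrite Rmult_assoc, Rinv_l by nra. rewrite Rmult_1_r.
  assert (e * (A / 2 * A) < e * (Cmod (f y) * A)).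
  { apply Rmult_lt_compat_l; [lra|]. apply Rmult_lt_compat_r; lra. }
  lra.
Qed.

Lemma cwi_eq_at f g x : (forall y, K y -> f y = g y) -> f x = g x -> cwi d K f x -> cwi d K g x.
Proof.
  intros E E0 H e he. destruct (H e he) as [r [hr Hr]]. exists r. split; auto.
  intros y Ky. rewrite <- E, <- E0 by auto. auto.
Qed.
End Continuity.

Lemma cwi_comp {X Y} (d : X -> X -> R) (dY : Y -> Y -> R) (K : X -> Prop) (L : Y -> Prop)
  (u : X -> Y) (f : Y -> C) x :
  (forall e, e > 0 -> exists r, r > 0 /\ forall y, K y -> d y x < r -> dY (u y) (u x) < e) ->
  (forall y, K y -> L (u y)) ->
  cwi dY L f (u x) -> cwi d K (fun y => f (u y)) x.
Proof.
  intros hu hL hf e he. destruct (hf e he) as [r [hr Hr]].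
  destruct (hu r hr) as [r' [hr' Hr']]. exists r'. split; auto.
Qed.

Lemma cwi_compC {X} (d : X -> X -> R) (K : X -> Prop) (u : X -> C) (f : C -> C) x :
  cwi d K u x -> cts f (u x) -> cwi d K (fun y => f (u y)) x.
Proof. intros. apply cwi_comp with (dY := dC) (L := full); try easy. Qed.

Lemma cwi_sub {X} (d : X -> X -> R) (K L : X -> Prop) f x :
  (forall y, K y -> L y) -> cwi d L f x -> cwi d K f x.
Proof.
  intros S H e he. destruct (H e he) as [r [hr Hr]]. exists r. split; auto.
Qed.

Lemma cts_cwi (K : C -> Prop) f x : cts f x -> cwi dC K f x.
Proof. apply cwi_sub. easy. Qed.

Lemma cts_id z : cts (fun w : C => w) z.
Proof. intros e he. exists e. split; auto. Qed.

Lemma cwi_id K z : cwi dC K (fun w : C => w) z.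
Proof. intros e he. exists e. split; auto. Qed.

Definition cd (f : C -> C) (z L : C) : Prop :=
  forall e, e > 0 -> exists r, r > 0 /\ forall w, Cmod (w - z) < r ->
    Cmod (f w - f z - L * (w - z)) <= e * Cmod (w - z).

Lemma has_cderiv_cd (f : C -> C) (z L : C) : has_cderiv f z L <-> cd f z L.
Proof.
  split; intros H e he; destruct (H e he) as [r [hr Hr]]; exists r; (split; [exact hr|]).
  - intros w hw. destruct (Req_dec (Cmod (w - z)) 0) as [h0|h0].
    + apply Cmod_sub_0 in h0. subst w.
      replace (f z - f z - L * (z - z))%C with (RtoC 0) by ring.
      rewrite Cmod_0, Cmod_sub_eq. lra.
    + specialize (Hr (w - z)%C). change Cnorm with Cmod in Hr.
      change (Cadd z (w - z)%C) with (z + (w - z))%C in Hr.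
      replace (z + (w - z))%C with w in Hr by ring. apply Hr.
      pose proof (Cmod_ge_0 (w - z)). lra.
  - intros h hh. change (h : Cplx) with (h : C). specialize (Hr (z + h)%C).
    assert (E : (z + h - z)%C = (h : C)) by (unfold Cminus; rewrite (Cplus_comm z h), <- Cplus_assoc, Cplus_opp_r; apply Cplus_0_r). rewrite E in Hr. apply Hr. apply hh.
Qed.

(** Caratheodory's form of differentiability: the difference quotient, completed by [L] at [z], is
    continuous there. The rules for products, compositions, reciprocals and lifts then reduce to
    rules for continuity. *)
Lemma cd_cara f z L :
  cd f z L <-> exists q r, r > 0 /\ (forall w, Cmod (w - z) < r -> f w - f z = q w * (w - z))%C
     /\ cts q z /\ q z = L.
Proof.
  split.
  - intros H.
    exists (fun w => if excluded_middle_informative (w = z) then L else (f w - f z) / (w - z))%C.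
    exists 1. split; [lra|]. split; [|split].
    + intros w _. destruct (excluded_middle_informative (w = z)) as [->|n]; [ring|].
      field. apply Csub_neq_0; auto.
    + intros e he. destruct (H (e/2)) as [r [hr Hr]]; [lra|].
      exists r. split; auto. intros w _ hw. unfold dC in hw.
      destruct (excluded_middle_informative (z = z)) as [_|n]; [|congruence].
      destruct (excluded_middle_informative (w = z)) as [->|n].
      * rewrite Cmod_sub_eq. lra.
      * specialize (Hr w hw). pose proof (Cmod_sub_pos _ _ n).
        replace ((f w - f z) / (w - z) - L)%C with ((f w - f z - L * (w - z)) / (w - z))%C
          by (field; apply Csub_neq_0; auto).
        rewrite Cmod_div by (apply Csub_neq_0; auto).
        apply Rle_lt_trans with (e/2); [|lra]. apply Rmult_le_reg_r with (Cmod (w - z)); auto.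
        unfold Rdiv at 1. rewrite Rmult_assoc, Rinv_l; lra.
    + destruct (excluded_middle_informative (z = z)); congruence.
  - intros [q [r [hr [E [c h]]]]] e he. destruct (c e he) as [r' [hr' Hr']].
    exists (Rmin r r'). split; [apply Rmin_pos; lra|]. intros w hw.
    rewrite E by (eapply Rlt_le_trans; [exact hw|apply Rmin_l]). rewrite <- h.
    replace (q w * (w - z) - q z * (w - z))%C with ((q w - q z) * (w - z))%C by ring.
    rewrite Cmod_mult. apply Rmult_le_compat_r; [apply Cmod_ge_0|].
    left. apply Hr'; [exact I|]. eapply Rlt_le_trans; [exact hw|apply Rmin_r].
Qed.

Lemma cd_cts f z L : cd f z L -> cts f z.
Proof.
  intros H. apply cd_cara in H. destruct H as [q [r [hr [E [c h]]]]].
  assert (c2 : cts (fun w => f z + q w * (w - z))%C z).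
  { apply cwi_plus; [apply cwi_const|]. apply cwi_mult; auto.
    apply cwi_minus; [apply cts_id|apply cwi_const]. }
  intros e he. destruct (c2 e he) as [r' [hr' Hr']]. exists (Rmin r r').
  split; [apply Rmin_pos; lra|]. intros w _ hw.
  specialize (Hr' w I (Rlt_le_trans _ _ _ hw (Rmin_r _ _))).
  rewrite <- E in Hr' by (eapply Rlt_le_trans; [exact hw|apply Rmin_l]).
  eapply Rle_lt_trans; [|exact Hr']. right. f_equal. ring.
Qed.

Lemma cd_ext_loc f g z L r : r > 0 -> (forall w, Cmod (w - z) < r -> f w = g w) ->
  cd f z L -> cd g z L.
Proof.
  intros hr E H e he. destruct (H e he) as [r' [hr' Hr']].
  exists (Rmin r r'). split; [apply Rmin_pos; lra|]. intros w hw.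
  rewrite <- !E. apply Hr'. eapply Rlt_le_trans; [exact hw|apply Rmin_r].
  rewrite Cmod_sub_eq; lra. eapply Rlt_le_trans; [exact hw|apply Rmin_l].
Qed.

Lemma cd_eq f z L M : cd f z L -> L = M -> cd f z M.
Proof. intros H <-. auto. Qed.

Lemma cd_const c z : cd (fun _ => c) z 0.
Proof.
  apply cd_cara. exists (fun _ => 0%C), 1. repeat split; try lra; intros; try ring.
  apply cwi_const.
Qed.

Lemma cd_id z : cd (fun w => w) z 1.
Proof.
  apply cd_cara. exists (fun _ => 1%C), 1. repeat split; try lra; intros; try ring.
  apply cwi_const.
Qed.

Lemma cd_plus f g z L M : cd f z L -> cd g z M -> cd (fun w => f w + g w)%C z (L + M)%C.
Proof.
  rewrite !cd_cara. intros [q [r [hr [E [c h]]]]] [q' [r' [hr' [E' [c' h']]]]].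
  exists (fun w => q w + q' w)%C, (Rmin r r'). split; [apply Rmin_pos; lra|].
  split; [|split; [apply cwi_plus; auto|subst; auto]].
  intros w hw. assert (h1 := Rlt_le_trans _ _ _ hw (Rmin_l _ _)).
  assert (h2 := Rlt_le_trans _ _ _ hw (Rmin_r _ _)).
  rewrite Cmult_plus_distr_r, <- E, <- E' by auto. ring.
Qed.

Lemma cd_mult f g z L M : cd f z L -> cd g z M ->
  cd (fun w => f w * g w)%C z (L * g z + f z * M)%C.
Proof.
  intros Hf Hg. assert (cg := cd_cts _ _ _ Hg). revert Hf Hg.
  rewrite !cd_cara. intros [q [r [hr [E [c h]]]]] [q' [r' [hr' [E' [c' h']]]]].
  exists (fun w => q w * g w + f z * q' w)%C, (Rmin r r'). split; [apply Rmin_pos; lra|].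
  split; [|split; [|subst; auto]].
  - intros w hw. assert (h1 := Rlt_le_trans _ _ _ hw (Rmin_l _ _)).
    assert (h2 := Rlt_le_trans _ _ _ hw (Rmin_r _ _)).
    transitivity ((q w * (w - z)) * g w + f z * (q' w * (w - z)))%C; [|ring].
    rewrite <- E, <- E' by auto. ring.
  - apply cwi_plus; apply cwi_mult; auto. apply cwi_const.
Qed.

Lemma cd_opp f z L : cd f z L -> cd (fun w => - f w)%C z (- L)%C.
Proof.
  intros H. apply cd_ext_loc with (fun w => (RtoC (-1)) * f w)%C 1; [lra| |].
  - intros; apply injective_projections; simpl; ring.
  - replace (- L)%C with (0 * f z + (RtoC (-1)) * L)%C
      by (apply injective_projections; simpl; ring).
    apply cd_mult; auto using cd_const.
Qed.

Lemma cd_minus f g z L M : cd f z L -> cd g z M -> cd (fun w => f w - g w)%C z (L - M)%C.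
Proof. intros. apply cd_plus; auto using cd_opp. Qed.

Lemma cd_comp f g z L M : cd f z L -> cd g (f z) M -> cd (fun w => g (f w)) z (M * L)%C.
Proof.
  intros Hf Hg. assert (cf := cd_cts _ _ _ Hf). revert Hf Hg.
  rewrite !cd_cara. intros [q [r [hr [E [c h]]]]] [q' [r' [hr' [E' [c' h']]]]].
  destruct (cf r' hr') as [r2 [hr2 H2]].
  exists (fun w => q' (f w) * q w)%C, (Rmin r r2). split; [apply Rmin_pos; lra|].
  split; [|split; [|subst; auto]].
  - intros w hw. assert (h1 := Rlt_le_trans _ _ _ hw (Rmin_l _ _)).
    assert (h2 := Rlt_le_trans _ _ _ hw (Rmin_r _ _)).
    rewrite E' by (apply H2; auto; exact I). rewrite E by auto. ring.
  - apply cwi_mult; auto. apply cwi_compC; auto.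
Qed.

Lemma cd_inv f z L : cd f z L -> f z <> 0%C -> cd (fun w => / f w)%C z (- L / (f z * f z))%C.
Proof.
  intros Hf n0. assert (cf := cd_cts _ _ _ Hf). revert Hf.
  rewrite !cd_cara. intros [q [r [hr [E [c h]]]]].
  assert (p := proj1 (Cmod_gt_0 _) n0).
  destruct (cf _ p) as [r2 [hr2 H2]].
  exists (fun w => - q w * / (f w * f z))%C, (Rmin r r2). split; [apply Rmin_pos; lra|].
  split; [|split; [|subst; unfold Cdiv; auto]].
  - intros w hw. assert (h1 := Rlt_le_trans _ _ _ hw (Rmin_l _ _)).
    assert (h2 := Rlt_le_trans _ _ _ hw (Rmin_r _ _)).
    specialize (H2 w I h2).
    assert (f w <> 0%C).
    { intros F. rewrite F in H2. replace (0 - f z)%C with (- f z)%C in H2 by ring.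
      rewrite Cmod_opp in H2. lra. }
    transitivity (- (q w * (w - z)) * / (f w * f z))%C; [|ring].
    rewrite <- E by auto. field; auto.
  - apply cwi_mult; [apply cwi_opp; auto|]. apply cwi_inv.
    + apply cwi_mult; auto. apply cwi_const.
    + apply Cmult_neq_0; auto.
Qed.

Lemma cd_unique f z L M : cd f z L -> cd f z M -> L = M.
Proof.
  intros H1 H2. apply Cmod_small_eq. intros e he.
  destruct (H1 (e/2)) as [r1 [h1 K1]]; [lra|]. destruct (H2 (e/2)) as [r2 [h2 K2]]; [lra|].
  set (t := Rmin r1 r2 / 2). assert (pt : 0 < Rmin r1 r2) by (apply Rmin_pos; lra).
  assert (ht : 0 < t) by (unfold t; lra).
  specialize (K1 (z + t)%C). specialize (K2 (z + t)%C).
  replace (z + t - z)%C with (RtoC t) in * by ring.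
  rewrite Cmod_R, Rabs_pos_eq in * by lra.
  assert (t < r1) by (pose proof (Rmin_l r1 r2); unfold t; lra).
  assert (t < r2) by (pose proof (Rmin_r r1 r2); unfold t; lra).
  specialize (K1 H). specialize (K2 H0).
  assert (Cmod ((L - M) * t) <= e * t).
  { replace ((L - M) * t)%C with
      ((f (z + t) - f z - M * t) - (f (z + t) - f z - L * t))%C by ring.
    unfold Cminus at 1. eapply Rle_trans; [apply Cmod_triangle|]. rewrite Cmod_opp. lra. }
  rewrite Cmod_mult, Cmod_R, (Rabs_pos_eq t) in H3 by lra. nra.
Qed.

(** * Compactness, the mean value inequality and the exponential *)

(** Connectedness of [a, b] in the form used for all continuation arguments: [P] need only pass
    between any two points near each [s], in both directions. Upwards this is a supremum argument;
    downwards it is the same after reflection. *)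
Lemma interval_clopen (a b : R) (P : R -> Prop) :
  (forall s, a <= s <= b -> exists d, d > 0 /\ forall s1 s2, a <= s1 <= b -> a <= s2 <= b ->
     Rabs (s1 - s) < d -> Rabs (s2 - s) < d -> P s1 -> P s2) ->
  forall s0 s, a <= s0 <= b -> a <= s <= b -> P s0 -> P s.
Proof.
  assert (up : forall (a b : R) (P : R -> Prop),
    (forall s, a <= s <= b -> exists d, d > 0 /\ forall s1 s2, a <= s1 <= b -> a <= s2 <= b ->
     Rabs (s1 - s) < d -> Rabs (s2 - s) < d -> P s1 -> P s2) ->
    forall s0 s, a <= s0 <= b -> a <= s <= b -> s0 <= s -> P s0 -> P s).
  { clear. intros a b P H s0 s h0 h le p0.
    set (E := fun t => s0 <= t <= s /\ forall t', s0 <= t' <= t -> P t').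
    destruct (completeness E) as [c [ub lb]].
    - exists s. intros t [ht _]. lra.
    - exists s0. split; [lra|]. intros t' ht'. replace t' with s0 by lra. auto.
    - assert (c0 : s0 <= c).
      { apply ub. split; [lra|]. intros t' ht'. replace t' with s0 by lra. auto. }
      assert (c1 : c <= s) by (apply lb; intros t [ht _]; lra).
      destruct (H c) as [d [hd Hd]]; [lra|].
      assert (exists t, E t /\ c - d < t) as [t [Et ht]].
      { apply NNPP. intros n. assert (c <= c - d); [|lra]. apply lb. intros t Et.
        destruct (Rle_dec t (c - d)); auto. exfalso. apply n. exists t. split; auto. lra. }
      assert (t <= c) by (apply ub; auto).
      destruct Et as [Et1 Et2].
      assert (all : forall x, s0 <= x <= s -> x < c + d -> P x).
      { intros x hx hx2. destruct (Rle_dec x t); [apply Et2; lra|].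
        apply (Hd t x); try lra; try (apply Rabs_def1; lra). apply Et2. lra. }
      destruct (Rlt_dec c s) as [l|l].
      + exfalso. set (u := Rmin s (c + d / 2)).
        assert (c < u) by (apply Rmin_glb_lt; lra).
        assert (u <= s) by apply Rmin_l. assert (u <= c + d / 2) by apply Rmin_r.
        assert (u <= c); [|lra]. apply ub. split; [lra|]. intros. apply all; lra.
      + apply all; lra. }
  intros H s0 s h0 h p0. destruct (Rle_dec s0 s) as [l|l]; [exact (up a b P H s0 s h0 h l p0)|].
  replace s with (- - s) by ring.
  refine (up (-b) (-a) (fun x => P (-x)) _ (-s0) (-s) _ _ _ _); try lra.
  - intros x hx. destruct (H (-x)) as [d [hd Hd]]; [lra|]. exists d. split; auto.
    intros s1 s2 h1 h2 k1 k2. apply Hd; try lra.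
    + replace (- s1 - - x) with (- (s1 - x)) by ring. rewrite Rabs_Ropp; auto.
    + replace (- s2 - - x) with (- (s2 - x)) by ring. rewrite Rabs_Ropp; auto.
  - rewrite Ropp_involutive. auto.
Qed.

Lemma bounded_cluster_R (u : nat -> R) (M : R) : (forall n, Rabs (u n) <= M) ->
  exists l, forall e N, e > 0 -> exists n, (N <= n)%nat /\ Rabs (u n - l) < e.
Proof.
  intros H. destruct (Bolzano_Weierstrass u (fun x => -M <= x <= M)) as [l Hl].
  - apply compact_P3.
  - intros n. specialize (H n). apply Rabs_le_between in H. auto.
  - exists l. intros e N he. destruct (Hl (disc l (mkposreal e he)) N) as [p [hp Hp]].
    + exists (mkposreal e he). intros x hx. exact hx.
    + exists p. split; auto.
Qed.

Lemma Rabs_fst_le (z : C) : Rabs (fst z) <= Cmod z.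
Proof. eapply Rle_trans; [apply Rmax_l|apply Rmax_Cmod]. Qed.
Lemma Rabs_snd_le (z : C) : Rabs (snd z) <= Cmod z.
Proof. eapply Rle_trans; [apply Rmax_r|apply Rmax_Cmod]. Qed.
Lemma Cmod_le_abs (z : C) : Cmod z <= Rabs (fst z) + Rabs (snd z).
Proof.
  replace z with ((fst z, 0) + (0, snd z))%C at 1 by (destruct z; apply injective_projections; simpl; ring).
  eapply Rle_trans; [apply Cmod_triangle|].
  right. f_equal; unfold Cmod; simpl.
  - replace (fst z * (fst z * 1) + 0 * (0 * 1)) with ((fst z)²) by (unfold Rsqr; ring).
    apply sqrt_Rsqr_abs.
  - replace (0 * (0 * 1) + snd z * (snd z * 1)) with ((snd z)²) by (unfold Rsqr; ring).
    apply sqrt_Rsqr_abs.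
Qed.

(** Bolzano-Weierstrass twice: the imaginary parts are clustered along indices [phi k] at which the
    real parts already converge. *)
Lemma bounded_cluster (u : nat -> C) (M : R) : (forall n, Cmod (u n) <= M) ->
  exists l, forall e N, e > 0 -> exists n, (N <= n)%nat /\ Cmod (u n - l) < e.
Proof.
  intros H.
  destruct (bounded_cluster_R (fun n => fst (u n)) M) as [l1 H1].
  { intros n. specialize (H n). pose proof (Rabs_fst_le (u n)). lra. }
  assert (ex : forall k : nat, exists n, (k <= n)%nat /\ Rabs (fst (u n) - l1) < / (INR k + 1)).
  { intros k. apply H1. apply Rinv_0_lt_compat. pose proof (pos_INR k). lra. }
  set (phi := fun k => proj1_sig (constructive_indefinite_description _ (ex k))).
  assert (hphi : forall k, (k <= phi k)%nat /\ Rabs (fst (u (phi k)) - l1) < / (INR k + 1)).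
  { intros k. unfold phi. destruct constructive_indefinite_description; auto. }
  destruct (bounded_cluster_R (fun k => snd (u (phi k))) M) as [l2 H2].
  { intros n. specialize (H (phi n)). pose proof (Rabs_snd_le (u (phi n))). lra. }
  exists (l1, l2). intros e N he.
  destruct (archimed_cor1 (e/2)) as [K [hK1 hK2]]; [lra|].
  destruct (H2 (e/2) (max N K)) as [k [hk Hk]]; [lra|].
  destruct (hphi k) as [a b]. exists (phi k). split; [lia|].
  assert (/ (INR k + 1) <= / INR K).
  { apply Rinv_le_contravar; [apply lt_0_INR; lia|].
    assert (INR K <= INR k) by (apply le_INR; lia). lra. }
  eapply Rle_lt_trans; [apply Cmod_le_abs|]. simpl. unfold Rminus in *. lra.
Qed.

Lemma cauchy_complete (u : nat -> C) :
  (forall e, e > 0 -> exists N, forall n m, (N <= n)%nat -> (N <= m)%nat -> Cmod (u n - u m) < e) ->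
  exists l, forall e, e > 0 -> exists N, forall n, (N <= n)%nat -> Cmod (u n - l) < e.
Proof.
  intros H.
  destruct (H 1) as [N0 H0]; [lra|].
  destruct (bounded_cluster (fun n => u (N0 + n)%nat) (Cmod (u N0) + 1)) as [l Hl].
  { intros n. specialize (H0 (N0 + n)%nat N0).
    pose proof (Cmod_le_add (u (N0 + n)%nat) (u N0)).
    assert (Cmod (u (N0 + n)%nat - u N0) < 1) by (apply H0; lia). lra. }
  exists l. intros e he. destruct (H (e/2)) as [N HN]; [lra|]. exists N. intros n hn.
  destruct (Hl (e/2) N) as [m [hm Hm]]; [lra|].
  specialize (HN n (N0 + m)%nat). pose proof (Cmod_tri (u n) (u (N0 + m)%nat) l).
  assert (Cmod (u n - u (N0 + m)%nat) < e/2) by (apply HN; lia). lra.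
Qed.

(** * Segments and the mean value inequality *)

Definition seg (a b : C) (t : R) : C := (a + t * (b - a))%C.

Lemma seg_0 a b : seg a b 0 = a.
Proof. unfold seg. ring. Qed.
Lemma seg_1 a b : seg a b 1 = b.
Proof. unfold seg. ring. Qed.
Lemma seg_diff a b s t : (seg a b s - seg a b t = (s - t)%R * (b - a))%C.
Proof. unfold seg. rewrite RtoC_minus. ring. Qed.
Lemma seg_dist a b s t : Cmod (seg a b s - seg a b t) = Rabs (s - t) * Cmod (b - a).
Proof. rewrite seg_diff, Cmod_mult, Cmod_R. auto. Qed.

Definition convexC (K : C -> Prop) : Prop :=
  forall a b t, K a -> K b -> 0 <= t <= 1 -> K (seg a b t).

Definition ballC (c : C) (r : R) : C -> Prop := fun z => Cmod (z - c) < r.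

Lemma convex_ball c r : convexC (ballC c r).
Proof.
  intros a b t Ha Hb Ht. unfold ballC, seg in *.
  replace (a + t * (b - a) - c)%C with ((1 - t)%R * (a - c) + t * (b - c))%C
    by (rewrite RtoC_minus; ring).
  eapply Rle_lt_trans; [apply Cmod_triangle|].
  rewrite !Cmod_mult, !Cmod_R, !Rabs_pos_eq by lra.
  destruct (Req_dec t 0) as [->|n]; [lra|].
  pose proof (Cmod_ge_0 (a - c)). pose proof (Cmod_ge_0 (b - c)). nra.
Qed.

Lemma seg_fst_deriv (f : C -> C) (c a b L : C) (t : R) : cd f (seg a b t) L ->
  derivable_pt_lim (fun s => fst (c * f (seg a b s))%C) t (fst (c * L * (b - a))%C).
Proof.
  intros H e he.
  set (B := Cmod c * Cmod (b - a) + 1).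
  assert (hB : B > 0) by (unfold B; pose proof (Cmod_ge_0 c); pose proof (Cmod_ge_0 (b - a)); nra).
  destruct (H (e / (2 * B))) as [r [hr Hr]]; [apply Rdiv_lt_0_compat; lra|].
  assert (hd : 0 < r / (Cmod (b - a) + 1)).
  { apply Rdiv_lt_0_compat; [lra|]. pose proof (Cmod_ge_0 (b - a)). lra. }
  exists (mkposreal _ hd). intros h n0 hh. simpl in hh.
  set (w := seg a b (t + h)). set (z := seg a b t) in *.
  assert (Ewz : Cmod (w - z) = Rabs h * Cmod (b - a)).
  { unfold w, z. rewrite seg_dist. f_equal. f_equal. ring. }
  assert (hw : Cmod (w - z) < r).
  { rewrite Ewz. pose proof (Cmod_ge_0 (b - a)). pose proof (Rabs_pos h).
    assert (Rabs h * (Cmod (b - a) + 1) < r / (Cmod (b - a) + 1) * (Cmod (b - a) + 1))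
      by (apply Rmult_lt_compat_r; lra).
    unfold Rdiv in H2. rewrite Rmult_assoc, Rinv_l in H2 by lra. lra. }
  specialize (Hr w hw).
  replace ((fst (c * f w)%C - fst (c * f z)%C) / h - fst (c * L * (b - a))%C) with
    (fst (c * (f w - f z - L * (w - z)))%C / h).
  2:{ assert (Ed : (w - z)%C = (h * (b - a))%C).
      { unfold w, z. rewrite seg_diff. f_equal. f_equal. ring. }
      rewrite Ed.
      replace (c * (f w - f z - L * (h * (b - a))))%C with
         ((c * f w - c * f z) - h * (c * L * (b - a)))%C by ring.
      set (X := (c * L * (b - a))%C). simpl. field. auto. }
  unfold Rdiv. rewrite Rabs_mult, Rabs_inv.
  pose proof (Rabs_pos_lt h n0) as ph.
  apply Rmult_lt_reg_r with (Rabs h); auto. rewrite Rmult_assoc, Rinv_l by lra.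
  rewrite Rmult_1_r.
  eapply Rle_lt_trans; [apply Rabs_fst_le|]. rewrite Cmod_mult.
  apply Rle_lt_trans with (Cmod c * (e / (2 * B) * (Rabs h * Cmod (b - a)))).
  - apply Rmult_le_compat_l; [apply Cmod_ge_0|]. rewrite <- Ewz. auto.
  - replace (Cmod c * (e / (2 * B) * (Rabs h * Cmod (b - a)))) with
      (e * Rabs h * ((Cmod c * Cmod (b - a)) / (2 * B))) by (field; lra).
    rewrite <- (Rmult_1_r (e * Rabs h)) at 2. apply Rmult_lt_compat_l; [nra|].
    apply Rmult_lt_reg_r with (2 * B); [lra|]. unfold Rdiv. rewrite Rmult_assoc, Rinv_l by lra.
    unfold B. pose proof (Cmod_ge_0 c). pose proof (Cmod_ge_0 (b - a)). nra.
Qed.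

Lemma mean_value (f f' : C -> C) (a b : C) (B : R) :
  (forall t, 0 <= t <= 1 -> cd f (seg a b t) (f' (seg a b t))) ->
  (forall t, 0 <= t <= 1 -> Cmod (f' (seg a b t)) <= B) ->
  Cmod (f b - f a) <= B * Cmod (b - a).
Proof.
  intros H HB.
  destruct (Req_dec (Cmod (f b - f a)) 0) as [E|n].
  { rewrite E. assert (0 <= B).
    { eapply Rle_trans; [apply (Cmod_ge_0 (f' (seg a b 0)))|apply HB; lra]. }
    pose proof (Cmod_ge_0 (b - a)). nra. }
  set (m := Cmod (f b - f a)) in *. assert (pm : 0 < m).
  { pose proof (Cmod_ge_0 (f b - f a)). unfold m in *. lra. }
  (* A unit factor that turns [f b - f a] into the positive number [m]; the real mean value theorem
     then applies to the real part of [c * f] along the segment. *)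
  set (c := (Cconj (f b - f a) / m)%C).
  assert (mc : RtoC m <> 0%C) by (intros E; apply RtoC_inj in E; lra).
  assert (hc : Cmod c = 1).
  { unfold c. rewrite Cmod_div, Cmod_conj, Cmod_R, Rabs_pos_eq by (auto; lra). fold m. field. lra. }
  destruct (MVT_cor2 (fun s => fst (c * f (seg a b s))%C)
     (fun t => fst (c * f' (seg a b t) * (b - a))%C) 0 1) as [t [Ht1 Ht2]]; [lra| |].
  { intros t ht. apply seg_fst_deriv. auto. }
  rewrite seg_0, seg_1 in Ht1.
  assert (E : fst (c * f b)%C - fst (c * f a)%C = m).
  { transitivity (fst (c * (f b - f a))%C).
    { replace (c * (f b - f a))%C with (c * f b - c * f a)%C by ring. reflexivity. }
    unfold c. replace (Cconj (f b - f a) / m * (f b - f a))%C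
      with (((f b - f a) * Cconj (f b - f a)) / m)%C by (field; auto).
    rewrite <- Cmod2_conj. fold m.
    replace (m ^ 2) with (m * m) by ring. rewrite RtoC_mult.
    replace (m * m / m)%C with (RtoC m) by (field; auto). reflexivity. }
  rewrite E in Ht1. rewrite Ht1.
  replace (1 - 0) with 1 by ring. rewrite Rmult_1_r.
  eapply Rle_trans; [apply Rle_abs|]. eapply Rle_trans; [apply Rabs_fst_le|].
  rewrite !Cmod_mult, hc, Rmult_1_l. apply Rmult_le_compat_r; [apply Cmod_ge_0|]. apply HB; lra.
Qed.

(** * The complex exponential *)

Definition Cexp (w : C) : C := (exp (fst w) * cos (snd w), exp (fst w) * sin (snd w)).

Lemma Cexp_plus a b : Cexp (a + b) = (Cexp a * Cexp b)%C.
Proof.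
  unfold Cexp. simpl. rewrite exp_plus, cos_plus, sin_plus.
  apply injective_projections; simpl; ring.
Qed.

Lemma Cexp_0 : Cexp 0 = 1%C.
Proof. unfold Cexp. simpl. rewrite exp_0, cos_0, sin_0. apply injective_projections; simpl; ring. Qed.

Lemma Cmod_Cexp w : Cmod (Cexp w) = exp (fst w).
Proof.
  unfold Cmod, Cexp. simpl.
  replace (exp (fst w) * cos (snd w) * (exp (fst w) * cos (snd w) * 1) +
     exp (fst w) * sin (snd w) * (exp (fst w) * sin (snd w) * 1)) with
    ((exp (fst w) * exp (fst w)) * ((sin (snd w))² + (cos (snd w))²)) by (unfold Rsqr; ring).
  rewrite sin2_cos2, Rmult_1_r. apply sqrt_square. left. apply exp_pos.
Qed.

Lemma Cexp_neq_0 w : Cexp w <> 0%C.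
Proof. apply Cmod_gt_0. rewrite Cmod_Cexp. apply exp_pos. Qed.

Lemma cd_Cexp_0 : cd Cexp 0 1.
Proof.
  intros e he.
  assert (he' : e / 10 > 0) by lra.
  destruct (derivable_pt_lim_exp 0 (e/10) he') as [[d1 p1] D1].
  destruct (derivable_pt_lim_sin 0 (e/10) he') as [[d2 p2] D2].
  destruct (derivable_pt_lim_cos 0 (e/10) he') as [[d3 p3] D3].
  simpl in *.
  (* With [exp x <= 3] and [|exp x - 1| <= e / 6] the remainders of exp, cos and sin, at most
     [e / 10] times the increment each, contribute 7/10 + 1/6 = 13/15 of the allowance [e]. *)
  set (r := Rmin (Rmin d1 (Rmin d2 d3)) (Rmin 1 (e / 24))).
  exists r. split.
  { repeat apply Rmin_pos; lra. }
  intros w hw. replace (w - 0)%C with w in * by ring.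
  assert (r1 : r <= d1) by (eapply Rle_trans; [apply Rmin_l|apply Rmin_l]).
  assert (r2 : r <= d2) by (eapply Rle_trans; [apply Rmin_l|eapply Rle_trans; [apply Rmin_r|apply Rmin_l]]).
  assert (r3 : r <= d3) by (eapply Rle_trans; [apply Rmin_l|eapply Rle_trans; [apply Rmin_r|apply Rmin_r]]).
  assert (r4 : r <= 1) by (eapply Rle_trans; [apply Rmin_r|apply Rmin_l]).
  assert (r5 : r <= e / 24) by (eapply Rle_trans; [apply Rmin_r|apply Rmin_r]).
  pose proof (Rabs_fst_le w) as hx. pose proof (Rabs_snd_le w) as hy.
  destruct w as [x y]. simpl in hx, hy. set (m := Cmod (x, y)) in *.
  assert (gen : forall g (v l h d : R), v = g 0 -> (forall h, h <> 0 -> Rabs h < d -> Rabs ((g (0 + h) - v) / h - l) < e / 10) ->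
      Rabs h < d -> Rabs (g h - v - l * h) <= e / 10 * Rabs h).
  { intros g v l h d -> D hd. destruct (Req_dec h 0) as [->|n].
    - replace (g 0 - g 0 - l * 0) with 0 by ring. rewrite Rabs_R0. lra.
    - specialize (D h n hd). rewrite Rplus_0_l in D.
      replace (g h - g 0 - l * h) with (((g h - g 0) / h - l) * h) by (field; auto).
      rewrite Rabs_mult. apply Rmult_le_compat_r; [apply Rabs_pos|lra]. }
  rewrite exp_0 in D1. rewrite sin_0, cos_0 in D2. rewrite sin_0, cos_0 in D3.
  replace (- 0) with 0 in D3 by ring.
  assert (X := gen exp 1 1 x d1 (eq_sym exp_0) D1 ltac:(lra)).
  assert (S := gen sin 0 1 y d2 (eq_sym sin_0) D2 ltac:(lra)).
  assert (K := gen cos 1 0 y d3 (eq_sym cos_0) D3 ltac:(lra)).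
  assert (ex : Rabs (exp x) <= 3).
  { rewrite Rabs_pos_eq by (left; apply exp_pos).
    apply Rle_trans with (exp 1); [|apply exp_le_3].
    pose proof (Rle_abs x). destruct (Rle_lt_or_eq_dec x 1) as [l|l]; [lra| |subst; lra].
    left. apply exp_increasing. auto. }
  assert (ex1 : Rabs (exp x - 1) <= e / 6).
  { replace (exp x - 1) with ((exp x - 1 - 1 * x) + x) by ring.
    eapply Rle_trans; [apply Rabs_triang|]. pose proof (Rabs_pos x).
    assert (e/10 * Rabs x <= e / 10 * 1) by (apply Rmult_le_compat_l; lra). lra. }
  eapply Rle_trans; [apply Cmod_le_abs|].
  rewrite Cexp_0. unfold Cexp. simpl.
  replace (exp x * cos y + - (1) + - (1 * x - 0 * y)) with
    ((exp x - 1 - 1 * x) + exp x * (cos y - 1 - 0 * y)) by ring.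
  replace (exp x * sin y + - 0 + - (1 * y + 0 * x)) with
    (exp x * (sin y - 0 - 1 * y) + (exp x - 1) * y) by ring.
  assert (A1 : Rabs ((exp x - 1 - 1 * x) + exp x * (cos y - 1 - 0 * y)) <= e / 10 * m + 3 * (e / 10 * m)).
  { eapply Rle_trans; [apply Rabs_triang|]. apply Rplus_le_compat.
    - eapply Rle_trans; [exact X|]. apply Rmult_le_compat_l; lra.
    - rewrite Rabs_mult. apply Rmult_le_compat; try apply Rabs_pos; auto.
      eapply Rle_trans; [exact K|]. apply Rmult_le_compat_l; lra. }
  assert (A2 : Rabs (exp x * (sin y - 0 - 1 * y) + (exp x - 1) * y) <= 3 * (e / 10 * m) + e / 6 * m).
  { eapply Rle_trans; [apply Rabs_triang|]. apply Rplus_le_compat.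
    - rewrite Rabs_mult. apply Rmult_le_compat; try apply Rabs_pos; auto.
      eapply Rle_trans; [exact S|]. apply Rmult_le_compat_l; lra.
    - rewrite Rabs_mult. apply Rmult_le_compat; try apply Rabs_pos; auto. }
  assert (0 <= m) by (unfold m; apply Cmod_ge_0). 
  assert (0 <= e * m) by nra. lra.
Qed.

Lemma cd_Cexp z : cd Cexp z (Cexp z).
Proof.
  apply cd_ext_loc with (fun w => Cexp z * Cexp (w - z))%C 1; [lra| |].
  { intros w _. rewrite <- Cexp_plus. f_equal. ring. }
  eapply cd_eq.
  - apply (cd_mult (fun _ => Cexp z) (fun w => Cexp (w - z))); [apply cd_const|].
    apply (cd_comp (fun w => w - z)%C).
    + apply cd_minus; [apply cd_id|apply cd_const].
    + replace (z - z)%C with (RtoC 0) by ring. apply cd_Cexp_0.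
  - ring.
Qed.

(** * Cauchy's estimate *)

Definition CI (phi : R -> C) (a b : R) : C := @RInt C_R_CompleteNormedModule phi a b.

Lemma normC (z : C) : @norm R_AbsRing C_R_NormedModule z = Cmod z.
Proof.
  unfold Cmod, norm; simpl. unfold prod_norm, norm; simpl. unfold abs; simpl. f_equal.
  f_equal; rewrite !Rmult_1_r, <- Rabs_mult; apply Rabs_pos_eq; apply Rle_0_sqr.
Qed.

Lemma ctsR_continuous (phi : R -> C) (t : R) : cwi dR full phi t ->
  @continuous R_UniformSpace C_R_NormedModule phi t.
Proof.
  intros H. apply filterlim_locally. intros eps.
  destruct (H eps) as [r [hr Hr]]; [apply cond_pos|].
  exists (mkposreal r hr). intros s hs. specialize (Hr s I hs).
  pose proof (Rabs_fst_le (phi s - phi t)). pose proof (Rabs_snd_le (phi s - phi t)).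
  split; (eapply Rle_lt_trans; [|exact Hr]); auto.
Qed.

Definition ctsI (phi : R -> C) a b := forall t, a <= t <= b -> cwi dR full phi t.

Lemma CI_ex phi a b : a <= b -> ctsI phi a b -> @ex_RInt C_R_NormedModule phi a b.
Proof.
  intros h H. apply (@ex_RInt_continuous C_R_CompleteNormedModule). intros t ht.
  rewrite Rmin_left, Rmax_right in ht by auto. apply ctsR_continuous. auto.
Qed.

Lemma CI_chasles phi a b c : a <= b -> b <= c -> ctsI phi a c ->
  CI phi a c = (CI phi a b + CI phi b c)%C.
Proof.
  intros h1 h2 H. symmetry. apply (@RInt_Chasles C_R_CompleteNormedModule); apply CI_ex; auto;
  intros t ht; apply H; lra.
Qed.

Lemma CI_minus phi psi a b : a <= b -> ctsI phi a b -> ctsI psi a b ->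
  CI (fun t => phi t - psi t)%C a b = (CI phi a b - CI psi a b)%C.
Proof. intros. apply (@RInt_minus C_R_CompleteNormedModule); apply CI_ex; auto. Qed.

Lemma CI_bound phi a b M : a <= b -> ctsI phi a b -> (forall t, a <= t <= b -> Cmod (phi t) <= M) ->
  Cmod (CI phi a b) <= (b - a) * M.
Proof.
  intros h H HM. rewrite <- normC.
  apply (@norm_RInt_le_const C_R_NormedModule phi a b); auto.
  - intros t ht. rewrite normC. auto.
  - apply (@RInt_correct C_R_CompleteNormedModule). apply CI_ex; auto.
Qed.

Lemma CI_ext phi psi a b : a <= b -> (forall t, a <= t <= b -> phi t = psi t) ->
  CI phi a b = CI psi a b.
Proof.
  intros h H. apply (@RInt_ext C_R_CompleteNormedModule). intros t ht.
  rewrite Rmin_left, Rmax_right in ht by auto. apply H. lra.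
Qed.

(** Together with the constant case these are the only integrals evaluated exactly: Goursat's
    argument subtracts the affine part of the integrand. *)
Lemma CI_affine (P Q : C) a b :
  CI (fun t => P + t * Q)%C a b = ((b - a)%R * P + ((b * b - a * a) / 2)%R * Q)%C.
Proof.
  apply (@is_RInt_unique C_R_CompleteNormedModule).
  destruct P as [p1 p2], Q as [q1 q2].
  assert (aux : forall p q, is_RInt (fun t => p + t * q) a b ((b - a) * p + (b * b - a * a) / 2 * q)).
  { intros p q.
    replace ((b - a) * p + (b * b - a * a) / 2 * q) with
      (minus ((fun t => t * p + t * t / 2 * q) b) ((fun t => t * p + t * t / 2 * q) a))
      by (unfold minus, plus, opp; simpl; field).
    apply (@is_RInt_derive R_CompleteNormedModule (fun t => t * p + t * t / 2 * q) (fun t => p + t * q)).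
    - intros x _. auto_derive; auto. field.
    - intros x _. apply (@ex_derive_continuous R_AbsRing). auto_derive. auto. }
  replace ((b - a)%R * (p1, p2) + ((b * b - a * a) / 2)%R * (q1, q2))%C with
    ((b - a) * p1 + (b * b - a * a) / 2 * q1, (b - a) * p2 + (b * b - a * a) / 2 * q2)
    by (apply injective_projections; simpl; ring).
  apply (@is_RInt_fct_extend_pair R_NormedModule R_NormedModule); simpl;
    eapply is_RInt_ext; [|apply aux| |apply aux]; intros; simpl; ring.
Qed.

Lemma CI_const (P : C) a b : CI (fun _ => P) a b = ((b - a)%R * P)%C.
Proof.
  transitivity (CI (fun t => P + t * 0)%C a b).
  - unfold CI. f_equal. apply functional_extensionality. intros. ring.
  - rewrite CI_affine. ring.
Qed.

(** The integral of F dz counterclockwise around the rectangle with lower left corner (x, y) and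
    sides a and b; the factor [Ci] is dz on the vertical sides. *)
Definition rectI (F : C -> C) (x y a b : R) : C :=
  (CI (fun t => F (t, y)) x (x + a) + Ci * CI (fun t => F ((x + a)%R, t)) y (y + b)
   - CI (fun t => F (t, (y + b)%R)) x (x + a) - Ci * CI (fun t => F (x, t)) y (y + b))%C.

Definition inrect (x y a b u v : R) := x <= u <= x + a /\ y <= v <= y + b.
Definition rcts (F : C -> C) x y a b := forall u v, inrect x y a b u v -> cts F (u, v).

Lemma cts_h F u v : cts F (u, v) -> cwi dR full (fun t => F (t, v)) u.
Proof.
  intros H. apply (cwi_comp dR dC full full (fun t => (t, v)) F); try easy.
  intros e he. exists e. split; auto. intros y _ hy. unfold dC.
  eapply Rle_lt_trans; [apply Cmod_le_abs|]. simpl.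
  replace (v + - v) with 0 by ring. rewrite Rabs_R0, Rplus_0_r. exact hy.
Qed.

Lemma cts_v F u v : cts F (u, v) -> cwi dR full (fun t => F (u, t)) v.
Proof.
  intros H. apply (cwi_comp dR dC full full (fun t => (u, t)) F); try easy.
  intros e he. exists e. split; auto. intros y _ hy. unfold dC.
  eapply Rle_lt_trans; [apply Cmod_le_abs|]. simpl.
  replace (u + - u) with 0 by ring. rewrite Rabs_R0, Rplus_0_l. exact hy.
Qed.

Ltac rc H := let t := fresh "t" in intros t ?; first [apply cts_h | apply cts_v]; apply H; unfold inrect; lra.

Lemma rectI_split F x y a b : 0 <= a -> 0 <= b -> rcts F x y (2 * a) (2 * b) ->
  rectI F x y (2 * a) (2 * b) =
  (rectI F x y a b + rectI F (x + a) y a b + rectI F x (y + b) a b + rectI F (x + a) (y + b) a b)%C.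
Proof.
  intros ha hb H. unfold rectI.
  replace (x + a + a) with (x + 2 * a) by ring. replace (y + b + b) with (y + 2 * b) by ring.
  rewrite (CI_chasles (fun t => F (t, y)) x (x + a) (x + 2 * a)); [|lra|lra|rc H].
  rewrite (CI_chasles (fun t => F (t, (y + 2 * b)%R)) x (x + a) (x + 2 * a)); [|lra|lra|rc H].
  rewrite (CI_chasles (fun t => F (x, t)) y (y + b) (y + 2 * b)); [|lra|lra|rc H].
  rewrite (CI_chasles (fun t => F ((x + 2 * a)%R, t)) y (y + b) (y + 2 * b)); [|lra|lra|rc H].
  ring.
Qed.

Lemma rectI_bound F x y a b M : 0 <= a -> 0 <= b -> rcts F x y a b ->
  (forall u v, inrect x y a b u v -> Cmod (F (u, v)) <= M) ->
  Cmod (rectI F x y a b) <= 2 * (a + b) * M.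
Proof.
  intros ha hb H HM. unfold rectI.
  assert (b1 := CI_bound (fun t => F (t, y)) x (x + a) M ltac:(lra) ltac:(rc H)
     ltac:(intros; apply HM; unfold inrect; lra)).
  assert (b2 := CI_bound (fun t => F (t, (y + b)%R)) x (x + a) M ltac:(lra) ltac:(rc H)
     ltac:(intros; apply HM; unfold inrect; lra)).
  assert (b3 := CI_bound (fun t => F (x, t)) y (y + b) M ltac:(lra) ltac:(rc H)
     ltac:(intros; apply HM; unfold inrect; lra)).
  assert (b4 := CI_bound (fun t => F ((x + a)%R, t)) y (y + b) M ltac:(lra) ltac:(rc H)
     ltac:(intros; apply HM; unfold inrect; lra)).
  unfold Cminus. eapply Rle_trans; [apply Cmod_triangle|].
  eapply Rle_trans; [apply Rplus_le_compat_r, Cmod_triangle|].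
  eapply Rle_trans; [apply Rplus_le_compat_r, Rplus_le_compat_r, Cmod_triangle|].
  rewrite !Cmod_opp, !Cmod_mult, !Cmod_Ci. lra.
Qed.

Lemma rectI_minus F G x y a b : 0 <= a -> 0 <= b -> rcts F x y a b -> rcts G x y a b ->
  rectI (fun z => F z - G z)%C x y a b = (rectI F x y a b - rectI G x y a b)%C.
Proof.
  intros ha hb HF HG. unfold rectI.
  rewrite (CI_minus (fun t => F (t, y)) (fun t => G (t, y))); [|lra|rc HF|rc HG].
  rewrite (CI_minus (fun t => F (t, (y + b)%R)) (fun t => G (t, (y + b)%R))); [|lra|rc HF|rc HG].
  rewrite (CI_minus (fun t => F (x, t)) (fun t => G (x, t))); [|lra|rc HF|rc HG].
  rewrite (CI_minus (fun t => F ((x + a)%R, t)) (fun t => G ((x + a)%R, t))); [|lra|rc HF|rc HG].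
  ring.
Qed.

Lemma rectI_affine (A B : C) x y a b : rectI (fun z => A + B * z)%C x y a b = 0%C.
Proof.
  assert (h : forall v, CI (fun t => A + B * (t, v))%C x (x + a) =
     ((x + a - x)%R * (A + B * (0, v)) + (((x + a) * (x + a) - x * x) / 2)%R * B)%C).
  { intros v. rewrite <- CI_affine. unfold CI. f_equal. apply functional_extensionality. intros t.
    apply injective_projections; simpl; ring. }
  assert (hv : forall u, CI (fun t => A + B * (u, t))%C y (y + b) =
     ((y + b - y)%R * (A + B * (u, 0)) + (((y + b) * (y + b) - y * y) / 2)%R * (Ci * B))%C).
  { intros v. rewrite <- CI_affine. unfold CI. f_equal. apply functional_extensionality. intros t.
    apply injective_projections; simpl; ring. }
  unfold rectI. rewrite !h, !hv. apply injective_projections; simpl; field.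
Qed.

(** Quartering keeps at least a quarter of the modulus at each stage. At the common point of the
    rectangles the affine part integrates to zero, and what remains is small compared with the
    area. *)
Lemma goursat F x y a b : 0 <= a -> 0 <= b ->
  (forall u v, inrect x y a b u v -> exists L, cd F (u, v) L) -> rectI F x y a b = 0%C.
Proof.
  intros ha hb H.
  assert (Hc : rcts F x y a b).
  { intros u v h. destruct (H u v h) as [L hL]. eapply cd_cts; eauto. }
  destruct (classic (rectI F x y a b = 0%C)) as [E|n]; auto. exfalso.
  assert (pc := proj1 (Cmod_gt_0 _) n). set (c := Cmod (rectI F x y a b)) in *.
  set (al := fun n : nat => a / 2 ^ n). set (be := fun n : nat => b / 2 ^ n).
  assert (p2 : forall n, 0 < 2 ^ n) by (intros; apply pow_lt; lra).
  assert (al0 : forall n, 0 <= al n).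
  { intros m. unfold al, Rdiv. apply Rmult_le_pos; auto. left. apply Rinv_0_lt_compat; auto. }
  assert (be0 : forall n, 0 <= be n).
  { intros m. unfold be, Rdiv. apply Rmult_le_pos; auto. left. apply Rinv_0_lt_compat; auto. }
  assert (alS : forall n, al n = 2 * al (S n)).
  { intros m. unfold al. simpl. field. specialize (p2 m). lra. }
  assert (beS : forall n, be n = 2 * be (S n)).
  { intros m. unfold be. simpl. field. specialize (p2 m). lra. }
  (* Stage n: a copy of the rectangle scaled by 2^-n inside the given one, carrying at least 4^-n of
     the modulus [c]. *)
  set (good := fun (n : nat) (p : R * R) =>
     x <= fst p /\ fst p + al n <= x + a /\ y <= snd p /\ snd p + be n <= y + b /\
     c <= 4 ^ n * Cmod (rectI F (fst p) (snd p) (al n) (be n))).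
  set (nxt := fun (n : nat) (p p' : R * R) =>
     fst p <= fst p' /\ fst p' + al (S n) <= fst p + al n /\
     snd p <= snd p' /\ snd p' + be (S n) <= snd p + be n).
  assert (step : forall n p, good n p -> exists p', good (S n) p' /\ nxt n p p').
  { intros m [u v] (g1 & g2 & g3 & g4 & g5). simpl in *.
    rewrite alS in g2. rewrite beS in g4. rewrite alS, beS in g5.
    rewrite rectI_split in g5; auto.
    2:{ intros u' v' [h1 h2]. apply Hc. unfold inrect. lra. }
    assert (A1 := al0 (S m)). assert (B1 := be0 (S m)).
    set (s := al (S m)) in *. set (t := be (S m)) in *.
    set (J1 := rectI F u v s t) in *. set (J2 := rectI F (u + s) v s t) in *.
    set (J3 := rectI F u (v + t) s t) in *. set (J4 := rectI F (u + s) (v + t) s t) in *.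
    assert (tri : Cmod (J1 + J2 + J3 + J4) <= Cmod J1 + Cmod J2 + Cmod J3 + Cmod J4).
    { eapply Rle_trans; [apply Cmod_triangle|]. apply Rplus_le_compat_r.
      eapply Rle_trans; [apply Cmod_triangle|]. apply Rplus_le_compat_r. apply Cmod_triangle. }
    assert (p4 : 0 < 4 ^ m) by (apply pow_lt; lra).
    assert (tri' : c <= 4 ^ m * (Cmod J1 + Cmod J2 + Cmod J3 + Cmod J4)).
    { eapply Rle_trans; [exact g5|]. apply Rmult_le_compat_l; lra. }
    assert (alm := alS m). assert (bem := beS m). fold s in alm. fold t in bem.
    unfold nxt, good. simpl. fold s t. rewrite alm, bem.
    destruct (Rle_dec c (4 * 4 ^ m * Cmod J1)); [exists (u, v); simpl; fold J1; repeat split; lra|].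
    destruct (Rle_dec c (4 * 4 ^ m * Cmod J2)); [exists (u + s, v); simpl; fold J2; repeat split; lra|].
    destruct (Rle_dec c (4 * 4 ^ m * Cmod J3)); [exists (u, v + t); simpl; fold J3; repeat split; lra|].
    destruct (Rle_dec c (4 * 4 ^ m * Cmod J4)); [exists (u + s, v + t); simpl; fold J4; repeat split; lra|].
    lra. }
  set (f := fun n p => match excluded_middle_informative (good n p) with
     | left g => proj1_sig (constructive_indefinite_description _ (step n p g)) | right _ => p end).
  set (P := nat_rect (fun _ => (R * R)%type) (x, y) f).
  assert (gP : forall n, good n (P n)).
  { intros k; induction k as [|m IH].
    - unfold good, al, be. simpl. replace (a / 1) with a by field. replace (b / 1) with b by field.
      fold c. lra.
    - simpl. unfold f at 1. destruct excluded_middle_informative; [|contradiction].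
      destruct constructive_indefinite_description as [p' [h1 h2]]. exact h1. }
  assert (nP : forall n, nxt n (P n) (P (S n))).
  { intros m. simpl. unfold f at 1. destruct excluded_middle_informative as [?|nn]; [|elim nn; auto].
    destruct constructive_indefinite_description as [p' [h1 h2]]. exact h2. }
  assert (mono : forall n k, fst (P n) <= fst (P (n + k)%nat) /\
      fst (P (n + k)%nat) + al (n + k)%nat <= fst (P n) + al n /\
      snd (P n) <= snd (P (n + k)%nat) /\ snd (P (n + k)%nat) + be (n + k)%nat <= snd (P n) + be n).
  { intros m k. induction k as [|k IH].
    - rewrite Nat.add_0_r. lra.
    - rewrite Nat.add_succ_r. destruct (nP (m + k)%nat) as (h1 & h2 & h3 & h4). lra. }
  assert (cmp : forall (u w : nat -> R), (forall n, 0 <= w n) ->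
     (forall n k, u n <= u (n + k)%nat /\ u (n + k)%nat + w (n + k)%nat <= u n + w n) ->
     exists l, forall n, u n <= l <= u n + w n).
  { intros u w w0 h. destruct (completeness (fun r => exists n, r = u n)) as [l [ub lb]].
    - exists (u 0%nat + w 0%nat). intros r [m ->]. destruct (h 0%nat m) as [_ h2]. simpl in h2.
      specialize (w0 m). lra.
    - exists (u 0%nat). exists 0%nat; auto.
    - exists l. intros m. split; [apply ub; eauto|]. apply lb. intros r [k ->].
      destruct (h m k) as [h1 h2]. destruct (h k m) as [h3 h4].
      rewrite (Nat.add_comm k m) in *. specialize (w0 (m + k)%nat). lra. }
  destruct (cmp (fun n => fst (P n)) al al0) as [u hu].
  { intros m k. destruct (mono m k) as (h1 & h2 & h3 & h4). lra. }
  destruct (cmp (fun n => snd (P n)) be be0) as [v hv].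
  { intros m k. destruct (mono m k) as (h1 & h2 & h3 & h4). lra. }
  assert (inr : inrect x y a b u v).
  { destruct (gP 0%nat) as (h1 & h2 & h3 & h4 & _). specialize (hu 0%nat). specialize (hv 0%nat).
    unfold inrect. lra. }
  destruct (H u v inr) as [L hL].
  (* [s] exceeds a + b, and scaled by 2^-N it bounds distances within the N-th rectangle. The
     tolerance [c / (4 * s * s)] leads to c <= (a + b) / s * (c / 2), which is absurd. *)
  set (s := a + b + 1). assert (hs : s > 0) by (unfold s; lra).
  destruct (hL (c / (4 * s * s))) as [r [hr Hr]].
  { apply Rdiv_lt_0_compat; [lra|]. nra. }
  destruct (pow_lt_1_zero (1/2)) with (y := r / s) as [N HN].
  { rewrite Rabs_pos_eq; lra. }
  { apply Rdiv_lt_0_compat; lra. }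
  specialize (HN N (Nat.le_refl N)).
  assert (eh : (1 / 2) ^ N = / 2 ^ N).
  { rewrite <- pow_inv. f_equal. field. }
  rewrite eh in HN.
  assert (q0 : 0 < / 2 ^ N) by (apply Rinv_0_lt_compat; auto).
  rewrite Rabs_pos_eq in HN by lra.
  set (q := / 2 ^ N) in *.
  assert (hq : q * s < r).
  { apply Rmult_lt_compat_r with (r := s) in HN; [|lra].
    unfold Rdiv in HN. rewrite Rmult_assoc, Rinv_l in HN; lra. }
  destruct (gP N) as (h1 & h2 & h3 & h4 & h5). specialize (hu N). specialize (hv N).
  simpl in hu, hv.
  set (X := fst (P N)) in *. set (Y := snd (P N)) in *.
  assert (ea : al N = a * q) by reflexivity. assert (eb : be N = b * q) by reflexivity.
  set (A := fun z => ((F (u, v) - L * (u, v)) + L * z)%C).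
  assert (Ac : rcts A X Y (al N) (be N)).
  { intros u' v' _. apply cwi_plus; [apply cwi_const|]. apply cwi_mult; [apply cwi_const|apply cts_id]. }
  assert (Fc : rcts F X Y (al N) (be N)).
  { intros u' v' [k1 k2]. apply Hc. unfold inrect. lra. }
  assert (E : rectI F X Y (al N) (be N) = rectI (fun z => F z - A z)%C X Y (al N) (be N)).
  { rewrite rectI_minus by auto. unfold A. rewrite rectI_affine. ring. }
  assert (bd : Cmod (rectI F X Y (al N) (be N)) <= 2 * (al N + be N) * (c / (4 * s * s) * (q * s))).
  { rewrite E. apply rectI_bound; auto.
    - intros u' v' hi. apply cwi_minus; auto.
    - intros u' v' [k1 k2].
      assert (dd : Cmod ((u', v') - (u, v)) <= q * s).
      { eapply Rle_trans; [apply Cmod_le_abs|]. simpl.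
        assert (Rabs (u' + - u) <= al N) by (apply Rabs_le; lra).
        assert (Rabs (v' + - v) <= be N) by (apply Rabs_le; lra).
        rewrite ea in H0. rewrite eb in H1. unfold s. nra. }
      replace (F (u', v') - A (u', v'))%C with (F (u', v') - F (u, v) - L * ((u', v') - (u, v)))%C
        by (unfold A; ring).
      eapply Rle_trans; [apply Hr; lra|]. apply Rmult_le_compat_l; auto.
      left. apply Rdiv_lt_0_compat; [lra|nra]. }
  rewrite ea, eb in bd.
  assert (q4 : 4 ^ N * (q * q) = 1).
  { unfold q. replace 4 with (2 * 2) by ring. rewrite Rpow_mult_distr. field. specialize (p2 N). lra. }
  assert (4 ^ N * Cmod (rectI F X Y (al N) (be N)) <=
     4 ^ N * (2 * (a * q + b * q) * (c / (4 * s * s) * (q * s)))).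
  { apply Rmult_le_compat_l; [left; apply pow_lt; lra|exact bd]. }
  replace (4 ^ N * (2 * (a * q + b * q) * (c / (4 * s * s) * (q * s)))) with
    ((4 ^ N * (q * q)) * ((a + b) / s * (c / 2))) in H0 by (field; lra).
  rewrite q4, Rmult_1_l in H0.
  assert ((a + b) / s < 1).
  { apply Rmult_lt_reg_r with s; [lra|]. unfold Rdiv. rewrite Rmult_assoc, Rinv_l by lra.
    unfold s. lra. }
  assert ((a + b) / s * (c / 2) <= 1 * (c / 2)) by (apply Rmult_le_compat_r; lra).
  lra.
Qed.

Lemma mean_value_punctured (phi : C -> C) (y c : C) (r rho M : R) :
  0 < rho < r ->
  (forall z, 0 < Cmod (z - y) < r -> exists L, cd phi z L) ->
  (forall e, e > 0 -> exists d, d > 0 /\ forall z, 0 < Cmod (z - y) < d -> Cmod (phi z - c) <= e) ->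
  (forall z, Cmod (z - y) = rho -> Cmod (phi z) <= M) ->
  Cmod c <= M.
Proof.
  intros hrho H Hl HM.
  destruct (Rle_dec (Cmod c) M) as [ok|no]; auto. exfalso.
  set (e := (Cmod c - M) / 2). assert (he : e > 0) by (unfold e; lra).
  destruct (Hl e he) as [d [hd Hd]].
  set (F := fun w => phi (y + Cexp w)%C).
  assert (ym : forall w, Cmod (y + Cexp w - y) = exp (fst w)).
  { intros w. replace (y + Cexp w - y)%C with (Cexp w) by ring. apply Cmod_Cexp. }
  set (s2 := ln rho). set (s1 := Rmin (s2 - 1) (ln (d / 2))).
  assert (h12 : s1 < s2) by (unfold s1; pose proof (Rmin_l (s2 - 1) (ln (d/2))); lra).
  assert (es2 : exp s2 = rho) by (apply exp_ln; lra).
  assert (es1 : exp s1 < d).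
  { apply Rle_lt_trans with (exp (ln (d/2))).
    - destruct (Rle_lt_or_eq_dec s1 (ln (d/2)) (Rmin_r _ _)) as [l|l].
      + left. apply exp_increasing. auto.
      + rewrite l. lra.
    - rewrite exp_ln; lra. }
  assert (FD : forall w, fst w <= s2 -> exists L, cd F w L).
  { intros w hw. destruct (H (y + Cexp w)%C) as [L hL].
    - rewrite ym. split; [apply exp_pos|]. apply Rle_lt_trans with rho; [|lra]. rewrite <- es2.
      destruct (Rle_lt_or_eq_dec _ _ hw) as [l|l]; [left; apply exp_increasing; auto|rewrite l; lra].
    - eexists. apply (cd_comp (fun w => y + Cexp w)%C phi); [|exact hL].
      apply cd_plus; [apply cd_const|apply cd_Cexp]. }
  assert (FC : forall w, fst w <= s2 -> cts F w).
  { intros w hw. destruct (FD w hw) as [L hL]. eapply cd_cts; eauto. }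
  assert (pi0 := PI_RGT_0).
  assert (G : rectI F s1 0 (s2 - s1) (2 * PI) = 0%C).
  { apply goursat; try lra. intros u v [h1 h2]. apply FD. simpl. lra. }
  unfold rectI in G. replace (s1 + (s2 - s1)) with s2 in G by ring. rewrite Rplus_0_l in G.
  assert (per : forall t, F (t, (2 * PI)%R) = F (t, 0%R)).
  { intros t. unfold F, Cexp. simpl. rewrite cos_2PI, sin_2PI, cos_0, sin_0. auto. }
  rewrite (CI_ext (fun t => F (t, (2 * PI)%R)) (fun t => F (t, 0%R))) in G; [|lra|auto].
  set (V2 := CI (fun t => F (s2, t)) 0 (2 * PI)) in *.
  set (V1 := CI (fun t => F (s1, t)) 0 (2 * PI)) in *.
  assert (EV : V2 = V1).
  { assert (Ci * (V2 - V1) = 0)%C by (rewrite <- G; ring).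
    apply Cmod_sub_0. assert (Cmod (Ci * (V2 - V1)) = 0) by (rewrite H0; apply Cmod_0).
    rewrite Cmod_mult, Cmod_Ci in H1. lra. }
  assert (B2 : Cmod V2 <= (2 * PI - 0) * M).
  { apply CI_bound; [lra| |].
    - intros t _. apply cts_v. apply FC. simpl. lra.
    - intros t _. apply HM. rewrite ym. exact es2. }
  assert (B1 : Cmod (V1 - CI (fun _ => c) 0 (2 * PI)) <= (2 * PI - 0) * e).
  { unfold V1. rewrite <- CI_minus; [|lra| |].
    - apply CI_bound; [lra| |].
      + intros t _. apply cwi_minus; [apply cts_v; apply FC; simpl; lra|apply cwi_const].
      + intros t _. apply Hd. rewrite ym. split; [apply exp_pos|exact es1].
    - intros t _. apply cts_v. apply FC. simpl. lra.
    - intros t _. apply cwi_const. }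
  rewrite CI_const in B1.
  pose proof (Cmod_le_add ((2 * PI - 0)%R * c) V1) as T. rewrite Cmod_sym in T.
  rewrite Cmod_mult, Cmod_R, Rabs_pos_eq in T by lra. rewrite EV in B2.
  assert (2 * PI * Cmod c <= 2 * PI * (M + e)) by lra.
  apply Rmult_le_reg_l in H0; [|lra]. unfold e in H0. lra.
Qed.

(** The mean value bound is applied to the difference quotient of [phi] at [y], whose limit there is
    [L]; on the circle of radius r / 2 it is at most 2 M / (r / 2), whence the factor 4. *)
Lemma cauchy_estimate (phi : C -> C) (y L : C) (r M : R) : 0 < r ->
  (forall z, Cmod (z - y) < r -> exists L, cd phi z L) ->
  (forall z, Cmod (z - y) < r -> Cmod (phi z) <= M) ->
  cd phi y L -> Cmod L <= 4 * M / r.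
Proof.
  intros hr H HM hL.
  assert (M0 : 0 <= M).
  { eapply Rle_trans; [apply Cmod_ge_0|apply (HM y)]. rewrite Cmod_sub_eq; lra. }
  apply (mean_value_punctured (fun z => (phi z - phi y) / (z - y))%C y L r (r/2)); [lra| | |].
  - intros z hz. assert (z <> y) by (apply Cmod_sub_neq; lra).
    destruct (H z) as [L' hL']; [lra|].
    eexists. unfold Cdiv. apply (cd_mult (fun z => phi z - phi y)%C (fun z => / (z - y))%C).
    + apply cd_minus; [exact hL'|apply cd_const].
    + apply (cd_inv (fun z => z - y)%C); [|apply Csub_neq_0; auto].
      apply cd_minus; [apply cd_id|apply cd_const].
  - intros e he. destruct (hL e he) as [d [hd Hd]]. exists d. split; auto.
    intros z hz. assert (z <> y) by (apply Cmod_sub_neq; lra).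
    replace ((phi z - phi y) / (z - y) - L)%C with ((phi z - phi y - L * (z - y)) / (z - y))%C
      by (field; apply Csub_neq_0; auto).
    rewrite Cmod_div by (apply Csub_neq_0; auto).
    apply Rmult_le_reg_r with (Cmod (z - y)); [lra|]. unfold Rdiv. rewrite Rmult_assoc, Rinv_l by lra.
    rewrite Rmult_1_r. apply Hd. lra.
  - intros z hz. assert (z <> y) by (apply Cmod_sub_neq; lra).
    rewrite Cmod_div, hz by (apply Csub_neq_0; auto).
    assert (Cmod (phi z - phi y) <= 2 * M).
    { unfold Cminus. eapply Rle_trans; [apply Cmod_triangle|]. rewrite Cmod_opp.
      assert (Cmod (phi z) <= M) by (apply HM; lra).
      assert (Cmod (phi y) <= M) by (apply HM; rewrite Cmod_sub_eq; lra). lra. }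
    apply Rmult_le_reg_r with (r/2); [lra|]. unfold Rdiv. rewrite (Rmult_assoc _ (/ _)), Rinv_l by lra.
    rewrite Rmult_1_r. eapply Rle_trans; [exact H1|]. right. field. lra.
Qed.

(** * Entire functions and local inverses *)

Lemma cts_bounded (f : C -> C) (c : C) (r : R) : (forall z, cts f z) ->
  exists M, forall z, Cmod (z - c) <= r -> Cmod (f z) <= M.
Proof.
  intros H. apply NNPP. intros n.
  assert (ex : forall k : nat, exists z, Cmod (z - c) <= r /\ INR k < Cmod (f z)).
  { intros k. apply NNPP. intros m. apply n. exists (INR k). intros z hz.
    destruct (Rle_dec (Cmod (f z)) (INR k)); auto. exfalso. apply m. exists z. split; auto. lra. }
  set (u := fun k => proj1_sig (constructive_indefinite_description _ (ex k))).
  assert (hu : forall k, Cmod (u k - c) <= r /\ INR k < Cmod (f (u k))).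
  { intros k. unfold u. destruct constructive_indefinite_description; auto. }
  destruct (bounded_cluster u (r + Cmod c)) as [l Hl].
  { intros k. destruct (hu k) as [a _]. pose proof (Cmod_le_add (u k) c). lra. }
  destruct (H l 1) as [d [hd Hd]]; [lra|].
  destruct (archimed_cor1 (/ (Cmod (f l) + 1))) as [N [hN1 hN2]].
  { apply Rinv_0_lt_compat. pose proof (Cmod_ge_0 (f l)). lra. }
  destruct (Hl d N hd) as [k [hk Hk]].
  specialize (Hd (u k) I Hk). destruct (hu k) as [_ b].
  pose proof (Cmod_le_add (f (u k)) (f l)).
  assert (Cmod (f l) + 1 < INR N).
  { pose proof (Cmod_ge_0 (f l)). apply Rinv_lt_cancel; [apply lt_0_INR; lia|]. auto. }
  assert (INR N <= INR k) by (apply le_INR; lia). lra.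
Qed.

Definition is_deriv (f f' : C -> C) : Prop := forall z, cd f z (f' z).

Lemma is_deriv_cts f f' : is_deriv f f' -> forall z, cts f z.
Proof. intros H z. eapply cd_cts. apply H. Qed.

Lemma cd_shift f y z L : cd f (z + y)%C L -> cd (fun w => f (w + y)%C) z L.
Proof.
  intros H. eapply cd_eq.
  - apply (cd_comp (fun w => w + y)%C f); [|exact H].
    apply cd_plus; [apply cd_id|apply cd_const].
  - ring.
Qed.

Lemma deriv_bounded f f' c r : is_deriv f f' ->
  exists B, 0 <= B /\ forall z, Cmod (z - c) <= r -> Cmod (f' z) <= B.
Proof.
  intros H. destruct (cts_bounded f c (r + 1) (is_deriv_cts _ _ H)) as [M HM].
  exists (Rmax 0 (4 * M / 1)). split; [apply Rmax_l|].
  intros z hz. eapply Rle_trans; [|apply Rmax_r].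
  apply cauchy_estimate with f z; [lra| | |apply H].
  - intros. eexists; apply H.
  - intros w hw. apply HM. pose proof (Cmod_tri w z c). lra.
Qed.

(** [f' y1 - f' y2] is the derivative at 0 of [f (w + y1) - f (w + y2)], a function that the mean
    value inequality bounds by a multiple of |y1 - y2| on the unit disc. *)
Lemma deriv_lipschitz f f' c r : is_deriv f f' ->
  exists B, 0 <= B /\ forall y1 y2, Cmod (y1 - c) < r -> Cmod (y2 - c) < r ->
    Cmod (f' y1 - f' y2) <= B * Cmod (y1 - y2).
Proof.
  intros H. destruct (deriv_bounded f f' c (r + 1) H) as [B [B0 HB]].
  exists (4 * B). split; [lra|]. intros y1 y2 h1 h2.
  replace (4 * B * Cmod (y1 - y2)) with (4 * (B * Cmod (y1 - y2)) / 1) by field.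
  apply cauchy_estimate with (fun w => f (w + y1) - f (w + y2))%C (RtoC 0); [lra| | |].
  - intros z _. eexists. apply cd_minus; apply cd_shift; apply H.
  - intros z hz. replace (z - 0)%C with z in hz by ring.
    replace (y1 - y2)%C with (z + y1 - (z + y2))%C by ring.
    apply (mean_value f f' (z + y2) (z + y1)); [intros; apply H|].
    intros t ht. apply HB.
    assert (hb : ballC c (r + 1) (seg (z + y2) (z + y1) t)).
    { apply convex_ball; auto; unfold ballC.
      - replace (z + y2 - c)%C with (z + (y2 - c))%C by ring.
        eapply Rle_lt_trans; [apply Cmod_triangle|]. lra.
      - replace (z + y1 - c)%C with (z + (y1 - c))%C by ring.
        eapply Rle_lt_trans; [apply Cmod_triangle|]. lra. }
    unfold ballC in hb. lra.
  - apply cd_minus; apply cd_shift.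
    + replace (0 + y1)%C with y1 by ring. apply H.
    + replace (0 + y2)%C with y2 by ring. apply H.
Qed.

Lemma deriv_cts f f' : is_deriv f f' -> forall z, cts f' z.
Proof.
  intros H z e he. destruct (deriv_lipschitz f f' z 1 H) as [B [B0 HB]].
  assert (p : 0 < e / (B + 1)) by (apply Rdiv_lt_0_compat; lra).
  exists (Rmin 1 (e / (B + 1))). split; [apply Rmin_pos; lra|].
  intros w _ hw. unfold dC in hw.
  assert (h1 := Rlt_le_trans _ _ _ hw (Rmin_l _ _)).
  assert (h2 := Rlt_le_trans _ _ _ hw (Rmin_r _ _)).
  eapply Rle_lt_trans; [apply HB; auto; rewrite Cmod_sub_eq; lra|].
  apply Rmult_lt_compat_r with (r := B + 1) in h2; [|lra].
  unfold Rdiv in h2. rewrite Rmult_assoc, Rinv_l in h2 by lra.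
  pose proof (Cmod_ge_0 (w - z)). nra.
Qed.

Lemma cd_scal c f z L : cd f z L -> cd (fun w => c * f w)%C z (c * L)%C.
Proof.
  intros H. eapply cd_eq; [apply (cd_mult (fun _ => c) f); [apply cd_const|exact H]|]. ring.
Qed.

(* The difference quotients of f converge to f' locally uniformly, so by Cauchy's estimate their
   derivatives, the difference quotients of f', converge. *)
Lemma deriv_differentiable f f' : is_deriv f f' -> exists f'', is_deriv f' f''.
Proof.
  intros H.
  assert (P : forall y, exists L, cd f' y L).
  { intros y. destruct (deriv_lipschitz f f' y 3 H) as [B [B0 HB]].
    set (q := fun (h z : C) => (/ h * (f (z + h) - f z))%C).
    set (q' := fun h : C => (/ h * (f' (y + h) - f' y))%C).
    assert (dq : forall h, cd (q h) y (q' h)).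
    { intros h. apply cd_scal. apply cd_minus; [apply cd_shift|]; apply H. }
    assert (near : forall h z : C, h <> 0%C -> Cmod h < 1 -> Cmod (z - y) < 1 ->
       Cmod (q h z - f' z) <= B * Cmod h).
    { intros h z h0 h1 hz. assert (ph := proj1 (Cmod_gt_0 _) h0).
      replace (q h z - f' z)%C with (/ h * ((f (z + h) - f' z * (z + h)) - (f z - f' z * z)))%C
        by (unfold q; field; auto).
      rewrite Cmod_mult, Cmod_inv by auto.
      apply Rmult_le_reg_l with (Cmod h); auto.
      rewrite <- Rmult_assoc, Rinv_r, Rmult_1_l by lra.
      replace (Cmod h * (B * Cmod h)) with (B * Cmod h * Cmod (z + h - z))
        by (replace (z + h - z)%C with h by ring; ring).
      apply (mean_value (fun w => f w - f' z * w)%C (fun w => f' w - f' z * 1)%C z (z + h)).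
      - intros t ht. apply cd_minus; [apply H|apply cd_scal, cd_id].
      - intros t ht. rewrite Cmult_1_r.
        assert (dz : Cmod (seg z (z + h) t - z) <= Cmod h).
        { pose proof (seg_dist z (z + h) t 0) as E. rewrite seg_0 in E. rewrite E.
          replace (z + h - z)%C with h by ring. rewrite Rabs_pos_eq by lra.
          pose proof (Cmod_ge_0 h). nra. }
        eapply Rle_trans; [apply HB|].
        + pose proof (Cmod_tri (seg z (z + h) t) z y). lra.
        + lra.
        + apply Rmult_le_compat_l; auto. }
    assert (cau : forall h k : C, h <> 0%C -> k <> 0%C -> Cmod h < 1 -> Cmod k < 1 ->
       Cmod (q' h - q' k) <= 4 * (B * Cmod h + B * Cmod k) / 1).
    { intros h k h0 k0 h1 k1.
      apply cauchy_estimate with (fun z => q h z - q k z)%C y; [lra| | |].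
      - intros z _. eexists. unfold q. apply cd_minus; apply cd_scal; apply cd_minus;
          first [apply cd_shift; apply H|apply H].
      - intros z hz. pose proof (Cmod_tri (q h z) (f' z) (q k z)).
        pose proof (near h z h0 h1 hz). pose proof (near k z k0 k1 hz).
        rewrite (Cmod_sym (f' z)) in H0. lra.
      - apply cd_minus; auto. }
    set (hn := fun n : nat => RtoC (/ INR (n + 2))).
    assert (hnp : forall n, 0 < / INR (n + 2)) by (intros; apply Rinv_0_lt_compat, lt_0_INR; lia).
    assert (hn0 : forall n, hn n <> 0%C).
    { intros n E. apply RtoC_inj in E. specialize (hnp n). lra. }
    assert (hnm : forall n, Cmod (hn n) = / INR (n + 2)).
    { intros n. unfold hn. rewrite Cmod_R, Rabs_pos_eq; auto. specialize (hnp n). lra. }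
    assert (hn1 : forall n, Cmod (hn n) < 1).
    { intros n. rewrite hnm. rewrite <- Rinv_1. apply Rinv_lt_contravar.
      - rewrite Rmult_1_l. apply lt_0_INR. lia.
      - replace 1 with (INR 1) by auto. apply lt_INR. lia. }
    assert (hnl : forall e, e > 0 -> exists N, forall n, (N <= n)%nat -> Cmod (hn n) < e).
    { intros e he. destruct (archimed_cor1 e he) as [N [a b]]. exists N. intros n hn'.
      rewrite hnm. eapply Rle_lt_trans; [|exact a]. apply Rinv_le_contravar.
      - apply lt_0_INR. lia.
      - apply le_INR. lia. }
    destruct (cauchy_complete (fun n => q' (hn n))) as [L HL].
    { intros e he. destruct (hnl (e / (32 * (B + 1)))) as [N HN].
      { apply Rdiv_lt_0_compat; lra. }
      exists N. intros n m a b. eapply Rle_lt_trans; [apply cau; auto|].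
      assert (E : e = 32 * (B + 1) * (e / (32 * (B + 1)))) by (field; lra).
      set (t := e / (32 * (B + 1))) in *. assert (pa := HN n a). assert (pb := HN m b).
      pose proof (Cmod_ge_0 (hn n)). pose proof (Cmod_ge_0 (hn m)). nra. }
    exists L. intros e he.
    assert (pe : 0 < e / (32 * (B + 1))) by (apply Rdiv_lt_0_compat; lra).
    exists (Rmin 1 (e / (32 * (B + 1)))). split; [apply Rmin_pos; lra|].
    intros w hw. assert (h1 := Rlt_le_trans _ _ _ hw (Rmin_l _ _)).
    assert (h2 := Rlt_le_trans _ _ _ hw (Rmin_r _ _)).
    destruct (classic (w = y)) as [->|n].
    { replace (f' y - f' y - L * (y - y))%C with (RtoC 0) by ring. rewrite Cmod_0, Cmod_sub_eq. lra. }
    assert (p := Cmod_sub_pos _ _ n). assert (n0 := Csub_neq_0 _ _ n).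
    assert (main : Cmod (q' (w - y)%C - L) <= e).
    { destruct (HL (e/4)) as [N1 HN1]; [lra|]. destruct (hnl (e / (32 * (B + 1))) pe) as [N2 HN2].
      set (m := max N1 N2). specialize (HN1 m ltac:(lia)). specialize (HN2 m ltac:(lia)).
      pose proof (Cmod_tri (q' (w - y)%C) (q' (hn m)) L).
      pose proof (cau (w - y)%C (hn m) n0 (hn0 m) h1 (hn1 m)).
      assert (E : e = 32 * (B + 1) * (e / (32 * (B + 1)))) by (field; lra).
      set (t := e / (32 * (B + 1))) in *. pose proof (Cmod_ge_0 (hn m)).
      assert (B * Cmod (w - y) <= (B + 1) * t) by nra.
      assert (B * Cmod (hn m) < (B + 1) * t) by nra. nra. }
    replace (f' w - f' y - L * (w - y))%C with ((q' (w - y)%C - L) * (w - y))%C.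
    2:{ unfold q'. replace (y + (w - y))%C with w by ring. field. auto. }
    rewrite Cmod_mult. apply Rmult_le_compat_r; lra. }
  exists (fun z => proj1_sig (constructive_indefinite_description _ (P z))).
  intros z. destruct constructive_indefinite_description; auto.
Qed.

Lemma entire_deriv (f : C -> C) : entire f -> exists f', is_deriv f f'.
Proof.
  intros H.
  assert (P : forall z, exists L, cd f z L).
  { intros z. destruct (H z) as [L hL]. exists L. apply has_cderiv_cd. exact hL. }
  exists (fun z => proj1_sig (constructive_indefinite_description _ (P z))).
  intros z. destruct constructive_indefinite_description; auto.
Qed.

(** Where [F'] stays within half its modulus of [L], the simplified Newton map
    [T u = u - (F u - y) / L] contracts by 1/2. Targets within m d / 4 of [F x] make its first step
    at most d / 4, so the iterates remain within d / 2 of [x]. *)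
Lemma inverse_function (F F' : C -> C) (x : C) (d0 : R) :
  is_deriv F F' -> (forall z, cts F' z) -> F' x <> 0%C -> d0 > 0 ->
  exists d rho k, 0 < d <= d0 /\ 0 < rho /\
    (forall u v, Cmod (u - x) < d -> Cmod (v - x) < d ->
       Cmod (F' x) / 2 * Cmod (u - v) <= Cmod (F u - F v)) /\
    (forall y, Cmod (y - F x) < rho -> Cmod (k y - x) < d /\ F (k y) = y).
Proof.
  intros H HC n0 hd0. set (L := F' x). set (m := Cmod L).
  assert (hm : 0 < m) by (apply Cmod_gt_0; auto).
  destruct (HC x (m/2)) as [d1 [hd1 Hd1]]; [lra|].
  set (d := Rmin d0 d1). assert (pd : 0 < d) by (apply Rmin_pos; lra).
  assert (lin : forall u v, Cmod (u - x) < d -> Cmod (v - x) < d ->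
     Cmod ((F u - F v) - L * (u - v)) <= m / 2 * Cmod (u - v)).
  { intros u v hu hv.
    replace ((F u - F v) - L * (u - v))%C with ((F u - L * u) - (F v - L * v))%C by ring.
    apply (mean_value (fun w => F w - L * w)%C (fun w => F' w - L * 1)%C v u).
    - intros t ht. apply cd_minus; [apply H|apply cd_scal, cd_id].
    - intros t ht. rewrite Cmult_1_r. left. apply Hd1; [exact I|].
      assert (hb : ballC x d (seg v u t)) by (apply convex_ball; auto).
      eapply Rlt_le_trans; [exact hb|apply Rmin_r]. }
  (* The condition on [y] stands inside the existential so that choice yields a total function
     [k]. *)
  assert (surj : forall y, exists u, Cmod (y - F x) < m * d / 4 -> Cmod (u - x) < d /\ F u = y).
  { intros y. destruct (Rlt_dec (Cmod (y - F x)) (m * d / 4)) as [hy|]; [|exists x; intros; contradiction].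
    set (T := fun u => (u - (F u - y) / L)%C).
    assert (contr : forall u v, Cmod (u - x) < d -> Cmod (v - x) < d ->
       Cmod (T u - T v) <= / 2 * Cmod (u - v)).
    { intros u v hu hv.
      replace (T u - T v)%C with (- ((F u - F v) - L * (u - v)) / L)%C by (unfold T; field; auto).
      rewrite Cmod_div, Cmod_opp by auto. fold m.
      apply Rmult_le_reg_r with m; auto. unfold Rdiv. rewrite Rmult_assoc, Rinv_l by lra.
      rewrite Rmult_1_r. eapply Rle_trans; [apply lin; auto|]. right. field. }
    assert (T0 : Cmod (T x - x) <= d / 4).
    { replace (T x - x)%C with ((y - F x) / L)%C by (unfold T; field; auto).
      rewrite Cmod_div by auto. fold m. apply Rmult_le_reg_r with m; auto.
      unfold Rdiv at 1. rewrite Rmult_assoc, Rinv_l by lra. lra. }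
    set (u := fun n : nat => Nat.iter n T x).
    assert (p2 : forall n, 0 < (/2) ^ n) by (intros; apply pow_lt; lra).
    assert (iter1 : forall n, Cmod (u n - x) <= d / 2 * (1 - (/2)^n) /\
        Cmod (u (S n) - u n) <= d / 4 * (/2)^n).
    { induction n as [|n [I1 I2]].
      - simpl. rewrite Cmod_sub_eq. split; [lra|]. rewrite Rmult_1_r. exact T0.
      - assert (hn : Cmod (u n - x) < d) by (specialize (p2 n); nra).
        assert (A : Cmod (u (S n) - x) <= d / 2 * (1 - (/2)^(S n))).
        { pose proof (Cmod_tri (u (S n)) (u n) x). simpl pow. lra. }
        split; auto.
        change (u (S (S n))) with (T (u (S n))). change (u (S n)) with (T (u n)) at 2.
        eapply Rle_trans; [apply contr; auto|].
        + specialize (p2 (S n)). nra.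
        + simpl pow. lra. }
    assert (far : forall n k, Cmod (u (n + k)%nat - u n) <= d / 2 * (/2)^n * (1 - (/2)^k)).
    { intros n k. induction k as [|k IH].
      - rewrite Nat.add_0_r, Cmod_sub_eq. simpl. lra.
      - rewrite Nat.add_succ_r. pose proof (Cmod_tri (u (S (n + k))) (u (n + k)%nat) (u n)).
        destruct (iter1 (n + k)%nat) as [_ I2]. rewrite pow_add in I2. simpl pow. 
        replace (d / 2 * (/2)^n * (1 - / 2 * (/2)^k)) with
          (d / 2 * (/2)^n * (1 - (/2)^k) + d / 4 * ((/2)^n * (/2)^k)) by field. lra. }
    destruct (cauchy_complete u) as [l Hl].
    { intros e he. destruct (pow_lt_1_zero (/2)) with (y := e / d) as [N HN].
      - rewrite Rabs_pos_eq; lra.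
      - apply Rdiv_lt_0_compat; lra.
      - exists N.
        assert (sm : forall n, (N <= n)%nat -> Cmod (u n - u N) < e / 2).
        { intros n hn. specialize (HN N (Nat.le_refl N)). specialize (far N (n - N)%nat).
          replace (N + (n - N))%nat with n in far by lia.
          rewrite Rabs_pos_eq in HN by (left; apply p2).
          apply Rmult_lt_compat_r with (r := d) in HN; auto.
          unfold Rdiv in HN. rewrite Rmult_assoc, Rinv_l in HN by lra.
          pose proof (p2 N). pose proof (p2 (n - N)%nat).
          assert (0 < d * (/2)^N) by nra.
          assert (d / 2 * (/2)^N * (1 - (/2)^(n - N)) <= d / 2 * (/2)^N * 1).
          { apply Rmult_le_compat_l; lra. }
          lra. }
        intros n k hn hk. pose proof (Cmod_tri (u n) (u N) (u k)). pose proof (sm n hn).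
        pose proof (sm k hk). rewrite (Cmod_sym (u N)) in H0. lra. }
    assert (lx : Cmod (l - x) <= d / 2).
    { apply Rnot_lt_le. intros c. destruct (Hl (Cmod (l - x) - d / 2)) as [N HN]; [lra|].
      specialize (HN N (Nat.le_refl N)). destruct (iter1 N) as [I1 _].
      pose proof (Cmod_tri l (u N) x). rewrite (Cmod_sym l (u N)) in H0. specialize (p2 N).
      assert (d / 2 * (1 - (/2)^N) <= d / 2 * 1) by (apply Rmult_le_compat_l; lra). lra. }
    exists l. intros _. split; [lra|].
    assert (fix_ : T l = l).
    { apply Cmod_small_eq. intros e he. destruct (Hl (e/2)) as [N HN]; [lra|].
      assert (a := HN N (Nat.le_refl N)). assert (b := HN (S N) (Nat.le_succ_diag_r N)).
      pose proof (Cmod_tri (T l) (u (S N)) l).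
      assert (Cmod (T l - u (S N)) <= /2 * Cmod (l - u N)).
      { apply contr; [lra|]. destruct (iter1 N) as [I1 _]. specialize (p2 N). nra. }
      rewrite (Cmod_sym l) in H1. lra. }
    unfold T in fix_.
    assert (Z : ((F l - y) / L)%C = 0%C).
    { transitivity (l - (l - (F l - y) / L))%C; [ring|]. rewrite fix_. ring. }
    apply Cmod_sub_0. replace (F l - y)%C with ((F l - y) / L * L)%C by (field; auto).
    rewrite Z, Cmult_0_l. apply Cmod_0. }
  exists d, (m * d / 4).
  exists (fun y => proj1_sig (constructive_indefinite_description _ (surj y))).
  split; [split; [auto|apply Rmin_l]|]. split; [nra|]. split.
  - intros u v hu hv. specialize (lin u v hu hv). fold L m.
    pose proof (Cmod_le_add (L * (u - v)) (F u - F v)). rewrite (Cmod_sym (L * (u - v))) in H0.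
    rewrite Cmod_mult in H0. fold m in H0. lra.
  - intros y hy. destruct constructive_indefinite_description as [w Hw]. simpl. apply Hw. lra.
Qed.

(** * Lifting through nonsingular values *)

(** The values over which continuation of lifts cannot break down; see [path_lift]. *)
Definition nonsing (F : C -> C) (y : C) : Prop := ~ critical_value F y /\ ~ asymptotic_value F y.

Lemma nonsing_deriv F F' x : is_deriv F F' -> nonsing F (F x) -> F' x <> 0%C.
Proof.
  intros H [n _] E. apply n. exists x. split; auto. apply has_cderiv_cd.
  change C0 with (RtoC 0). rewrite <- E. apply H.
Qed.

Definition icc (a b t : R) : Prop := a <= t <= b.

Lemma cwi_ball (K : C -> Prop) f z r : r > 0 -> cwi dC (fun w => K w /\ Cmod (w - z) < r) f z ->
  cwi dC K f z.
Proof.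
  intros hr H e he. destruct (H e he) as [d [hd Hd]]. exists (Rmin d r).
  split; [apply Rmin_pos; lra|]. intros y Ky hy. apply Hd.
  - split; auto. eapply Rlt_le_trans; [exact hy|apply Rmin_r].
  - eapply Rlt_le_trans; [exact hy|apply Rmin_l].
Qed.

Lemma local_section F F' x d0 : is_deriv F F' -> F' x <> 0%C -> d0 > 0 ->
  exists d rho k, 0 < d <= d0 /\ 0 < rho /\
    (forall u v, Cmod (u - x) < d -> Cmod (v - x) < d -> F u = F v -> u = v) /\
    (forall y, Cmod (y - F x) < rho -> Cmod (k y - x) < d /\ F (k y) = y /\ cts k y).
Proof.
  intros H n0 hd0.
  destruct (inverse_function F F' x d0 H (deriv_cts _ _ H) n0 hd0)
    as (d & rho & k & hd & hrho & lip & sec).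
  assert (pm := proj1 (Cmod_gt_0 _) n0).
  exists d, rho, k. split; auto. split; auto. split.
  - intros u v hu hv E. apply Cmod_sub_0. specialize (lip u v hu hv). rewrite E, Cmod_sub_eq in lip.
    pose proof (Cmod_ge_0 (u - v)). nra.
  - intros y hy. destruct (sec y hy) as [s1 s2]. split; auto. split; auto.
    apply cwi_ball with (rho - Cmod (y - F x)); [lra|].
    intros e he. exists (e * (Cmod (F' x) / 2)). split; [nra|].
    intros y' [_ hy'] hd'. unfold dC in hd'.
    assert (h' : Cmod (y' - F x) < rho) by (pose proof (Cmod_tri y' y (F x)); lra).
    destruct (sec y' h') as [s1' s2']. specialize (lip (k y') (k y) s1' s1).
    rewrite s2, s2' in lip. nra.
Qed.

(** The set where the two lifts agree is open because [F] is injective near a point with nonzero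
    derivative, and closed by continuity. *)
Lemma path_unique F F' (a b : R) (q1 q2 : R -> C) s0 : is_deriv F F' ->
  (forall t, icc a b t -> cwi dR (icc a b) q1 t /\ cwi dR (icc a b) q2 t /\
     F (q1 t) = F (q2 t) /\ F' (q1 t) <> 0%C) ->
  icc a b s0 -> q1 s0 = q2 s0 -> forall t, icc a b t -> q1 t = q2 t.
Proof.
  intros H Hq h0 E0 t ht.
  apply (interval_clopen a b (fun t => q1 t = q2 t)) with s0; auto.
  intros s hs. destruct (Hq s hs) as (c1 & c2 & EF & n0).
  destruct (classic (q1 s = q2 s)) as [E|n].
  - destruct (local_section F F' (q1 s) 1 H n0) as (d & rho & k & hd & _ & inj & _); [lra|].
    destruct (c1 d) as [r1 [hr1 H1]]; [lra|]. destruct (c2 d) as [r2 [hr2 H2]]; [lra|].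
    exists (Rmin r1 r2). split; [apply Rmin_pos; lra|]. intros s1 s2 _ h2 _ k2 _.
    apply inj.
    + apply H1; auto. eapply Rlt_le_trans; [exact k2|apply Rmin_l].
    + rewrite E. apply H2; auto. eapply Rlt_le_trans; [exact k2|apply Rmin_r].
    + apply (Hq s2 h2).
  - assert (p := Cmod_sub_pos _ _ n). set (e := Cmod (q1 s - q2 s)) in *.
    destruct (c1 (e/2)) as [r1 [hr1 H1]]; [lra|]. destruct (c2 (e/2)) as [r2 [hr2 H2]]; [lra|].
    exists (Rmin r1 r2). split; [apply Rmin_pos; lra|]. intros s1 s2 h1 _ k1 _ Es. exfalso.
    specialize (H1 s1 h1 (Rlt_le_trans _ _ _ k1 (Rmin_l _ _))).
    specialize (H2 s1 h1 (Rlt_le_trans _ _ _ k1 (Rmin_r _ _))).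
    pose proof (Cmod_tri (q1 s) (q1 s1) (q2 s)). rewrite (Cmod_sym (q1 s) (q1 s1)) in H0.
    rewrite Es in *. fold e in H0. lra.
Qed.

Lemma cwi_glue (q k : R -> C) a t1 b t : a <= t1 <= b -> icc a b t ->
  (forall t, icc a t1 t -> cwi dR (icc a t1) q t) ->
  (forall t, icc t1 b t -> cwi dR (icc t1 b) k t) -> q t1 = k t1 ->
  cwi dR (icc a b) (fun t => if Rle_dec t t1 then q t else k t) t.
Proof.
  intros h1 ht Hq Hk E e he. unfold dR, icc in *.
  destruct (Rtotal_order t t1) as [l|[->|g]].
  - destruct (Hq t ltac:(lra) e he) as [d [hd Hd]]. exists (Rmin d (t1 - t)).
    split; [apply Rmin_pos; lra|]. intros y hy yd.
    assert (y1 := Rlt_le_trans _ _ _ yd (Rmin_l _ _)).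
    assert (y2 := Rlt_le_trans _ _ _ yd (Rmin_r _ _)). apply Rabs_def2 in y2.
    destruct (Rle_dec y t1); [|lra]. destruct (Rle_dec t t1); [|lra]. apply Hd; auto. lra.
  - destruct (Hq t1 ltac:(lra) e he) as [d [hd Hd]]. destruct (Hk t1 ltac:(lra) e he) as [d' [hd' Hd']].
    exists (Rmin d d'). split; [apply Rmin_pos; lra|]. intros y hy yd.
    assert (y1 := Rlt_le_trans _ _ _ yd (Rmin_l _ _)).
    assert (y2 := Rlt_le_trans _ _ _ yd (Rmin_r _ _)).
    destruct (Rle_dec t1 t1); [|lra]. destruct (Rle_dec y t1).
    + apply Hd; auto. lra.
    + rewrite E. apply Hd'; auto. lra.
  - destruct (Hk t ltac:(lra) e he) as [d [hd Hd]]. exists (Rmin d (t - t1)).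
    split; [apply Rmin_pos; lra|]. intros y hy yd.
    assert (y1 := Rlt_le_trans _ _ _ yd (Rmin_l _ _)).
    assert (y2 := Rlt_le_trans _ _ _ yd (Rmin_r _ _)). apply Rabs_def2 in y2.
    destruct (Rle_dec y t1); [lra|]. destruct (Rle_dec t t1); [lra|]. apply Hd; auto. lra.
Qed.

Definition is_plift (F : C -> C) (p : R -> C) (x : C) (s : R) (q : R -> C) : Prop :=
  q 0 = x /\ forall t, icc 0 s t -> cwi dR (icc 0 s) q t /\ F (q t) = p t.

Lemma plift_restrict F p x s s' q : s' <= s -> is_plift F p x s q -> is_plift F p x s' q.
Proof.
  intros h [E H]. split; auto. unfold icc in *. intros t ht. destruct (H t ltac:(lra)) as [c e].
  split; auto. eapply cwi_sub; [|exact c]. simpl. intros; unfold icc in *; lra.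
Qed.

(** If a lift over [0, s) tends to infinity, then [p s] is an asymptotic value. Otherwise it has a
    finite cluster point over [p s], which is not critical, and the local section there carries the
    lift past [s]. *)
Lemma path_lift F F' (p : R -> C) x : is_deriv F F' ->
  (forall t, icc 0 1 t -> cwi dR (icc 0 1) p t) ->
  (forall t, icc 0 1 t -> nonsing F (p t)) -> F x = p 0 ->
  exists q, is_plift F p x 1 q.
Proof.
  intros H Hp Hs E0.
  assert (Fc := is_deriv_cts _ _ H).
  assert (uniq : forall s q1 q2, s <= 1 -> is_plift F p x s q1 -> is_plift F p x s q2 ->
     forall t, icc 0 s t -> q1 t = q2 t).
  { intros s q1 q2 s1 [e1 H1] [e2 H2] t ht. unfold icc in *.
    apply (path_unique F F' 0 s q1 q2 0 H); unfold icc; try lra; [|congruence].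
    intros u hu. destruct (H1 u hu) as [c1 f1]. destruct (H2 u hu) as [c2 f2].
    repeat split; auto; [congruence|]. apply nonsing_deriv with F; auto. rewrite f1. apply Hs.
    unfold icc. lra. }
  apply (interval_clopen 0 1 (fun s => exists q, is_plift F p x s q)) with 0; try lra.
  2:{ exists (fun _ => x). split; auto. unfold icc. intros t ht. split; [apply cwi_const|].
      replace t with 0 by lra. auto. }
  intros s hs.
  (* If lifting already fails before [s], no lift exists at any point near [s], and the implication
     to be propagated is vacuous. *)
  destruct (classic (exists t0, 0 <= t0 < s /\ ~ exists q, is_plift F p x t0 q)) as [[t0 [ht0 n0]]|all].
  { exists (s - t0). split; [lra|]. intros s1 s2 h1 h2 k1 k2 [q hq]. exfalso. apply n0. exists q.
    apply plift_restrict with s1; auto. apply Rabs_def2 in k1. lra. }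
  assert (all' : forall t, 0 <= t < s -> exists q, is_plift F p x t q).
  { intros t ht. apply NNPP. intros n. apply all. eauto. }
  assert (ext : exists xs, F xs = p s /\ forall e d, e > 0 -> d > 0 ->
     exists t q, icc 0 s t /\ s - d < t /\ is_plift F p x t q /\ Cmod (q t - xs) < e).
  { destruct (Req_dec s 0) as [->|sn].
    { exists x. split; auto. intros e d he hd. exists 0, (fun _ => x).
      unfold icc. repeat split; try lra; try apply cwi_const.
      - unfold icc in *. intros. replace t with 0 by lra. auto.
      - rewrite Cmod_sub_eq. lra. }
    (* The lifts over [0, t] with t < s agree by [uniq] and so form one map [Q] on [0, s); the value
       [x] elsewhere is a default. *)
    set (Q := fun t => match excluded_middle_informative (0 <= t < s) with
       | left h => proj1_sig (constructive_indefinite_description _ (all' t h)) t | right _ => x end).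
    assert (HQ : forall t q, 0 <= t < s -> is_plift F p x t q -> forall u, icc 0 t u -> Q u = q u).
    { intros t q ht hq u hu. unfold icc in hu. unfold Q.
      destruct (excluded_middle_informative (0 <= u < s)) as [h|h]; [|elim h; lra].
      destruct constructive_indefinite_description as [q' hq']. simpl.
      apply (uniq u); auto; [lra| |unfold icc; lra]. apply plift_restrict with t; auto. lra. }
    assert (FQ : forall t, 0 <= t < s -> F (Q t) = p t).
    { intros t ht. destruct (all' t ht) as [q hq]. rewrite (HQ t q ht hq); [|unfold icc; lra].
      apply hq. unfold icc. lra. }
    destruct (classic (exists M, forall d, d > 0 -> exists t, 0 <= t < s /\ s - d < t /\ Cmod (Q t) <= M))
      as [[M HM]|ninf].
    - assert (ex : forall n : nat, exists t, 0 <= t < s /\ s - / (INR n + 1) < t /\ Cmod (Q t) <= M).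
      { intros n. apply HM. apply Rinv_0_lt_compat. pose proof (pos_INR n). lra. }
      set (tn := fun n => proj1_sig (constructive_indefinite_description _ (ex n))).
      assert (htn : forall n, 0 <= tn n < s /\ s - / (INR n + 1) < tn n /\ Cmod (Q (tn n)) <= M).
      { intros n. unfold tn. destruct constructive_indefinite_description; auto. }
      destruct (bounded_cluster (fun n => Q (tn n)) M) as [l Hl]; [intros; apply htn|].
      assert (close : forall e d, e > 0 -> d > 0 -> exists t, 0 <= t < s /\ s - d < t /\ Cmod (Q t - l) < e).
      { intros e d he hd. destruct (archimed_cor1 d hd) as [N [a b]].
        destruct (Hl e N he) as [n [hn Hn]]. destruct (htn n) as (h1 & h2 & h3).
        exists (tn n). repeat split; try lra.
        assert (/ (INR n + 1) <= / INR N); [|lra]. apply Rinv_le_contravar; [apply lt_0_INR; lia|].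
        assert (INR N <= INR n) by (apply le_INR; lia). lra. }
      exists l. split.
      + apply Cmod_small_eq. intros e he.
        destruct (Fc l (e/2)) as [d1 [hd1 Hd1]]; [lra|].
        destruct (Hp s hs (e/2)) as [d2 [hd2 Hd2]]; [lra|].
        destruct (close d1 d2 hd1 hd2) as (t & h1 & h2 & h3).
        specialize (Hd1 (Q t) I h3). rewrite FQ in Hd1 by auto.
        assert (Cmod (p t - p s) < e / 2).
        { apply Hd2; unfold icc, dR; [lra|]. apply Rabs_def1; lra. }
        pose proof (Cmod_tri (F l) (p t) (p s)). rewrite (Cmod_sym (F l) (p t)) in H1. lra.
      + intros e d he hd. destruct (close e d he hd) as (t & h1 & h2 & h3).
        destruct (all' t h1) as [q hq]. exists t, q. unfold icc. repeat split; try lra; try apply hq; auto.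
        rewrite <- (HQ t q h1 hq); auto. unfold icc. lra.
    - exfalso. destruct (Hs s hs) as [_ na]. apply na.
      assert (inf : forall M, exists d, d > 0 /\ forall t, 0 <= t < s -> s - d < t -> Cmod (Q t) > M).
      { intros M. apply NNPP. intros n. apply ninf. exists M. intros d hd. apply NNPP. intros n2.
        apply n. exists d. split; auto. intros t h1 h2.
        destruct (Rlt_dec M (Cmod (Q t))); [lra|]. exfalso. apply n2. exists t. repeat split; lra. }
      (* A reparametrization of [0, s) by [0, infinity), the form in which asymptotic values are
         defined. *)
      set (r := fun u => s - s / (1 + u)).
      assert (hr : forall u, 0 <= u -> 0 <= r u < s).
      { intros u hu. unfold r. assert (0 < s / (1 + u)) by (apply Rdiv_lt_0_compat; lra).
        assert (s / (1 + u) <= s); [|lra]. apply Rmult_le_reg_r with (1 + u); [lra|].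
        unfold Rdiv. rewrite Rmult_assoc, Rinv_l by lra. nra. }
      assert (hr2 : forall d, d > 0 -> forall u, u >= s / d -> s - d < r u).
      { intros d hd u hu. assert (0 < s / d) by (apply Rdiv_lt_0_compat; lra).
        unfold r. assert (s / (1 + u) < d); [|lra]. apply Rmult_lt_reg_r with (1 + u); [lra|].
        unfold Rdiv. rewrite Rmult_assoc, Rinv_l by lra. rewrite Rmult_1_r.
        assert (d * u >= d * (s / d)) by nra. replace (d * (s / d)) with s in H1 by (field; lra). lra. }
      exists (fun u => Q (r u)). split; [|split].
      + intros u hu e he. destruct (hr u ltac:(lra)) as [r1 r2].
        set (t' := (r u + s) / 2). assert (ht' : 0 <= t' < s) by (unfold t'; lra).
        destruct (all' t' ht') as [q hq]. destruct hq as [q0 hq'].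
        destruct (proj1 (hq' (r u) ltac:(unfold icc, t'; lra)) e he) as [d [hd Hd]].
        set (d2 := Rmin d ((s - r u) / 2)).
        assert (p2 : 0 < d2) by (apply Rmin_pos; lra).
        exists (d2 / s). split; [apply Rdiv_lt_0_compat; lra|].
        intros v hv hvu.
        assert (rd : Rabs (r v - r u) < d2).
        { unfold r. replace (s - s / (1 + v) - (s - s / (1 + u))) with
            (s * ((v - u) / ((1 + u) * (1 + v)))) by (field; lra).
          rewrite Rabs_mult, (Rabs_pos_eq s) by lra. unfold Rdiv. rewrite Rabs_mult, Rabs_inv.
          rewrite (Rabs_pos_eq ((1 + u) * (1 + v))) by nra.
          assert (/ ((1 + u) * (1 + v)) <= 1).
          { rewrite <- Rinv_1. apply Rinv_le_contravar; nra. }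
          apply Rmult_lt_compat_r with (r := s) in hvu; [|lra].
          unfold Rdiv in hvu. rewrite Rmult_assoc, Rinv_l in hvu by lra.
          pose proof (Rabs_pos (v - u)).
          assert (Rabs (v - u) * / ((1 + u) * (1 + v)) <= Rabs (v - u) * 1) by (apply Rmult_le_compat_l; lra).
          nra. }
        destruct (hr v ltac:(lra)) as [v1 v2].
        assert (rd1 := Rlt_le_trans _ _ _ rd (Rmin_l _ _)).
        assert (rd2 := Rlt_le_trans _ _ _ rd (Rmin_r _ _)). apply Rabs_def2 in rd2.
        assert (pl : is_plift F p x t' q) by (split; auto).
        change Cnorm with Cmod.
        change (Cmod (Q (r v) - Q (r u)) < e).
        rewrite !(HQ t' q ht' pl) by (unfold icc, t'; lra).
        apply Hd; auto. unfold icc, t'. lra.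
      + intros M. destruct (inf M) as [d [hd Hd]]. exists (Rmax 0 (s / d)). intros u hu.
        assert (0 <= u) by (pose proof (Rmax_l 0 (s/d)); lra).
        apply Hd; auto. apply hr2; auto. pose proof (Rmax_r 0 (s/d)). lra.
      + intros e he. destruct (Hp s hs e he) as [d [hd Hd]].
        exists (Rmax 0 (s / d)). intros u hu.
        assert (0 <= u) by (pose proof (Rmax_l 0 (s/d)); lra).
        destruct (hr u H0) as [u1 u2].
        assert (s - d < r u) by (apply hr2; auto; pose proof (Rmax_r 0 (s/d)); lra).
        change (Cmod (F (Q (r u)) - p s) < e). rewrite FQ by lra.
        apply Hd; unfold icc, dR; [lra|]. apply Rabs_def1; lra. }
  destruct ext as [xs [Exs close]].
  assert (n0 : F' xs <> 0%C).
  { apply nonsing_deriv with F; auto. rewrite Exs. apply Hs. exact hs. }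
  destruct (local_section F F' xs 1 H n0) as (d & rho & k & hd & hrho & inj & sec); [lra|].
  destruct (Hp s hs rho hrho) as [eta [heta Heta]].
  destruct (close d eta) as (t1 & q & ht1 & ht1' & hq & hd1); [lra|lra|]. unfold icc in ht1.
  exists eta. split; auto. intros s1 s2 _ h2 _ k2 _. apply Rabs_def2 in k2.
  assert (inb : forall t, 0 <= t <= 1 -> s - eta < t < s + eta -> Cmod (p t - F xs) < rho).
  { intros t h3 h4. rewrite Exs. apply Heta; [exact h3|]. apply Rabs_def1; lra. }
  assert (Ek : q t1 = k (p t1)).
  { destruct (sec (p t1)) as (a & b & c); [apply inb; lra|]. apply inj; auto.
    rewrite b. apply hq. unfold icc. lra. }
  destruct (Rle_dec s2 t1) as [l|l].
  { exists q. apply plift_restrict with t1; auto. }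
  exists (fun t => if Rle_dec t t1 then q t else k (p t)). split.
  - destruct (Rle_dec 0 t1); [apply hq|lra].
  - intros t ht. split.
    + apply (cwi_glue q (fun t => k (p t)) 0 t1 s2 t); auto; [lra| |].
      * intros u hu. apply hq. auto.
      * intros u hu. unfold icc in hu. apply cwi_compC.
        -- eapply cwi_sub; [|apply Hp; unfold icc; lra]. intros y hy. unfold icc in *. lra.
        -- apply sec. apply inb; lra.
    + unfold icc in ht. destruct (Rle_dec t t1) as [l2|l2].
      * apply hq. unfold icc. lra.
      * apply sec. apply inb; lra.
Qed.

Definition clift (F : C -> C) (K : C -> Prop) (phi : C -> C) (c x : C) (q : C -> C) : Prop :=
  q c = x /\ forall z, K z -> cwi dC K q z /\ F (q z) = phi z.

Lemma seg_cts (K : C -> Prop) (phi : C -> C) c z : convexC K -> K c -> K z ->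
  (forall w, K w -> cwi dC K phi w) ->
  forall t, icc 0 1 t -> cwi dR (icc 0 1) (fun t => phi (seg c z t)) t.
Proof.
  intros cv hc hz H t ht. apply (cwi_comp dR dC (icc 0 1) K).
  - intros e he. exists (e / (Cmod (z - c) + 1)). pose proof (Cmod_ge_0 (z - c)).
    split; [apply Rdiv_lt_0_compat; lra|]. intros y hy hd. unfold dC. rewrite seg_dist.
    unfold dR in hd. apply Rmult_lt_compat_r with (r := Cmod (z - c) + 1) in hd; [|lra].
    unfold Rdiv in hd. rewrite Rmult_assoc, Rinv_l in hd by lra.
    pose proof (Rabs_pos (y - t)). nra.
  - intros y hy. apply cv; auto.
  - apply H. apply cv; auto.
Qed.

Lemma clift_unique F F' K c q1 q2 : is_deriv F F' -> convexC K -> K c ->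
  (forall z, K z -> cwi dC K q1 z) -> (forall z, K z -> cwi dC K q2 z) ->
  (forall z, K z -> F (q1 z) = F (q2 z)) -> (forall z, K z -> nonsing F (F (q1 z))) ->
  q1 c = q2 c -> forall z, K z -> q1 z = q2 z.
Proof.
  intros H cv hc H1 H2 HF Hn E z hz.
  rewrite <- (seg_1 c z).
  apply (path_unique F F' 0 1 (fun t => q1 (seg c z t)) (fun t => q2 (seg c z t)) 0 H);
    unfold icc; try lra.
  - intros t ht. assert (kt := cv c z t hc hz ht). split; [|split; [|split]].
    + apply (seg_cts K); auto.
    + apply (seg_cts K); auto.
    + auto.
    + apply nonsing_deriv with F; auto.
  - rewrite seg_0. auto.
Qed.

(** The lift is built along the segments from [c]. Its continuity in [z] is carried along the
    segment parameter: near the lifted point at [s], one local section describes the lifts over all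
    neighbouring segments. *)
Lemma convex_lift F F' K phi c x : is_deriv F F' -> convexC K -> K c ->
  (forall z, K z -> cwi dC K phi z) -> (forall z, K z -> nonsing F (phi z)) ->
  F x = phi c -> exists q, clift F K phi c x q.
Proof.
  intros H cv hc Hp Hs E0.
  assert (ex : forall z, exists q, K z -> is_plift F (fun t => phi (seg c z t)) x 1 q).
  { intros z. destruct (classic (K z)) as [hz|n]; [|exists (fun _ => 0%C); intros; contradiction].
    destruct (path_lift F F' (fun t => phi (seg c z t)) x) as [q hq]; auto.
    - apply seg_cts with K; auto.
    - rewrite seg_0. auto.
    - exists q. auto. }
  set (L := fun z => proj1_sig (constructive_indefinite_description _ (ex z))).
  assert (HL : forall z, K z -> is_plift F (fun t => phi (seg c z t)) x 1 (L z)).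
  { intros z hz. unfold L. destruct constructive_indefinite_description; auto. }
  exists (fun z => L z 1). split.
  { transitivity (L c 0); [|apply (HL c hc)].
    apply (path_unique F F' 0 1 (L c) (fun _ => L c 0) 0 H); unfold icc; try lra; try reflexivity.
    intros t ht. destruct (HL c hc) as [e h]. split; [apply h; auto|]. split; [apply cwi_const|].
    assert (sg : forall t, seg c c t = c) by (intros; unfold seg; ring).
    assert (F (L c t) = phi c) by (rewrite (proj2 (h t ht)), sg; auto).
    split.
    - rewrite H0, e. auto.
    - apply nonsing_deriv with F; auto. rewrite H0. auto. }
  intros z1 hz1. split.
  2:{ rewrite (proj2 (proj2 (HL z1 hz1) 1 ltac:(unfold icc; lra))), seg_1. auto. }
  apply (interval_clopen 0 1 (fun t => cwi dC K (fun z => L z t) z1)) with 0; try lra.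
  2:{ apply cwi_eq_at with (fun _ => x); [| |apply cwi_const].
      - intros y hy. symmetry. apply (HL y hy).
      - symmetry. apply (HL z1 hz1). }
  intros s hs. destruct (HL z1 hz1) as [L0 HL1].
  set (xs := L z1 s). assert (Fxs : F xs = phi (seg c z1 s)) by (apply HL1; exact hs).
  assert (ks := cv c z1 s hc hz1 hs).
  assert (n0 : F' xs <> 0%C) by (apply nonsing_deriv with F; auto; rewrite Fxs; auto).
  destruct (local_section F F' xs 1 H n0) as (d & rho & k & hd & hrho & inj & sec); [lra|].
  destruct (Hp _ ks rho hrho) as [r [hr Hr]].
  destruct (proj1 (HL1 s hs) d ltac:(lra)) as [eta0 [heta0 Heta0]].
  set (eta := Rmin eta0 (r / (2 * (Cmod (z1 - c) + 1)))).
  pose proof (Cmod_ge_0 (z1 - c)) as nn.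
  assert (peta : 0 < eta) by (apply Rmin_pos; [lra|apply Rdiv_lt_0_compat; lra]).
  assert (inb : forall t z, icc 0 1 t -> K z -> Rabs (t - s) < eta -> Cmod (z - z1) < r / 2 ->
      Cmod (phi (seg c z t) - F xs) < rho).
  { intros t z ht hz h1 h2. rewrite Fxs. apply Hr; [apply cv; auto|]. unfold dC.
    eapply Rle_lt_trans; [apply (Cmod_tri _ (seg c z1 t))|]. rewrite seg_dist.
    replace (seg c z t - seg c z1 t)%C with (t * (z - z1))%C by (unfold seg; ring).
    rewrite Cmod_mult, Cmod_R. unfold icc in ht. rewrite (Rabs_pos_eq t) by lra.
    assert (h3 := Rlt_le_trans _ _ _ h1 (Rmin_r _ _)).
    apply Rmult_lt_compat_r with (r := 2 * (Cmod (z1 - c) + 1)) in h3; [|lra].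
    unfold Rdiv in h3. rewrite Rmult_assoc, Rinv_l in h3 by lra.
    pose proof (Rabs_pos (t - s)). pose proof (Cmod_ge_0 (z - z1)). nra. }
  assert (L1k : forall t, icc 0 1 t -> Rabs (t - s) < eta -> L z1 t = k (phi (seg c z1 t))).
  { intros t ht h1.
    assert (b := inb t z1 ht hz1 h1). rewrite Cmod_sub_eq in b. specialize (b ltac:(lra)).
    destruct (sec _ b) as (b1 & b2 & _). apply inj; auto.
    - apply Heta0; auto. eapply Rlt_le_trans; [exact h1|apply Rmin_l].
    - rewrite b2. apply HL1; auto. }
  exists eta. split; auto. intros s1 s2 h1 h2 k1 k2 P1.
  assert (d1 : Cmod (L z1 s1 - xs) < d).
  { apply Heta0; auto. eapply Rlt_le_trans; [exact k1|apply Rmin_l]. }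
  destruct (P1 (d - Cmod (L z1 s1 - xs))) as [r2 [hr2 Hr2]]; [lra|].
  apply cwi_ball with (Rmin r2 (r / 2)); [apply Rmin_pos; lra|].
  apply cwi_eq_at with (fun z => k (phi (seg c z s2))).
  - intros z [hz hzr]. assert (hz1r := Rlt_le_trans _ _ _ hzr (Rmin_l _ _)).
    assert (hz2r := Rlt_le_trans _ _ _ hzr (Rmin_r _ _)).
    specialize (Hr2 z hz hz1r). pose proof (Cmod_tri (L z s1) (L z1 s1) xs) as tr.
    assert (Es1 : L z s1 = k (phi (seg c z s1))).
    { destruct (sec _ (inb s1 z h1 hz k1 hz2r)) as (b1 & b2 & _). apply inj; auto; [lra|].
      rewrite b2. apply (HL z hz). auto. }
    symmetry.
    assert (win : forall t, icc (Rmin s1 s2) (Rmax s1 s2) t -> icc 0 1 t /\ Rabs (t - s) < eta).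
    { intros t [t1 t2]. apply Rabs_def2 in k1. apply Rabs_def2 in k2.
      assert (Rmin s1 s2 >= 0) by (apply Rle_ge, Rmin_glb; lra).
      assert (Rmax s1 s2 <= 1) by (apply Rmax_lub; lra).
      assert (s - eta < Rmin s1 s2) by (apply Rmin_glb_lt; lra).
      assert (Rmax s1 s2 < s + eta) by (apply Rmax_lub_lt; lra).
      split; [unfold icc; lra|]. apply Rabs_def1; lra. }
    apply (path_unique F F' (Rmin s1 s2) (Rmax s1 s2) (L z) (fun t => k (phi (seg c z t))) s1 H); auto.
    + intros t ht. destruct (win t ht) as [w1 w2]. destruct (HL z hz) as [_ HLz].
      destruct (HLz t w1) as [c1 f1]. assert (b := inb t z w1 hz w2 hz2r).
      destruct (sec _ b) as (b1 & b2 & b3). split; [|split; [|split]].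
      * eapply cwi_sub; [|exact c1]. intros y hy. apply win; auto.
      * apply cwi_compC; auto.
        eapply cwi_sub; [|apply (seg_cts K phi c z cv hc hz Hp t w1)]. intros y hy. apply win; auto.
      * rewrite f1, b2. auto.
      * apply nonsing_deriv with F; auto. rewrite f1. apply Hs. apply cv; auto.
    + split; [apply Rmin_l|apply Rmax_l].
    + split; [apply Rmin_r|apply Rmax_r].
  - symmetry. apply L1k; auto.
  - assert (b := inb s2 z1 h2 hz1 k2). rewrite Cmod_sub_eq in b. specialize (b ltac:(lra)).
    apply cwi_compC; [|apply (sec _ b)].
    apply (cwi_comp dC dC _ K).
    + intros e he. exists e. split; auto. intros y _ hy. unfold dC in *.
      replace (seg c y s2 - seg c z1 s2)%C with (s2 * (y - z1))%C by (unfold seg; ring).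
      rewrite Cmod_mult, Cmod_R, Rabs_pos_eq by lra. pose proof (Cmod_ge_0 (y - z1)). nra.
    + intros y [hy _]. apply cv; auto.
    + apply Hp. apply cv; auto.
Qed.

(** With Caratheodory quotients [A] of [F] and [B] of [phi], the equation F (q w) = phi w reads A (q
    w) (q w - q z) = B w (w - z), so the quotient of [q] is [B w / A (q w)]. *)
Lemma lift_cd F F' phi q z L r : is_deriv F F' -> r > 0 -> cts q z ->
  (forall w, Cmod (w - z) < r -> F (q w) = phi w) -> cd phi z L -> F' (q z) <> 0%C ->
  cd q z (L / F' (q z))%C.
Proof.
  intros H hr cq E hphi n0.
  destruct (proj1 (cd_cara _ _ _) (H (q z))) as (A & r1 & hr1 & EA & cA & A0).
  destruct (proj1 (cd_cara _ _ _) hphi) as (B & r2 & hr2 & EB & cB & B0).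
  apply cd_cara.
  assert (cAq : cts (fun w => A (q w)) z) by (apply cwi_compC; auto).
  assert (pA : 0 < Cmod (A (q z))) by (rewrite A0; apply Cmod_gt_0; auto).
  destruct (cAq _ pA) as [r3 [hr3 H3]]. destruct (cq r1 hr1) as [r4 [hr4 H4]].
  exists (fun w => B w * / A (q w))%C, (Rmin (Rmin r r2) (Rmin r3 r4)).
  split; [repeat apply Rmin_pos; lra|]. split; [|split].
  - intros w hw.
    assert (a1 : Cmod (w - z) < r) by (eapply Rlt_le_trans; [exact hw|eapply Rle_trans; [apply Rmin_l|apply Rmin_l]]).
    assert (a2 : Cmod (w - z) < r2) by (eapply Rlt_le_trans; [exact hw|eapply Rle_trans; [apply Rmin_l|apply Rmin_r]]).
    assert (a3 : Cmod (w - z) < r3) by (eapply Rlt_le_trans; [exact hw|eapply Rle_trans; [apply Rmin_r|apply Rmin_l]]).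
    assert (a4 : Cmod (w - z) < r4) by (eapply Rlt_le_trans; [exact hw|eapply Rle_trans; [apply Rmin_r|apply Rmin_r]]).
    specialize (H3 w I a3). specialize (H4 w I a4).
    assert (An : A (q w) <> 0%C).
    { intros Z. rewrite Z in H3. replace (0 - A (q z))%C with (- A (q z))%C in H3 by ring.
      rewrite Cmod_opp in H3. lra. }
    assert (e1 := EA (q w) H4). assert (e2 := EB w a2).
    rewrite E in e1 by auto. rewrite (E z) in e1 by (rewrite Cmod_sub_eq; lra). rewrite e1 in e2.
    transitivity ((A (q w) * (q w - q z)) / A (q w))%C; [field; auto|]. rewrite e2. field; auto.
  - apply cwi_mult; auto. apply cwi_inv; auto. rewrite A0. auto.
  - rewrite A0, B0. reflexivity.
Qed.

(** * Logarithms and distortion *)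

Definition Csq (z : C) : C := (z * z)%C.

Lemma is_deriv_Csq : is_deriv Csq (fun z => z + z)%C.
Proof.
  intros z. eapply cd_eq; [apply (cd_mult (fun w => w) (fun w => w)); apply cd_id|]. ring.
Qed.

Lemma is_deriv_Cexp : is_deriv Cexp Cexp.
Proof. exact cd_Cexp. Qed.

Lemma double_eq_0 (z : C) : (z + z = 0)%C -> z = 0%C.
Proof.
  intros E. destruct z as [a b]. injection E as E1 E2. apply injective_projections; simpl; lra.
Qed.

Lemma nonsing_Csq (y : C) : y <> 0%C -> nonsing Csq y.
Proof.
  intros n0. split.
  - intros [c [E Hc]]. apply has_cderiv_cd in Hc. apply n0.
    assert (Z := double_eq_0 c (cd_unique _ _ _ _ (is_deriv_Csq c) Hc)).
    change (Csq c = y) in E. rewrite <- E, Z. unfold Csq. ring.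
  - intros [g [_ [inf lim]]]. destruct (lim 1) as [T1 H1]; [lra|].
    destruct (inf (Cmod y + 1)) as [T2 H2].
    set (t := Rmax T1 T2). specialize (H1 t (Rle_ge _ _ (Rmax_l _ _))).
    specialize (H2 t (Rle_ge _ _ (Rmax_r _ _))).
    change (Cmod (Csq (g t) - y) < 1) in H1. change (Cmod (g t) > Cmod y + 1) in H2.
    pose proof (Cmod_le_add (Csq (g t)) y) as h. unfold Csq at 1 in h. rewrite Cmod_mult in h.
    pose proof (Cmod_ge_0 y). nra.
Qed.

Lemma snd_ivt (q : R -> C) a b v : a <= b ->
  (forall t, icc a b t -> cwi dR (icc a b) q t) ->
  Rmin (snd (q a)) (snd (q b)) <= v <= Rmax (snd (q a)) (snd (q b)) ->
  exists t, icc a b t /\ snd (q t) = v.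
Proof.
  intros hab Hq hv. apply NNPP. intros n.
  assert (ne : forall t, icc a b t -> snd (q t) <> v) by (intros t ht E; apply n; eauto).
  assert (cl : forall s1 s2, icc a b s1 -> icc a b s2 -> snd (q s1) < v -> snd (q s2) < v).
  { intros s1 s2 h1 h2. apply (interval_clopen a b (fun t => snd (q t) < v)); auto.
    intros s hs. assert (p : 0 < Rabs (snd (q s) - v)).
    { apply Rabs_pos_lt. specialize (ne s hs). lra. }
    destruct (Hq s hs _ p) as [d [hd Hd]]. exists d. split; auto.
    intros u1 u2 hu1 hu2 k1 k2 l. specialize (Hd u1 hu1 k1) as e1. specialize (Hd u2 hu2 k2) as e2.
    pose proof (Rabs_snd_le (q u1 - q s)) as f1. pose proof (Rabs_snd_le (q u2 - q s)) as f2.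
    simpl in f1, f2.
    assert (g1 : Rabs (snd (q u1) + - snd (q s)) < Rabs (snd (q s) - v)) by lra.
    assert (g2 : Rabs (snd (q u2) + - snd (q s)) < Rabs (snd (q s) - v)) by lra.
    unfold Rabs in g1, g2. repeat destruct Rcase_abs in g1; repeat destruct Rcase_abs in g2; lra. }
  assert (ia : icc a b a) by (unfold icc; lra). assert (ib : icc a b b) by (unfold icc; lra).
  pose proof (cl a b ia ib). pose proof (cl b a ib ia). pose proof (ne a ia). pose proof (ne b ib).
  unfold Rmin, Rmax in hv. repeat destruct Rle_dec in hv; lra.
Qed.

(** On a path to infinity along which exp tends to [y], the real part is bounded, so the imaginary
    part eventually moves by pi. The two values of exp lie on opposite rays from 0, yet both belong
    to a disc about [y] that does not contain 0, against convexity of the disc. *)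
Lemma nonsing_Cexp (y : C) : y <> 0%C -> nonsing Cexp y.
Proof.
  intros n0. assert (py := proj1 (Cmod_gt_0 _) n0). split.
  { intros [c [E Hc]]. apply has_cderiv_cd in Hc.
    apply (Cexp_neq_0 c). exact (cd_unique _ _ _ _ (is_deriv_Cexp c) Hc). }
  intros [g [cg [inf lim]]].
  destruct (lim (Cmod y / 2)) as [T1 H1]; [lra|].
  set (T := Rmax 0 T1).
  assert (near : forall t, T <= t -> Cmod (Cexp (g t) - y) < Cmod y / 2).
  { intros t ht. apply (H1 t). pose proof (Rmax_r 0 T1). unfold T in ht. lra. }
  assert (re : forall t, T <= t -> Rabs (fst (g t)) <= Rabs (ln (Cmod y / 2)) + Rabs (ln (2 * Cmod y))).
  { intros t ht. specialize (near t ht).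
    pose proof (Cmod_le_add y (Cexp (g t))) as a. rewrite Cmod_sym in a.
    pose proof (Cmod_le_add (Cexp (g t)) y) as b. rewrite Cmod_Cexp in a, b.
    assert (l1 : ln (Cmod y / 2) <= fst (g t)).
    { rewrite <- (ln_exp (fst (g t))). apply Rlt_le, ln_increasing; lra. }
    assert (l2 : fst (g t) <= ln (2 * Cmod y)).
    { rewrite <- (ln_exp (fst (g t))). apply Rlt_le, ln_increasing; [apply exp_pos|lra]. }
    unfold Rabs; repeat destruct Rcase_abs; lra. }
  set (B := Rabs (ln (Cmod y / 2)) + Rabs (ln (2 * Cmod y))) in *.
  assert (im : forall t, T <= t -> Cmod (g t) <= B + Rabs (snd (g t))).
  { intros t ht. specialize (re t ht). pose proof (Cmod_le_abs (g t)). lra. }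
  set (t1 := T). set (y1 := snd (g t1)).
  destruct (inf (B + Rabs y1 + 4)) as [T2 H2].
  set (t2 := Rmax T T2).
  assert (ht2 : T <= t2) by apply Rmax_l.
  assert (big : Rabs (snd (g t2)) > Rabs y1 + 4).
  { specialize (H2 t2 (Rle_ge _ _ (Rmax_r _ _))). change (Cmod (g t2) > B + Rabs y1 + 4) in H2.
    specialize (im t2 ht2). lra. }
  assert (T0 : 0 <= T) by apply Rmax_l.
  assert (cont : forall t, icc t1 t2 t -> cwi dR (icc t1 t2) g t).
  { intros t ht e he. unfold icc, t1 in ht. destruct (cg t ltac:(lra) e he) as [d [hd Hd]].
    exists d. split; auto. intros s hs. apply Hd. unfold icc, t1 in hs. lra. }
  assert (pi4 := PI_4). assert (pi0 := PI_RGT_0).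
  assert (ex : exists t3, icc t1 t2 t3 /\ (snd (g t3) = y1 + PI \/ snd (g t3) = y1 - PI)).
  { destruct (Rle_dec y1 (snd (g t2))) as [l|l].
    - destruct (snd_ivt g t1 t2 (y1 + PI) ht2 cont) as [t3 [a b]]; [|eauto].
      fold y1. rewrite Rmin_left, Rmax_right by lra.
      unfold Rabs in big; repeat destruct Rcase_abs in big; lra.
    - destruct (snd_ivt g t1 t2 (y1 - PI) ht2 cont) as [t3 [a b]]; [|eauto].
      fold y1. rewrite Rmin_right, Rmax_left by lra.
      unfold Rabs in big; repeat destruct Rcase_abs in big; lra. }
  destruct ex as [t3 [ht3 E3]]. unfold icc in ht3.
  set (e1 := exp (fst (g t1))). set (e3 := exp (fst (g t3))).
  assert (p1 : 0 < e1) by apply exp_pos. assert (p3 : 0 < e3) by apply exp_pos.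
  assert (G1 := near t1 (Rle_refl _)). assert (G3 := near t3 ltac:(unfold t1 in *; lra)).
  assert (hb : ballC y (Cmod y / 2) (seg (Cexp (g t1)) (Cexp (g t3)) (e1 / (e1 + e3)))).
  { apply convex_ball; auto. split.
    - apply Rlt_le, Rdiv_lt_0_compat; lra.
    - apply Rmult_le_reg_r with (e1 + e3); [lra|]. unfold Rdiv. rewrite Rmult_assoc, Rinv_l; lra. }
  replace (seg (Cexp (g t1)) (Cexp (g t3)) (e1 / (e1 + e3))) with (RtoC 0) in hb.
  { unfold ballC in hb. replace (0 - y)%C with (- y)%C in hb by ring. rewrite Cmod_opp in hb. lra. }
  unfold seg, Cexp. fold e1 e3. fold y1.
  assert (c3 : cos (snd (g t3)) = - cos y1 /\ sin (snd (g t3)) = - sin y1).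
  { destruct E3 as [-> | ->].
    - rewrite neg_cos, neg_sin. auto.
    - unfold Rminus. rewrite cos_plus, sin_plus, cos_neg, sin_neg, cos_PI, sin_PI. split; ring. }
  destruct c3 as [-> ->]. apply injective_projections; simpl; field; lra.
Qed.

Lemma Cexp_surj (z : C) : z <> 0%C -> exists w, Cexp w = z.
Proof.
  intros n0. assert (p := proj1 (Cmod_gt_0 _) n0). set (m := Cmod z) in *.
  assert (m2 : m * m = fst z * fst z + snd z * snd z).
  { unfold m, Cmod. rewrite sqrt_sqrt; [ring|]. apply Rplus_le_le_0_compat; apply pow2_ge_0. }
  set (c := fst z / m). set (s := snd z / m).
  assert (cs : c * c + s * s = 1).
  { unfold c, s. transitivity ((fst z * fst z + snd z * snd z) / (m * m)); [field; lra|].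
    rewrite <- m2. field. lra. }
  assert (hc : -1 <= c <= 1) by nra.
  assert (sa : sin (acos c) = Rabs s).
  { rewrite sin_acos by auto. replace (1 - c²) with (s²) by (unfold Rsqr; lra). apply sqrt_Rsqr_abs. }
  assert (exists th, cos th = c /\ sin th = s) as [th [h1 h2]].
  { destruct (Rle_dec 0 s).
    - exists (acos c). rewrite cos_acos, sa, Rabs_pos_eq by auto. auto.
    - exists (- acos c). rewrite cos_neg, sin_neg, cos_acos, sa, Rabs_left by lra. split; lra. }
  exists (ln m, th). unfold Cexp. simpl. rewrite exp_ln, h1, h2 by auto. unfold c, s.
  destruct z. apply injective_projections; simpl; field; lra.
Qed.

Definition twopii (k : Z) : C := (0, 2 * (IZR k * PI)).

Lemma Cexp_twopii k : Cexp (twopii k) = 1%C.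
Proof.
  unfold Cexp, twopii. simpl. rewrite exp_0, cos_2a_sin, sin_2a.
  rewrite sin_eq_0_1 by eauto. apply injective_projections; simpl; ring.
Qed.

Lemma Cexp_inj (a b : C) : Cexp a = Cexp b -> exists k, (a = b + twopii k)%C.
Proof.
  intros E.
  assert (E1 : Cexp (a - b) = 1%C).
  { assert (h : (Cexp (a - b) * Cexp b = Cexp a)%C) by (rewrite <- Cexp_plus; f_equal; ring).
    rewrite E in h. transitivity (Cexp (a - b) * Cexp b / Cexp b)%C.
    - field. apply Cexp_neq_0.
    - rewrite h. field. apply Cexp_neq_0. }
  assert (m := f_equal Cmod E1). rewrite Cmod_Cexp, Cmod_1 in m.
  assert (re : fst (a - b)%C = 0) by (rewrite <- (ln_exp (fst (a - b)%C)), m; apply ln_1).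
  assert (cs : cos (snd (a - b)%C) = 1).
  { assert (E2 : fst (Cexp (a - b)%C) = 1) by (rewrite E1; reflexivity).
    change (exp (fst (a - b)%C) * cos (snd (a - b)%C) = 1) in E2. rewrite re, exp_0 in E2. lra. }
  set (x := snd (a - b)%C) in *.
  assert (s0 : sin (x / 2) = 0).
  { assert (h := cos_2a_sin (x / 2)). replace (2 * (x / 2)) with x in h by field. nra. }
  destruct (sin_eq_0_0 _ s0) as [k hk]. exists k.
  replace a with (b + (a - b))%C at 1 by ring. f_equal.
  apply injective_projections; [exact re|]. fold x. simpl. lra.
Qed.

Lemma cwi_open (K : C -> Prop) f z r : r > 0 -> (forall w, Cmod (w - z) < r -> K w) ->
  cwi dC K f z -> cts f z.
Proof.
  intros hr h H. apply cwi_ball with r; auto. eapply cwi_sub; [|exact H]. intros y [_ hy]. auto.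
Qed.

Lemma ball_open c r z : Cmod (z - c) < r -> forall w, Cmod (w - z) < r - Cmod (z - c) -> ballC c r w.
Proof. intros h w hw. unfold ballC. pose proof (Cmod_tri w z c). lra. Qed.

Lemma cwi_ball_cts c r f z : Cmod (z - c) < r -> cwi dC (ballC c r) f z -> cts f z.
Proof. intros h. apply cwi_open with (r - Cmod (z - c)); [lra|]. apply ball_open; auto. Qed.

(** The branch of the logarithm on the unit disc about 1 is a lift through [Cexp]; on the half disc
    its derivative has modulus at most 2. *)
Lemma log_near_1 (s : C) : Cmod s <= 1 / 2 -> exists t, Cexp t = (1 + s)%C /\ Cmod t <= 2 * Cmod s.
Proof.
  intros hs.
  assert (nz : forall z, ballC 0 1 z -> (1 + z)%C <> 0%C).
  { intros z hz E. unfold ballC in hz. replace (z - 0)%C with z in hz by ring.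
    assert (z = - (1))%C by (transitivity ((1 + z) - 1)%C; [ring|rewrite E; ring]).
    subst z. rewrite Cmod_opp, Cmod_1 in hz. lra. }
  assert (b0 : ballC 0 1 0%C) by (unfold ballC; rewrite Cmod_sub_eq; lra).
  destruct (convex_lift Cexp Cexp (ballC 0 1) (fun z => 1 + z)%C 0%C 0%C is_deriv_Cexp) as [q [q0 Hq]].
  - apply convex_ball.
  - exact b0.
  - intros z _. apply cwi_plus; [apply cwi_const|apply cwi_id].
  - intros z hz. apply nonsing_Cexp. auto.
  - rewrite Cexp_0. ring.
  - assert (bs : ballC 0 1 s) by (unfold ballC; replace (s - 0)%C with s by ring; lra).
    exists (q s). split; [apply Hq; auto|].
    replace (q s) with (q s - q 0%C)%C by (rewrite q0; ring).
    replace s with (s - 0)%C at 2 by ring.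
    apply (mean_value q (fun z => (0 + 1) / Cexp (q z))%C).
    + intros t ht. assert (bt := convex_ball 0 1 0%C s t b0 bs ht).
      set (z := seg 0 s t) in *. unfold ballC in bt.
      apply (lift_cd Cexp Cexp (fun z => 1 + z)%C q z (0 + 1)%C (1 - Cmod (z - 0)) is_deriv_Cexp); [lra| | | |].
      * apply cwi_ball_cts with (RtoC 0) 1; auto. apply Hq; auto.
      * intros w hw. apply Hq. apply ball_open with z; auto.
      * apply cd_plus; [apply cd_const|apply cd_id].
      * apply Cexp_neq_0.
    + intros t ht. assert (bt := convex_ball 0 1 0%C s t b0 bs ht).
      rewrite (proj2 (Hq _ bt)). rewrite Cplus_0_l, Cmod_div, Cmod_1 by (apply nz; auto).
      assert (Cmod (seg 0 s t) <= 1 / 2).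
      { unfold seg. replace (0 + t * (s - 0))%C with (t * s)%C by ring.
        rewrite Cmod_mult, Cmod_R, Rabs_pos_eq by lra. pose proof (Cmod_ge_0 s). nra. }
      assert (1 / 2 <= Cmod (1 + seg 0 s t)).
      { pose proof (Cmod_le_add 1 (- seg 0 s t)) as h.
        replace (1 - - seg 0 s t)%C with (1 + seg 0 s t)%C in h by ring.
        rewrite Cmod_1, Cmod_opp in h. lra. }
      unfold Rdiv at 1. rewrite Rmult_1_l. replace 2 with (/ (1 / 2)) by field.
      apply Rinv_le_contravar; lra.
Qed.

Definition ball_section (F : C -> C) (y : C) (r : R) (h : C -> C) : Prop :=
  forall z, Cmod (z - y) < r -> cts h z /\ F (h z) = z.

Definition omits (h : C -> C) (y : C) (r : R) (v : C) : Prop :=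
  forall z, Cmod (z - y) < r -> h z <> v.

Lemma section_cd F F' y r h z : is_deriv F F' -> ball_section F y r h -> Cmod (z - y) < r ->
  F' (h z) <> 0%C -> cd h z (1 / F' (h z))%C.
Proof.
  intros H hs hz n0. apply (lift_cd F F' (fun z => z) h z 1%C (r - Cmod (z - y)) H); auto.
  - lra.
  - apply hs; auto.
  - intros w hw. apply hs. apply ball_open with z; auto.
  - apply cd_id.
Qed.

Lemma section_sub F y r h z r' : ball_section F y r h -> Cmod (z - y) + r' <= r -> ball_section F z r' h.
Proof. intros H hr w hw. apply H. pose proof (Cmod_tri w z y). lra. Qed.

Lemma omits_sub h y r z r' v : omits h y r v -> Cmod (z - y) + r' <= r -> omits h z r' v.
Proof. intros H hr w hw. apply H. pose proof (Cmod_tri w z y). lra. Qed.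

(* A weak form of the Koebe quarter theorem. For v' an omitted value nearly closest to h y, the
   square root s of h - v' is univalent, its image contains the ball of radius |s y| / 5 about s y,
   and the image is disjoint from its negative; so 1 / (s + s y) is bounded. *)
Lemma koebe F F' y r h v : is_deriv F F' -> r > 0 -> ball_section F y r h ->
  (forall z, Cmod (z - y) < r -> F' (h z) <> 0%C) -> omits h y r v ->
  Cmod (1 / F' (h y)) * r <= 220 * Cmod (v - h y).
Proof.
  intros H hr hs n0 hv.
  assert (yy : Cmod (y - y) < r) by (rewrite Cmod_sub_eq; lra).
  (* The radii of discs about [h y] covered by [h]. Their supremum [S] is positive, since [h] is
     locally onto, and at most the distance from [h y] to the omitted value [v]. *)
  set (A := fun rho => 0 <= rho /\ forall w, Cmod (w - h y) < rho -> exists z, Cmod (z - y) < r /\ h z = w).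
  assert (A0 : exists rho, rho > 0 /\ A rho).
  { destruct (local_section F F' (h y) 1 H (n0 y yy)) as (d & rho & k & hd & hrho & inj & sec); [lra|].
    destruct (proj1 (hs y yy) d ltac:(lra)) as [r1 [hr1 Hr1]].
    destruct (is_deriv_cts _ _ H (h y) (Rmin r r1)) as [r2 [hr2 Hr2]]; [apply Rmin_pos; lra|].
    exists (Rmin d r2). split; [apply Rmin_pos; lra|]. split; [apply Rlt_le, Rmin_pos; lra|].
    intros w hw. assert (w1 := Rlt_le_trans _ _ _ hw (Rmin_l _ _)).
    assert (w2 := Rlt_le_trans _ _ _ hw (Rmin_r _ _)).
    specialize (Hr2 w I w2). rewrite (proj2 (hs y yy)) in Hr2.
    assert (f1 := Rlt_le_trans _ _ _ Hr2 (Rmin_l _ _)).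
    assert (f2 := Rlt_le_trans _ _ _ Hr2 (Rmin_r _ _)).
    exists (F w). split; auto. apply inj; auto; [apply Hr1; auto; exact I|]. apply hs. auto. }
  assert (Ab : forall rho, A rho -> rho <= Cmod (v - h y)).
  { intros rho [p q]. apply Rnot_lt_le. intros l. destruct (q v l) as [z [z1 z2]]. apply (hv z); auto. }
  destruct (completeness A) as [S [ub lb]].
  { exists (Cmod (v - h y)). exact Ab. }
  { destruct A0 as [rho [_ a]]. eauto. }
  assert (S0 : 0 < S) by (destruct A0 as [rho [a b]]; specialize (ub rho b); lra).
  assert (Sv : S <= Cmod (v - h y)) by (apply lb; exact Ab).
  (* Below [S] so that the disc of radius [rho] is covered, above half of [S] so that some omitted
     value [v'] lies within [2 * rho]. *)
  set (rho := 2 / 3 * S).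
  assert (Arho : forall w, Cmod (w - h y) < rho -> exists z, Cmod (z - y) < r /\ h z = w).
  { intros w hw. apply NNPP. intros n. assert (S <= rho); [|unfold rho in *; lra]. apply lb.
    intros x [x0 hx]. apply Rnot_lt_le. intros l. apply n. apply hx. lra. }
  assert (exists v', omits h y r v' /\ Cmod (v' - h y) < 2 * rho) as [v' [hv' dv]].
  { apply NNPP. intros n. assert (2 * rho <= S); [|unfold rho in *; lra]. apply ub. split; [unfold rho; lra|].
    intros w hw. apply NNPP. intros n2. apply n. exists w. split; auto. intros z hz E. apply n2. eauto. }
  set (D := ballC y r).
  assert (nz : forall z, D z -> (h z - v')%C <> 0%C) by (intros z hz; apply Csub_neq_0, hv', hz).
  destruct (Cexp_surj (h y - v')%C (nz y yy)) as [l0 El0].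
  destruct (convex_lift Csq _ D (fun z => h z - v')%C y (Cexp (l0 / 2)%C) is_deriv_Csq) as [s [Es0 Hs]].
  { apply convex_ball. } { exact yy. }
  { intros z hz. apply cwi_minus; [apply cts_cwi, hs, hz|apply cwi_const]. }
  { intros z hz. apply nonsing_Csq. auto. }
  { unfold Csq. rewrite <- Cexp_plus, <- El0. f_equal. field. }
  clear Es0. set (s0 := s y).
  assert (Es0 : (s0 * s0 = h y - v')%C) by apply (proj2 (Hs y yy)).
  set (nu := Cmod (v' - h y)) in *.
  assert (s02 : Cmod s0 * Cmod s0 = nu) by (rewrite <- Cmod_mult, Es0; apply Cmod_sym).
  assert (nurho : rho <= nu).
  { apply Rnot_lt_le. intros l. destruct (Arho v' l) as [z [z1 z2]]. apply (hv' z); auto. }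
  assert (rho0 : 0 < rho) by (unfold rho; lra).
  assert (ps0 : 0 < Cmod s0) by (pose proof (Cmod_ge_0 s0); nra).
  (* For u within [r1] of [s0], |u^2 - s0^2| < (1/5) (11/5) nu = 11/25 nu < 22/25 rho, so
     [u * u + v'] stays in the covered disc. *)
  set (r1 := Cmod s0 / 5).
  assert (inD : forall u, ballC s0 r1 u -> D (F (u * u + v')%C) /\ h (F (u * u + v')%C) = (u * u + v')%C).
  { intros u hu. unfold ballC in hu. destruct (Arho (u * u + v')%C) as [z [z1 z2]].
    - replace (u * u + v' - h y)%C with ((u - s0) * (u + s0))%C.
      2:{ transitivity (u * u - s0 * s0)%C; [ring|]. rewrite Es0. ring. }
      rewrite Cmod_mult. assert (Cmod (u + s0) <= 11 / 5 * Cmod s0).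
      { replace (u + s0)%C with ((u - s0) + (s0 + s0))%C by ring.
        eapply Rle_trans; [apply Cmod_triangle|]. pose proof (Cmod_triangle s0 s0). unfold r1 in hu. lra. }
      apply Rle_lt_trans with (r1 * (11 / 5 * Cmod s0)).
      + apply Rmult_le_compat; try apply Cmod_ge_0; lra.
      + unfold r1. nra.
    - assert (E := proj2 (hs z z1)). rewrite z2 in E. rewrite E. split; auto. }
  assert (us0 : forall u, ballC s0 r1 u -> u <> 0%C).
  { intros u hu E. subst u. unfold ballC in hu. replace (0 - s0)%C with (- s0)%C in hu by ring.
    rewrite Cmod_opp in hu. unfold r1 in hu. lra. }
  assert (ku : forall u, ballC s0 r1 u -> s (F (u * u + v')%C) = u).
  { assert (c0 : ballC s0 r1 s0) by (unfold ballC, r1; rewrite Cmod_sub_eq; lra).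
    apply (clift_unique Csq _ (ballC s0 r1) s0 (fun u => s (F (u * u + v')%C)) (fun u => u) is_deriv_Csq).
    - apply convex_ball.
    - exact c0.
    - intros u hu. apply (cwi_comp dC dC _ D).
      + assert (cc : cwi dC (ballC s0 r1) (fun u => F (u * u + v')%C) u).
        { apply (cwi_compC dC _ (fun u => u * u + v')%C F).
          - apply cwi_plus; [apply cwi_mult; apply cwi_id|apply cwi_const].
          - apply (is_deriv_cts _ _ H). }
        exact cc.
      + intros w hw. apply inD; auto.
      + apply Hs. apply inD; auto.
    - intros. apply cwi_id.
    - intros u hu. destruct (inD u hu) as [a b]. rewrite (proj2 (Hs _ a)), b. unfold Csq. ring.
    - intros u hu. destruct (inD u hu) as [a b]. apply nonsing_Csq. rewrite (proj2 (Hs _ a)). auto.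
    - replace (s0 * s0 + v')%C with (h y) by (rewrite Es0; ring). rewrite (proj2 (hs y yy)). auto. }
  assert (far : forall z, D z -> r1 <= Cmod (s z + s0)).
  { intros z hz. apply Rnot_lt_le. intros l.
    assert (hu : ballC s0 r1 (- s z)%C).
    { unfold ballC. replace (- s z - s0)%C with (- (s z + s0))%C by ring. rewrite Cmod_opp. auto. }
    destruct (inD _ hu) as [a b]. assert (k := ku _ hu).
    replace (- s z * - s z + v')%C with (h z) in *.
    2:{ replace (- s z * - s z + v')%C with (Csq (s z) + v')%C by (unfold Csq; ring).
        rewrite (proj2 (Hs z hz)). ring. }
    rewrite (proj2 (hs z hz)) in k.
    assert (s z = 0%C).
    { apply double_eq_0. rewrite k at 1. ring. }
    apply (nz z hz). rewrite <- (proj2 (Hs z hz)). unfold Csq. rewrite H0. ring. }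
  assert (scd : forall z, D z -> cd s z ((1 / F' (h z) - 0) / (s z + s z))%C).
  { intros z hz. apply (lift_cd Csq (fun z => z + z)%C (fun z => h z - v')%C s z
       (1 / F' (h z) - 0)%C (r - Cmod (z - y)) is_deriv_Csq).
    - unfold D, ballC in hz. lra.
    - apply cwi_ball_cts with y r; auto. apply Hs; auto.
    - intros w hw. apply Hs. apply ball_open with z; auto.
    - apply cd_minus; [|apply cd_const]. apply section_cd with F y r; auto.
    - intros E. apply double_eq_0 in E. apply (nz z hz). rewrite <- (proj2 (Hs z hz)). unfold Csq.
      rewrite E. ring. }
  assert (r10 : 0 < r1) by (unfold r1; lra).
  assert (nzs : forall z, D z -> (s z + s0)%C <> 0%C).
  { intros z hz E. specialize (far z hz). rewrite E, Cmod_0 in far. lra. }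
  assert (cde : forall z, D z -> cd (fun z => / (s z + s0))%C z
     (- ((1 / F' (h z) - 0) / (s z + s z) + 0) / ((s z + s0) * (s z + s0)))%C).
  { intros z hz. apply (cd_inv (fun z => s z + s0)%C); [|apply nzs; auto].
    apply cd_plus; [apply scd; auto|apply cd_const]. }
  assert (est := cauchy_estimate (fun z => / (s z + s0))%C y
    (- ((1 / F' (h y) - 0) / (s y + s y) + 0) / ((s y + s0) * (s y + s0)))%C r (/ r1) hr
    (fun z hz => ex_intro _ _ (cde z hz))).
  assert (bd : forall z, Cmod (z - y) < r -> Cmod (/ (s z + s0)) <= / r1).
  { intros z hz. rewrite Cmod_inv by (apply nzs; auto). apply Rinv_le_contravar; auto. }
  specialize (est bd (cde y yy)). fold s0 in est.
  assert (s0n : s0 <> 0%C) by (apply Cmod_gt_0; auto).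
  assert (n0y := n0 y yy).
  assert (two : (1 + 1)%C <> 0%C) by (intros E; injection E; lra).
  (* The factor 8 s0^3 is made of s' = h' / (2 s) and of the square (2 s0)^2 from differentiating 1
     / (s + s0). *)
  replace (- ((1 / F' (h y) - 0) / (s0 + s0) + 0) / ((s0 + s0) * (s0 + s0)))%C with
    (- ((1 / F' (h y)) / ((1 + 1) * (1 + 1) * (1 + 1) * (s0 * s0 * s0))))%C in est.
  2:{ field. repeat split; auto. intros E. apply double_eq_0 in E. auto. }
  assert (c2 : Cmod (1 + 1) = 2) by (rewrite <- RtoC_plus, Cmod_R, Rabs_pos_eq; lra).
  rewrite Cmod_opp, Cmod_div in est by (repeat apply Cmult_neq_0; auto).
  rewrite !(Cmod_mult), c2 in est. set (m := Cmod s0) in *. set (X := Cmod (1 / F' (h y))) in *.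
  assert (e2 : X * r <= 160 * (m * m)).
  { apply Rmult_le_compat_r with (r := 2 * 2 * 2 * (m * m * m) * r) in est.
    2:{ assert (0 < m * m) by nra. assert (0 < m * m * m) by nra. nra. }
    replace (X / (2 * 2 * 2 * (m * m * m)) * (2 * 2 * 2 * (m * m * m) * r)) with (X * r) in est by (field; lra).
    unfold r1 in est.
    replace (4 * / (m / 5) / r * (2 * 2 * 2 * (m * m * m) * r)) with (160 * (m * m)) in est by (field; lra).
    exact est. }
  (* 160 nu < 320 rho = (640/3) S, which accounts for the constant 220. *)
  rewrite s02 in e2. unfold rho in *. lra.
Qed.

(** The exponent is (440 / r) (r / 2), a bound for the variation of log (h - v) from the centre over
    the half disc. *)
Definition Kd : R := exp 220.
Lemma Kd_ge_1 : 1 <= Kd.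
Proof. unfold Kd. pose proof (exp_ineq1 220). lra. Qed.

(** At each point of the half disc [koebe] holds with radius r / 2, so the derivative of log (h - v)
    is at most 440 / r there; it is integrated along a radius. *)
Lemma growth F F' y r h v : is_deriv F F' -> r > 0 -> ball_section F y r h ->
  (forall z, Cmod (z - y) < r -> F' (h z) <> 0%C) -> omits h y r v ->
  forall z, Cmod (z - y) < r / 2 -> Cmod (h z - v) <= Kd * Cmod (h y - v).
Proof.
  intros H hr hs n0 hv z hz. set (D := ballC y (r / 2)).
  assert (yy : D y) by (unfold D, ballC; rewrite Cmod_sub_eq; lra).
  assert (Dr : forall w, D w -> Cmod (w - y) < r) by (unfold D, ballC; intros; lra).
  assert (nz : forall w, D w -> (h w - v)%C <> 0%C) by (intros w hw; apply Csub_neq_0, hv; auto).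
  destruct (Cexp_surj (h y - v)%C (nz y yy)) as [l0 El0].
  destruct (convex_lift Cexp Cexp D (fun z => h z - v)%C y l0 is_deriv_Cexp) as [q [q0 Hq]]; auto.
  { apply convex_ball. }
  { intros w hw. apply cwi_minus; [apply cts_cwi, hs; auto|apply cwi_const]. }
  { intros w hw. apply nonsing_Cexp. auto. }
  assert (qc : forall w, D w -> cd q w ((1 / F' (h w) - 0) / Cexp (q w))%C).
  { intros w hw. apply (lift_cd Cexp Cexp (fun z => h z - v)%C q w _ (r / 2 - Cmod (w - y)) is_deriv_Cexp).
    - unfold D, ballC in hw. lra.
    - apply cwi_ball_cts with y (r / 2); auto. apply Hq; auto.
    - intros u hu. apply Hq. apply ball_open with w; auto.
    - apply cd_minus; [|apply cd_const]. apply section_cd with F y r; auto.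
    - apply Cexp_neq_0. }
  assert (mv : Cmod (q z - q y) <= 440 / r * Cmod (z - y)).
  { apply (mean_value q (fun w => (1 / F' (h w) - 0) / Cexp (q w))%C).
    - intros t ht. apply qc. apply convex_ball; auto.
    - intros t ht. assert (hw := convex_ball y (r / 2) y z t yy hz ht). set (w := seg y z t) in *.
      rewrite (proj2 (Hq w hw)). replace (1 / F' (h w) - 0)%C with (1 / F' (h w))%C by ring.
      rewrite Cmod_div by (apply nz; auto).
      assert (p := proj1 (Cmod_gt_0 _) (nz w hw)). unfold D, ballC in hw.
      assert (k := koebe F F' w (r / 2) h v H ltac:(lra)).
      assert (k1 : ball_section F w (r / 2) h) by (apply section_sub with y r; auto; lra).
      assert (k2 : omits h w (r / 2) v) by (apply omits_sub with y r; auto; lra).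
      specialize (k k1). specialize (k ltac:(intros u hu; apply n0; pose proof (Cmod_tri u w y); lra) k2).
      rewrite (Cmod_sym v) in k.
      apply Rmult_le_reg_r with (Cmod (h w - v) * (r / 2)); [nra|].
      replace (Cmod (1 / F' (h w)) / Cmod (h w - v) * (Cmod (h w - v) * (r / 2))) with
        (Cmod (1 / F' (h w)) * (r / 2)) by (field; lra).
      replace (440 / r * (Cmod (h w - v) * (r / 2))) with (220 * Cmod (h w - v)) by (field; lra). exact k. }
  rewrite <- (proj2 (Hq z hz)), <- (proj2 (Hq y yy)), !Cmod_Cexp.
  unfold Kd. rewrite <- exp_plus.
  assert (fst (q z) <= 220 + fst (q y)).
  { pose proof (Rabs_fst_le (q z - q y)) as a. simpl in a. pose proof (Rle_abs (fst (q z) + - fst (q y))).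
    assert (440 / r * Cmod (z - y) <= 440 / r * (r / 2)).
    { apply Rmult_le_compat_l; [apply Rlt_le, Rdiv_lt_0_compat; lra|lra]. }
    replace (440 / r * (r / 2)) with 220 in H1 by (field; lra). lra. }
  destruct (Rle_lt_or_eq_dec _ _ H0) as [l|l]; [left; apply exp_increasing; auto|rewrite l; lra].
Qed.

(** If [h2] covered the disc of radius rho = 2000 Kd |h1 y1 - v|, then |F - y2| < r on it, and
    Cauchy's estimate would bound the derivative of [F] at [h2 y2] by 4 r / rho. But [koebe] for
    [h1] at [y2], where both sections agree, bounds it from below, which forces rho <= 1760 Kd |h1
    y1 - v|. *)
Lemma omit_transfer F F' y1 y2 r h1 h2 v : is_deriv F F' -> r > 0 ->
  ball_section F y1 r h1 -> ball_section F y2 r h2 ->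
  (forall z, Cmod (z - y1) < r -> F' (h1 z) <> 0%C) ->
  (forall z, Cmod (z - y2) < r -> F' (h2 z) <> 0%C) ->
  omits h1 y1 r v -> Cmod (y2 - y1) < r / 2 -> h1 y2 = h2 y2 ->
  exists v2, omits h2 y2 r v2 /\ Cmod (v2 - h2 y2) <= 2000 * Kd * Cmod (h1 y1 - v).
Proof.
  intros H hr s1 s2 n1 n2 hv hy E. apply NNPP. intros no.
  assert (g := growth F F' y1 r h1 v H hr s1 n1 hv y2 hy).
  assert (k := koebe F F' y2 (r / 2) h1 v H ltac:(lra)).
  specialize (k (section_sub F y1 r h1 y2 (r/2) s1 ltac:(lra))).
  specialize (k ltac:(intros u hu; apply n1; pose proof (Cmod_tri u y2 y1); lra)
    (omits_sub h1 y1 r y2 (r/2) v hv ltac:(lra))).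
  rewrite (Cmod_sym v) in k. rewrite E in k, g.
  set (m := Cmod (h2 y2 - v)) in *. set (M := Cmod (h1 y1 - v)) in *.
  assert (yy : Cmod (y2 - y2) < r) by (rewrite Cmod_sub_eq; lra).
  assert (pM : 0 < M).
  { apply Cmod_sub_pos. apply hv. rewrite Cmod_sub_eq. lra. }
  pose proof Kd_ge_1 as K1.
  set (rho := 2000 * Kd * M). assert (prho : 0 < rho) by (unfold rho; nra).
  assert (all : forall w, Cmod (w - h2 y2) < rho -> exists z, Cmod (z - y2) < r /\ h2 z = w).
  { intros w hw. apply NNPP. intros n. apply no. exists w. split; [|fold M rho; lra].
    intros z hz Ez. apply n. eauto. }
  assert (c := cauchy_estimate (fun w => F w - y2)%C (h2 y2) (F' (h2 y2) - 0)%C rho r prho).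
  assert (c' : Cmod (F' (h2 y2) - 0) <= 4 * r / rho).
  { apply c.
    - intros w _. eexists. apply cd_minus; [apply H|apply cd_const].
    - intros w hw. destruct (all w hw) as [z [z1 z2]]. rewrite <- z2, (proj2 (s2 z z1)). lra.
    - apply cd_minus; [apply H|apply cd_const]. }
  replace (F' (h2 y2) - 0)%C with (F' (h2 y2)) in c' by ring.
  assert (n0 := n2 y2 yy). rewrite Cmod_div, Cmod_1 in k by auto.
  assert (pf := proj1 (Cmod_gt_0 _) n0). set (f := Cmod (F' (h2 y2))) in *.
  assert (r / 2 <= 220 * m * f).
  { apply Rmult_le_compat_r with (r := f) in k; [|lra].
    replace (1 / f * (r / 2) * f) with (r / 2) in k by (field; lra). lra. }
  assert (f * rho <= 4 * r).
  { apply Rmult_le_compat_r with (r := rho) in c'; [|lra].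
    replace (4 * r / rho * rho) with (4 * r) in c' by (field; lra). lra. }
  assert (m0 : 0 <= m) by apply Cmod_ge_0.
  assert (r / 2 * rho <= 220 * m * (4 * r)).
  { apply Rle_trans with (220 * m * f * rho); [apply Rmult_le_compat_r; lra|].
    rewrite Rmult_assoc. apply Rmult_le_compat_l; lra. }
  assert (rho <= 1760 * m) by nra. unfold rho in H3.
  assert (Kd * M > 0) by nra. nra.
Qed.

(** * Closed walks on the lattice *)

Section GridWalks.
Import ListNotations.
Local Open Scope Z_scope.

Definition Zadj (u w : Z * Z) : Prop :=
  (snd u = snd w /\ (fst u = fst w + 1 \/ fst w = fst u + 1)) \/
  (fst u = fst w /\ (snd u = snd w + 1 \/ snd w = snd u + 1)).

Fixpoint wadj (l : list (Z * Z)) : Prop :=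
  match l with
  | u :: ((w :: _) as l') => Zadj u w /\ wadj l'
  | _ => True
  end.

(* Does the step from u to w cross the vertical ray going up from (fst q + 1/2, snd q)? *)
Definition crosses (q u w : Z * Z) : bool :=
  ((Z.min (fst u) (fst w) =? fst q) && negb (fst u =? fst w) && (snd q <? snd u))%bool.

Fixpoint crossing_parity (q : Z * Z) (l : list (Z * Z)) : bool :=
  match l with
  | u :: ((w :: _) as l') => xorb (crosses q u w) (crossing_parity q l')
  | _ => false
  end.

Lemma crossing_parity_cons q u w l :
  crossing_parity q (u :: w :: l) = xorb (crosses q u w) (crossing_parity q (w :: l)).
Proof. reflexivity. Qed.

Lemma wadj_cons u w l : wadj (u :: w :: l) <-> Zadj u w /\ wadj (w :: l).
Proof. reflexivity. Qed.

Ltac zb := repeat match goal with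
  | |- context [Z.eqb ?a ?b] => destruct (Z.eqb_spec a b)
  | |- context [Z.ltb ?a ?b] => destruct (Z.ltb_spec a b) end.

(** An edge crossed by the ray from [q] but not by that from [q'] has [q'] as its left end. *)
Lemma crossing_parity_up q q' l : wadj l -> fst q' = fst q -> snd q' = snd q + 1 -> ~ In q' l ->
  crossing_parity q l = crossing_parity q' l.
Proof.
  intros A e1 e2 n. induction l as [|u [|w l] IH]; auto.
  rewrite !crossing_parity_cons. rewrite wadj_cons in A. destruct A as [A A'].
  rewrite IH; auto; [|intros h; apply n; right; auto]. f_equal.
  assert (n1 : u <> q') by (intros ->; apply n; left; auto).
  assert (n2 : w <> q') by (intros ->; apply n; right; left; auto).
  destruct u as [u1 u2], w as [w1 w2], q as [a b], q' as [a' b']. simpl in *. subst.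
  assert (~ (u1 = a /\ u2 = b + 1)) by (intros [-> ->]; auto).
  assert (~ (w1 = a /\ w2 = b + 1)) by (intros [-> ->]; auto).
  unfold crosses, Zadj in *. simpl in *. zb; simpl; auto; lia.
Qed.

(** The rays run on both sides of the column of [q']. A step is crossed by exactly one of them when
    it enters or leaves the half-column above [q'], so the differences telescope; a closed walk
    leaves nothing. *)
Lemma crossing_parity_right_telescope q q' l u0 : wadj (u0 :: l) -> fst q' = fst q + 1 -> snd q' = snd q ->
  ~ In q' (u0 :: l) ->
  xorb (crossing_parity q (u0 :: l)) (crossing_parity q' (u0 :: l)) =
  xorb ((fst u0 =? fst q') && (snd q <? snd u0))%bool
       ((fst (last l u0) =? fst q') && (snd q <? snd (last l u0)))%bool.
Proof.
  revert u0. induction l as [|w l IH]; intros u A e1 e2 n.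
  - simpl. destruct (_ && _)%bool; auto.
  - rewrite !crossing_parity_cons. rewrite wadj_cons in A. destruct A as [A A'].
    specialize (IH w A' e1 e2 (fun h => n (or_intror h))).
    replace (last (w :: l) u) with (last l w).
    2:{ clear. revert w. induction l as [|x l IH]; intros w; auto. simpl. destruct l; auto. }
    set (L := ((fst (last l w) =? fst q') && (snd q <? snd (last l w)))%bool) in *. clearbody L.
    set (P := crossing_parity q (w :: l)) in *. set (P' := crossing_parity q' (w :: l)) in *.
    clearbody P P'.
    assert (E : xorb (crosses q u w) (crosses q' u w) =
       xorb ((fst u =? fst q') && (snd q <? snd u))%bool ((fst w =? fst q') && (snd q <? snd w))%bool).
    { assert (n1 : u <> q') by (intros ->; apply n; left; auto).
      assert (n2 : w <> q') by (intros ->; apply n; right; left; auto).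
      destruct u as [u1 u2], w as [w1 w2], q as [a b], q' as [a' b']. simpl in *. subst.
      assert (~ (u1 = a + 1 /\ u2 = b)) by (intros [-> ->]; auto).
      assert (~ (w1 = a + 1 /\ w2 = b)) by (intros [-> ->]; auto).
      unfold crosses, Zadj in *. simpl in *. zb; simpl; auto; lia. }
    destruct (crosses q u w), (crosses q' u w), P, P', L,
      (((fst u =? fst q') && (snd q <? snd u))%bool), (((fst w =? fst q') && (snd q <? snd w))%bool);
    simpl in *; congruence.
Qed.

Lemma last_snoc {A} (l : list A) v d : last (l ++ [v]) d = v.
Proof. induction l as [|a l IH]; auto. simpl. destruct (l ++ [v]) eqn:E; auto. destruct l; discriminate. Qed.

Lemma crossing_parity_right q q' v l : wadj (v :: l ++ [v]) -> fst q' = fst q + 1 -> snd q' = snd q ->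
  ~ In q' (v :: l) -> crossing_parity q (v :: l ++ [v]) = crossing_parity q' (v :: l ++ [v]).
Proof.
  intros A e1 e2 n.
  assert (n' : ~ In q' (v :: l ++ [v])).
  { intros [h|h]; [apply n; left; auto|]. apply in_app_or in h. destruct h as [h|[h|[]]].
    - apply n; right; auto.
    - apply n; left; auto. }
  assert (T := crossing_parity_right_telescope q q' (l ++ [v]) v A e1 e2 n').
  rewrite last_snoc, xorb_nilpotent in T. apply xorb_eq in T. exact T.
Qed.

Lemma crossing_parity_none q l : wadj l ->
  (forall u, In u l -> snd u <= snd q \/ fst u < fst q \/ fst q < fst u - 1) ->
  crossing_parity q l = false.
Proof.
  intros A H. induction l as [|u [|w l] IH]; auto. rewrite wadj_cons in A. destruct A as [A A'].
  rewrite crossing_parity_cons, IH by (auto; intros x hx; apply H; right; auto).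
  rewrite xorb_false_r. assert (hu := H u (or_introl eq_refl)).
  assert (hw := H w (or_intror (or_introl eq_refl))).
  unfold crosses, Zadj in *. zb; simpl; auto; lia.
Qed.

Lemma crossing_parity_below_telescope q l u0 : wadj (u0 :: l) -> (forall u, In u (u0 :: l) -> snd q < snd u) ->
  crossing_parity q (u0 :: l) = xorb (fst q <? fst u0) (fst q <? fst (last l u0)).
Proof.
  revert u0. induction l as [|w l IH]; intros u A H.
  - simpl. rewrite xorb_nilpotent. auto.
  - rewrite crossing_parity_cons. rewrite wadj_cons in A. destruct A as [A A'].
    rewrite IH; auto; [|intros x hx; apply H; right; auto].
    replace (last (w :: l) u) with (last l w).
    2:{ clear. revert w. induction l as [|x l IH]; intros w; auto. simpl. destruct l; auto. }
    assert (E : crosses q u w = xorb (fst q <? fst u) (fst q <? fst w)).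
    { assert (hu := H u (or_introl eq_refl)). assert (hw := H w (or_intror (or_introl eq_refl))).
      unfold crosses, Zadj in *. zb; simpl; auto; lia. }
    rewrite E. destruct (fst q <? fst u), (fst q <? fst w), (fst q <? fst (last l w)); auto.
Qed.

Lemma crossing_parity_below q v l : wadj (v :: l ++ [v]) -> (forall u, In u (v :: l) -> snd q < snd u) ->
  crossing_parity q (v :: l ++ [v]) = false.
Proof.
  intros A H. rewrite crossing_parity_below_telescope; auto.
  - rewrite last_snoc. apply xorb_nilpotent.
  - intros u [<-|h]; [apply H; left; auto|]. apply in_app_or in h.
    destruct h as [h|[<-|[]]]; apply H; [right|left]; auto.
Qed.

Inductive zpath (P : Z * Z -> Prop) : Z * Z -> Z * Z -> Prop :=
| zpath_refl q : P q -> zpath P q q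
| zpath_step q r s : zpath P q r -> Zadj r s -> P s -> zpath P q s.

Lemma zpath_trans (P : Z * Z -> Prop) q r s : zpath P q r -> zpath P r s -> zpath P q s.
Proof.
  intros H1 H2. revert H1. induction H2 as [r|r s t H2 IH a Pt]; intros H1; auto.
  exact (zpath_step _ _ _ _ (IH H1) a Pt).
Qed.

Lemma zpath_start (P : Z * Z -> Prop) q r : zpath P q r -> P q.
Proof. intros H; induction H; auto. Qed.

Lemma zpath_end (P : Z * Z -> Prop) q r : zpath P q r -> P r.
Proof. intros H; induction H; auto. Qed.

Lemma zpath_weaken (P Q : Z * Z -> Prop) q r : (forall u, P u -> Q u) -> zpath P q r -> zpath Q q r.
Proof. intros h H. induction H; [apply zpath_refl|eapply zpath_step]; eauto. Qed.

Lemma crossing_parity_zpath (P : Z * Z -> Prop) q r v l : wadj (v :: l ++ [v]) -> zpath P q r ->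
  (forall u, P u -> ~ In u (v :: l)) ->
  crossing_parity q (v :: l ++ [v]) = crossing_parity r (v :: l ++ [v]).
Proof.
  intros A H HP. assert (start := zpath_start).
  assert (HP' : forall u, P u -> ~ In u (v :: l ++ [v])).
  { intros u hu [h|h]; [apply (HP u hu); left; auto|]. apply in_app_or in h.
    destruct h as [h|[h|[]]]; apply (HP u hu); [right|left]; auto. }
  induction H as [|q r s H IH adj Ps]; auto. rewrite IH.
  assert (Pr := zpath_end _ _ _ H). clear IH start.
  destruct adj as [[e [f|f]]|[e [f|f]]].
  - symmetry. apply crossing_parity_right; auto.
  - apply crossing_parity_right; auto.
  - symmetry. apply crossing_parity_up; auto.
  - apply crossing_parity_up; auto.
Qed.

Lemma zpath_product (P1 P2 : Z -> Prop) u w :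
  (forall a b c, P1 a -> P1 c -> a <= b <= c -> P1 b) ->
  (forall a b c, P2 a -> P2 c -> a <= b <= c -> P2 b) ->
  P1 (fst u) -> P2 (snd u) -> P1 (fst w) -> P2 (snd w) ->
  zpath (fun v => P1 (fst v) /\ P2 (snd v)) u w.
Proof.
  intros m1 m2. set (S := fun v : Z * Z => P1 (fst v) /\ P2 (snd v)).
  assert (hor : forall n u1 w1 y, Z.abs_nat (u1 - w1) = n -> S (u1, y) -> S (w1, y) -> zpath S (u1, y) (w1, y)).
  { induction n as [|n IH]; intros u1 w1 y hn [hu hy] [hw _]; simpl in *.
    - replace w1 with u1 by lia. apply zpath_refl. split; auto.
    - assert (st : exists v1, P1 v1 /\ Z.abs_nat (u1 - v1) = n /\ (v1 = w1 + 1 \/ w1 = v1 + 1)).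
      { destruct (Z_lt_ge_dec u1 w1).
        - exists (w1 - 1). split; [apply (m1 u1 _ w1); auto; lia|lia].
        - exists (w1 + 1). split; [apply (m1 w1 _ u1); auto; lia|lia]. }
      destruct st as (v1 & k1 & k2 & k3). apply zpath_step with (v1, y); [apply IH; auto; split; auto| |split; auto].
      left. simpl. lia. }
  assert (ver : forall n x u2 w2, Z.abs_nat (u2 - w2) = n -> S (x, u2) -> S (x, w2) -> zpath S (x, u2) (x, w2)).
  { induction n as [|n IH]; intros x u2 w2 hn [hx hu] [_ hw]; simpl in *.
    - replace w2 with u2 by lia. apply zpath_refl. split; auto.
    - assert (st : exists v1, P2 v1 /\ Z.abs_nat (u2 - v1) = n /\ (v1 = w2 + 1 \/ w2 = v1 + 1)).
      { destruct (Z_lt_ge_dec u2 w2).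
        - exists (w2 - 1). split; [apply (m2 u2 _ w2); auto; lia|lia].
        - exists (w2 + 1). split; [apply (m2 w2 _ u2); auto; lia|lia]. }
      destruct st as (v1 & k1 & k2 & k3). apply zpath_step with (x, v1); [apply IH; auto; split; auto| |split; auto].
      right. simpl. lia. }
  destruct u as [u1 u2], w as [w1 w2]. simpl. intros.
  eapply zpath_trans; [eapply (hor _ u1 w1 u2)|eapply (ver _ w1 u2 w2)]; eauto; split; auto.
Qed.

(** * Transport along closed walks *)

Section Holonomy.
(** [tr v u x y] reads: along the edge from v to u, the value x over v is carried to y over u.
    [tr_sq] closes up a unit square from three of its sides. *)
Context (good : Z * Z -> Prop) {X : Type} (tr : Z * Z -> Z * Z -> X -> X -> Prop).
Context (tr_adj : forall v u x y, tr v u x y -> Zadj v u /\ good v /\ good u)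
  (tr_sym : forall v u x y, tr v u x y -> tr u v y x)
  (tr_fun : forall v u x y y', tr v u x y -> tr v u x y' -> y = y')
  (tr_ex : forall v u w x y, tr v u y x -> good w -> Zadj u w -> exists z, tr u w x z)
  (tr_sq : forall a b x x1 xp z, tr (a, b) (a - 1, b) x x1 -> tr (a, b) (a, b - 1) x xp ->
     tr (a, b - 1) (a - 1, b - 1) xp z -> tr (a - 1, b) (a - 1, b - 1) x1 z).
(* No bounded set of good points encloses a bad one. *)
Context (escape : forall q N, ~ good q -> exists q', zpath (fun u => ~ good u) q q' /\
   (N < Z.abs (fst q') \/ N < Z.abs (snd q'))).

Fixpoint trw (l : list (Z * Z)) (x y : X) : Prop :=
  match l with
  | u :: ((w :: _) as l') => exists z, tr u w x z /\ trw l' z y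
  | _ => x = y
  end.

Lemma trw_cons u w l x y : trw (u :: w :: l) x y <-> exists z, tr u w x z /\ trw (w :: l) z y.
Proof. reflexivity. Qed.

Lemma trw_app l1 u l2 x y : trw (l1 ++ u :: l2) x y <-> exists z, trw (l1 ++ [u]) x z /\ trw (u :: l2) z y.
Proof.
  revert x. induction l1 as [|a l1 IH]; intros x.
  - simpl app. split; [intros h; exists x; split; auto; reflexivity|].
    intros [z [E h]]. simpl in E. subst. auto.
  - destruct l1 as [|b l1].
    + simpl app. rewrite trw_cons. split.
      * intros [z [h1 h2]]. exists z. split; auto. exists z. split; auto. reflexivity.
      * intros [z [[z' [h1 h1']] h2]]. simpl in h1'. subst. eauto.
    + simpl app in *. rewrite trw_cons. split.
      * intros [z [h1 h2]]. apply IH in h2. destruct h2 as [z' [h2 h3]]. exists z'. split; auto.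
        rewrite trw_cons. eauto.
      * intros [z [h1 h2]]. rewrite trw_cons in h1. destruct h1 as [z' [h0 h1]]. exists z'. split; auto.
        apply IH. eauto.
Qed.

Lemma trw_rev l x y : trw l x y -> trw (rev l) y x.
Proof.
  revert x. induction l as [|u [|w l] IH]; intros x.
  - simpl. auto.
  - simpl. auto.
  - rewrite trw_cons. intros [z [h1 h2]]. apply IH in h2. simpl rev in *.
    rewrite <- app_assoc. simpl app. apply trw_app. exists z. split; auto.
    rewrite trw_cons. exists x. split; [apply tr_sym; auto|reflexivity].
Qed.

Lemma trw_fun l x y y' : trw l x y -> trw l x y' -> y = y'.
Proof.
  revert x. induction l as [|u [|w l] IH]; intros x.
  - simpl. congruence.
  - simpl. congruence.
  - rewrite !trw_cons. intros [z [h1 h2]] [z' [h1' h2']].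
    rewrite (tr_fun _ _ _ _ _ h1 h1') in h2. eauto.
Qed.

Lemma trw_wadj l x y : trw l x y -> wadj l.
Proof.
  revert x. induction l as [|u [|w l] IH]; intros x; try exact (fun _ => I).
  rewrite trw_cons, wadj_cons. intros [z [h1 h2]]. split; [eapply tr_adj; eauto|eauto].
Qed.

Lemma trw_good l x y u : trw l x y -> (2 <= length l)%nat -> In u l -> good u.
Proof.
  revert x. induction l as [|a [|b l] IH]; intros x; simpl length; try lia.
  rewrite trw_cons. intros [z [h1 h2]] _ [<-|h]; [eapply tr_adj; eauto|].
  destruct l as [|c l]; [|eapply IH; eauto; simpl; lia].
  destruct h as [<-|[]]. eapply tr_adj; eauto.
Qed.

(** Existence of transport depends only on goodness of the vertices, so every value that occurs over
    the first vertex can be carried along the same walk. *)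
Lemma trw_transport u l x y x' : trw (u :: l) x y -> (exists w z, tr u w x' z) ->
  exists y', trw (u :: l) x' y'.
Proof.
  revert u x x'. induction l as [|w l IH]; intros u x x' H [w' [z' h]].
  - exists x'. reflexivity.
  - rewrite trw_cons in H. destruct H as [z [h1 h2]]. destruct (tr_adj _ _ _ _ h1) as (a1 & a2 & a3).
    destruct (tr_ex _ _ w _ _ (tr_sym _ _ _ _ h) a3 a1) as [z1 hz1].
    destruct (IH w z z1 h2) as [y' hy'].
    + exists u, x'. apply tr_sym. auto.
    + exists y'. rewrite trw_cons. eauto.
Qed.

(** A path of bad vertices leads from [q] far away without meeting the walk, so the crossing parity
    is the same as for a distant point. *)
Lemma no_enclosed v l x y q : trw (v :: l ++ [v]) x y -> ~ good q ->
  crossing_parity q (v :: l ++ [v]) = false.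
Proof.
  intros H nq. assert (A := trw_wadj _ _ _ H).
  assert (bd : exists N, forall u, In u (v :: l) -> Z.abs (fst u) < N /\ Z.abs (snd u) < N).
  { clear. generalize (v :: l). intros k. induction k as [|a k [N IH]]; [exists 0; intros u []|].
    exists (Z.max N (Z.max (Z.abs (fst a)) (Z.abs (snd a)) + 1)). intros u [<-|h]; [lia|].
    specialize (IH u h). lia. }
  destruct bd as [N HN]. destruct (escape q N nq) as [q' [zp far]].
  rewrite (crossing_parity_zpath (fun u => ~ good u) q q' v l A zp).
  2:{ intros u nu hu. apply nu. eapply trw_good; eauto.
      - simpl. rewrite length_app. simpl. lia.
      - destruct hu as [<-|h]; [left; auto|right; apply in_or_app; auto]. }
  assert (HN' : forall u, In u (v :: l ++ [v]) -> Z.abs (fst u) < N /\ Z.abs (snd u) < N).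
  { intros u [<-|h]; [apply HN; left; auto|]. apply in_app_or in h.
    destruct h as [h|[<-|[]]]; apply HN; [right|left]; auto. }
  (* Far below, the upward ray does meet the walk and the parity is even because the walk closes; in
     the other directions the ray misses it. *)
  destruct (Z.lt_ge_cases (snd q') (- N)) as [l1|l1].
  - apply crossing_parity_below; auto. intros u hu. specialize (HN u hu). lia.
  - apply crossing_parity_none; auto. intros u hu. specialize (HN' u hu). lia.
Qed.

Fixpoint leftw (a y : Z) (k : nat) : list (Z * Z) :=
  match k with O => [] | S k => (a - 1, y) :: leftw (a - 1) y k end.

Lemma in_leftw a y k u : In u (leftw a y k) <-> snd u = y /\ a - Z.of_nat k <= fst u < a.
Proof.
  revert a. induction k as [|k IH]; intros a.
  - simpl. lia.
  - cbn [leftw In]. rewrite IH. destruct u as [u1 u2]. simpl fst. simpl snd. split.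
    + intros [E|h]; [injection E; lia|lia].
    + intros [-> h]. destruct (Z.eq_dec u1 (a - 1)) as [->|n]; [left; auto|right; lia].
Qed.

Lemma leftw_last a y k : exists l, (a, y) :: leftw a y k = l ++ [(a - Z.of_nat k, y)].
Proof.
  revert a. induction k as [|k IH]; intros a.
  - exists []. simpl. rewrite Z.sub_0_r. auto.
  - destruct (IH (a - 1)) as [l E]. exists ((a, y) :: l). cbn [leftw]. rewrite E.
    replace (a - Z.of_nat (S k)) with (a - 1 - Z.of_nat k) by lia. auto.
Qed.

Lemma leftw_length a y k : length (leftw a y k) = k.
Proof. revert a. induction k; intros; simpl; auto. Qed.

(** The squares under a westward run are closed up one after another by [tr_sq]; going along the top
    and down the last rung amounts to going down the first rung and along the bottom. *)
Lemma ladder k : forall a y x xp z,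
  trw ((a, y) :: leftw a y k ++ [(a - Z.of_nat k, y - 1)]) x z ->
  tr (a, y) (a, y - 1) x xp ->
  (forall c, a - Z.of_nat k <= c < a -> good (c, y - 1)) ->
  trw ((a, y - 1) :: leftw a (y - 1) k) xp z.
Proof.
  induction k as [|k IH]; intros a y x xp z H hp hg.
  - simpl in H. replace (a - 0) with a in H by lia. destruct H as [z' [h E]]. subst z'.
    simpl. eapply tr_fun; eauto.
  - cbn [leftw app] in *. rewrite trw_cons in *. destruct H as [x1 [h1 h2]].
    destruct (tr_ex _ _ (a - 1, y - 1) _ _ hp) as [z1 hz1].
    { apply hg. lia. }
    { left. simpl. lia. }
    exists z1. split; auto. apply (IH (a - 1) y x1).
    + replace (a - 1 - Z.of_nat k) with (a - Z.of_nat (S k)) by lia. exact h2.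
    + eapply tr_sq; eauto.
    + intros c hc. apply hg. lia.
Qed.

(* Along a top row a simple walk keeps its direction until it steps down. *)
Lemma top_run l : forall a y, wadj ((a, y) :: l) -> NoDup ((a, y) :: l) ->
  ~ In (a + 1, y) l -> (forall u, In u l -> snd u <= y) -> (exists u, In u l /\ snd u < y) ->
  exists k rest, l = leftw a y k ++ (a - Z.of_nat k, y - 1) :: rest.
Proof.
  induction l as [|[b c] l IH]; intros a y A ND nr top [u [hu du]]; [destruct hu|].
  rewrite wadj_cons in A. destruct A as [A A'].
  assert (tb := top (b, c) (or_introl eq_refl)). simpl in tb.
  unfold Zadj in A. simpl in A.
  assert (cases : (b = a - 1 /\ c = y) \/ (b = a + 1 /\ c = y) \/ (b = a /\ c = y - 1)) by lia.
  destruct cases as [[-> ->]|[[-> ->]|[-> ->]]].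
  - inversion ND as [|? ? n1 ND']; subst.
    destruct (IH (a - 1) y) as [k [rest E]]; auto.
    + replace (a - 1 + 1) with a by lia. intros h. apply n1. right. auto.
    + intros w hw. apply top. right. auto.
    + destruct hu as [<-|hu]; [simpl in du; lia|]. eauto.
    + exists (S k), rest. cbn [leftw app]. rewrite E.
      replace (a - Z.of_nat (S k)) with (a - 1 - Z.of_nat k) by lia. auto.
  - exfalso. apply nr. left. auto.
  - exists 0%nat, l. simpl. rewrite Z.sub_0_r. auto.
Qed.

Lemma crossing_parity_app q l1 u l2 :
  crossing_parity q (l1 ++ u :: l2) = xorb (crossing_parity q (l1 ++ [u])) (crossing_parity q (u :: l2)).
Proof.
  induction l1 as [|a [|b l1] IH].
  - simpl app. cbn [crossing_parity]. rewrite xorb_false_l. auto.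
  - simpl app. rewrite !crossing_parity_cons. cbn [crossing_parity]. rewrite xorb_false_r. auto.
  - simpl app in *. rewrite !crossing_parity_cons, IH, xorb_assoc. auto.
Qed.

(** The edge with left end (c, y) is the only one of the run above the point. *)
Lemma crossing_parity_leftw c y k : forall a, a - Z.of_nat k <= c < a ->
  crossing_parity (c, y - 1) ((a, y) :: leftw a y k) = true.
Proof.
  induction k as [|k IH]; intros a h; [lia|].
  cbn [leftw]. rewrite crossing_parity_cons. destruct (Z.eq_dec c (a - 1)) as [->|n].
  - assert (E : crossing_parity (a - 1, y - 1) ((a - 1, y) :: leftw (a - 1) y k) = false).
    { clear. generalize (a - 1). intros b.
      assert (G : forall k d, d <= b -> crossing_parity (b, y - 1) ((d, y) :: leftw d y k) = false).
      { clear. induction k as [|k IH]; intros d h; auto.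
        cbn [leftw]. rewrite crossing_parity_cons, IH by lia.
        unfold crosses. simpl. zb; simpl; auto; lia. }
      apply G. lia. }
    rewrite E. unfold crosses. simpl. zb; simpl; auto; lia.
  - rewrite IH by lia. unfold crosses. simpl. zb; simpl; auto; lia.
Qed.

Lemma crossing_parity_avoid q l : wadj l -> (forall u, In u l -> snd u <= snd q + 1) ->
  ~ In (fst q, snd q + 1) l -> crossing_parity q l = false.
Proof.
  intros A H n. induction l as [|u [|w l] IH]; auto.
  rewrite wadj_cons in A. destruct A as [A A'].
  rewrite crossing_parity_cons, IH; auto.
  - rewrite xorb_false_r. assert (hu := H u (or_introl eq_refl)).
    assert (n1 : u <> (fst q, snd q + 1)) by (intros E; apply n; left; auto).
    assert (n2 : w <> (fst q, snd q + 1)) by (intros E; apply n; right; left; auto).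
    assert (hw := H w (or_intror (or_introl eq_refl))).
    destruct u as [u1 u2], w as [w1 w2], q as [a b]. unfold Zadj in A. simpl in *.
    assert (~ (u1 = a /\ u2 = b + 1)) by (intros [-> ->]; auto).
    assert (~ (w1 = a /\ w2 = b + 1)) by (intros [-> ->]; auto).
    unfold crosses. simpl. zb; simpl; auto; try lia.
  - intros x hx. apply H. right. auto.
  - intros h. apply n. right. auto.
Qed.

Lemma wadj_app_r l1 l2 : wadj (l1 ++ l2) -> wadj l2.
Proof.
  induction l1 as [|a l1 IH]; auto. intros H. apply IH. destruct l1 as [|b l1].
  - destruct l2; [exact I|]. apply wadj_cons in H. apply H.
  - simpl app in H. apply wadj_cons in H. apply H.
Qed.

Lemma lex_max (l : list (Z * Z)) m0 : exists m, In m (m0 :: l) /\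
  forall u, In u (m0 :: l) -> snd u < snd m \/ (snd u = snd m /\ fst u <= fst m).
Proof.
  induction l as [|a l [m [hm Hm]]].
  - exists m0. split; [left; auto|]. intros u [<-|[]]. lia.
  - destruct (Z_lt_ge_dec (snd m) (snd a)).
    + exists a. split; [right; left; auto|]. intros u [<-|[<-|h]].
      * specialize (Hm _ (or_introl eq_refl)). lia.
      * lia.
      * specialize (Hm u (or_intror h)). lia.
    + destruct (Z.eq_dec (snd m) (snd a)); [destruct (Z_lt_ge_dec (fst m) (fst a))|].
      * exists a. split; [right; left; auto|]. intros u [<-|[<-|h]].
        -- specialize (Hm _ (or_introl eq_refl)). lia.
        -- lia.
        -- specialize (Hm u (or_intror h)). lia.
      * exists m. split; [destruct hm; [left|right; right]; auto|]. intros u [<-|[<-|h]].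
        -- apply Hm. left; auto.
        -- lia.
        -- apply Hm. right; auto.
      * exists m. split; [destruct hm; [left|right; right]; auto|]. intros u [<-|[<-|h]].
        -- apply Hm. left; auto.
        -- lia.
        -- apply Hm. right; auto.
Qed.

Lemma not_NoDup_split (l : list (Z * Z)) : ~ NoDup l -> exists l1 u l2 l3, l = l1 ++ u :: l2 ++ u :: l3.
Proof.
  induction l as [|a l IH]; intros H; [elim H; constructor|].
  destruct (classic (In a l)) as [h|h].
  - apply in_split in h. destruct h as [l2 [l3 ->]]. exists [], a, l2, l3. auto.
  - destruct IH as (l1 & u & l2 & l3 & ->).
    + intros ND. apply H. constructor; auto.
    + exists (a :: l1), u, l2, l3. auto.
Qed.

(* The induction step for a simple closed walk whose top-right vertex (a, y) is left westwards
   and reached from below: the run along the top row is pushed down by one. *)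
Lemma push_down n a y l' p x x' :
  (forall v l x x', (length l <= n)%nat -> trw (v :: l ++ [v]) x x' -> x = x') ->
  (length l' <= n)%nat -> NoDup ((a, y) :: (a - 1, y) :: l' ++ [p]) -> p = (a, y - 1) ->
  (forall u, In u ((a, y) :: (a - 1, y) :: l' ++ [p]) -> snd u < y \/ (snd u = y /\ fst u <= a)) ->
  trw ((a, y) :: ((a - 1, y) :: l' ++ [p]) ++ [(a, y)]) x x' -> x = x'.
Proof.
  intros IHn hl ND -> top H.
  assert (A := trw_wadj _ _ _ H).
  set (l := (a - 1, y) :: l' ++ [(a, y - 1)]) in *.
  destruct (top_run l a y) as [k [rest E]]; auto.
  { change ((a, y) :: l ++ [(a, y)]) with (((a, y) :: l) ++ [(a, y)]) in A.
    revert A. generalize ((a, y) :: l). clear. intros k. induction k as [|u [|w k] IH]; auto; [simpl; auto|].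
    simpl app. rewrite !wadj_cons. intros [h1 h2]. split; auto. }
  { intros h. specialize (top (a + 1, y) (or_intror h)). simpl in top. lia. }
  { intros u hu. specialize (top u (or_intror hu)). lia. }
  { exists (a, y - 1). split; [right; apply in_or_app; right; left; auto|simpl; lia]. }
  assert (k0 : k <> 0%nat).
  { intros ->. simpl in E. unfold l in E. injection E. intros. lia. }
  set (e := (a - Z.of_nat k, y - 1)) in *.
  assert (hrest : exists rest', rest = rest' ++ [(a, y - 1)]).
  { destruct rest as [|r0 rest0] using rev_ind.
    - exfalso. assert (E' : last l (a, y) = last (leftw a y k ++ [e]) (a, y)) by (rewrite E; auto).
      rewrite last_snoc in E'. unfold l in E'.
      change ((a - 1, y) :: l' ++ [(a, y - 1)]) with (((a - 1, y) :: l') ++ [(a, y - 1)]) in E'.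
      rewrite last_snoc in E'. unfold e in E'. injection E'. intros. lia.
    - clear IHrest0. exists rest0. f_equal. f_equal.
      assert (E' : last l (a, y) = last (leftw a y k ++ e :: rest0 ++ [r0]) (a, y)) by (rewrite E; auto).
      unfold l in E'. change ((a - 1, y) :: l' ++ [(a, y - 1)]) with (((a - 1, y) :: l') ++ [(a, y - 1)]) in E'.
      change (leftw a y k ++ e :: rest0 ++ [r0]) with (leftw a y k ++ (e :: rest0) ++ [r0]) in E'.
      rewrite app_assoc, !last_snoc in E'. auto. }
  destruct hrest as [rest' ->].
  assert (len : (length rest' + k <= n)%nat).
  { assert (Z : length l = length (leftw a y k ++ e :: rest' ++ [(a, y - 1)])) by (rewrite E; auto).
    unfold l in Z. simpl in Z. rewrite !length_app in Z. simpl in Z. rewrite length_app, leftw_length in Z.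
    simpl in Z. lia. }
  assert (H2 := H).
  replace ((a, y) :: l ++ [(a, y)]) with (((a, y) :: leftw a y k) ++ e :: rest' ++ [(a, y - 1); (a, y)]) in H2.
  2:{ rewrite E. simpl. rewrite <- !app_assoc. simpl. rewrite <- app_assoc. auto. }
  apply trw_app in H2. destruct H2 as [z [H1 H2]].
  change (e :: rest' ++ [(a, y - 1); (a, y)]) with ((e :: rest') ++ (a, y - 1) :: [(a, y)]) in H2.
  apply trw_app in H2. destruct H2 as [xp' [H2 H3]]. rewrite trw_cons in H3.
  destruct H3 as [x'' [H3 Ex]]. simpl in Ex. subst x''.
  assert (ga : good (a, y)) by (eapply tr_adj; eauto). assert (gp : good (a, y - 1)) by (eapply tr_adj; eauto).
  assert (hxp : exists xp, tr (a, y) (a, y - 1) x xp).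
  { assert (H0 := H). unfold l in H0. cbn [app] in H0. rewrite trw_cons in H0. destruct H0 as [x1 [h1 _]].
    apply (tr_ex (a - 1, y) (a, y) _ x x1); auto. right. simpl. lia. }
  destruct hxp as [xp hxp].
  (* A bad vertex right below the top run would have odd crossing parity: one edge of the run lies
     above it, and the rest of the simple walk does not use the vertex over it. This contradicts
     [no_enclosed]. *)
  assert (hg : forall c, a - Z.of_nat k <= c < a -> good (c, y - 1)).
  { intros c hc. apply NNPP. intros nq. assert (P := no_enclosed _ _ _ _ _ H nq).
    replace ((a, y) :: l ++ [(a, y)]) with (((a, y) :: leftw a y k) ++ e :: rest' ++ [(a, y - 1); (a, y)]) in P, A.
    2:{ rewrite E. simpl. rewrite <- !app_assoc. simpl. rewrite <- app_assoc. auto. }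
    destruct (leftw_last a y k) as [l0 El0]. rewrite El0, <- app_assoc in P, A. simpl app in P, A.
    rewrite crossing_parity_app, <- El0, crossing_parity_leftw in P by auto.
    rewrite crossing_parity_cons in P.
    replace (crosses (c, y - 1) (a - Z.of_nat k, y) e) with false in P.
    2:{ unfold crosses, e. simpl. rewrite Z.eqb_refl. simpl. rewrite andb_false_r. auto. }
    rewrite crossing_parity_avoid in P; [discriminate| | |].
    - apply wadj_app_r, wadj_cons in A. apply A.
    - simpl snd. intros u hu. replace (y - 1 + 1) with y by lia.
      destruct hu as [<-|hu]; [unfold e; simpl; lia|].
      apply in_app_or in hu. destruct hu as [hu|[<-|[<-|[]]]]; [|simpl; lia|simpl; lia].
      assert (h : In u ((a, y) :: l)).
      { right. rewrite E. apply in_or_app. right. right. apply in_or_app. auto. }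
      specialize (top u h). lia.
    - simpl fst. simpl snd. replace (y - 1 + 1) with y by lia. intros hin.
      assert (inr : In (c, y) (leftw a y k)) by (apply in_leftw; simpl; lia).
      assert (ND' : NoDup (leftw a y k ++ e :: rest' ++ [(a, y - 1)])).
      { rewrite <- E. inversion ND; auto. }
      destruct hin as [hin|hin]; [apply (f_equal snd) in hin; unfold e in hin; simpl in hin; lia|].
      apply in_app_or in hin. destruct hin as [hin|[hin|[hin|[]]]]; [|apply (f_equal snd) in hin; simpl in hin; lia|apply (f_equal fst) in hin; simpl in hin; lia].
      apply NoDup_remove_1 in ND'. revert inr hin ND'. generalize (leftw a y k). clear. intros l1 h1 h2 ND.
      induction l1 as [|u l1 IH]; [destruct h1|]. inversion ND as [|? ? n ND']; subst.
      destruct h1 as [->|h1]; [|auto]. apply n. apply in_or_app. right. apply in_or_app. left. auto. }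
  assert (LD := ladder k a y x xp z H1 hxp hg).
  (* The lowered walk is based at (a, y - 1) and is shorter by two, since the first and the last
     rung have disappeared. *)
  assert (CL : trw ((a, y - 1) :: (leftw a (y - 1) k ++ rest') ++ [(a, y - 1)]) xp xp').
  { destruct (leftw_last a (y - 1) k) as [l0 El0]. fold e in El0.
    change ((a, y - 1) :: (leftw a (y - 1) k ++ rest') ++ [(a, y - 1)]) with
      ((((a, y - 1) :: leftw a (y - 1) k) ++ rest') ++ [(a, y - 1)]).
    rewrite El0, <- !app_assoc. simpl app. apply trw_app. exists z. rewrite <- El0. auto. }
  assert (xp = xp').
  { apply (IHn (a, y - 1) (leftw a (y - 1) k ++ rest') xp xp'); auto.
    rewrite length_app, leftw_length. lia. }
  subst xp'. eapply tr_fun; [apply tr_sym; exact hxp|exact H3].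
Qed.

(** Induction on length. A walk that repeats a vertex is composed of two shorter closed walks; a
    simple one is started at its top right vertex and lowered by [push_down]. *)
Lemma closed_walk_trivial n : forall v l x x', (length l <= n)%nat -> trw (v :: l ++ [v]) x x' -> x = x'.
Proof.
  induction n as [n IHn] using lt_wf_ind. intros v l x x' hl H.
  assert (IH : forall v l' x x', (length l' < length l)%nat -> trw (v :: l' ++ [v]) x x' -> x = x').
  { intros v' l' y y' hl' H'. apply (IHn (length l') ltac:(lia) v' l' y y'); auto. }
  clear IHn hl n.
  destruct (classic (NoDup (v :: l))) as [ND|ND].
  2:{ destruct (not_NoDup_split _ ND) as ([|v' l1] & u & l2 & l3 & E); injection E as -> ->.
      - replace (u :: (l2 ++ u :: l3) ++ [u]) with ((u :: l2) ++ u :: l3 ++ [u]) in H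
          by (simpl; rewrite <- app_assoc; auto).
        apply trw_app in H. destruct H as [z [H1 H2]]. rewrite length_app in IH. cbn [length] in IH.
        transitivity z; [eapply (IH u l2)|eapply (IH u l3)]; eauto; lia.
      - replace (v' :: (l1 ++ u :: l2 ++ u :: l3) ++ [v']) with ((v' :: l1) ++ u :: l2 ++ u :: l3 ++ [v']) in H
          by (simpl; rewrite <- !app_assoc; simpl; rewrite <- app_assoc; auto).
        apply trw_app in H. destruct H as [z [H1 H2]].
        change (u :: l2 ++ u :: l3 ++ [v']) with ((u :: l2) ++ u :: l3 ++ [v']) in H2.
        apply trw_app in H2. destruct H2 as [z' [H2 H3]].
        rewrite length_app in IH. cbn [length] in IH. rewrite length_app in IH. cbn [length] in IH.
        assert (z = z') by (eapply (IH u l2); eauto; lia). subst z'.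
        apply (IH v' (l1 ++ u :: l3)); [rewrite length_app; simpl; lia|].
        replace (v' :: (l1 ++ u :: l3) ++ [v']) with ((v' :: l1) ++ u :: l3 ++ [v'])
          by (simpl; rewrite <- app_assoc; auto).
        apply trw_app. eauto. }
  destruct (lex_max l v) as [m [hm Hm]].
  (* Starting at another vertex conjugates the transport, so triviality at [m] implies triviality at
     [v]. *)
  assert (rot : exists l', length l' = length l /\ NoDup (m :: l') /\
     (forall u, In u (m :: l') -> In u (v :: l)) /\
     exists y y', trw (m :: l' ++ [m]) y y' /\ (y = y' -> x = x')).
  { apply in_split in hm. destruct hm as [[|v' l1] [l2 E]]; injection E as -> ->.
    - exists l2. repeat split; auto. exists x, x'. auto.
    - exists (l2 ++ v' :: l1).
      assert (P : Permutation.Permutation (v' :: l1 ++ m :: l2) (m :: l2 ++ v' :: l1)).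
      { change (v' :: l1 ++ m :: l2) with ((v' :: l1) ++ m :: l2).
        apply Permutation.Permutation_sym. apply (Permutation.Permutation_app_comm (m :: l2)). }
      split; [|split; [|split]].
      + rewrite !length_app. simpl. lia.
      + eapply Permutation.Permutation_NoDup; eauto.
      + intros u hu. eapply Permutation.Permutation_in; [apply Permutation.Permutation_sym|]; eauto.
      + replace (v' :: (l1 ++ m :: l2) ++ [v']) with ((v' :: l1) ++ m :: l2 ++ [v']) in H
          by (simpl; rewrite <- app_assoc; auto).
        apply trw_app in H. destruct H as [y [H1 H2]].
        assert (ex : exists y', trw ((v' :: l1) ++ [m]) x' y').
        { apply (trw_transport v' (l1 ++ [m]) x y x' H1). assert (H2r := trw_rev _ _ _ H2).
          change (m :: l2 ++ [v']) with ((m :: l2) ++ [v']) in H2r. rewrite rev_app_distr in H2r.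
          change (rev [v'] ++ rev (m :: l2)) with (v' :: rev (m :: l2)) in H2r.
          destruct (rev (m :: l2)) as [|w k] eqn:Er.
          - apply (f_equal (@length _)) in Er. rewrite length_rev in Er. discriminate.
          - rewrite trw_cons in H2r. destruct H2r as [z' [h2 _]]. eauto. }
        destruct ex as [y' H3]. exists y, y'. split.
        * replace (m :: (l2 ++ v' :: l1) ++ [m]) with ((m :: l2) ++ v' :: l1 ++ [m])
            by (simpl; rewrite <- app_assoc; auto).
          apply trw_app. eauto.
        * intros ->. apply trw_rev in H1, H3. eapply trw_fun; eauto. }
  destruct rot as (l' & hl & ND' & sub & y & y' & H' & imp). apply imp.
  assert (Hm' : forall u, In u (m :: l') -> snd u < snd m \/ (snd u = snd m /\ fst u <= fst m)) by auto.
  rewrite <- hl in IH. clear H imp hl sub ND hm Hm. destruct m as [a b]. simpl in Hm'.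
  destruct l' as [|s l']; [exfalso|].
  { simpl in H'. destruct H' as [z [h _]]. apply tr_adj in h. destruct h as [h _]. unfold Zadj in h. simpl in h. lia. }
  destruct l' as [|p l' _] using rev_ind.
  { simpl in H'. destruct H' as [z [h1 [z' [h2 E]]]]. subst. apply tr_sym in h1. eapply tr_fun; eauto. }
  assert (A := trw_wadj _ _ _ H').
  assert (As : Zadj (a, b) s) by (simpl in A; apply A).
  assert (Ap : Zadj p (a, b)).
  { replace ((a, b) :: (s :: l' ++ [p]) ++ [(a, b)]) with (((a, b) :: s :: l') ++ [p; (a, b)]) in A
      by (simpl; rewrite <- app_assoc; auto).
    apply wadj_app_r in A. apply A. }
  assert (hs := Hm' s (or_intror (or_introl eq_refl))).
  assert (inp : In p ((a, b) :: s :: l' ++ [p])) by (right; right; apply in_or_app; right; left; auto).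
  assert (hp := Hm' p inp).
  assert (spn : s <> p).
  { intros ->. inversion ND' as [|? ? _ ND2]; subst. inversion ND2 as [|? ? n _]; subst.
    apply n. apply in_or_app. right. left. auto. }
  assert (sa : s <> (a, b)).
  { intros ->. inversion ND' as [|? ? n _]; subst. apply n. left. auto. }
  destruct s as [s1 s2], p as [p1 p2]. unfold Zadj in As, Ap. simpl in As, Ap, hs, hp.
  assert (cs : (s1, s2) = (a - 1, b) \/ (s1, s2) = (a, b - 1)).
  { destruct As as [[? ?]|[? ?]]; [left|right]; f_equal; lia. }
  assert (cp : (p1, p2) = (a - 1, b) \/ (p1, p2) = (a, b - 1)).
  { destruct Ap as [[? ?]|[? ?]]; [left|right]; f_equal; lia. }
  assert (IH' : forall v k x x', (length k <= length l')%nat -> trw (v :: k ++ [v]) x x' -> x = x').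
  { intros v0 k u u' hk. apply IH. simpl. rewrite length_app. simpl. lia. }
  (* At the top right vertex the walk can use only the western and the southern neighbour; leaving
     south and returning from the west is the other case traversed backwards. *)
  destruct cs as [Es|Es], cp as [Ep|Ep]; try congruence; rewrite Es, Ep in *.
  - apply (push_down (length l') a b l' (a, b - 1) y y'); auto.
  - symmetry. apply (push_down (length l') a b (rev l') (a, b - 1) y' y); auto.
    + rewrite length_rev. auto.
    + eapply Permutation.Permutation_NoDup; [|exact ND']. constructor.
      rewrite <- (rev_involutive ((a - 1, b) :: rev l' ++ [(a, b - 1)])).
      eapply Permutation.Permutation_trans; [|apply Permutation.Permutation_rev].
      simpl. rewrite rev_app_distr, rev_involutive. auto.
    + intros u hu. apply Hm'. destruct hu as [<-|[<-|hu]]; [left; auto|right; right; apply in_or_app; right; left; auto|].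
      apply in_app_or in hu. destruct hu as [hu|[<-|[]]]; [|right; left; auto].
      right. right. apply in_or_app. left. apply in_rev. auto.
    + apply trw_rev in H'.
      replace (rev ((a, b) :: ((a, b - 1) :: l' ++ [(a - 1, b)]) ++ [(a, b)])) with
        ((a, b) :: ((a - 1, b) :: rev l' ++ [(a, b - 1)]) ++ [(a, b)]) in H'; auto.
      simpl. rewrite !rev_app_distr. simpl. rewrite <- ?app_assoc. auto.
Qed.

End Holonomy.
End GridWalks.

(** * Chains, connectedness and monodromy *)

(** Finite chains take the place of paths: connectedness of an open set provides them for every
    mesh, and they can be rounded to a lattice. *)
Inductive chain (P : C -> Prop) (s : R) : C -> C -> Prop :=
| chain_refl a : P a -> chain P s a a
| chain_step a b c : chain P s a b -> P c -> Cmod (c - b) < s -> chain P s a c.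

Lemma chain_trans P s a b c : chain P s a b -> chain P s b c -> chain P s a c.
Proof.
  intros H1 H2. revert H1. induction H2 as [b|b d e H2 IH Pe hd]; intros H1; auto.
  apply chain_step with d; auto.
Qed.

Lemma chain_start P s a b : chain P s a b -> P a.
Proof. intros H; induction H; auto. Qed.
Lemma chain_end P s a b : chain P s a b -> P b.
Proof. intros H; induction H; auto. Qed.

Lemma chain_weaken (P Q : C -> Prop) s a b : (forall z, P z -> Q z) -> chain P s a b -> chain Q s a b.
Proof. intros h H. induction H; [apply chain_refl|eapply chain_step]; eauto. Qed.

Lemma chain_sym P s a b : chain P s a b -> chain P s b a.
Proof.
  intros H. induction H as [a Pa|a b c H IH Pc hd]; [apply chain_refl; auto|].
  apply chain_trans with b; auto. apply chain_step with c; [apply chain_refl; auto| |].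
  - eapply chain_end; eauto.
  - rewrite Cmod_sym. auto.
Qed.

Lemma chain_path (P : C -> Prop) s (g : R -> C) a b : s > 0 -> a <= b ->
  (forall t, icc a b t -> cwi dR (icc a b) g t) -> (forall t, icc a b t -> P (g t)) ->
  forall t, icc a b t -> chain P s (g a) (g t).
Proof.
  intros hs hab Hg HP t ht.
  apply (interval_clopen a b (fun t => chain P s (g a) (g t))) with a; auto.
  - intros u hu. destruct (Hg u hu (s/2)) as [d [hd Hd]]; [lra|]. exists d. split; auto.
    intros s1 s2 h1 h2 k1 k2 H. apply chain_step with (g s1); auto.
    assert (e1 := Hd s1 h1 k1). assert (e2 := Hd s2 h2 k2).
    pose proof (Cmod_tri (g s2) (g u) (g s1)). rewrite (Cmod_sym (g u) (g s1)) in H0. lra.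
  - lra.
  - apply chain_refl. apply HP. unfold icc; lra.
Qed.

Lemma seg_full_cts a b (K : R -> Prop) t : cwi dR K (seg a b) t.
Proof.
  intros e he. exists (e / (Cmod (b - a) + 1)). pose proof (Cmod_ge_0 (b - a)).
  split; [apply Rdiv_lt_0_compat; lra|]. intros y _ hd. rewrite seg_dist.
  unfold dR in hd. apply Rmult_lt_compat_r with (r := Cmod (b - a) + 1) in hd; [|lra].
  unfold Rdiv in hd. rewrite Rmult_assoc, Rinv_l in hd by lra.
  pose proof (Rabs_pos (y - t)). nra.
Qed.

Lemma chain_seg (P : C -> Prop) s a b : s > 0 -> (forall t, icc 0 1 t -> P (seg a b t)) -> chain P s a b.
Proof.
  intros hs HP. rewrite <- (seg_0 a b) at 1. rewrite <- (seg_1 a b) at 2.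
  apply (chain_path P s (seg a b) 0 1); auto; unfold icc; try lra.
  intros. apply seg_full_cts.
Qed.

(** The uniform distance to the complement and the bound that a path in the open set [U] would have
    by compactness. *)
Definition deep (U : C -> Prop) (eta M : R) (z : C) : Prop :=
  Cmod z <= M /\ forall w, Cmod (w - z) < eta -> U w.

Lemma deep_mono U eta M eta' M' z : eta' <= eta -> M <= M' -> deep U eta M z -> deep U eta' M' z.
Proof. intros h1 h2 [a b]. split; [lra|]. intros w hw. apply b. lra. Qed.

(** The depth is chosen before the mesh [s], so later constants may depend on it. The points reached
    from [a] in this sense are open in [U], and so are the others. *)
Lemma connected_chain (U B : C -> Prop) a b : open_set U -> connected B -> (forall z, B z -> U z) ->
  B a -> B b -> exists eta M, eta > 0 /\ forall s, s > 0 -> chain (deep U eta M) s a b.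
Proof.
  intros hU hB hBU Ba Bb.
  set (O1 := fun z => exists eta M, eta > 0 /\ forall s, s > 0 -> chain (deep U eta M) s a z).
  assert (ball : forall z, U z -> exists r, r > 0 /\ forall z' z'', Cmod (z' - z) < r -> Cmod (z'' - z) < r ->
     U z' /\ (O1 z' -> O1 z'')).
  { intros z hz. destruct (hU z hz) as [r [hr Hr]]. exists (r / 2). split; [lra|].
    intros z' z'' h1 h2. split; [apply Hr; change (Cmod (z' - z) < r); lra|].
    intros (eta & M & he & H). exists (Rmin eta (r / 2)), (Rmax M (Cmod z + r)).
    split; [apply Rmin_pos; lra|]. intros s hs. apply chain_trans with z'.
    - apply chain_weaken with (deep U eta M); [|auto]. intros w hw.
      eapply deep_mono; [apply Rmin_l|apply Rmax_l|exact hw].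
    - apply chain_seg; auto. intros t ht.
      assert (hb : ballC z (r / 2) (seg z' z'' t)) by (apply convex_ball; auto).
      unfold ballC in hb. split.
      + eapply Rle_trans; [|apply Rmax_r]. pose proof (Cmod_le_add (seg z' z'' t) z). lra.
      + intros w hw. apply Hr. change (Cmod (w - z) < r).
        assert (hw' := Rlt_le_trans _ _ _ hw (Rmin_r _ _)).
        pose proof (Cmod_tri w (seg z' z'' t) z). lra. }
  apply NNPP. intros nb. apply hB. exists (fun z => U z /\ O1 z), (fun z => U z /\ ~ O1 z).
  split; [|split; [|split; [|split; [|split]]]].
  - intros z [hz h1]. destruct (ball z hz) as [r [hr Hr]]. exists r. split; auto.
    intros w hw. change (Cmod (w - z) < r) in hw.
    assert (zz : Cmod (z - z) < r) by (rewrite Cmod_sub_eq; lra).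
    destruct (Hr z w zz hw) as [_ k]. destruct (Hr w w hw hw) as [k2 _]. auto.
  - intros z [hz h1]. destruct (ball z hz) as [r [hr Hr]]. exists r. split; auto.
    intros w hw. change (Cmod (w - z) < r) in hw.
    assert (zz : Cmod (z - z) < r) by (rewrite Cmod_sub_eq; lra).
    destruct (Hr w z hw zz) as [k2 k]. auto.
  - intros z hz. destruct (classic (O1 z)); auto.
  - intros z _ [_ h1] [_ h2]. auto.
  - exists a. split; auto. split; auto. destruct (hU a (hBU a Ba)) as [r [hr Hr]].
    exists r, (Cmod a). split; auto. intros s _. apply chain_refl. split; [lra|]. exact Hr.
  - exists b. split; auto.
Qed.

Lemma connected_image_convex (K : C -> Prop) (q : C -> C) : convexC K -> (forall z, K z -> cwi dC K q z) ->
  connected (fun y => exists z, K z /\ y = q z).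
Proof.
  intros cv Hq (O1 & O2 & h1 & h2 & cov & dis & [y1 [[z1 [k1 ->]] a1]] & [y2 [[z2 [k2 ->]] a2]]).
  assert (cl : O1 (q (seg z1 z2 1))).
  { apply (interval_clopen 0 1 (fun t => O1 (q (seg z1 z2 t)))) with 0; try lra.
    2:{ rewrite seg_0. auto. }
    intros s hs. assert (ks := cv z1 z2 s k1 k2 hs).
    assert (cs := seg_cts K q z1 z2 cv k1 k2 Hq s hs).
    assert (memb : forall t, icc 0 1 t -> exists z, K z /\ q (seg z1 z2 t) = q z).
    { intros t ht. exists (seg z1 z2 t). split; auto. }
    destruct (cov (q (seg z1 z2 s)) (memb s hs)) as [o|o].
    - destruct (h1 _ o) as [r [hr Hr]]. destruct (cs r hr) as [d [hd Hd]]. exists d. split; [exact hd|].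
      intros s1 s2 _ b2 _ e2 _. apply Hr. exact (Hd s2 b2 e2).
    - destruct (h2 _ o) as [r [hr Hr]]. destruct (cs r hr) as [d [hd Hd]]. exists d. split; [exact hd|].
      intros s1 s2 b1 _ e1 _ o1. exfalso. apply (dis (q (seg z1 z2 s1)) (memb s1 b1) o1).
      apply Hr. exact (Hd s1 b1 e1). }
  rewrite seg_1 in cl. apply (dis (q z2)); eauto.
Qed.

Lemma connected_convex (K : C -> Prop) : convexC K -> connected K.
Proof.
  intros cv H. apply (connected_image_convex K (fun z => z) cv); [intros; apply cwi_id|].
  destruct H as (O1 & O2 & h1 & h2 & cov & dis & [y1 [k1 a1]] & [y2 [k2 a2]]).
  exists O1, O2. repeat split; auto.
  - intros z [w [hw ->]]. auto.
  - intros z [w [hw ->]]. apply dis; auto.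
  - exists y1. split; eauto.
  - exists y2. split; eauto.
Qed.

Lemma connected_union (A B : C -> Prop) x : connected A -> connected B -> A x -> B x ->
  connected (fun z => A z \/ B z).
Proof.
  intros hA hB Ax Bx (O1 & O2 & h1 & h2 & cov & dis & [y1 [k1 a1]] & [y2 [k2 a2]]).
  assert (half : forall (S : C -> Prop) (O O' : C -> Prop), open_set O -> open_set O' ->
    connected S -> (forall z, S z -> O z \/ O' z) -> (forall z, S z -> O z -> O' z -> False) ->
    S x -> O x -> forall z, S z -> O z).
  { intros S O O' o o' hS c d Sx Ox z Sz. destruct (c z Sz) as [|oz]; auto. exfalso. apply hS.
    exists O, O'. repeat split; eauto. }
  assert (cA : forall z, A z -> O1 z \/ O2 z) by auto.
  assert (cB : forall z, B z -> O1 z \/ O2 z) by auto.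
  assert (dA : forall z, A z -> O1 z -> O2 z -> False) by (intros z hz; apply dis; auto).
  assert (dB : forall z, B z -> O1 z -> O2 z -> False) by (intros z hz; apply dis; auto).
  destruct (cov x (or_introl Ax)) as [ox|ox].
  - destruct k2 as [k2|k2]; [apply (dA y2 k2)|apply (dB y2 k2)]; auto.
    + apply (half A O1 O2); auto.
    + apply (half B O1 O2); auto.
  - destruct k1 as [k1|k1]; [apply (dA y1 k1)|apply (dB y1 k1)]; auto.
    + apply (half A O2 O1); auto. intros z hz. destruct (cA z hz); auto. intros z hz a b. eapply dA; eauto.
    + apply (half B O2 O1); auto. intros z hz. destruct (cB z hz); auto. intros z hz a b. eapply dB; eauto.
Qed.

(** The relation behind [comp]: connected sets rather than paths, as in the definition of
    fundamental domains. *)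
Definition linked (U : C -> Prop) (a b : C) : Prop :=
  exists B : C -> Prop, connected B /\ (forall z, B z -> U z) /\ B a /\ B b.

Lemma linked_sym U a b : linked U a b -> linked U b a.
Proof. intros (B & h1 & h2 & h3 & h4). exists B; auto. Qed.

Lemma linked_trans U a b c : linked U a b -> linked U b c -> linked U a c.
Proof.
  intros (B & h1 & h2 & h3 & h4) (B' & k1 & k2 & k3 & k4).
  exists (fun z => B z \/ B' z). split; [apply connected_union with b; auto|].
  split; auto. intros z [h|h]; auto.
Qed.

Lemma linked_refl (U : C -> Prop) a : U a -> linked U a a.
Proof.
  intros h. exists (fun z => z = a). split; [|split; [intros z ->; auto|auto]].
  apply connected_convex. intros x y t -> -> _. unfold seg. ring.
Qed.

Definition box (c : C) (r : R) : C -> Prop := fun z => Rabs (fst z - fst c) < r /\ Rabs (snd z - snd c) < r.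

Lemma convex_box c r : convexC (box c r).
Proof.
  assert (aux : forall a b c t, 0 <= t <= 1 -> Rabs (a - c) < r -> Rabs (b - c) < r ->
     Rabs (a + t * (b - a) - c) < r).
  { intros a b d t ht h1 h2. apply Rabs_def2 in h1. apply Rabs_def2 in h2. 
    destruct (Req_dec t 0) as [->|n]; [apply Rabs_def1; lra|]. apply Rabs_def1; nra. }
  intros a b t [h1 h2] [h3 h4] ht. unfold seg. split; simpl.
  - replace (fst a + (t * (fst b + - fst a) - 0 * (snd b + - snd a)) - fst c) with
      (fst a + t * (fst b - fst a) - fst c) by ring. apply aux; auto.
  - replace (snd a + (t * (snd b + - snd a) + 0 * (fst b + - fst a)) - snd c) with
      (snd a + t * (snd b - snd a) - snd c) by ring. apply aux; auto.
Qed.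

Lemma box_center c r : r > 0 -> box c r c.
Proof. intros h. split; unfold Rminus; rewrite Rplus_opp_r, Rabs_R0; auto. Qed.

Lemma box_sub c r c' r' d : Rabs (fst c - fst c') <= d -> Rabs (snd c - snd c') <= d -> d + r <= r' ->
  forall z, box c r z -> box c' r' z.
Proof.
  intros h1 h2 h z [a b]. split.
  - replace (fst z - fst c') with ((fst z - fst c) + (fst c - fst c')) by ring.
    eapply Rle_lt_trans; [apply Rabs_triang|]. lra.
  - replace (snd z - snd c') with ((snd z - snd c) + (snd c - snd c')) by ring.
    eapply Rle_lt_trans; [apply Rabs_triang|]. lra.
Qed.

Lemma convex_inter A B : convexC A -> convexC B -> convexC (fun z => A z /\ B z).
Proof. intros h1 h2 a b t [a1 a2] [b1 b2] ht. split; auto. Qed.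

Lemma clift_restrict F (K K' : C -> Prop) phi c x q c' : (forall z, K' z -> K z) -> K' c' ->
  clift F K phi c x q -> clift F K' phi c' (q c') q.
Proof.
  intros sub k' [E H]. split; auto. intros z hz. destruct (H z (sub z hz)). split; auto.
  eapply cwi_sub; eauto.
Qed.

Lemma clift_agree F F' K K' phi c x q c' x' q' z0 : is_deriv F F' -> convexC K -> convexC K' ->
  clift F K phi c x q -> clift F K' phi c' x' q' -> (forall z, K z -> nonsing F (phi z)) ->
  K z0 -> K' z0 -> q z0 = q' z0 -> forall z, K z -> K' z -> q z = q' z.
Proof.
  intros H cv cv' [_ Hq] [_ Hq'] Hn k0 k0' E z kz kz'.
  apply (clift_unique F F' (fun z => K z /\ K' z) z0 q q' H); auto using convex_inter.
  - intros w [h h']. eapply cwi_sub; [|apply Hq; auto]. intros ? [? ?]; auto.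
  - intros w [h h']. eapply cwi_sub; [|apply Hq'; auto]. intros ? [? ?]; auto.
  - intros w [h h']. rewrite (proj2 (Hq w h)), (proj2 (Hq' w h')). auto.
  - intros w [h h']. rewrite (proj2 (Hq w h)). auto.
Qed.

(** * Monodromy through a square lattice *)

Section Lattice.
Context (F F' : C -> C) (b : C -> C) (E : C -> Prop) (eps : R).
Context (hF : is_deriv F F') (hb : forall z, cts b z) (heps : eps > 0)
  (hE : forall z, ~ E z -> nonsing F (b z))
  (hesc : forall e M, E e -> exists e', chain E eps e e' /\ (M < Rabs (fst e') \/ M < Rabs (snd e'))).

Definition pos (v : Z * Z) : C := (eps * IZR (fst v), eps * IZR (snd v)).
(** With half-side 3 eps the box of a vertex contains its eight neighbours, so the lift on one box
    settles a whole unit square. *)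
Definition lgood (v : Z * Z) : Prop := forall z, box (pos v) (3 * eps) z -> ~ E z.

Definition ltr (v u : Z * Z) (x y : C) : Prop :=
  Zadj v u /\ lgood v /\ lgood u /\ exists q, clift F (box (pos v) (3 * eps)) b (pos v) x q /\ q (pos u) = y.

Lemma pos_diff v u : (Z.abs (fst v - fst u) <= 1)%Z -> (Z.abs (snd v - snd u) <= 1)%Z ->
  Rabs (fst (pos v) - fst (pos u)) <= eps /\ Rabs (snd (pos v) - snd (pos u)) <= eps.
Proof.
  intros h1 h2. unfold pos. simpl.
  rewrite <- !Rmult_minus_distr_l, <- !minus_IZR, !Rabs_mult, (Rabs_pos_eq eps), <- !abs_IZR by lra.
  apply IZR_le in h1. apply IZR_le in h2. split; nra.
Qed.

Lemma pos_box v u : (Z.abs (fst v - fst u) <= 1)%Z -> (Z.abs (snd v - snd u) <= 1)%Z ->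
  box (pos u) (3 * eps) (pos v).
Proof. intros h1 h2. destruct (pos_diff v u h1 h2). split; lra. Qed.

Lemma Zadj_box v u : Zadj v u -> box (pos v) (3 * eps) (pos u).
Proof. intros h. apply pos_box; unfold Zadj in h; lia. Qed.

Lemma pos_self v : box (pos v) (3 * eps) (pos v).
Proof. apply box_center. lra. Qed.

Lemma lgood_nonsing v z : lgood v -> box (pos v) (3 * eps) z -> nonsing F (b z).
Proof. intros g h. apply hE. apply g. auto. Qed.

Lemma Zadj_sym u v : Zadj u v -> Zadj v u.
Proof. unfold Zadj. lia. Qed.

Lemma lift_box c x r : r > 0 -> (forall z, box c r z -> ~ E z) -> F x = b c ->
  exists q, clift F (box c r) b c x q.
Proof.
  intros hr h e. apply (convex_lift F F' _ b c x hF); auto using convex_box, box_center.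
  intros z _. apply cts_cwi. auto.
Qed.

Lemma round_lattice (c : C) : exists u, Rabs (fst c - fst (pos u)) <= eps /\ Rabs (snd c - snd (pos u)) <= eps.
Proof.
  assert (r1 : forall c, exists k, Rabs (c - eps * IZR k) <= eps).
  { clear c. intros c. exists (up (c / eps)). destruct (archimed (c / eps)) as [k1 k2].
    set (k := IZR (up (c / eps))) in *. assert (ee : c = eps * (c / eps)) by (field; lra).
    rewrite ee at 1. rewrite <- Rmult_minus_distr_l, Rabs_mult, (Rabs_pos_eq eps) by lra.
    rewrite <- (Rmult_1_r eps) at 3. apply Rmult_le_compat_l; [lra|]. apply Rabs_le. lra. }
  destruct c as [c1 c2]. destruct (r1 c1) as [k1 h1]. destruct (r1 c2) as [k2 h2]. exists (k1, k2). simpl. auto.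
Qed.

Lemma ltr_closed (v : Z * Z) (l : list (Z * Z)) x x' : trw ltr (v :: l ++ v :: nil) x x' -> x = x'.
Proof.
  apply (closed_walk_trivial lgood ltr) with (n := length l); auto.
  - intros v0 u x0 y (h1 & h2 & h3 & _). auto.
  - intros v0 u x0 y (h1 & h2 & h3 & q & hq & Eq). split; [apply Zadj_sym; auto|].
    split; auto. split; auto.
    assert (Fy : F y = b (pos u)) by (rewrite <- Eq; apply hq, Zadj_box; auto).
    destruct (lift_box (pos u) y (3 * eps)) as [q' hq']; auto; [lra|].
    exists q'. split; auto. rewrite <- (proj1 hq). symmetry.
    apply (clift_agree F F' _ _ b _ _ q _ _ q' (pos u) hF (convex_box _ _) (convex_box _ _) hq hq'); auto using pos_self, Zadj_box, Zadj_sym.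
    rewrite Eq. symmetry. apply hq'.
  - intros v0 u x0 y y' (h1 & h2 & h3 & q & hq & Eq) (_ & _ & _ & q' & hq' & Eq').
    rewrite <- Eq, <- Eq'.
    apply (clift_agree F F' _ _ b _ _ q _ _ q' (pos v0) hF (convex_box _ _) (convex_box _ _) hq hq'); auto using pos_self, Zadj_box.
    rewrite (proj1 hq), (proj1 hq'). auto.
  - intros v0 u w x0 y (h1 & h2 & h3 & q & hq & Eq) gw a.
    assert (Fx : F x0 = b (pos u)) by (rewrite <- Eq; apply hq, Zadj_box; auto).
    destruct (lift_box (pos u) x0 (3 * eps)) as [q' hq']; auto; [lra|].
    exists (q' (pos w)). split; auto. split; auto. split; auto. exists q'. auto.
  - intros a c x0 x1 xp z (A1 & g & g1 & q & hq & Eq) (A2 & _ & gp & q' & hq' & Eq') (A3 & _ & gz & q2 & hq2 & Eq2).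
    set (m := (a, c)%Z) in *. set (m1 := (a - 1, c)%Z) in *. set (p := (a, c - 1)%Z) in *. set (p1 := (a - 1, c - 1)%Z) in *.
    assert (Am : Zadj m1 p1) by (right; unfold m1, p1; simpl; lia).
    split; auto. split; auto. split; auto.
    assert (ns : forall v0, lgood v0 -> forall z, box (pos v0) (3 * eps) z -> nonsing F (b z))
      by (intros; eapply lgood_nonsing; eauto).
    assert (bx : forall u v0, (Z.abs (fst v0 - fst u) <= 1)%Z -> (Z.abs (snd v0 - snd u) <= 1)%Z -> box (pos u) (3 * eps) (pos v0))
      by (intros; apply pos_box; auto).
    assert (Eq3 : q (pos p) = xp).
    { rewrite <- Eq'.
      apply (clift_agree F F' _ _ b _ _ q _ _ q' (pos m) hF (convex_box _ _) (convex_box _ _) hq hq'); auto using pos_self, Zadj_box.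
      rewrite (proj1 hq), (proj1 hq'). auto. }
    assert (Eq4 : q (pos p1) = z).
    { rewrite <- Eq2.
      apply (clift_agree F F' _ _ b _ _ q _ _ q2 (pos p) hF (convex_box _ _) (convex_box _ _) hq hq2); auto using pos_self, Zadj_box.
      - rewrite (proj1 hq2). auto.
      - apply bx; unfold m, p1; simpl; lia. }
    assert (Fx1 : F x1 = b (pos m1)) by (rewrite <- Eq; apply hq, Zadj_box; auto).
    destruct (lift_box (pos m1) x1 (3 * eps)) as [q3 hq3]; auto; [lra|].
    exists q3. split; auto. rewrite <- Eq4. symmetry.
    apply (clift_agree F F' _ _ b _ _ q _ _ q3 (pos m1) hF (convex_box _ _) (convex_box _ _) hq hq3); auto using pos_self, Zadj_box.
    + rewrite (proj1 hq3). auto.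
    + apply bx; unfold m, p1; simpl; lia.
  - intros q N nq.
    assert (ex : exists e, E e /\ box (pos q) (3 * eps) e).
    { apply NNPP. intros n. apply nq. intros z hz ez. apply n. eauto. }
    destruct ex as [e [Ee be]].
    set (S := fun (e : C) (u : Z * Z) => box (pos u) (3 * eps) e).
    assert (Sbad : forall e u, E e -> S e u -> ~ lgood u) by (intros e0 u h1 h2 g; apply (g e0 h2 h1)).
    (* The vertices whose boxes contain a given point of [E] form a product of two integer
       intervals; all of them are bad. *)
    assert (conn : forall e u w, S e u -> S e w -> zpath (S e) u w).
    { assert (mono : forall c a b d, Rabs (c - eps * IZR a) < 3 * eps -> Rabs (c - eps * IZR d) < 3 * eps ->
         (a <= b <= d)%Z -> Rabs (c - eps * IZR b) < 3 * eps).
      { intros c0 a0 b0 d0 k1 k2 [k3 k4]. apply IZR_le in k3. apply IZR_le in k4.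
        apply Rabs_def2 in k1. apply Rabs_def2 in k2. apply Rabs_def1; nra. }
      intros e0 u w [hu1 hu2] [hw1 hw2].
      apply (zpath_product (fun k => Rabs (fst e0 - eps * IZR k) < 3 * eps)
        (fun k => Rabs (snd e0 - eps * IZR k) < 3 * eps)); auto; cbv beta; intros a0 b0 c0 k1 k2 k3; apply (mono _ a0 b0 c0); auto. }
    set (M := eps * (IZR (Z.abs N) + 4)).
    destruct (hesc e M Ee) as [e' [ch far]].
    (* A link of the chain is shorter than eps, so the vertex rounding its start has both ends in
       its box; this joins the bad vertices of successive points. *)
    assert (cp : forall e e', chain E eps e e' -> forall u, S e u -> exists w, S e' w /\ zpath (fun u => ~ lgood u) u w).
    { intros e1 e2 H. induction H as [e1 Ee1|e1 e2 e3 H IH Ee3 hd]; intros u hu.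
      - exists u. split; auto. apply zpath_refl. eauto.
      - destruct (IH u hu) as [w [hw pw]]. destruct (round_lattice e2) as [r [hr1 hr2]].
        assert (S2 : S e2 r) by (split; lra).
        assert (S3 : S e3 r).
        { pose proof (Rabs_fst_le (e3 - e2)) as a1. pose proof (Rabs_snd_le (e3 - e2)) as a2. simpl in a1, a2.
          split.
          - replace (fst e3 - fst (pos r)) with ((fst e3 + - fst e2) + (fst e2 - fst (pos r))) by ring.
            eapply Rle_lt_trans; [apply Rabs_triang|]. lra.
          - replace (snd e3 - snd (pos r)) with ((snd e3 + - snd e2) + (snd e2 - snd (pos r))) by ring.
            eapply Rle_lt_trans; [apply Rabs_triang|]. lra. }
        exists r. split; auto. eapply zpath_trans; [exact pw|].
        apply zpath_weaken with (S e2); [|apply conn; auto].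
        intros u0 h0. apply (Sbad e2); auto. eapply chain_end; eauto. }
    destruct (cp e e' ch q be) as [w [[hw1 hw2] pw]]. exists w. split; auto.
    assert (big : forall c k, M < Rabs c -> Rabs (c - eps * IZR k) < 3 * eps -> (N < Z.abs k)%Z).
    { intros c k k1 k2. apply lt_IZR. rewrite abs_IZR.
      assert (k3 : Rabs c <= Rabs (c - eps * IZR k) + Rabs (eps * IZR k)).
      { replace c with ((c - eps * IZR k) + eps * IZR k) at 1 by ring. apply Rabs_triang. }
      rewrite Rabs_mult, (Rabs_pos_eq eps) in k3 by lra. unfold M in k1.
      assert (IZR N <= IZR (Z.abs N)) by (apply IZR_le; lia). nra. }
    destruct far as [far|far]; [left|right]; eapply big; eauto.
Qed.

(** A pair is a point together with a value of the lift over it. The 5 eps are 3 + 2: a vertex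
    within 2 eps of the point has its own box inside the large one. *)
Definition lstep (p p' : C * C) : Prop :=
  (forall z, box (fst p) (5 * eps) z -> ~ E z) /\ Cmod (fst p' - fst p) < eps /\
  exists q, clift F (box (fst p) (5 * eps)) b (fst p) (snd p) q /\ q (fst p') = snd p'.

Inductive lchain : C * C -> C * C -> Prop :=
| lchain_refl p : lchain p p
| lchain_step p p' p'' : lchain p p' -> lstep p' p'' -> lchain p p''.

Lemma lchain_trans p p' p'' : lchain p p' -> lchain p' p'' -> lchain p p''.
Proof.
  intros H1 H2. revert H1. induction H2 as [q|q q1 q2 H2 IH st]; intros H1; auto.
  apply lchain_step with q1; auto.
Qed.

Definition lattice_at (p : C * C) (v : Z * Z) (y : C) : Prop :=
  Rabs (fst (fst p) - fst (pos v)) <= eps /\ Rabs (snd (fst p) - snd (pos v)) <= eps /\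
  exists q, clift F (box (fst p) (5 * eps)) b (fst p) (snd p) q /\ q (pos v) = y.

Definition freebox (c : C) : Prop := forall z, box c (5 * eps) z -> ~ E z.

Definition lreach (v : Z * Z) (x : C) (v' : Z * Z) (x' : C) : Prop :=
  (v = v' /\ x = x') \/ exists l, trw ltr (v :: l ++ v' :: nil) x x'.

Lemma lreach_trans v x v' x' v'' x'' : lreach v x v' x' -> lreach v' x' v'' x'' -> lreach v x v'' x''.
Proof.
  intros [[-> ->]|[l H]]; auto. intros [[<- <-]|[l' H']]; [right; eauto|].
  right. exists (l ++ v' :: l'). replace (v :: (l ++ v' :: l') ++ v'' :: nil) with ((v :: l) ++ v' :: l' ++ v'' :: nil)
    by (simpl; rewrite <- app_assoc; auto).
  apply trw_app. eauto.
Qed.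

Lemma box_point (c : C) v z : box (pos v) (3 * eps) z -> Rabs (fst c - fst (pos v)) <= 2 * eps ->
  Rabs (snd c - snd (pos v)) <= 2 * eps -> box c (5 * eps) z.
Proof.
  intros h h1 h2. apply (box_sub (pos v) (3 * eps) c (5 * eps) (2 * eps)); auto; try lra.
  - rewrite Rabs_minus_sym. auto.
  - rewrite Rabs_minus_sym. auto.
Qed.

Lemma lreach_near c q x u u' : freebox c -> clift F (box c (5 * eps)) b c x q -> 
  (forall w, w = u \/ w = u' -> Rabs (fst c - fst (pos w)) <= 2 * eps /\ Rabs (snd c - snd (pos w)) <= 2 * eps) ->
  Zadj u u' \/ u = u' -> lreach u (q (pos u)) u' (q (pos u')).
Proof.
  intros fb hq near [a| ->]; [|left; auto].
  destruct (near u (or_introl eq_refl)) as [n1 n2]. destruct (near u' (or_intror eq_refl)) as [n3 n4].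
  right. exists nil. simpl app. rewrite trw_cons. exists (q (pos u')). split; [|reflexivity].
  split; auto. split; [|split].
  - intros z hz. apply fb. apply box_point with u; auto.
  - intros z hz. apply fb. apply box_point with u'; auto.
  - exists q. split; auto. apply (clift_restrict F (box c (5 * eps)) _ b c x q (pos u)); auto using pos_self.
    intros z hz. apply box_point with u; auto.
Qed.

Lemma lreach_same c q x u u' : freebox c -> clift F (box c (5 * eps)) b c x q ->
  Rabs (fst c - fst (pos u)) <= 2 * eps /\ Rabs (snd c - snd (pos u)) <= 2 * eps ->
  Rabs (fst c - fst (pos u')) <= 2 * eps /\ Rabs (snd c - snd (pos u')) <= 2 * eps ->
  lreach u (q (pos u)) u' (q (pos u')).
Proof.
  intros fb hq h1 h2.
  assert (mono : forall c a b d, Rabs (c - eps * IZR a) <= 2 * eps -> Rabs (c - eps * IZR d) <= 2 * eps ->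
     (a <= b <= d)%Z -> Rabs (c - eps * IZR b) <= 2 * eps).
  { intros c0 a0 b0 d0 k1 k2 [k3 k4]. apply IZR_le in k3. apply IZR_le in k4.
    apply Rabs_le_between in k1. apply Rabs_le_between in k2. apply Rabs_le_between. nra. }
  assert (zp : zpath (fun w => Rabs (fst c - fst (pos w)) <= 2 * eps /\ Rabs (snd c - snd (pos w)) <= 2 * eps) u u').
  { apply (zpath_product (fun k => Rabs (fst c - eps * IZR k) <= 2 * eps)
        (fun k => Rabs (snd c - eps * IZR k) <= 2 * eps)); try apply h1; try apply h2; cbv beta; intros a0 b0 c0 k1 k2 k3; apply (mono _ a0 b0 c0); auto. }
  clear h1 h2. induction zp as [u hu|u v w zp IH a hw]; [left; auto|].
  eapply lreach_trans; [exact IH|]. apply (lreach_near c q x); auto.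
  intros w0 [-> | ->]; auto. apply zpath_end in zp. auto.
Qed.

(** Each point of the chain is rounded to a vertex; the lift on its large box restricts to the boxes
    of nearby vertices, and so the chain of lifts becomes a lattice walk with the same transport. *)
Lemma lchain_lattice p p' : lchain p p' -> freebox (fst p') -> F (snd p) = b (fst p) -> freebox (fst p) ->
  F (snd p') = b (fst p') /\
  forall v v' y y', lattice_at p v y -> lattice_at p' v' y' -> lreach v y v' y'.
Proof.
  intros H. induction H as [p|p p1 p2 H IH st]; intros fb' Fp fb.
  - split; auto. intros v v' y y' (n1 & n2 & q & hq & Eq) (n3 & n4 & q' & hq' & Eq').
    assert (same : q (pos v') = y').
    { rewrite <- Eq'.
      apply (clift_agree F F' _ _ b _ _ q _ _ q' (fst p) hF (convex_box _ _) (convex_box _ _) hq hq'); auto.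
      - apply box_center; lra.
      - apply box_center; lra.
      - rewrite (proj1 hq), (proj1 hq'). auto.
      - split; rewrite Rabs_minus_sym; lra.
      - split; rewrite Rabs_minus_sym; lra. }
    rewrite <- Eq, <- same. apply (lreach_same (fst p) q (snd p)); auto; split; lra.
  - destruct st as (fb1 & hd & q & hq & Eq).
    destruct (IH fb1 Fp fb) as [F1 IH2].
    assert (in1 : box (fst p1) (5 * eps) (fst p2)).
    { pose proof (Rabs_fst_le (fst p2 - fst p1)) as a1. pose proof (Rabs_snd_le (fst p2 - fst p1)) as a2.
      simpl in a1, a2. split; unfold Rminus; lra. }
    assert (F2 : F (snd p2) = b (fst p2)) by (rewrite <- Eq; apply hq; auto).
    split; auto. intros v v' y y' hv (n3 & n4 & q' & hq' & Eq').
    destruct (round_lattice (fst p1)) as [u [r1 r2]].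
    eapply lreach_trans; [apply (IH2 v u y (q (pos u)) hv)|].
    { split; auto. split; auto. exists q. auto. }
    pose proof (Rabs_fst_le (fst p2 - fst p1)) as a1. pose proof (Rabs_snd_le (fst p2 - fst p1)) as a2.
    simpl in a1, a2.
    assert (m1 : Rabs (fst (fst p1) - fst (pos v')) <= 2 * eps).
    { replace (fst (fst p1) - fst (pos v')) with
        (- (fst (fst p2) + - fst (fst p1)) + (fst (fst p2) - fst (pos v'))) by ring.
      eapply Rle_trans; [apply Rabs_triang|]. rewrite Rabs_Ropp. lra. }
    assert (m2 : Rabs (snd (fst p1) - snd (pos v')) <= 2 * eps).
    { replace (snd (fst p1) - snd (pos v')) with
        (- (snd (fst p2) + - snd (fst p1)) + (snd (fst p2) - snd (pos v'))) by ring.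
      eapply Rle_trans; [apply Rabs_triang|]. rewrite Rabs_Ropp. lra. }
    assert (same : q (pos v') = y').
    { rewrite <- Eq'.
      apply (clift_agree F F' _ _ b _ _ q _ _ q' (fst p2) hF (convex_box _ _) (convex_box _ _) hq hq'); auto.
      - apply box_center; lra.
      - rewrite Eq. symmetry. apply hq'.
      - split; rewrite Rabs_minus_sym; lra.
      - split; rewrite Rabs_minus_sym; lra. }
    rewrite <- same. apply (lreach_same (fst p1) q (snd p1)); auto; split; lra.
Qed.

(** The monodromy theorem in the form used below: the region avoided by the loop may be arbitrary,
    provided that all of [E] is chained to infinity. *)
Lemma lchain_closed c x x' : freebox c -> F x = b c -> lchain (c, x) (c, x') -> x = x'.
Proof.
  intros fb Fx H. destruct (lchain_lattice _ _ H fb Fx fb) as [Fx' L]. simpl in *.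
  destruct (round_lattice c) as [u [r1 r2]].
  assert (h5 : 5 * eps > 0) by lra.
  destruct (lift_box c x (5 * eps) h5 fb Fx) as [q hq].
  destruct (lift_box c x' (5 * eps) h5 fb Fx') as [q' hq'].
  assert (R : lreach u (q (pos u)) u (q' (pos u))).
  { apply L; (split; [auto|split; [auto|eauto]]). }
  assert (Eu : q (pos u) = q' (pos u)).
  { destruct R as [[_ h]|[l h]]; auto. eapply ltr_closed; eauto. }
  rewrite <- (proj1 hq), <- (proj1 hq').
  apply (clift_agree F F' _ _ b _ _ q _ _ q' (pos u) hF (convex_box _ _) (convex_box _ _) hq hq'); auto.
  - split; rewrite Rabs_minus_sym; lra.
  - split; rewrite Rabs_minus_sym; lra.
  - apply box_center; lra.
  - apply box_center; lra.
Qed.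
End Lattice.

(** * The exterior of D in logarithmic coordinates *)

Lemma comp_self (A : CSet) x : A x -> comp A x x.
Proof. intros h. destruct (linked_refl A x h) as (B & h1 & h2 & h3 & h4). exists B; auto. Qed.

Lemma comp_connected (A : CSet) x : A x -> connected (comp A x).
Proof.
  intros Ax (O1 & O2 & h1 & h2 & cov & dis & [y1 [k1 a1]] & [y2 [k2 a2]]).
  assert (cx := comp_self A x Ax).
  assert (sub : forall B : CSet, connected B -> (forall w, B w -> A w) -> B x -> forall w, B w -> comp A x w).
  { intros B c s bx w bw. exists B. auto. }
  destruct (cov x cx) as [ox|ox].
  - destruct k2 as (B & c & s & bx & by2). apply c. exists O1, O2. repeat split; auto.
    + intros z hz. apply cov. eapply sub; eauto.
    + intros z hz. apply dis. eapply sub; eauto.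
    + exists x; auto.
    + exists y2; auto.
  - destruct k1 as (B & c & s & bx & by1). apply c. exists O1, O2. repeat split; auto.
    + intros z hz. apply cov. eapply sub; eauto.
    + intros z hz. apply dis. eapply sub; eauto.
    + exists y1; auto.
    + exists x; auto.
Qed.

Lemma comp_sub (A : CSet) x z : comp A x z -> A z.
Proof. intros (B & _ & s & _ & bz). auto. Qed.

Lemma comp_open (A : CSet) x : open_set A -> open_set (comp A x).
Proof.
  intros hA z (B & c & s & bx & bz). destruct (hA z (s z bz)) as [r [hr Hr]]. exists r. split; auto.
  intros w hw. exists (fun u => B u \/ ballC z r u). split; [|split; [|split]].
  - apply connected_union with z; auto; [apply connected_convex, convex_ball|].
    unfold ballC. rewrite Cmod_sub_eq. lra.
  - intros u [h|h]; auto.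
  - auto.
  - right. exact hw.
Qed.

Lemma closed_image_avoid (g : R -> C) (b : R) z : 0 <= b ->
  (forall t, icc 0 b t -> cwi dR (icc 0 b) g t) -> (forall t, icc 0 b t -> z <> g t) ->
  exists r, r > 0 /\ forall t, icc 0 b t -> r <= Cmod (g t - z).
Proof.
  intros hb Hg Hn.
  assert (Q : exists r, r > 0 /\ forall t, 0 <= t <= b -> r <= Cmod (g t - z)).
  { apply (interval_clopen 0 b (fun u => exists r, r > 0 /\ forall t, 0 <= t <= u -> r <= Cmod (g t - z))) with 0; try lra.
    - intros u hu. assert (p := Cmod_sub_pos _ _ (Hn u hu)). rewrite Cmod_sym in p.
      destruct (Hg u hu (Cmod (g u - z) / 2)) as [d [hd Hd]]; [lra|]. exists d. split; auto.
      intros s1 s2 h1 h2 k1 k2 [r [hr Hr]]. exists (Rmin r (Cmod (g u - z) / 2)).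
      split; [apply Rmin_pos; lra|]. intros t ht. destruct (Rle_dec t s1) as [l|l].
      + eapply Rle_trans; [apply Rmin_l|]. apply Hr. lra.
      + eapply Rle_trans; [apply Rmin_r|].
        assert (k : dR t u < d).
        { unfold dR. apply Rabs_def2 in k1. apply Rabs_def2 in k2. apply Rabs_def1; lra. }
        assert (h3 : icc 0 b t) by (unfold icc; lra).
        specialize (Hd t h3 k). pose proof (Cmod_tri (g u) (g t) z). rewrite (Cmod_sym (g u) (g t)) in H. lra.
    - assert (i0 : icc 0 b 0) by (unfold icc; lra). assert (p := Cmod_sub_pos _ _ (Hn 0 i0)).
      rewrite Cmod_sym in p. exists (Cmod (g 0 - z)). split; auto.
      intros t ht. replace t with 0 by lra. lra. }
  exact Q.
Qed.

Lemma notP_nonsing (f : C -> C) z : ~ P_f f z -> nonsing f z.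
Proof.
  intros n. assert (k : critical_value f z \/ asymptotic_value f z -> P_f f z).
  { intros h r hr. exists z. split; [|rewrite Cmod_sub_eq; lra].
    exists 0%nat, z. split; auto. intros r' hr'. exists z. split; auto.
    change (Cmod (z - z) < r'). rewrite Cmod_sub_eq. lra. }
  split; intros h; apply n; auto.
Qed.

Lemma Cexp_minus_1 t : Cmod t <= 1 -> Cmod (Cexp t - 1) <= 3 * Cmod t.
Proof.
  intros h. replace t with (t - 0)%C at 2 by ring. rewrite <- Cexp_0.
  apply (mean_value Cexp Cexp); [intros; apply cd_Cexp|].
  intros u hu. rewrite Cmod_Cexp. apply Rle_trans with (exp 1); [|apply exp_le_3].
  assert (fst (seg 0 t u) <= 1).
  { pose proof (Rabs_fst_le (seg 0 t u)). pose proof (Rle_abs (fst (seg 0 t u))).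
    assert (Cmod (seg 0 t u) <= 1); [|lra].
    unfold seg. replace (0 + u * (t - 0))%C with (u * t)%C by ring.
    rewrite Cmod_mult, Cmod_R, Rabs_pos_eq by lra. pose proof (Cmod_ge_0 t). nra. }
  destruct (Rle_lt_or_eq_dec _ _ H) as [l|l]; [left; apply exp_increasing; auto|rewrite l; lra].
Qed.

Lemma exp_le_mono a b : a <= b -> exp a <= exp b.
Proof. intros h. destruct (Rle_lt_or_eq_dec _ _ h) as [l|l]; [left; apply exp_increasing; auto|rewrite l; lra]. Qed.

Section Plane.
Context (f f' : C -> C) (D : C -> Prop) (alpha : R -> C) (p0 : C) (RD : R).
Context (Hf : is_deriv f f') (Dopen : open_set D) (Dconn : connected D) (Dp0 : D p0)
  (Dbd : forall z, D z -> Cmod (z - p0) < RD) (hPD : forall z, P_f f z -> D z)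
  (halpha : admissible_alpha f D alpha).

(** Fundamental domains are connected subsets of the preimage of this set under f; [Lam] is its
    preimage under w -> p0 + e^w. *)
Definition Aal (z : C) : Prop := outer D z /\ forall t, t >= 0 -> z <> alpha t.
Definition Lam (w : C) : Prop := Aal (p0 + Cexp w)%C.

Lemma D_closure z : D z -> Defs.closure D z.
Proof. intros h r hr. exists z. split; auto. change (Cmod (z - z) < r). rewrite Cmod_sub_eq. lra. Qed.

Lemma RD_pos : 0 < RD.
Proof. specialize (Dbd p0 Dp0). rewrite Cmod_sub_eq in Dbd. lra. Qed.

Lemma closure_bound z : Defs.closure D z -> Cmod (z - p0) <= RD.
Proof.
  intros h. apply Rnot_lt_le. intros l. destruct (h (Cmod (z - p0) - RD)) as [w [dw hw]]; [lra|].
  change (Cmod (w - z) < Cmod (z - p0) - RD) in hw. specialize (Dbd w dw).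
  pose proof (Cmod_tri z w p0). rewrite (Cmod_sym z w) in H. lra.
Qed.

Lemma outer_far z : RD < Cmod (z - p0) -> outer D z.
Proof. intros h c. apply closure_bound in c. lra. Qed.

Lemma outer_notP z : outer D z -> ~ P_f f z.
Proof. intros h p. apply h. apply D_closure. auto. Qed.

Lemma open_outer : open_set (outer D).
Proof.
  intros z hz. apply NNPP. intros n. apply hz. intros r hr. apply NNPP. intros n2. apply n.
  exists (r / 2). split; [lra|]. intros w hw c. change (Cmod (w - z) < r / 2) in hw.
  destruct (c (r / 2)) as [u [du hu]]; [lra|]. change (Cmod (u - w) < r / 2) in hu.
  apply n2. exists u. split; auto. change (Cmod (u - z) < r). pose proof (Cmod_tri u w z). lra.
Qed.

Lemma alpha_cts b t : icc 0 b t -> cwi dR (icc 0 b) alpha t.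
Proof.
  intros ht e he. destruct halpha as (c & _). unfold icc in ht.
  destruct (c t ltac:(lra) e he) as [d [hd Hd]]. exists d. split; [exact hd|].
  intros y hy. unfold icc in hy. apply Hd. lra.
Qed.

Lemma open_Aal : open_set Aal.
Proof.
  intros z [oz az]. destruct (open_outer z oz) as [r1 [hr1 H1]].
  destruct halpha as (_ & _ & _ & _ & inf & _). destruct (inf (Cmod z + 1)) as [T HT].
  set (b := Rmax 0 T). assert (b0 : 0 <= b) by apply Rmax_l.
  destruct (closed_image_avoid alpha b z b0 (alpha_cts b)) as [r2 [hr2 H2]].
  { intros t ht. apply az. unfold icc in ht. lra. }
  exists (Rmin r1 (Rmin r2 1)). split; [repeat apply Rmin_pos; lra|].
  intros w hw. change (Cmod (w - z) < Rmin r1 (Rmin r2 1)) in hw.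
  assert (a1 := Rlt_le_trans _ _ _ hw (Rmin_l _ _)).
  assert (a2 := Rlt_le_trans _ _ _ (Rlt_le_trans _ _ _ hw (Rmin_r _ _)) (Rmin_l _ _)).
  assert (a3 := Rlt_le_trans _ _ _ (Rlt_le_trans _ _ _ hw (Rmin_r _ _)) (Rmin_r _ _)).
  split; [apply H1; auto|]. intros t ht ->. destruct (Rle_dec t b) as [l|l].
  - specialize (H2 t ltac:(unfold icc; lra)). lra.
  - assert (h := HT t ltac:(unfold b in l; pose proof (Rmax_r 0 T); lra)).
    change (Cmod (alpha t) > Cmod z + 1) in h. pose proof (Cmod_le_add (alpha t) z). lra.
Qed.

Lemma open_preimage (g : C -> C) (U : C -> Prop) : (forall z, cts g z) -> open_set U -> open_set (fun z => U (g z)).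
Proof.
  intros hg hU z hz. destruct (hU _ hz) as [r [hr Hr]]. destruct (hg z r hr) as [d [hd Hd]].
  exists d. split; auto. intros w hw. apply Hr. exact (Hd w I hw).
Qed.

Lemma expp_cts z : cts (fun w => p0 + Cexp w)%C z.
Proof. apply cwi_plus; [apply cwi_const|]. eapply cd_cts. apply cd_Cexp. Qed.

Lemma open_Lam : open_set Lam.
Proof. apply (open_preimage _ Aal expp_cts open_Aal). Qed.

Lemma alpha_chain (E : C -> Prop) eps t T : eps > 0 -> 0 <= t -> 0 <= T ->
  (forall t, t >= 0 -> E (alpha t)) -> chain E eps (alpha t) (alpha T).
Proof.
  intros he ht hT HE.
  assert (k : forall u, 0 <= u -> chain E eps (alpha 0) (alpha u)).
  { intros u hu. apply (chain_path E eps alpha 0 u); auto; unfold icc; try lra.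
    - intros s hs. apply alpha_cts. auto.
    - intros s hs. apply HE. lra. }
  apply chain_trans with (alpha 0); auto. apply chain_sym; auto.
Qed.

(* D together with alpha joins p0 to infinity, so it meets every closed curve winding around p0. *)
Lemma log_unlink w k : linked Lam w (w + twopii k)%C -> k = 0%Z.
Proof.
  intros (B & cB & sB & b0 & b1).
  destruct (connected_chain Lam B w _ open_Lam cB sB b0 b1) as (eta & M & heta & ch).
  destruct (Dopen p0 Dp0) as [r0 [hr0 Hr0]].
  (* [r0] bounds |e^u| from below for points outside D, so a displacement of p0 + e^u by less than
     [mu] changes the logarithm by less than [eta]. Chains of depth [eta] in the plane of u thus
     stay [mu] away from D and alpha. *)
  set (mu := r0 * Rmin (eta / 2) (1 / 2)).
  assert (pm : 0 < Rmin (eta / 2) (1 / 2)) by (apply Rmin_pos; lra).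
  assert (hmu : 0 < mu) by (unfold mu; nra).
  set (eps := mu / 10). assert (heps : eps > 0) by (unfold eps; lra).
  set (E := fun z => D z \/ exists t, t >= 0 /\ z = alpha t).
  set (b := fun z => (z - p0)%C).
  assert (AE : forall z, Aal z -> ~ E z).
  { intros z [o a] [dz|[t [ht ez]]]; [apply o, D_closure; auto|apply (a t ht ez)]. }
  assert (big : forall z, outer D z -> r0 <= Cmod (z - p0)).
  { intros z hz. apply Rnot_lt_le. intros l. apply hz, D_closure, Hr0. exact l. }
  assert (marg : forall u, deep Lam eta M u -> freebox E eps (p0 + Cexp u)%C).
  { intros u [_ hu] z [hz1 hz2].
    assert (Lu : Lam u) by (apply hu; rewrite Cmod_sub_eq; lra).
    assert (bu := big _ (proj1 Lu)). replace (p0 + Cexp u - p0)%C with (Cexp u) in bu by ring.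
    assert (dz : Cmod (z - (p0 + Cexp u)) < mu).
    { eapply Rle_lt_trans; [apply Cmod_le_abs|]. simpl in *. unfold Rminus in hz1, hz2. unfold eps in *. lra. }
    set (s := ((z - (p0 + Cexp u)) / Cexp u)%C).
    assert (hs : Cmod s < Rmin (eta / 2) (1 / 2)).
    { unfold s. rewrite Cmod_div by apply Cexp_neq_0.
      apply Rmult_lt_reg_r with (Cmod (Cexp u)); [lra|]. unfold Rdiv at 1. rewrite Rmult_assoc, Rinv_l by lra.
      rewrite Rmult_1_r. eapply Rlt_le_trans; [exact dz|]. unfold mu. rewrite Rmult_comm.
      apply Rmult_le_compat_l; lra. }
    assert (s1 := Rlt_le_trans _ _ _ hs (Rmin_l _ _)). assert (s2 := Rlt_le_trans _ _ _ hs (Rmin_r _ _)).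
    destruct (log_near_1 s) as [t [Et ht]]; [lra|].
    apply AE. replace z with (p0 + Cexp (u + t))%C.
    - apply hu. replace (u + t - u)%C with t by ring. lra.
    - rewrite Cexp_plus, Et. unfold s. field. apply Cexp_neq_0. }
  assert (hesc : forall e M, E e -> exists e', chain E eps e e' /\ (M < Rabs (fst e') \/ M < Rabs (snd e'))).
  { intros e M' he. assert (ha := halpha). destruct ha as (_ & _ & [ba _] & _ & inf & _).
    destruct (inf (2 * Rabs M' + 1)) as [T0 HT]. set (T := Rmax 0 T0).
    assert (T0' : 0 <= T) by apply Rmax_l.
    assert (EA : forall t, t >= 0 -> E (alpha t)) by (intros t ht; right; eauto).
    exists (alpha T). split.
    - assert (toa : exists t, 0 <= t /\ chain E eps e (alpha t)).
      { destruct he as [de|[t [ht ->]]].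
        - exists 0. split; [lra|]. destruct (ba eps heps) as [d [dd hd]].
          destruct (connected_chain D D e d Dopen Dconn (fun z h => h) de dd) as (eta' & M2 & heta' & ch').
          apply chain_step with d.
          + apply chain_weaken with (deep D eta' M2); auto. intros z [_ hz]. left. apply hz.
            rewrite Cmod_sub_eq. lra.
          + apply EA. lra.
          + rewrite Cmod_sym. exact hd.
        - exists t. split; [lra|]. apply chain_refl. apply EA. auto. }
      destruct toa as [t [ht h]]. eapply chain_trans; [exact h|]. apply alpha_chain; auto.
    - assert (h := HT T (Rle_ge _ _ (Rmax_r _ _))). change (Cmod (alpha T) > 2 * Rabs M' + 1) in h.
      pose proof (Cmod_le_abs (alpha T)). pose proof (Rle_abs M').
      destruct (Rlt_dec M' (Rabs (fst (alpha T)))); auto. right. lra. }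
  assert (hE : forall z, ~ E z -> nonsing Cexp (b z)).
  { intros z hz. apply nonsing_Cexp. unfold b. intros Z. apply hz. left.
    replace z with p0; auto. apply Cmod_sub_0. rewrite Cmod_sym, Z. apply Cmod_0. }
  assert (hb : forall z, cts b z) by (intros z; apply cwi_minus; [apply cts_id|apply cwi_const]).
  assert (eM : 0 < exp (M + 1)) by apply exp_pos.
  set (s := Rmin 1 (eps / exp (M + 1))).
  assert (hs : s > 0) by (apply Rmin_pos; [lra|apply Rdiv_lt_0_compat; lra]).
  assert (lip : forall u v, Cmod u <= M -> Cmod (v - u) < s -> Cmod (Cexp v - Cexp u) < eps).
  { intros u v hu hv. assert (v1 := Rlt_le_trans _ _ _ hv (Rmin_l _ _)).
    assert (v2 := Rlt_le_trans _ _ _ hv (Rmin_r _ _)).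
    apply Rle_lt_trans with (exp (M + 1) * Cmod (v - u)).
    - apply (mean_value Cexp Cexp); [intros; apply cd_Cexp|]. intros t ht. rewrite Cmod_Cexp.
      apply exp_le_mono. assert (hb' : ballC u 1 (seg u v t)).
      { apply convex_ball; auto. unfold ballC. rewrite Cmod_sub_eq. lra. }
      unfold ballC in hb'. pose proof (Cmod_le_add (seg u v t) u).
      pose proof (Rabs_fst_le (seg u v t)). pose proof (Rle_abs (fst (seg u v t))). lra.
    - apply Rmult_lt_compat_l with (r := exp (M + 1)) in v2; auto.
      replace (exp (M + 1) * (eps / exp (M + 1))) with eps in v2 by (field; lra). exact v2. }
  (* Near v, the lift of z - p0 through [Cexp] with value v, taken at p0 + e^x, is x itself; the
     chain of logarithms is therefore the lifted chain. *)
  assert (L : forall u v, chain (deep Lam eta M) s u v ->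
     lchain Cexp b E eps ((p0 + Cexp u)%C, u) ((p0 + Cexp v)%C, v)).
  { intros u v H. induction H as [u Hu|u v v' H IH Hv' hd]; [apply lchain_refl|].
    eapply lchain_step; [exact IH|]. assert (Hv := chain_end _ _ _ _ H).
    split; [apply (marg v Hv)|]. simpl fst. simpl snd. split.
    - replace (p0 + Cexp v' - (p0 + Cexp v))%C with (Cexp v' - Cexp v)%C by ring.
      apply lip; auto. apply Hv.
    - destruct (lift_box Cexp Cexp b E is_deriv_Cexp hb hE (p0 + Cexp v)%C v (5 * eps)) as [q hq].
      { lra. } { apply (marg v Hv). } { unfold b. ring. }
      exists q. split; auto.
      assert (inb : forall x, ballC v s x -> box (p0 + Cexp v) (5 * eps) (p0 + Cexp x)%C).
      { intros x hx. assert (h := lip v x (proj1 Hv) hx).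
        pose proof (Rabs_fst_le (Cexp x - Cexp v)) as a1. pose proof (Rabs_snd_le (Cexp x - Cexp v)) as a2.
        split; simpl in *.
        - replace (fst p0 + exp (fst x) * cos (snd x) - (fst p0 + exp (fst v) * cos (snd v))) with
            (exp (fst x) * cos (snd x) + - (exp (fst v) * cos (snd v))) by ring. lra.
        - replace (snd p0 + exp (fst x) * sin (snd x) - (snd p0 + exp (fst v) * sin (snd v))) with
            (exp (fst x) * sin (snd x) + - (exp (fst v) * sin (snd v))) by ring. lra. }
      apply (clift_unique Cexp Cexp (ballC v s) v (fun x => q (p0 + Cexp x)%C) (fun x => x) is_deriv_Cexp).
      + apply convex_ball.
      + unfold ballC. rewrite Cmod_sub_eq. lra.
      + intros x hx. apply (cwi_comp dC dC _ (box (p0 + Cexp v) (5 * eps))); auto.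
        * assert (cc := cts_cwi (ballC v s) _ x (expp_cts x)). exact cc.
        * apply hq. auto.
      + intros. apply cwi_id.
      + intros x hx. rewrite (proj2 (proj2 hq _ (inb x hx))). unfold b. ring.
      + intros x hx. rewrite (proj2 (proj2 hq _ (inb x hx))). apply nonsing_Cexp. unfold b.
        replace (p0 + Cexp x - p0)%C with (Cexp x) by ring. apply Cexp_neq_0.
      + apply hq.
      + exact hd. }
  assert (H := L _ _ (ch s hs)).
  assert (Ex : Cexp (w + twopii k) = Cexp w) by (rewrite Cexp_plus, Cexp_twopii; ring).
  rewrite Ex in H.
  assert (W : w = (w + twopii k)%C).
  { apply (lchain_closed Cexp Cexp b E eps is_deriv_Cexp hb heps hE hesc (p0 + Cexp w)%C); auto.
    - apply marg. apply chain_start with (s := s) (b := (w + twopii k)%C). auto.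
    - unfold b. ring. }
  assert (Z : twopii k = 0%C).
  { transitivity ((w + twopii k) - w)%C; [ring|]. rewrite <- W. ring. }
  apply (f_equal snd) in Z. unfold twopii in Z. simpl in Z. pose proof PI_RGT_0.
  apply eq_IZR_R0. nra.
Qed.

(** P(f) is compact in the connected open set D. A sequence in P(f) violating ever weaker depth
    conditions would cluster at a point of P(f) that has a neighbourhood of positive depth. *)
Lemma P_deep : exists eta M, eta > 0 /\ forall s z, s > 0 -> P_f f z -> chain (deep D eta M) s p0 z.
Proof.
  apply NNPP. intros n.
  assert (ex : forall k : nat, exists z s, s > 0 /\ P_f f z /\ ~ chain (deep D (/ (INR k + 1)) (INR k)) s p0 z).
  { intros k. apply NNPP. intros m. apply n. exists (/ (INR k + 1)), (INR k).
    split; [apply Rinv_0_lt_compat; pose proof (pos_INR k); lra|].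
    intros s z hs hz. apply NNPP. intros c. apply m. eauto. }
  set (u := fun k => proj1_sig (constructive_indefinite_description _ (ex k))).
  assert (hu : forall k, exists s, s > 0 /\ P_f f (u k) /\ ~ chain (deep D (/ (INR k + 1)) (INR k)) s p0 (u k)).
  { intros k. unfold u. destruct constructive_indefinite_description; auto. }
  destruct (bounded_cluster u (RD + Cmod p0)) as [l Hl].
  { intros k. destruct (hu k) as (s & _ & hp & _). specialize (Dbd _ (hPD _ hp)).
    pose proof (Cmod_le_add (u k) p0). lra. }
  assert (Pl : P_f f l).
  { intros r hr. destruct (Hl (r / 2) 0%nat) as [k [_ hk]]; [lra|].
    destruct (hu k) as (s & _ & hp & _). destruct (hp (r / 2)) as [w [hw1 hw2]]; [lra|].
    exists w. split; auto. change (Cmod (w - u k) < r / 2) in hw2. change (Cmod (w - l) < r).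
    pose proof (Cmod_tri w (u k) l). lra. }
  destruct (connected_chain D D p0 l Dopen Dconn (fun z h => h) Dp0 (hPD l Pl)) as (eta & M & heta & ch).
  destruct (Dopen l (hPD l Pl)) as [r [hr Hr]].
  set (e := Rmin eta (r / 2)). assert (he : 0 < e) by (apply Rmin_pos; lra).
  set (M' := Rmax M (Cmod l + r)).
  destruct (archimed_cor1 e he) as [N1 [hN1 hN1']].
  destruct (INR_unbounded M') as [N2 hN2].
  destruct (Hl (r / 2) (max N1 N2)) as [k [hk Hk]]; [lra|].
  destruct (hu k) as (s & hs & _ & nc). apply nc.
  assert (k1 : / (INR k + 1) <= e).
  { apply Rle_trans with (/ INR N1); [|lra]. apply Rinv_le_contravar; [apply lt_0_INR; lia|].
    assert (INR N1 <= INR k) by (apply le_INR; lia). lra. }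
  assert (k2 : M' <= INR k).
  { assert (INR N2 <= INR k) by (apply le_INR; lia). lra. }
  apply chain_weaken with (deep D e M'); [intros z; apply deep_mono; auto|].
  apply chain_trans with l.
  - apply chain_weaken with (deep D eta M); auto. intros z; apply deep_mono; [apply Rmin_l|apply Rmax_l].
  - apply chain_seg; auto. intros t ht.
    assert (hb : ballC l (r / 2) (seg l (u k) t)).
    { apply convex_ball; auto. unfold ballC. rewrite Cmod_sub_eq. lra. }
    unfold ballC in hb. split.
    + eapply Rle_trans; [|apply Rmax_r]. pose proof (Cmod_le_add (seg l (u k) t) l). lra.
    + intros w hw. apply Hr. change (Cmod (w - l) < r).
      assert (hw' := Rlt_le_trans _ _ _ hw (Rmin_r _ _)).
      pose proof (Cmod_tri w (seg l (u k) t) l). lra.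
Qed.

(** The half-plane that w -> p0 + e^w maps onto the points at distance more than [R] from [p0]. *)
Definition HR (R : R) : C -> Prop := fun w => ln R < fst w.

Lemma convex_HR R : convexC (HR R).
Proof.
  intros a b t ha hb ht. unfold HR, seg in *. simpl. 
  replace (fst a + (t * (fst b + - fst a) - 0 * (snd b + - snd a))) with
    (fst a + t * (fst b - fst a)) by ring.
  destruct (Req_dec t 0) as [->|n]; [lra|]. nra.
Qed.

Lemma HR_far R w : 0 < R -> HR R w <-> R < Cmod (p0 + Cexp w - p0).
Proof.
  intros hR. replace (p0 + Cexp w - p0)%C with (Cexp w) by ring. rewrite Cmod_Cexp. unfold HR. split; intros h.
  - rewrite <- (exp_ln R) by auto. apply exp_increasing. auto.
  - rewrite <- (ln_exp (fst w)). apply ln_increasing; auto.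
Qed.

Lemma HR_nonsing R w : RD <= R -> HR R w -> nonsing f (p0 + Cexp w).
Proof.
  intros hR hw. pose proof RD_pos. apply notP_nonsing, outer_notP, outer_far.
  apply HR_far in hw; lra.
Qed.

(* A path from eta w0 to y inside f^-1(Aal) is followed by small steps in the logarithmic plane, and one
   returns to w0 inside the half-plane; the obstructions to lifting all chain out to infinity, so the
   lift along this loop closes up. *)
Lemma tract_param R (eta : C -> C) (w0 y : C) (B : C -> Prop) : 3 * RD <= R -> HR R w0 ->
  (forall w, HR R w -> cwi dC (HR R) eta w /\ f (eta w) = (p0 + Cexp w)%C) ->
  connected B -> (forall z, B z -> Aal (f z)) -> B (eta w0) -> B y -> R < Cmod (f y - p0) ->
  exists w, HR R w /\ eta w = y /\ linked Lam w0 w.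
Proof.
  intros hR hw0 Heta cB sB b0 b1 fy. assert (prd := RD_pos).
  assert (fc := is_deriv_cts _ _ Hf).
  set (G := fun z => Aal (f z)).
  destruct (connected_chain G B (eta w0) y (open_preimage f Aal fc open_Aal) cB sB b0 b1) as (eta1 & M & heta1 & ch).
  destruct P_deep as (etaP & MP & hetaP & chP).
  destruct (Dopen p0 Dp0) as [r0 [hr0 Hr0]].
  set (eta0 := Rmin etaP (r0 / 2)). assert (heta0 : 0 < eta0) by (apply Rmin_pos; lra).
  set (M0 := Rmax MP (Cmod p0 + r0)).
  destruct (cts_bounded (fun z => f z - p0)%C 0%C M) as [M2' HM2].
  { intros z. apply cwi_minus; [auto|apply cwi_const]. }
  set (M2 := Rmax M2' 0). assert (hM2 : 0 <= M2) by apply Rmax_r.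
  destruct (deriv_bounded f f' 0%C (M + eta1) Hf) as [Bf [Bf0 HBf]].
  set (eps := Rmin (1 / 10) (eta0 / (60 * (M2 + 1)))).
  assert (heps : eps > 0) by (apply Rmin_pos; [lra|apply Rdiv_lt_0_compat; lra]).
  assert (eps1 : eps <= 1 / 10) by apply Rmin_l.
  assert (eps2 : 60 * eps * (M2 + 1) <= eta0).
  { assert (h : eps <= eta0 / (60 * (M2 + 1))) by apply Rmin_r.
    apply Rmult_le_compat_r with (r := 60 * (M2 + 1)) in h; [|lra].
    replace (eta0 / (60 * (M2 + 1)) * (60 * (M2 + 1))) with eta0 in h by (field; lra). lra. }
  set (r1 := r0 / 2). assert (hr1 : 0 < r1) by (unfold r1; lra).
  set (s := eps * r1 / 4). assert (hs : s > 0) by (unfold s; nra).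
  assert (sr1 : s <= r1 / 2) by (unfold s; nra).
  (* The obstacle contains all logarithms of points of P(f). It is defined through chains from [p0]
     so that each of its points can be followed back towards [p0], which in the logarithmic plane
     lies at real part minus infinity. *)
  set (E := fun w => chain (deep D eta0 M0) s p0 (p0 + Cexp w)%C).
  set (b := fun w => (p0 + Cexp w)%C).
  assert (nearp0 : forall z, Cmod (z - p0) < r1 -> chain (deep D eta0 M0) s p0 z).
  { intros z hz. apply chain_seg; auto. intros t ht.
    assert (hb : ballC p0 r1 (seg p0 z t)).
    { apply convex_ball; auto. unfold ballC. rewrite Cmod_sub_eq. lra. }
    unfold ballC in hb. unfold r1 in hb. split.
    - eapply Rle_trans; [|apply Rmax_r]. pose proof (Cmod_le_add (seg p0 z t) p0). lra.
    - intros w hw. apply Hr0. change (Cmod (w - p0) < r0).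
      assert (hw' := Rlt_le_trans _ _ _ hw (Rmin_r _ _)).
      pose proof (Cmod_tri w (seg p0 z t) p0). lra. }
  assert (hE : forall w, ~ E w -> nonsing f (b w)).
  { intros w n. apply notP_nonsing. intros hp. apply n. unfold E.
    apply chain_weaken with (deep D etaP MP); [|apply chP; auto].
    intros z. apply deep_mono; [apply Rmin_l|apply Rmax_l]. }
  assert (left_chain : forall w T, Cmod (Cexp w) < r1 -> T <= fst w -> chain E eps w (T, snd w)).
  { intros w T hw hT. rewrite Cmod_Cexp in hw. apply chain_seg; [lra|]. intros t ht. apply nearp0.
    replace (p0 + Cexp (seg w (T, snd w) t) - p0)%C with (Cexp (seg w (T, snd w) t)) by ring.
    rewrite Cmod_Cexp. eapply Rle_lt_trans; [|exact hw]. apply exp_le_mono. unfold seg. simpl.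
    unfold icc in ht. nra. }
  assert (hesc : forall e M, E e -> exists e', chain E eps e e' /\ (M < Rabs (fst e') \/ M < Rabs (snd e'))).
  { assert (key : forall z, chain (deep D eta0 M0) s p0 z -> forall e M, (p0 + Cexp e)%C = z ->
       exists e', chain E eps e e' /\ (M < Rabs (fst e') \/ M < Rabs (snd e'))).
    2:{ intros e M' he. apply (key _ he); auto. }
    assert (lft : forall e M, Cmod (Cexp e) < r1 -> exists e', chain E eps e e' /\ (M < Rabs (fst e') \/ M < Rabs (snd e'))).
    { intros e M' he. set (T := Rmin (fst e) (- (Rabs M' + 1))). exists (T, snd e).
      split; [apply left_chain; auto; apply Rmin_l|]. left. simpl.
      assert (T <= - (Rabs M' + 1)) by apply Rmin_r. pose proof (Rabs_pos M'). pose proof (Rle_abs M').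
      rewrite Rabs_left by lra. lra. }
    assert (key' : forall a z, chain (deep D eta0 M0) s a z -> a = p0 -> forall e M, (p0 + Cexp e)%C = z ->
       exists e', chain E eps e e' /\ (M < Rabs (fst e') \/ M < Rabs (snd e'))).
    2:{ intros z H. apply (key' p0 z H eq_refl). }
    intros a z H. induction H as [a Pa|a z z' H IH Pz' hd]; intros Ea e M' Ee.
    - exfalso. apply (Cexp_neq_0 e). transitivity ((p0 + Cexp e) - p0)%C; [ring|]. rewrite Ee, Ea. ring.
    - rewrite Ea in H. destruct (Rlt_dec (Cmod (Cexp e)) r1) as [l|l]; [apply lft; auto|].
      assert (n0 := Cexp_neq_0 e).
      destruct (log_near_1 ((z - z') / Cexp e)%C) as [t [Et ht]].
      { rewrite Cmod_div, Cmod_sym by auto. apply Rmult_le_reg_r with (Cmod (Cexp e)); [lra|].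
        unfold Rdiv at 1. rewrite Rmult_assoc, Rinv_l by lra. nra. }
      assert (Ez : (p0 + Cexp (e + t))%C = z).
      { rewrite Cexp_plus, Et. replace z' with (p0 + Cexp e)%C. field. auto. }
      destruct (IH Ea (e + t)%C M' Ez) as [e' [c far]]. exists e'. split; auto.
      apply chain_trans with (e + t)%C; auto. apply chain_step with e.
      + apply chain_refl. unfold E. rewrite Ee. apply chain_step with z; auto.
      + unfold E. rewrite Ez. auto.
      + replace (e + t - e)%C with t by ring. eapply Rle_lt_trans; [exact ht|].
        rewrite Cmod_div, Cmod_sym by auto.
        apply Rmult_lt_reg_r with (Cmod (Cexp e)); [lra|].
        unfold Rdiv. rewrite !Rmult_assoc, Rinv_l by lra. unfold s in hd. nra. }
  assert (hb : forall z, cts b z) by apply expp_cts.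
  (* A displacement of w by less than 10 eps moves [f k] by at most 30 eps M2 < eta0; if it led to a
     point of [E], the depth of that point would place [f k] in D. *)
  assert (marg : forall k w, Cmod k <= M -> Aal (f k) -> (p0 + Cexp w)%C = f k -> freebox E eps w).
  { intros k w hk ak Ew u [hu1 hu2] Eu. apply chain_end in Eu. destruct Eu as [_ du].
    apply (proj1 ak), D_closure. apply du. rewrite <- Ew.
    assert (du' : Cmod (u - w) < 10 * eps).
    { eapply Rle_lt_trans; [apply Cmod_le_abs|]. simpl. unfold Rminus in hu1, hu2. lra. }
    replace (p0 + Cexp w - (p0 + Cexp u))%C with (- (Cexp w * (Cexp (u - w) - 1)))%C.
    2:{ replace (Cexp u) with (Cexp w * Cexp (u - w))%C by (rewrite <- Cexp_plus; f_equal; ring). ring. }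
    rewrite Cmod_opp, Cmod_mult.
    assert (h1 : Cmod (Cexp (u - w) - 1) <= 30 * eps).
    { eapply Rle_trans; [apply Cexp_minus_1; lra|]. lra. }
    assert (h2 : Cmod (Cexp w) <= M2).
    { replace (Cexp w) with (f k - p0)%C by (rewrite <- Ew; ring).
      eapply Rle_trans; [apply HM2|apply Rmax_l]. replace (k - 0)%C with k by ring. auto. }
    apply Rle_lt_trans with (M2 * (30 * eps)).
    - apply Rmult_le_compat; auto; apply Cmod_ge_0.
    - nra. }
  assert (big : forall z, outer D z -> r0 <= Cmod (z - p0)).
  { intros z hz. apply Rnot_lt_le. intros l. apply hz, D_closure, Hr0. exact l. }
  set (s' := Rmin (eta1 / 2) (eps * r0 / (Bf + 1))).
  assert (hs' : s' > 0) by (apply Rmin_pos; [lra|apply Rdiv_lt_0_compat; nra]).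
  assert (s'1 : s' < eta1) by (assert (s' <= eta1 / 2) by apply Rmin_l; lra).
  assert (s'2 : Bf / r0 * s' <= eps).
  { assert (h : s' <= eps * r0 / (Bf + 1)) by apply Rmin_r.
    apply Rle_trans with (Bf / r0 * (eps * r0 / (Bf + 1))).
    - apply Rmult_le_compat_l; auto. apply Rmult_le_pos; auto. left. apply Rinv_0_lt_compat; lra.
    - replace (Bf / r0 * (eps * r0 / (Bf + 1))) with (eps * (Bf / (Bf + 1))) by (field; lra).
      rewrite <- (Rmult_1_r eps) at 2. apply Rmult_le_compat_l; [lra|].
      apply Rmult_le_reg_r with (Bf + 1); [lra|]. unfold Rdiv. rewrite Rmult_assoc, Rinv_l; lra. }
  assert (Fw0 : f (eta w0) = b w0) by apply (Heta w0 hw0).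
  (* Along the chain of points k a logarithm w of f k - p0 is continued, and then the k are the lift
     through f of the chain of the w. The sets swept by the logarithms keep w linked to [w0]. *)
  assert (L : forall x k, x = eta w0 -> chain (deep G eta1 M) s' x k -> exists w, lchain f b E eps (w0, eta w0) (w, k) /\
      (p0 + Cexp w)%C = f k /\ linked Lam w0 w).
  { intros x k Ex H. induction H as [x Hx|x k k' H IH Hk' hd].
    - subst x. exists w0. split; [apply lchain_refl|]. split; auto. apply linked_refl. unfold Lam.
      replace (p0 + Cexp w0)%C with (f (eta w0)). auto.
    - destruct (IH Ex) as (w & lc & Ew & lk). assert (Hk := chain_end _ _ _ _ H). destruct Hk as [kM kd].
      assert (bk : ballC k eta1 k) by (unfold ballC; rewrite Cmod_sub_eq; lra).
      assert (nz : forall z, ballC k eta1 z -> (f z - p0)%C <> 0%C).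
      { intros z hz Z. assert (h := big _ (proj1 (kd z hz))). rewrite Z, Cmod_0 in h. lra. }
      destruct (convex_lift Cexp Cexp (ballC k eta1) (fun z => f z - p0)%C k w is_deriv_Cexp) as [q [q0 Hq]]; auto.
      { apply convex_ball. }
      { intros z _. apply cwi_minus; [apply cts_cwi; auto|apply cwi_const]. }
      { intros z hz. apply nonsing_Cexp. auto. }
      { rewrite <- Ew. ring. }
      assert (Eq' : forall z, ballC k eta1 z -> (p0 + Cexp (q z))%C = f z).
      { intros z hz. rewrite (proj2 (Hq z hz)). ring. }
      assert (lip : forall z, ballC k s' z -> Cmod (q z - w) < eps).
      { intros z hz. rewrite <- q0. unfold ballC in hz.
        apply Rle_lt_trans with (Bf / r0 * Cmod (z - k)).
        - apply (mean_value q (fun z => (f' z - 0) / Cexp (q z))%C).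
          + intros t ht. assert (hb' : ballC k eta1 (seg k z t)) by (apply convex_ball; auto; unfold ballC; lra).
            apply (lift_cd Cexp Cexp (fun z => f z - p0)%C q (seg k z t) _ (eta1 - Cmod (seg k z t - k)) is_deriv_Cexp).
            * unfold ballC in hb'. lra.
            * apply cwi_ball_cts with k eta1; auto. apply Hq; auto.
            * intros u hu. apply Hq. apply ball_open with (seg k z t); auto.
            * apply cd_minus; [apply Hf|apply cd_const].
            * apply Cexp_neq_0.
          + intros t ht. assert (hb' : ballC k eta1 (seg k z t)) by (apply convex_ball; auto; unfold ballC; lra).
            rewrite Cmod_div by apply Cexp_neq_0.
            assert (h1 : r0 <= Cmod (Cexp (q (seg k z t)))).
            { rewrite (proj2 (Hq _ hb')). apply big. apply (kd _ hb'). }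
            assert (h2 : Cmod (f' (seg k z t) - 0) <= Bf).
            { replace (f' (seg k z t) - 0)%C with (f' (seg k z t)) by ring. apply HBf.
              replace (seg k z t - 0)%C with (seg k z t) by ring. unfold ballC in hb'.
              pose proof (Cmod_le_add (seg k z t) k). lra. }
            unfold Rdiv. apply Rmult_le_compat; auto using Cmod_ge_0.
            * left. apply Rinv_0_lt_compat. lra.
            * apply Rinv_le_contravar; lra.
        - destruct (Req_dec Bf 0) as [Z|nZ].
          + rewrite Z. unfold Rdiv. rewrite !Rmult_0_l. lra.
          + apply Rlt_le_trans with (Bf / r0 * s'); auto. apply Rmult_lt_compat_l; auto. apply Rdiv_lt_0_compat; lra. }
      exists (q k'). assert (hk' : ballC k s' k') by exact hd.
      assert (hk1 : ballC k eta1 k') by (unfold ballC in *; lra).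
      split; [|split; [apply Eq'; auto|]].
      + eapply lchain_step; [exact lc|].
        assert (fb : freebox E eps w).
        { apply (marg k); auto. apply kd. auto. }
        split; [exact fb|]. simpl fst. simpl snd. split; [apply lip; auto|].
        destruct (lift_box f f' b E Hf hb hE w k (5 * eps)) as [Q hQ]; [lra|exact fb|auto|].
        exists Q. split; auto.
        assert (inb : forall z, ballC k s' z -> box w (5 * eps) (q z)).
        { intros z hz. specialize (lip z hz). pose proof (Rabs_fst_le (q z - w)) as a1.
          pose proof (Rabs_snd_le (q z - w)) as a2. simpl in a1, a2. split; unfold Rminus; lra. }
        apply (clift_unique f f' (ballC k s') k (fun z => Q (q z)) (fun z => z) Hf).
        * apply convex_ball.
        * unfold ballC. rewrite Cmod_sub_eq. lra.
        * intros z hz. apply (cwi_comp dC dC _ (box w (5 * eps))); auto.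
          -- assert (cc : cwi dC (ballC k s') q z).
             { eapply cwi_sub; [|apply (proj1 (Hq z ltac:(unfold ballC in *; lra)))].
               intros u hu. unfold ballC in *. lra. }
             exact cc.
          -- apply hQ. auto.
        * intros. apply cwi_id.
        * intros z hz. rewrite (proj2 (proj2 hQ _ (inb z hz))). apply Eq'. unfold ballC in *; lra.
        * intros z hz. rewrite (proj2 (proj2 hQ _ (inb z hz))). unfold b. rewrite Eq' by (unfold ballC in *; lra).
          apply notP_nonsing, outer_notP. apply (kd z). unfold ballC in hz. lra.
        * rewrite q0. apply hQ.
        * exact hd.
      + apply linked_trans with w; auto.
        exists (fun v => exists z, ballC k eta1 z /\ v = q z).
        split; [apply connected_image_convex; [apply convex_ball|apply Hq]|]. split; [|split].
        * intros v [z [hz ->]]. unfold Lam. rewrite Eq' by auto. apply (kd z hz).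
        * exists k. split; auto.
        * exists k'. split; auto. }
  destruct (L (eta w0) y eq_refl (ch s' hs')) as (w & lc & Ew & lk).
  assert (hw : HR R w).
  { apply HR_far; [lra|]. rewrite Ew. auto. }
  exists w. split; auto. split; auto.
  assert (HRns : forall u, HR R u -> nonsing f (b u)) by (intros u hu; apply (HR_nonsing R u); auto; lra).
  (* Boxes have half-side 5 eps <= 1/2, and exp (-1/2) >= 1/3; so [3 * RD <= R] keeps them off the
     logarithms of D. *)
  assert (HRfree : forall u, HR R u -> freebox E eps u).
  { intros u hu v [hv1 hv2] Ev. apply chain_end in Ev. destruct Ev as [_ dv].
    assert (Dv : D (p0 + Cexp v)%C) by (apply dv; rewrite Cmod_sub_eq; lra).
    apply Dbd in Dv. replace (p0 + Cexp v - p0)%C with (Cexp v) in Dv by ring. rewrite Cmod_Cexp in Dv.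
    assert (h1 : ln R - 1 / 2 < fst v).
    { unfold HR in hu. apply Rabs_def2 in hv1. lra. }
    assert (h2 : exp (ln R - 1 / 2) < RD) by (eapply Rlt_trans; [apply exp_increasing; exact h1|auto]).
    unfold Rminus in h2. rewrite exp_plus, exp_ln in h2 by lra.
    assert (h3 : 1 / 3 <= exp (- (1 / 2))).
    { rewrite exp_Ropp. replace (1 / 3) with (/ 3) by field. apply Rinv_le_contravar; [apply exp_pos|].
      apply Rle_trans with (exp 1); [|apply exp_le_3]. apply exp_le_mono. lra. }
    nra. }
  (* The return along the half-plane starts from [y] over [w]. Trivial monodromy gives
     [e2 w0 = eta w0], hence [e2 = eta] on the half-plane and [eta w = y]. *)
  destruct (convex_lift f f' (HR R) b w y Hf (convex_HR R) hw) as [e2 [e20 He2]]; auto.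
  { intros z _. apply cts_cwi. auto. }
  assert (back : lchain f b E eps (w, y) (w0, e2 w0)).
  { assert (cs : chain (HR R) eps w w0) by (apply chain_seg; auto; intros; apply convex_HR; auto).
    rewrite <- e20.
    clear - cs He2 HRfree HRns heps hb hE Hf. induction cs as [w hw|w u v cs IH hv hd]; [apply lchain_refl|].
    eapply lchain_step; [exact IH|]. assert (hu := chain_end _ _ _ _ cs).
    split; [apply (HRfree u hu)|]. split; [exact hd|]. simpl fst. simpl snd.
    destruct (lift_box f f' b E Hf hb hE u (e2 u) (5 * eps)) as [Q hQ].
    { lra. } { apply (HRfree u hu). } { apply He2. auto. }
    exists Q. split; auto.
    assert (bv : box u (5 * eps) v).
    { pose proof (Rabs_fst_le (v - u)) as a1. pose proof (Rabs_snd_le (v - u)) as a2. simpl in a1, a2.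
      split; unfold Rminus; lra. }
    apply (clift_agree f f' _ (HR R) b u (e2 u) Q u (e2 u) e2 u Hf (convex_box _ _) (convex_HR R) hQ); auto.
    - split; auto.
    - intros z hz. apply hE. apply (HRfree u hu). auto.
    - apply box_center. lra.
    - apply hQ. }
  assert (Ec : eta w0 = e2 w0).
  { apply (lchain_closed f f' b E eps Hf hb heps hE hesc w0); auto. eapply lchain_trans; eauto. }
  rewrite <- e20.
  apply (clift_unique f f' (HR R) w0 eta e2 Hf (convex_HR R) hw0); auto.
  - intros z hz. apply Heta; auto.
  - intros z hz. apply He2; auto.
  - intros z hz. rewrite (proj2 (Heta z hz)), (proj2 (He2 z hz)). auto.
  - intros z hz. rewrite (proj2 (Heta z hz)). apply (HRns z hz).
Qed.
End Plane.

(** * Towers of inverse branches *)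

Fixpoint itd (f f' : C -> C) (n : nat) (z : C) : C :=
  match n with O => 1%C | S k => (f' (iter k f z) * itd f f' k z)%C end.

Lemma is_deriv_iter f f' n : is_deriv f f' -> is_deriv (iter n f) (itd f f' n).
Proof.
  intros H. induction n as [|n IH]; intros z; simpl.
  - apply cd_id.
  - apply (cd_comp (iter n f) f z); [apply IH|apply H].
Qed.

Lemma iter_add f a b z : iter (a + b) f z = iter a f (iter b f z).
Proof. induction a as [|a IH]; simpl; auto. rewrite IH. auto. Qed.

Lemma iter_S_in f n z : iter (S n) f z = iter n f (f z).
Proof. rewrite <- (Nat.add_1_r n), iter_add. auto. Qed.

Lemma iter_mul f n k z : iter k (iter n f) z = iter (k * n) f z.
Proof. induction k as [|k IH]; simpl; auto. rewrite IH, iter_add. auto. Qed.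

Lemma iter_fix f n z : f z = z -> iter n f z = z.
Proof. intros h. induction n as [|n IH]; simpl; auto. rewrite IH. auto. Qed.

Lemma iter_cts f f' n : is_deriv f f' -> forall z, cts (iter n f) z.
Proof. intros H. eapply is_deriv_cts. apply (is_deriv_iter f f' n H). Qed.

Lemma P_iter f n s : critical_value f s \/ asymptotic_value f s -> P_f f (iter n f s).
Proof.
  intros h r hr. exists (iter n f s). split.
  - exists n, s. split; auto. intros r' hr'. exists s. split; auto.
    change (Cmod (s - s) < r'). rewrite Cmod_sub_eq. lra.
  - change (Cmod (iter n f s - iter n f s) < r). rewrite Cmod_sub_eq. lra.
Qed.

Lemma notP_iter_nonsing f n z : ~ P_f f (iter n f z) -> nonsing f z.
Proof. intros h. split; intros c; apply h, P_iter; auto. Qed.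

Lemma itd_neq_0 f f' n z : is_deriv f f' -> ~ P_f f (iter n f z) -> itd f f' n z <> 0%C.
Proof.
  intros H. 
  assert (k : forall m, (forall k, (k < m)%nat -> f' (iter k f z) <> 0%C) -> itd f f' m z <> 0%C).
  { induction m as [|m IH]; intros h; simpl.
    - apply C1_nz.
    - apply Cmult_neq_0; [apply h; lia|apply IH; intros; apply h; lia]. }
  intros np. apply k. intros j hj Z. apply np.
  replace n with ((n - S j) + S j)%nat by lia. rewrite iter_add. apply P_iter. left.
  exists (iter j f z). split; auto. apply has_cderiv_cd. change C0 with (RtoC 0). rewrite <- Z. apply H.
Qed.

(** The form of uniqueness suited to iterates, for which a nonzero derivative along the lift follows
    from [itd_neq_0]. *)
Lemma section_unique F F' K c q1 q2 : is_deriv F F' -> convexC K -> K c ->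
  (forall z, K z -> cwi dC K q1 z) -> (forall z, K z -> cwi dC K q2 z) ->
  (forall z, K z -> F (q1 z) = F (q2 z)) -> (forall z, K z -> F' (q1 z) <> 0%C) ->
  q1 c = q2 c -> forall z, K z -> q1 z = q2 z.
Proof.
  intros H cv hc H1 H2 HF Hn E z hz. rewrite <- (seg_1 c z).
  apply (path_unique F F' 0 1 (fun t => q1 (seg c z t)) (fun t => q2 (seg c z t)) 0 H);
    unfold icc; try lra.
  - intros t ht. assert (kt := cv c z t hc hz ht). split; [|split; [|split]]; auto.
    + apply (seg_cts K); auto.
    + apply (seg_cts K); auto.
  - rewrite seg_0. auto.
Qed.

Definition backorbit (f : C -> C) (x : nat -> C) : Prop := forall n, f (x (S n)) = x n.

Lemma backorbit_iter f x n k : backorbit f x -> iter n f (x (n + k)%nat) = x k.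
Proof.
  intros h. revert k. induction n as [|n IH]; intros k; simpl; auto.
  replace (S (n + k)) with (n + S k)%nat by lia. rewrite IH. apply h.
Qed.

(** The map [q n] is a branch over K of the inverse of the n-th iterate, composed with [phi];
    consecutive branches are compatible. *)
Definition tower (f : C -> C) (K : C -> Prop) (phi : C -> C) (q : nat -> C -> C) : Prop :=
  (forall z, K z -> q 0%nat z = phi z) /\
  forall n z, K z -> cwi dC K (q n) z /\ f (q (S n) z) = q n z.

Lemma tower_iter f K phi q n z : tower f K phi q -> K z -> iter n f (q n z) = phi z.
Proof.
  intros [h0 hS] hz. rewrite <- (h0 z hz). rewrite <- (Nat.add_0_r n) at 2.
  apply (backorbit_iter f (fun n => q n z)). intros m. apply hS. auto.
Qed.

Lemma tower_backorbit f K phi q z : tower f K phi q -> K z -> backorbit f (fun n => q n z).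
Proof. intros [h0 hS] hz n. apply hS. auto. Qed.

(** The branches are lifted one at a time through f. A singular value met by [q n] would be carried
    by f^n to a point of P(f) in the image of [phi]. *)
Lemma tower_exists f f' K phi c x : is_deriv f f' -> convexC K -> K c ->
  (forall z, K z -> cwi dC K phi z) -> (forall z, K z -> ~ P_f f (phi z)) ->
  x 0%nat = phi c -> backorbit f x -> exists q, tower f K phi q /\ forall n, q n c = x n.
Proof.
  intros H cv hc Hp HP x0 bx.
  set (good := fun (n : nat) (q : C -> C) => q c = x n /\ forall z, K z -> cwi dC K q z /\ iter n f (q z) = phi z).
  assert (ex : forall n q, exists q', good n q -> good (S n) q' /\ forall z, K z -> f (q' z) = q z).
  { intros n q. destruct (classic (good n q)) as [[E Hq]|n0]; [|exists q; contradiction].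
    destruct (convex_lift f f' K q c (x (S n)) H cv hc) as [q' [E' Hq']].
    - intros z hz. apply Hq; auto.
    - intros z hz. apply (notP_iter_nonsing f n). rewrite (proj2 (Hq z hz)). auto.
    - rewrite bx. auto.
    - exists q'. intros _. split; [split; [exact E'|]|].
      + intros z hz. split; [apply Hq'; auto|]. rewrite iter_S_in, (proj2 (Hq' z hz)). apply Hq. auto.
      + intros z hz. apply Hq'. auto. }
  set (nx := fun n q => proj1_sig (constructive_indefinite_description _ (ex n q))).
  assert (Hnx : forall n q, good n q -> good (S n) (nx n q) /\ forall z, K z -> f (nx n q z) = q z).
  { intros n q. unfold nx. destruct constructive_indefinite_description. auto. }
  set (q := fix q n := match n with O => phi | S n => nx n (q n) end).
  assert (Hq : forall n, good n (q n)).
  { induction n as [|n IH].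
    - split; [simpl; auto|]. intros z hz. split; [apply Hp; auto|auto].
    - apply (Hnx n (q n) IH). }
  exists q. split.
  - split; [auto|]. intros n z hz. split; [apply Hq; auto|]. apply (Hnx n (q n) (Hq n)). auto.
  - intros n. apply Hq.
Qed.

(** * Branches over a far half-plane *)

Section Far.
Context (f f' : C -> C) (p0 z0 : C) (R R' : R).
Context (Hf : is_deriv f f') (hR : 0 < R) (hP : forall z, R < Cmod (z - p0) -> ~ P_f f z)
  (hR' : 2 * R <= R') (fz0 : f z0 = z0) (hz0 : Cmod (z0 - p0) <= R).

Definition expp (w : C) : C := (p0 + Cexp w)%C.
Definition towerR (q : nat -> C -> C) : Prop := tower f (HR R) expp q.

Lemma expp_far r w : 0 < r -> HR r w <-> r < Cmod (expp w - p0).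
Proof. apply HR_far. Qed.

Lemma expp_mod w : Cmod (expp w - p0) = exp (fst w).
Proof. rewrite <- Cmod_Cexp. f_equal. unfold expp. ring. Qed.

Lemma HR_mono r r' w : 0 < r -> r <= r' -> HR r' w -> HR r w.
Proof. intros h h' hw. apply expp_far; auto. apply expp_far in hw; lra. Qed.

Lemma towerR_exists x w : backorbit f x -> HR R w -> x 0%nat = expp w ->
  exists q, towerR q /\ forall n, q n w = x n.
Proof.
  intros bx hw E. apply (tower_exists f f' (HR R) expp w x); auto using convex_HR.
  - intros z _. apply cts_cwi. apply expp_cts.
  - intros z hz. apply hP. apply expp_far; auto.
Qed.

(** A displacement of w below this radius moves p0 + e^w by less than 3 e^(Re w) R / (6 e^(Re w)) =
    R / 2, the half disc of [growth]. *)
Definition lrad (w : C) := R / (6 * exp (fst w)).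

Lemma lrad_pos w : 0 < lrad w.
Proof. apply Rdiv_lt_0_compat; auto. pose proof (exp_pos (fst w)). lra. Qed.

Lemma lrad_move w w2 : HR R' w -> Cmod (w2 - w) < lrad w -> Cmod (expp w2 - expp w) < R / 2.
Proof.
  intros hw h. apply expp_far in hw; [|lra]. rewrite expp_mod in hw.
  unfold lrad in h. revert h hw. set (e := exp (fst w)). intros h hw.
  assert (h1 : Cmod (w2 - w) * (6 * e) < R).
  { apply Rmult_lt_compat_r with (r := 6 * e) in h; [|lra].
    replace (R / (6 * e) * (6 * e)) with R in h by (field; lra). auto. }
  replace (expp w2 - expp w)%C with (Cexp w * (Cexp (w2 - w) - 1))%C.
  2:{ unfold expp. replace (Cexp w2) with (Cexp w * Cexp (w2 - w))%C by (rewrite <- Cexp_plus; f_equal; ring). ring. }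
  rewrite Cmod_mult, Cmod_Cexp. fold e. pose proof (Cmod_ge_0 (w2 - w)).
  assert (h3 : Cmod (w2 - w) * (12 * R) <= R).
  { apply Rle_trans with (Cmod (w2 - w) * (6 * e)); [apply Rmult_le_compat_l; lra|lra]. }
  assert (h2 : Cmod (Cexp (w2 - w) - 1) <= 3 * Cmod (w2 - w)) by (apply Cexp_minus_1; nra).
  apply Rle_lt_trans with (e * (3 * Cmod (w2 - w))); [apply Rmult_le_compat_l; lra|lra].
Qed.

(** The tower near w read as sections on the round disc of radius R about p0 + e^w, where the
    distortion lemmas apply. As R' >= 2 R, the disc lies beyond R; the fixed point z0 does not, so
    it is omitted by all the branches. *)
Definition is_disc (q : nat -> C -> C) (w : C) (h : nat -> C -> C) : Prop :=
  forall n, ball_section (iter n f) (expp w) R (h n) /\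
    (forall z, Cmod (z - expp w) < R -> itd f f' n (h n z) <> 0%C) /\
    omits (h n) (expp w) R z0 /\
    (forall w2, Cmod (w2 - w) < lrad w -> h n (expp w2) = q n w2).

Lemma far_disc w z : HR R' w -> Cmod (z - expp w) < R -> R < Cmod (z - p0).
Proof.
  intros hw hz. apply expp_far in hw; [|lra]. pose proof (Cmod_tri (expp w) z p0).
  rewrite (Cmod_sym (expp w) z) in H. lra.
Qed.

Lemma disc_exists q w : towerR q -> HR R' w -> exists h, is_disc q w h.
Proof.
  intros tq hw. assert (hw1 : HR R w) by (apply HR_mono with R'; auto; lra).
  assert (b0 : ballC (expp w) R (expp w)) by (unfold ballC; rewrite Cmod_sub_eq; lra).
  destruct (tower_exists f f' (ballC (expp w) R) (fun z => z) (expp w) (fun n => q n w) Hf) as [h [th Eh]]; auto.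
  - apply convex_ball.
  - intros. apply cwi_id.
  - intros z hz. apply hP. apply far_disc with w; auto.
  - apply tq. auto.
  - eapply tower_backorbit; eauto.
  - exists h. intros n.
    assert (sec : forall z, ballC (expp w) R z -> iter n f (h n z) = z).
    { intros z hz. apply (tower_iter _ _ _ h n z th hz). }
    split; [|split; [|split]].
    + intros z hz. split; [|apply sec; auto]. apply cwi_ball_cts with (expp w) R; auto. apply th. auto.
    + intros z hz. apply itd_neq_0; auto. rewrite sec by auto. apply hP. apply far_disc with w; auto.
    + intros z hz E. assert (e := sec z hz). rewrite E, iter_fix in e by auto. subst z.
      apply far_disc in hz; auto. lra.
    + intros w2 hw2.
      assert (inb : forall v, ballC w (lrad w) v -> ballC (expp w) R (expp v)).
      { intros v hv. unfold ballC. apply lrad_move in hv; auto. lra. }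
      assert (HRv : forall v, ballC w (lrad w) v -> HR R v).
      { intros v hv. apply expp_far; auto. apply far_disc with w; auto. apply inb. auto. }
      apply (section_unique (iter n f) (itd f f' n) (ballC w (lrad w)) w (fun v => h n (expp v)) (q n)).
      * apply is_deriv_iter. auto.
      * apply convex_ball.
      * unfold ballC. rewrite Cmod_sub_eq. apply lrad_pos.
      * intros v hv. apply (cwi_comp dC dC _ (ballC (expp w) R)); auto.
        -- apply (cts_cwi (ballC w (lrad w)) expp v). apply expp_cts.
        -- apply th. auto.
      * intros v hv. eapply cwi_sub; [exact HRv|]. apply tq. auto.
      * intros v hv. rewrite sec by auto. symmetry. apply (tower_iter _ _ _ q n v tq). auto.
      * intros v hv. apply itd_neq_0; auto. rewrite sec by auto. apply hP. apply far_disc with w; auto.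
        apply inb; auto.
      * apply Eh.
      * exact hw2.
Qed.

(** One fixed choice for each tower and centre, so that [small] speaks of a definite branch. *)
Definition tdisc (q : nat -> C -> C) (w : C) : nat -> C -> C :=
  epsilon (inhabits (fun _ z => z)) (is_disc q w).

Lemma disc_spec q w : towerR q -> HR R' w -> is_disc q w (tdisc q w).
Proof. intros h1 h2. unfold tdisc. apply epsilon_spec. apply disc_exists; auto. Qed.

Lemma disc_center q w n : towerR q -> HR R' w -> tdisc q w n (expp w) = q n w.
Proof.
  intros h1 h2. apply (disc_spec q w h1 h2). rewrite Cmod_sub_eq. apply lrad_pos.
Qed.

Lemma growth_step q n w w2 : towerR q -> HR R' w -> Cmod (w2 - w) < lrad w ->
  Cmod (q n w2 - z0) <= Kd * Cmod (q n w - z0).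
Proof.
  intros tq hw h. destruct (disc_spec q w tq hw n) as (s & nz & om & E).
  rewrite <- (E w2 h), <- (disc_center q w n tq hw).
  apply (growth (iter n f) (itd f f' n) (expp w) R); auto using is_deriv_iter.
  apply lrad_move; auto.
Qed.

(** An omitted value close to the centre stands for a small image: [growth], applied with that
    value, confines the image of the half disc. Unlike a diameter it passes to neighbouring discs by
    [omit_transfer]. *)
Definition small (q : nat -> C -> C) (n : nat) (w : C) e : Prop :=
  exists v, omits (tdisc q w n) (expp w) R v /\ Cmod (v - q n w) <= e.

Lemma small_step q n w w2 e : towerR q -> HR R' w -> HR R' w2 -> Cmod (w2 - w) < lrad w -> small q n w e ->
  small q n w2 (2000 * Kd * e) /\ Cmod (q n w2 - q n w) <= (Kd + 1) * e.
Proof.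
  intros tq hw hw2 h [v [om hv]]. destruct (disc_spec q w tq hw n) as (s & nz & _ & E).
  destruct (disc_spec q w2 tq hw2 n) as (s2 & nz2 & _ & _).
  assert (c := disc_center q w n tq hw). assert (c2 := disc_center q w2 n tq hw2).
  assert (mv := lrad_move w w2 hw h). pose proof Kd_ge_1. split.
  - destruct (omit_transfer (iter n f) (itd f f' n) (expp w) (expp w2) R (tdisc q w n) (tdisc q w2 n) v)
      as [v2 [o2 h2]]; auto using is_deriv_iter.
    { rewrite (E w2 h). auto. }
    exists v2. split; auto. rewrite <- c2. eapply Rle_trans; [exact h2|].
    rewrite c, Cmod_sym. apply Rmult_le_compat_l; lra.
  - assert (g := growth (iter n f) (itd f f' n) (expp w) R (tdisc q w n) v (is_deriv_iter f f' n Hf) hR s nz om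
      (expp w2) mv). rewrite c, (E w2 h) in g.
    pose proof (Cmod_tri (q n w2) v (q n w)). rewrite (Cmod_sym (q n w) v) in g.
    assert (Kd * Cmod (v - q n w) <= Kd * e) by (apply Rmult_le_compat_l; lra). lra.
Qed.

(* m steps of length less than lrad lead from w to w'; E bounds exp (Re) on the segment. *)
Definition reach (m : nat) E (w w' : C) : Prop :=
  HR R' w /\ HR R' w' /\ exp (fst w) <= E /\ exp (fst w') <= E /\ Cmod (w' - w) * (6 * E) < INR m * R.

(** The last of m + 2 equal parts of the segment is split off; the bound [E] makes each part shorter
    than the local radius. *)
Lemma reach_step m E w w' : reach (S (S m)) E w w' -> exists w2, reach (S m) E w w2 /\ HR R' w2 /\ HR R' w' /\ Cmod (w' - w2) < lrad w2.
Proof.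
  intros (h1 & h2 & h3 & h4 & h5). set (t := INR (S m) / INR (S (S m))).
  assert (pS : 0 < INR (S m)) by (apply lt_0_INR; lia).
  assert (pSS : INR (S (S m)) = INR (S m) + 1) by (rewrite (S_INR (S m)); auto).
  assert (t0 : 0 < t) by (apply Rdiv_lt_0_compat; lra).
  assert (tE : t * (INR (S m) + 1) = INR (S m)) by (unfold t; rewrite pSS; field; lra).
  assert (t1 : t < 1) by nra.
  set (w2 := seg w w' t). assert (hw2 : HR R' w2) by (apply convex_HR; auto; lra).
  assert (e2 : exp (fst w2) <= E).
  { assert (k1 : fst w2 <= Rmax (fst w) (fst w')).
    { unfold w2, seg. simpl. pose proof (Rmax_l (fst w) (fst w')). pose proof (Rmax_r (fst w) (fst w')). nra. }
    eapply Rle_trans; [apply exp_le_mono; exact k1|]. apply Rmax_case; auto. }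
  exists w2. 
  assert (d1 : Cmod (w2 - w) = t * Cmod (w' - w)).
  { pose proof (seg_dist w w' t 0) as k. rewrite seg_0, Rminus_0_r, Rabs_pos_eq in k; [exact k|lra]. }
  assert (d2 : Cmod (w' - w2) = (1 - t) * Cmod (w' - w)).
  { pose proof (seg_dist w w' 1 t) as k. rewrite seg_1, Rabs_pos_eq in k; [exact k|lra]. }
  rewrite pSS in h5. split; [|split; [auto|split; auto]].
  - repeat split; auto. rewrite d1.
    assert (k : t * (Cmod (w' - w) * (6 * E)) < t * ((INR (S m) + 1) * R)) by (apply Rmult_lt_compat_l; auto).
    replace (t * ((INR (S m) + 1) * R)) with (t * (INR (S m) + 1) * R) in k by ring. rewrite tE in k. lra.
  - rewrite d2. unfold lrad. pose proof (exp_pos (fst w2)).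
    apply Rmult_lt_reg_r with (6 * exp (fst w2)); [lra|].
    replace (R / (6 * exp (fst w2)) * (6 * exp (fst w2))) with R by (field; lra).
    assert (k : (1 - t) * (Cmod (w' - w) * (6 * E)) < (1 - t) * ((INR (S m) + 1) * R)) by (apply Rmult_lt_compat_l; lra).
    replace ((1 - t) * ((INR (S m) + 1) * R)) with R in k.
    2:{ transitivity ((INR (S m) + 1) * R - t * (INR (S m) + 1) * R); [rewrite tE; ring|ring]. }
    eapply Rle_lt_trans; [|exact k]. rewrite <- (Rmult_assoc (1 - t)).
    apply Rmult_le_compat_l; [|lra]. apply Rmult_le_pos; [lra|apply Cmod_ge_0].
Qed.

Lemma reach_one E w w' : reach 1 E w w' -> Cmod (w' - w) < lrad w.
Proof.
  intros (h1 & h2 & h3 & h4 & h5). simpl in h5. unfold lrad. pose proof (exp_pos (fst w)).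
  apply Rmult_lt_reg_r with (6 * exp (fst w)); [lra|].
  replace (R / (6 * exp (fst w)) * (6 * exp (fst w))) with R by (field; lra).
  pose proof (Cmod_ge_0 (w' - w)). nra.
Qed.

Lemma reach_exists E L : exists m, forall w w', HR R' w -> HR R' w' -> exp (fst w) <= E -> exp (fst w') <= E ->
  Cmod (w' - w) <= L -> reach (S m) E w w'.
Proof.
  destruct (INR_unbounded (L * (6 * E) / R)) as [m hm]. exists m.
  intros w w' h1 h2 h3 h4 h5. repeat split; auto.
  assert (pE : 0 < E) by (pose proof (exp_pos (fst w)); lra).
  apply Rle_lt_trans with (L * (6 * E)).
  - apply Rmult_le_compat_r; lra.
  - rewrite S_INR. apply Rmult_lt_compat_r with (r := R) in hm; auto. unfold Rdiv in hm.
    rewrite Rmult_assoc, Rinv_l in hm by lra. lra.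
Qed.

Lemma growth_reach m E : exists c, 1 <= c /\ forall q n w w', towerR q -> reach (S m) E w w' ->
  Cmod (q n w' - z0) <= c * Cmod (q n w - z0).
Proof.
  pose proof Kd_ge_1 as K1. induction m as [|m [c [c0 IH]]].
  - exists Kd. split; auto. intros q n w w' tq h. apply growth_step; auto; [apply h|]. eapply reach_one; eauto.
  - exists (Kd * c). split; [nra|]. intros q n w w' tq h.
    destruct (reach_step m E w w' h) as (w2 & r & h2 & h' & hd).
    eapply Rle_trans; [apply (growth_step q n w2 w'); auto|]. rewrite Rmult_assoc. apply Rmult_le_compat_l; [lra|].
    apply IH; auto.
Qed.

Lemma small_mono q n w e e' : e <= e' -> small q n w e -> small q n w e'.
Proof. intros h [v [h1 h2]]. exists v. split; auto. lra. Qed.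

Lemma small_reach m E : exists c, 0 < c /\ forall q n w w' e, 0 <= e -> towerR q -> reach (S m) E w w' ->
  small q n w e -> small q n w' (c * e) /\ Cmod (q n w' - q n w) <= c * e.
Proof.
  pose proof Kd_ge_1 as K1. induction m as [|m [c [c0 IH]]].
  - exists (2000 * Kd). split; [lra|]. intros q n w w' e he tq h s.
    assert (hr := reach_one _ _ _ h). destruct h as (h1 & h2 & _).
    destruct (small_step q n w w' e) as [s2 d]; auto. split; auto. eapply Rle_trans; [exact d|].
    apply Rmult_le_compat_r; lra.
  - exists (2000 * Kd * c + (Kd + 1) * c + c). split; [nra|]. intros q n w w' e he tq h s.
    destruct (reach_step m E w w' h) as (w2 & r & h2 & h' & hd).
    destruct (IH q n w w2 e he tq r s) as [s2 d2].
    destruct (small_step q n w2 w' (c * e)) as [s3 d3]; auto.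
    assert (0 <= c * e) by nra. split.
    + eapply small_mono; [|exact s3]. nra.
    + pose proof (Cmod_tri (q n w') (q n w2) (q n w)). nra.
Qed.

(** The growth factor between two fixed points of the half-plane does not depend on the index n, so
    convergence to z0 spreads. *)
Lemma towerR_conv q w w' : towerR q -> HR R' w -> HR R' w' ->
  (forall e, e > 0 -> exists N, forall n, (N <= n)%nat -> Cmod (q n w - z0) < e) ->
  (forall e, e > 0 -> exists N, forall n, (N <= n)%nat -> Cmod (q n w' - z0) < e).
Proof.
  intros tq h h' H e he.
  destruct (reach_exists (Rmax (exp (fst w)) (exp (fst w'))) (Cmod (w' - w))) as [m hm].
  assert (r := hm w w' h h' (Rmax_l _ _) (Rmax_r _ _) (Rle_refl _)).
  destruct (growth_reach m (Rmax (exp (fst w)) (exp (fst w')))) as [c [c1 hc]].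
  destruct (H (e / c)) as [N HN]; [apply Rdiv_lt_0_compat; lra|]. exists N. intros n hn.
  eapply Rle_lt_trans; [apply hc; eauto|]. specialize (HN n hn).
  apply Rmult_lt_compat_l with (r := c) in HN; [|lra].
  replace (c * (e / c)) with e in HN by (field; lra). auto.
Qed.

(* If sections h_k and h_l of f^k and f^l covered e-discs with nearby centres p_k, p_l, then p_k would
   lie in h_l(disc), hence f^{l-k}(y) in the disc about y, although y escapes. *)
Lemma escaping_small y M e N0 : (forall m, (N0 <= m)%nat -> ~ Cmod (iter m f y - y) < R) -> e > 0 ->
  exists N, forall n h, (N <= n)%nat -> ball_section (iter n f) y R h -> Cmod (h y) <= M ->
  exists v, omits h y R v /\ Cmod (v - h y) <= e.
Proof.
  intros esc he. apply NNPP. intros no.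
  assert (ex : forall N, exists n h, (N <= n)%nat /\ ball_section (iter n f) y R h /\ Cmod (h y) <= M /\
     forall v, Cmod (v - h y) <= e -> exists z, Cmod (z - y) < R /\ h z = v).
  { intros N. apply NNPP. intros n1. apply no. exists N. intros n h hn hs hM. apply NNPP. intros n2. apply n1.
    exists n, h. repeat split; auto; try apply hs; auto. intros v hv. apply NNPP. intros n3. apply n2. exists v. split; auto.
    intros z hz E. apply n3. eauto. }
  set (P := fun (N : nat) (p : nat * (C -> C)) => (N <= fst p)%nat /\ ball_section (iter (fst p) f) y R (snd p) /\ Cmod (snd p y) <= M /\
     forall v, Cmod (v - snd p y) <= e -> exists z, Cmod (z - y) < R /\ snd p z = v).
  assert (ex' : forall N, exists p, P N p).
  { intros N. destruct (ex N) as (n & h & H). exists (n, h). exact H. }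
  set (s := fun N => proj1_sig (constructive_indefinite_description _ (ex' N))).
  assert (hs : forall N, P N (s N)) by (intros N; unfold s; destruct constructive_indefinite_description; auto).
  destruct (bounded_cluster (fun N => snd (s N) y) M) as [l Hl]; [intros N; apply hs|].
  destruct (Hl (e / 2) 0%nat) as [i [_ hi]]; [lra|].
  destruct (Hl (e / 2) (fst (s i) + N0)%nat) as [j [hj hj']]; [lra|].
  destruct (hs i) as (i1 & i2 & i3 & i4). destruct (hs j) as (j1 & j2 & j3 & j4).
  destruct (j4 (snd (s i) y)) as [z [hz Ez]].
  { pose proof (Cmod_tri (snd (s i) y) l (snd (s j) y)). rewrite (Cmod_sym l (snd (s j) y)) in H. lra. }
  apply (esc (fst (s j) - fst (s i))%nat); [lia|].
  assert (yy : Cmod (y - y) < R) by (rewrite Cmod_sub_eq; lra).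
  replace (iter (fst (s j) - fst (s i)) f y) with z; auto.
  rewrite <- (proj2 (j2 z hz)), Ez. rewrite <- (proj2 (i2 y yy)) at 2. rewrite <- iter_add. f_equal. lia.
Qed.

Lemma log_near (y w : C) : y <> p0 -> exists w', expp w' = y /\ Rabs (snd w' - snd w) <= 2 * PI.
Proof.
  intros n. destruct (Cexp_surj (y - p0)%C) as [u Eu].
  { apply Csub_neq_0. auto. }
  pose proof PI_RGT_0 as pp. set (k := up ((snd w - snd u) / (2 * PI))).
  destruct (archimed ((snd w - snd u) / (2 * PI))) as [a1 a2]. fold k in a1, a2.
  exists (u + twopii k)%C. split.
  - unfold expp. rewrite Cexp_plus, Cexp_twopii, Eu. ring.
  - simpl. set (x := (snd w - snd u) / (2 * PI)) in *.
    assert (Ex : snd w - snd u = x * (2 * PI)) by (unfold x; field; lra).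
    apply Rabs_le. nra.
Qed.

(** The point w may lie at any height, so the logarithm u of [y] is taken within 2 pi of it; the
    distances are then at most [L] and the constants uniform. Growth bounds [q n u],
    [escaping_small] gives an omitted value near it, and smallness returns to w and w'. *)
Lemma tower_shrink y N0 Rs e : R' < Cmod (y - p0) -> (forall m, (N0 <= m)%nat -> ~ Cmod (iter m f y - y) < R) -> e > 0 ->
  exists N, forall q n w w', (N <= n)%nat -> towerR q -> HR R' w -> HR R' w' -> exp (fst w) <= Rs -> exp (fst w') <= Rs ->
    snd w' = snd w -> Cmod (q n w - z0) <= 1 -> Cmod (q n w' - q n w) <= e.
Proof.
  intros hy esc he. set (E := Rmax Rs (Cmod (y - p0))).
  assert (E1 : Rs <= E) by apply Rmax_l. assert (E2 : Cmod (y - p0) <= E) by apply Rmax_r.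
  set (L := (ln E - ln R') + 2 * PI).
  destruct (reach_exists E L) as [m hm].
  destruct (growth_reach m E) as [c1 [hc1 Hc1]].
  destruct (small_reach m E) as [c2 [hc2 Hc2]].
  destruct (escaping_small y (c1 + Cmod z0) (e / (c2 + c2)) N0 esc) as [N HN].
  { apply Rdiv_lt_0_compat; lra. }
  exists N. intros q n w w' hn tq hw hw' ew ew' Ew hq.
  destruct (log_near y w) as [u [Eu hu]].
  { intros ->. rewrite Cmod_sub_eq in hy. lra. }
  assert (hu' : HR R' u) by (apply expp_far; [lra|rewrite Eu; auto]).
  assert (eu : exp (fst u) <= E) by (rewrite <- expp_mod, Eu; auto).
  pose proof (exp_pos (fst w)) as pw.
  assert (lnb : forall v, HR R' v -> exp (fst v) <= E -> ln R' < fst v <= ln E).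
  { intros v h1 h2. split; [exact h1|]. rewrite <- (ln_exp (fst v)). destruct (Rle_lt_or_eq_dec _ _ h2) as [l|l].
    - left. apply ln_increasing; auto. apply exp_pos.
    - rewrite l. lra. }
  assert (dist : forall v v', HR R' v -> HR R' v' -> exp (fst v) <= E -> exp (fst v') <= E -> Rabs (snd v' - snd v) <= 2 * PI -> Cmod (v' - v) <= L).
  { intros v v' h1 h2 h3 h4 h5. eapply Rle_trans; [apply Cmod_le_abs|]. simpl.
    apply Rplus_le_compat; [|exact h5]. pose proof (lnb v h1 h3). pose proof (lnb v' h2 h4).
    apply Rabs_le. lra. }
  assert (r1 : reach (S m) E w u) by (apply hm; auto; try lra; apply dist; auto; lra).
  assert (r2 : reach (S m) E u w) by (apply hm; auto; try lra; apply dist; auto; [lra|rewrite Rabs_minus_sym; auto]).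
  pose proof PI_RGT_0.
  assert (r3 : reach (S m) E u w').
  { apply hm; auto; try lra; apply dist; auto; [lra|]. rewrite Ew, Rabs_minus_sym. auto. }
  assert (g := Hc1 q n w u tq r1).
  assert (cu := disc_center q u n tq hu'). rewrite Eu in cu.
  destruct (disc_spec q u tq hu' n) as (su & _ & _ & _). rewrite Eu in su.
  destruct (HN n (tdisc q u n) hn su) as [v [hv1 hv2]].
  { rewrite cu. pose proof (Cmod_le_add (q n u) z0).
    assert (c1 * Cmod (q n w - z0) <= c1 * 1) by (apply Rmult_le_compat_l; lra). lra. }
  assert (sm : small q n u (e / (c2 + c2))).
  { exists v. rewrite Eu. rewrite cu in hv2. auto. }
  assert (pe : 0 <= e / (c2 + c2)) by (left; apply Rdiv_lt_0_compat; lra).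
  destruct (Hc2 q n u w _ pe tq r2 sm) as [_ d1].
  destruct (Hc2 q n u w' _ pe tq r3 sm) as [_ d2].
  replace (c2 * (e / (c2 + c2))) with (e / 2) in d1, d2 by (field; lra).
  pose proof (Cmod_tri (q n w') (q n u) (q n w)). rewrite (Cmod_sym (q n u) (q n w)) in H0. lra.
Qed.
End Far.

(** * Power series at a fixed point *)

Fixpoint pw (z : C) (n : nat) : C := match n with O => 1%C | S k => (z * pw z k)%C end.

Lemma pw_mult a b n : pw (a * b) n = (pw a n * pw b n)%C.
Proof. induction n as [|n IH]; simpl; [ring|]. rewrite IH. ring. Qed.

Lemma pw_neq_0 (z : C) n : z <> 0%C -> pw z n <> 0%C.
Proof. intros h. induction n as [|n IH]; cbn [pw]; [apply C1_nz|]. apply Cmult_neq_0; [exact h|exact IH]. Qed.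

Lemma Cmod_pw z n : Cmod (pw z n) = Cmod z ^ n.
Proof. induction n as [|n IH]; simpl; [apply Cmod_1|]. rewrite Cmod_mult, IH. auto. Qed.

Lemma pw_Cexp w n : pw (Cexp w) n = Cexp (INR n * w)%C.
Proof.
  induction n as [|n IH]; [simpl; rewrite <- Cexp_0; f_equal; ring|].
  rewrite S_INR. cbn [pw]. rewrite IH, <- Cexp_plus. f_equal. rewrite RtoC_plus. ring.
Qed.

Lemma cts_pw f n z : cts f z -> cts (fun y => pw (f y) n) z.
Proof.
  intros h. induction n as [|n IH]; simpl; [apply cwi_const|]. apply cwi_mult; auto.
Qed.

(** The quotient has value H'(0) and derivative H''(0) / 2 at 0, by the mean value inequality for
    the second-order remainder. *)
Lemma divide_entire H H' : is_deriv H H' -> H 0%C = 0%C ->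
  exists H1 H1', is_deriv H1 H1' /\ forall t, H t = (t * H1 t)%C.
Proof.
  intros hH h0. destruct (deriv_differentiable H H' hH) as [H2 hH2].
  set (H1 := fun t : C => if excluded_middle_informative (t = 0%C) then H' 0%C else (H t / t)%C).
  assert (E : forall t, H t = (t * H1 t)%C).
  { intros t. unfold H1. destruct excluded_middle_informative as [->|n]; [rewrite h0; ring|]. field. auto. }
  assert (D : forall t, exists L, cd H1 t L).
  { intros t. destruct (classic (t = 0%C)) as [->|n].
    - exists (H2 0 / 2)%C. intros e he. destruct (hH2 0%C e he) as [r [hr Hr]]. exists r. split; auto.
      intros w hw. unfold H1 at 2. destruct excluded_middle_informative as [_|n0]; [|contradiction].
      destruct (classic (w = 0%C)) as [->|nw].
      { unfold H1. destruct excluded_middle_informative as [_|n0]; [|contradiction].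
        replace (H' 0 - H' 0 - H2 0 / 2 * (0 - 0))%C with (RtoC 0) by field.
        rewrite Cmod_0. apply Rmult_le_pos; [lra|apply Cmod_ge_0]. }
      assert (mv : Cmod ((H w - H' 0 * w - H2 0 / 2 * (w * w)) - (H 0 - H' 0 * 0 - H2 0 / 2 * (0 * 0)))%C <= (e * Cmod w) * Cmod (w - 0)).
      { apply (mean_value (fun w => H w - H' 0 * w - H2 0 / 2 * (w * w))%C (fun w => H' w - H' 0 - H2 0 * w)%C 0 w).
        - intros s hs. eapply cd_eq.
          + apply cd_minus; [apply cd_minus; [apply hH|]|].
            * apply (cd_scal (H' 0%C) (fun w => w)). apply cd_id.
            * apply (cd_scal (H2 0 / 2)%C (fun w => w * w)%C). apply (cd_mult (fun w => w) (fun w => w)); apply cd_id.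
          + field.
        - intros s hs. 
          assert (ls : Cmod (seg 0 w s) <= Cmod w).
          { unfold seg. replace (0 + s * (w - 0))%C with (s * w)%C by ring. rewrite Cmod_mult, Cmod_R, Rabs_pos_eq by lra.
            pose proof (Cmod_ge_0 w). nra. }
          replace (w - 0)%C with w in hw by ring.
          assert (k := Hr (seg 0 w s)). replace (seg 0 w s - 0)%C with (seg 0 w s) in k by ring.
          eapply Rle_trans; [apply k; lra|]. apply Rmult_le_compat_l; lra. }
      assert (pw0 := proj1 (Cmod_gt_0 _) nw).
      replace (H1 w - H' 0 - H2 0 / 2 * (w - 0))%C with ((H w - H' 0 * w - H2 0 / 2 * (w * w)) / w)%C.
      2:{ rewrite (E w). field. auto. }
      rewrite Cmod_div by auto. replace (w - 0)%C with w in * by ring.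
      replace (H w - H' 0 * w - H2 0 / 2 * (w * w) - (H 0 - H' 0 * 0 - H2 0 / 2 * (0 * 0)))%C with
        (H w - H' 0 * w - H2 0 / 2 * (w * w))%C in mv by (rewrite h0; ring).
      apply Rmult_le_reg_r with (Cmod w); auto. unfold Rdiv. rewrite Rmult_assoc, Rinv_l, Rmult_1_r by lra. auto.
    - eexists. apply (cd_ext_loc (fun w => H w * / w)%C H1 t _ (Cmod t)).
      + apply Cmod_gt_0. auto.
      + intros w hw. unfold H1. destruct excluded_middle_informative as [->|nw]; auto.
        exfalso. replace (0 - t)%C with (- t)%C in hw by ring. rewrite Cmod_opp in hw. lra.
      + apply cd_mult; [apply hH|]. apply (cd_inv (fun w => w)); [apply cd_id|auto]. }
  exists H1, (fun t => proj1_sig (constructive_indefinite_description _ (D t))). split; auto.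
  intros t. destruct constructive_indefinite_description. auto.
Qed.

(** Were H divisible by every power, H = z^n g, then on the circle of radius 3 |t| about t, where
    |z| >= 2 |t|, one has |g| <= M / (2 |t|)^n. The mean value bound gives |H t| <= M / 2^n for all
    n. *)
Lemma entire_order H H' : is_deriv H H' -> (exists t, H t <> 0%C) ->
  exists n g g', is_deriv g g' /\ g 0%C <> 0%C /\ forall t, H t = (pw t n * g t)%C.
Proof.
  intros hH [t ht]. apply NNPP. intros no.
  assert (all : forall n, exists g g', is_deriv g g' /\ forall t, H t = (pw t n * g t)%C).
  { induction n as [|n (g & g' & h1 & h2)].
    - exists H, H'. split; auto. intros s. simpl. ring.
    - destruct (classic (g 0%C = 0%C)) as [z|nz].
      + destruct (divide_entire g g' h1 z) as (g1 & g1' & k1 & k2). exists g1, g1'. split; auto.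
        intros s. rewrite h2, k2. simpl. ring.
      + exfalso. apply no. exists n, g, g'. auto. }
  destruct (classic (t = 0%C)) as [->|nt].
  { apply no. exists 0%nat, H, H'. split; auto. split; auto. intros s. simpl. ring. }
  assert (pt := proj1 (Cmod_gt_0 _) nt).
  destruct (cts_bounded H 0%C (4 * Cmod t) (is_deriv_cts _ _ hH)) as [M HM].
  assert (M0 : 0 <= M).
  { eapply Rle_trans; [apply Cmod_ge_0|apply (HM 0%C)]. rewrite Cmod_sub_eq. lra. }
  assert (bd : forall n, Cmod (H t) <= M * (/ 2) ^ n).
  { intros n. destruct (all n) as (g & g' & h1 & h2).
    assert (p2 : 0 < (2 * Cmod t) ^ n) by (apply pow_lt; lra).
    assert (gb : Cmod (g t) <= M / (2 * Cmod t) ^ n).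
    { apply (mean_value_punctured g t (g t) (4 * Cmod t) (3 * Cmod t)); [lra| | |].
      - intros z _. eexists. apply h1.
      - intros e he. destruct (is_deriv_cts _ _ h1 t e he) as [d [hd Hd]]. exists d. split; auto.
        intros z hz. left. apply (Hd z I). apply hz.
      - intros z hz. 
        assert (z2 : 2 * Cmod t <= Cmod z).
        { pose proof (Cmod_tri z 0 t). replace (z - 0)%C with z in H0 by ring. replace (0 - t)%C with (- t)%C in H0 by ring.
          rewrite Cmod_opp in H0. lra. }
        assert (z4 : Cmod z <= 4 * Cmod t) by (pose proof (Cmod_le_add z t); lra).
        assert (hz' := HM z). rewrite h2, Cmod_mult, Cmod_pw in hz'. replace (z - 0)%C with z in hz' by ring. specialize (hz' z4).
        assert (le : (2 * Cmod t) ^ n <= Cmod z ^ n) by (apply pow_incr; lra).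
        apply Rmult_le_reg_r with ((2 * Cmod t) ^ n); auto. unfold Rdiv. rewrite Rmult_assoc, Rinv_l, Rmult_1_r by lra.
        eapply Rle_trans; [|exact hz']. rewrite Rmult_comm. apply Rmult_le_compat_r; auto. apply Cmod_ge_0. }
    rewrite h2, Cmod_mult, Cmod_pw. 
    apply Rle_trans with (Cmod t ^ n * (M / (2 * Cmod t) ^ n)).
    - apply Rmult_le_compat_l; auto. apply pow_le. lra.
    - right. rewrite Rpow_mult_distr, pow_inv. field. split; apply pow_nonzero; lra. }
  assert (p := proj1 (Cmod_gt_0 _) ht).
  destruct (pow_lt_1_zero (/ 2) ltac:(rewrite Rabs_pos_eq; lra) (Cmod (H t) / (M + 1))) as [N HN].
  { apply Rdiv_lt_0_compat; lra. }
  specialize (HN N (Nat.le_refl _)). specialize (bd N). rewrite Rabs_pos_eq in HN by (apply pow_le; lra).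
  assert (0 < (/ 2) ^ N) by (apply pow_lt; lra).
  apply Rmult_lt_compat_r with (r := M + 1) in HN; [|lra].
  replace (Cmod (H t) / (M + 1) * (M + 1)) with (Cmod (H t)) in HN by (field; lra). nra.
Qed.

Lemma parabolic_expansion F F' z0 : is_deriv F F' -> F z0 = z0 -> F' z0 = 1%C -> (exists z, F z <> z) ->
  exists m g g', (1 <= m)%nat /\ is_deriv g g' /\ g 0%C <> 0%C /\ forall t, F (z0 + t)%C = (z0 + t + pw t (S m) * g t)%C.
Proof.
  intros hF e0 d0 [z nz]. set (H := fun t => (F (t + z0) - t - z0)%C).
  assert (hH : is_deriv H (fun t => F' (t + z0) - 1 - 0)%C).
  { intros t. apply cd_minus; [apply cd_minus|apply cd_const]; [apply (cd_shift F); apply hF|apply cd_id]. }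
  destruct (entire_order H _ hH) as (n & g & g' & h1 & h2 & h3).
  { exists (z - z0)%C. unfold H. intros E. apply nz. replace (z - z0 + z0)%C with z in E by ring.
    transitivity (F z - (z - z0) - z0 + z)%C; [ring|]. rewrite E. ring. }
  assert (H0 : H 0%C = 0%C). { unfold H. rewrite Cplus_0_l, e0. ring. }
  destruct n as [|[|m]].
  - exfalso. apply h2. rewrite h3 in H0. transitivity (pw 0 0 * g 0)%C; [simpl; ring|exact H0].
  - exfalso. apply h2.
    assert (k : cd H 0 (1 * g 0%C + 0 * g' 0%C)%C).
    { apply (cd_ext_loc (fun t => t * g t)%C H 0 _ 1); [lra| |].
      - intros w _. rewrite h3. simpl. ring.
      - apply cd_mult; [apply cd_id|apply h1]. }
    assert (k2 := cd_unique _ _ _ _ k (hH 0%C)). rewrite Cplus_0_l, d0 in k2.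
    transitivity (1 * g 0 + 0 * g' 0)%C; [ring|]. rewrite k2. ring.
  - exists (S m), g, g'. split; [lia|]. split; auto. split; auto. intros t.
    rewrite <- h3. unfold H. rewrite (Cplus_comm z0 t). ring.
Qed.

(** * Repelling sectors *)

Definition tends (x : nat -> C) (l : C) : Prop :=
  forall e, e > 0 -> exists N, forall n, (N <= n)%nat -> Cmod (x n - l) < e.

Lemma iter_near f f' z0 q e : is_deriv f f' -> f z0 = z0 -> e > 0 ->
  exists r, r > 0 /\ forall i z, (i <= q)%nat -> Cmod (z - z0) < r -> Cmod (iter i f z - z0) < e.
Proof.
  intros H E he. induction q as [|q [r [hr Hr]]].
  - exists e. split; auto. intros i z hi hz. replace i with 0%nat by lia. exact hz.
  - destruct (iter_cts f f' (S q) H z0 e he) as [d [hd Hd]].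
    exists (Rmin r d). split; [apply Rmin_pos; lra|]. intros i z hi hz.
    destruct (Nat.eq_dec i (S q)) as [->|n].
    + rewrite <- (iter_fix f (S q) z0 E). apply Hd; [exact I|].
      apply Rlt_le_trans with (1 := hz). apply Rmin_r.
    + apply Hr; [lia|]. apply Rlt_le_trans with (1 := hz). apply Rmin_l.
Qed.

(** Uniformly bounded iterates have uniformly bounded derivatives near z0, so entries close to z0
    cannot be carried back to the fixed positive distance of [x 0]. *)
Lemma expel_contra f f' z0 rho M x : is_deriv f f' -> f z0 = z0 -> backorbit f x -> tends x z0 -> x 0%nat <> z0 ->
  rho > 0 -> (forall k v, Cmod (v - z0) < rho -> Cmod (iter k f v - z0) <= M) -> False.
Proof.
  intros H E bx tx nx hr HM. assert (p := Cmod_sub_pos _ _ nx).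
  assert (M0 : 0 <= M).
  { eapply Rle_trans; [apply Cmod_ge_0|apply (HM 0%nat z0)]. rewrite Cmod_sub_eq. lra. }
  set (c := 4 * M / (rho / 2)). assert (c0 : 0 <= c).
  { unfold c. apply Rmult_le_pos; [lra|]. left. apply Rinv_0_lt_compat. lra. }
  assert (db : forall k v, Cmod (v - z0) < rho / 2 -> Cmod (itd f f' k v) <= c).
  { intros k v hv. assert (h2 : 0 < rho / 2) by lra.
    replace (itd f f' k v) with (itd f f' k v - 0)%C by ring.
    apply (cauchy_estimate (fun z => iter k f z - z0)%C v (itd f f' k v - 0) (rho / 2) M h2).
    - intros z _. eexists. apply cd_minus; [apply (is_deriv_iter f f' k H)|apply cd_const].
    - intros z hz. apply HM. pose proof (Cmod_tri z v z0). lra.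
    - apply cd_minus; [apply (is_deriv_iter f f' k H)|apply cd_const]. }
  destruct (tx (Rmin (rho / 2) (Cmod (x 0%nat - z0) / (c + 1)))) as [N HN].
  { apply Rmin_pos; [lra|]. apply Rdiv_lt_0_compat; lra. }
  specialize (HN N (Nat.le_refl _)). assert (h1 := Rlt_le_trans _ _ _ HN (Rmin_l _ _)).
  assert (h2 := Rlt_le_trans _ _ _ HN (Rmin_r _ _)).
  assert (mv : Cmod (iter N f (x N) - iter N f z0) <= c * Cmod (x N - z0)).
  { apply (mean_value (iter N f) (itd f f' N)).
    - intros t _. apply is_deriv_iter. auto.
    - intros t ht. apply db. apply (convex_ball z0 (rho / 2)); auto.
      unfold ballC. rewrite Cmod_sub_eq. lra. }
  rewrite (iter_fix f N z0 E) in mv.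
  assert (k := backorbit_iter f x N 0 bx). rewrite Nat.add_0_r in k. rewrite k in mv.
  apply Rmult_lt_compat_r with (r := c + 1) in h2; [|lra].
  replace (Cmod (x 0%nat - z0) / (c + 1) * (c + 1)) with (Cmod (x 0%nat - z0)) in h2 by (field; lra).
  pose proof (Cmod_ge_0 (x N - z0)). nra.
Qed.

Lemma backorbit_extend f n z x : backorbit f x -> x 0%nat = z ->
  backorbit f (fun j => if le_lt_dec n j then x (j - n)%nat else iter (n - j) f z).
Proof.
  intros bx x0 j. destruct (le_lt_dec n j) as [l|l].
  - destruct (le_lt_dec n (S j)) as [l2|l2]; [|lia]. replace (S j - n)%nat with (S (j - n)) by lia. apply bx.
  - replace (n - j)%nat with (S (n - S j)) by lia. destruct (le_lt_dec n (S j)) as [l2|l2].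
    + replace (S j - n)%nat with 0%nat by lia. replace (n - S j)%nat with 0%nat by lia. rewrite x0. auto.
    + auto.
Qed.

(** Either orbits starting in Q get arbitrarily far, and prefixing one to a backward orbit of its
    starting point gives what is wanted; or all of them are bounded, whence by assumption the
    iterates are bounded on a neighbourhood of z0, against [expel_contra]. *)
Lemma expelled_orbit f f' z0 (Q : C -> Prop) : is_deriv f f' -> f z0 = z0 -> (exists z, Q z /\ z <> z0) ->
  (forall z, Q z -> z <> z0 -> exists x, backorbit f x /\ tends x z0 /\ x 0%nat = z) ->
  (forall M, 1 <= M -> (forall z n, Q z -> Cmod (iter n f z - z0) <= M) ->
     exists rho, rho > 0 /\ forall k v, Cmod (v - z0) < rho -> Cmod (iter k f v - z0) <= M) ->
  forall M, exists x, backorbit f x /\ tends x z0 /\ M < Cmod (x 0%nat - z0).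
Proof.
  intros H E [z1 [q1 n1]] BK H3 M. apply NNPP. intros no.
  assert (all : forall z n, Q z -> Cmod (iter n f z - z0) <= Rmax M 1).
  { intros z n hz. apply Rnot_lt_le. intros l. apply no.
    assert (nz : z <> z0).
    { intros ->. rewrite iter_fix, Cmod_sub_eq in l by auto. pose proof (Rmax_r M 1). lra. }
    destruct (BK z hz nz) as (x & bx & tx & x0).
    exists (fun j => if le_lt_dec n j then x (j - n)%nat else iter (n - j) f z). split; [apply backorbit_extend; auto|].
    split.
    - intros e he. destruct (tx e he) as [N HN]. exists (N + n)%nat. intros j hj.
      destruct (le_lt_dec n j); [apply HN|]; lia.
    - eapply Rle_lt_trans; [apply (Rmax_l M 1)|]. destruct (le_lt_dec n 0) as [l0|l0].
      + replace n with 0%nat in * by lia. simpl in *. rewrite x0. auto.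
      + rewrite Nat.sub_0_r. auto. }
  destruct (H3 (Rmax M 1) (Rmax_r _ _) all) as [rho [hr Hr]].
  destruct (BK z1 q1 n1) as (x & bx & tx & x0).
  apply (expel_contra f f' z0 rho (Rmax M 1) x); auto. rewrite x0. auto.
Qed.

(** The entry f^((q-1) n) (v n) needs no division of n by q, since n + (q - 1) n = q n. *)
Lemma backorbit_of_power f f' z0 q v : is_deriv f f' -> f z0 = z0 -> (1 <= q)%nat -> backorbit (iter q f) v -> tends v z0 ->
  exists x, backorbit f x /\ tends x z0 /\ x 0%nat = v 0%nat.
Proof.
  intros H E hq bv tv. exists (fun n => iter ((q - 1) * n) f (v n)). split; [|split].
  - intros n. rewrite <- (bv n), <- iter_add. change (iter (S ((q - 1) * S n)) f (v (S n)) = iter ((q - 1) * n + q) f (v (S n))).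
    f_equal. nia.
  - intros e he. destruct (iter_near f f' z0 q e H E he) as [r [hr Hr]]. destruct (tv r hr) as [N HN].
    (* Writing (q - 1) n = j q + i with i < q, the entry is f^i (v (n - j)), and n - j >= N. *)
    exists (q * S N)%nat. intros n hn. set (m := ((q - 1) * n)%nat).
    assert (dm := Nat.div_mod_eq m q). assert (um := Nat.mod_upper_bound m q ltac:(lia)).
    set (j := (m / q)%nat) in *. set (i := (m mod q)%nat) in *.
    assert (mj : (j <= n)%nat) by (unfold m in *; nia).
    assert (nj : (N <= n - j)%nat) by (unfold m in *; nia).
    replace m with (i + j * q)%nat by lia. rewrite iter_add, <- iter_mul.
    replace n with (j + (n - j))%nat by lia. rewrite (backorbit_iter (iter q f) v j (n - j) bv).
    apply Hr; [lia|]. apply HN. auto.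
  - rewrite Nat.mul_0_r. auto.
Qed.

(* Q is a repelling sector at z0 (a punctured disc if z0 is repelling): orbits leave Q only through a
   set at definite distance from z0, unless they stay near z0 forever. *)
Definition sector f z0 q (Q : C -> Prop) r1 delta : Prop :=
  (1 <= q)%nat /\ 0 < r1 /\ 0 < delta /\
  (forall z, Q z -> forall i, (i <= q)%nat -> Cmod (iter i f z - z0) < r1 / 2) /\
  (forall z, (forall i, (i <= q)%nat -> Cmod (iter i f z - z0) < r1) -> Q (iter q f z) -> Q z) /\
  (forall z, (forall i, (i <= q)%nat -> Cmod (iter i f z - z0) < r1) -> Q (iter q f z) -> ~ Q (iter (q + q) f z) ->
     (exists n, 1 <= Cmod (iter n f z - z0)) -> forall v, Cmod (v - z) < delta -> Q v) /\
  (forall x, backorbit f x -> tends x z0 -> (forall n, x n <> z0) -> forall N, exists n, (N <= n)%nat /\ Q (x n)).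

(** The source of the initial orbit: it converges to z0 although its first entry may be required to
    lie beyond any given circle. *)
Definition unbounded_back f z0 : Prop :=
  forall M, exists x, backorbit f x /\ tends x z0 /\ M < Cmod (x 0%nat - z0).

(** Here q = 1 and Q is a disc. Distances to z0 grow by a factor mu > 1, so a nearby point with
    image in Q lies in the disc smaller by that factor; the difference of the radii is the margin
    [delta]. *)
Lemma repelling_sector f f' z0 rho0 : is_deriv f f' -> f z0 = z0 -> 1 < Cmod (f' z0) -> rho0 > 0 ->
  (exists q Q r1 delta, sector f z0 q Q r1 delta /\ r1 <= rho0) /\ unbounded_back f z0.
Proof.
  intros H E hl hrho. set (l := Cmod (f' z0)) in *. set (mu := (1 + l) / 2).
  assert (hmu : 1 < mu < l) by (unfold mu; lra).
  destruct (H z0 ((l - 1) / 2)) as [r [hr Hr]]; [lra|].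
  assert (low : forall z, Cmod (z - z0) < r -> mu * Cmod (z - z0) <= Cmod (f z - z0)).
  { intros z hz. specialize (Hr z hz). rewrite E in Hr.
    pose proof (Cmod_tri (f' z0 * (z - z0))%C (f z - z0)%C 0%C) as k.
    replace (f' z0 * (z - z0) - 0)%C with (f' z0 * (z - z0))%C in k by ring.
    replace (f z - z0 - 0)%C with (f z - z0)%C in k by ring.
    rewrite (Cmod_sym (f' z0 * (z - z0))%C), Cmod_mult in k. fold l in k. unfold mu. nra. }
  set (r1 := Rmin rho0 r). assert (hr1 : 0 < r1) by (apply Rmin_pos; lra).
  assert (r1a : r1 <= rho0) by apply Rmin_l. assert (r1b : r1 <= r) by apply Rmin_r.
  destruct (iter_near f f' z0 1 (r1 / 2) H E) as [r2 [hr2 Hr2]]; [lra|].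
  set (Q := fun z => Cmod (z - z0) < r2).
  assert (shrink : forall z, Cmod (z - z0) < r1 -> Q (f z) -> Cmod (z - z0) <= r2 / mu).
  { intros z hz qz. unfold Q in qz. specialize (low z ltac:(lra)).
    apply Rmult_le_reg_r with mu; [lra|]. unfold Rdiv. rewrite Rmult_assoc, Rinv_l by lra. lra. }
  assert (lt2 : r2 / mu < r2).
  { apply Rmult_lt_reg_r with mu; [lra|]. unfold Rdiv. rewrite Rmult_assoc, Rinv_l by lra. nra. }
  split.
  - exists 1%nat, Q, r1, (r2 - r2 / mu). split; [|auto].
    split; [lia|]. split; [auto|]. split; [lra|]. split; [|split; [|split]].
    + intros z hz i hi. apply Hr2; auto.
    + intros z hz qz. assert (k := shrink z (hz 0%nat ltac:(lia)) qz). unfold Q. lra.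
    + intros z hz qz _ _ v hv. assert (k := shrink z (hz 0%nat ltac:(lia)) qz). unfold Q.
      pose proof (Cmod_tri v z z0). lra.
    + intros x bx tx _ N. destruct (tx r2 hr2) as [N' HN]. exists (N + N')%nat. split; [lia|]. apply HN. lia.
  - destruct (inverse_function f f' z0 (Rmin r (r1)) H (deriv_cts f f' H)) as (d & rho & k & hd & hrh & _ & inv).
    { intros Z. unfold l in hl. rewrite Z, Cmod_0 in hl. lra. }
    { apply Rmin_pos; lra. }
    rewrite E in inv. set (s := Rmin rho r2). assert (hs : 0 < s) by (apply Rmin_pos; lra).
    intros M; revert M; refine (expelled_orbit f f' z0 (fun z => Cmod (z - z0) < s) H E _ _ _).
    + exists (z0 + (s / 2)%R)%C. replace (z0 + (s / 2)%R - z0)%C with (RtoC (s / 2)) by ring.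
      rewrite Cmod_R, Rabs_pos_eq by lra. split; [lra|]. intros Z.
      assert (k2 : RtoC (s / 2) = 0%C) by (transitivity ((z0 + (s / 2)%R) - z0)%C; [ring|rewrite Z; ring]).
      apply RtoC_inj in k2. lra.
    + intros z hz _. set (v := fun n => iter n k z).
      assert (v1 : forall n, Cmod (v n - z0) <= s * (/ mu) ^ n /\ Cmod (v n - z0) < s /\ f (v (S n)) = v n).
      { assert (st : forall y, Cmod (y - z0) < s -> f (k y) = y /\ Cmod (k y - z0) <= / mu * Cmod (y - z0)).
        { intros y hy. assert (hy1 := Rlt_le_trans _ _ _ hy (Rmin_l _ _)).
          destruct (inv y hy1) as [i1 i2]. split; auto.
          assert (lw := low (k y)). rewrite i2 in lw. pose proof (Rmin_l r r1).
          apply Rmult_le_reg_l with mu; [lra|]. rewrite <- Rmult_assoc, Rinv_r by lra. lra. }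
        assert (imu : 0 < / mu < 1).
        { split; [apply Rinv_0_lt_compat; lra|]. rewrite <- Rinv_1. apply Rinv_lt_contravar; lra. }
        assert (P : forall n, Cmod (v n - z0) <= s * (/ mu) ^ n /\ Cmod (v n - z0) < s).
        { induction n as [|n [h1 h2]]; simpl; [unfold v; simpl; lra|].
          destruct (st (v n) h2) as [s1 s2]. change (v (S n)) with (k (v n)). pose proof (Cmod_ge_0 (v n - z0)).
          split; nra. }
        intros n. destruct (P n) as [h1 h2]. split; auto. split; auto. apply (st (v n) h2). }
      exists v. split; [|split].
      * intros n. apply v1.
      * intros e he. assert (a1 : Rabs (/ mu) < 1).
        { rewrite Rabs_pos_eq by (left; apply Rinv_0_lt_compat; lra). rewrite <- Rinv_1. apply Rinv_lt_contravar; lra. }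
        assert (a2 : 0 < e / s) by (apply Rdiv_lt_0_compat; lra).
        destruct (pow_lt_1_zero (/ mu) a1 (e / s) a2) as [N HN].
        exists N. intros n hn. specialize (HN n hn). destruct (v1 n) as [h1 _].
        assert (0 < / mu) by (apply Rinv_0_lt_compat; lra).
        rewrite Rabs_pos_eq in HN by (apply pow_le; lra). eapply Rle_lt_trans; [exact h1|].
        apply Rmult_lt_compat_l with (r := s) in HN; auto. replace (s * (e / s)) with e in HN by (field; lra). auto.
      * reflexivity.
    + intros M _ HM. exists s. split; auto.
Qed.

(** * Parabolic petals *)

(** The geometric sum 1 + w + ... + w^(m-1), the quotient of w^m - 1 by w - 1 that remains
    meaningful at w = 1. *)
Fixpoint geo (w : C) (m : nat) : C := match m with O => 0%C | S k => (pw w k + geo w k)%C end.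

Lemma geo_spec w m : ((w - 1) * geo w m = pw w m - 1)%C.
Proof.
  induction m as [|m IH]; cbn [geo pw]; [ring|].
  replace ((w - 1) * (pw w m + geo w m))%C with ((w - 1) * pw w m + (w - 1) * geo w m)%C by ring.
  rewrite IH. ring.
Qed.

Lemma pw_1 m : pw 1 m = 1%C.
Proof. induction m as [|m IH]; cbn [pw]; [auto|]. rewrite IH. ring. Qed.

Lemma geo_1 m : geo 1 m = INR m.
Proof.
  induction m as [|m IH]; [auto|]. rewrite S_INR. cbn [geo]. rewrite IH, pw_1, RtoC_plus. ring.
Qed.

Lemma cts_geo f m z : cts f z -> cts (fun y => geo (f y) m) z.
Proof.
  intros h. induction m as [|m IH]; cbn [geo]; [apply cwi_const|]. apply cwi_plus; auto. apply cts_pw. auto.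
Qed.

Lemma pw_0 m : (1 <= m)%nat -> pw 0 m = 0%C.
Proof. intros h. destruct m; [lia|]. cbn [pw]. ring. Qed.

(** * An approximate Fatou coordinate *)

Section Fatou.
Context (F g : C -> C) (z0 : C) (m : nat).
Context (hm : (1 <= m)%nat) (gc : forall z, cts g z) (g0 : g 0%C <> 0%C)
  (hF : forall t, F (z0 + t)%C = (z0 + t + pw t (S m) * g t)%C).

(* The Fatou coordinate, up to its logarithmic and lower-order terms. *)
Definition fat (z : C) : C := (- / (INR m * g 0 * pw (z - z0) m))%C.

Lemma mC : RtoC (INR m) <> 0%C.
Proof. intros Z. apply RtoC_inj in Z. apply (not_0_INR m); [lia|auto]. Qed.

Lemma fat_den z : z <> z0 -> (INR m * g 0 * pw (z - z0) m)%C <> 0%C.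
Proof.
  intros n. apply Cmult_neq_0; [apply Cmult_neq_0; [apply mC|exact g0]|]. apply pw_neq_0, Csub_neq_0. auto.
Qed.

Lemma fat_cts z : z <> z0 -> cts fat z.
Proof.
  intros n. apply cwi_opp, cwi_inv; [|apply fat_den; auto].
  apply cwi_mult; [apply cwi_const|]. apply cts_pw. apply cwi_minus; [apply cts_id|apply cwi_const].
Qed.

(** With t = z - z0 and F z - z0 = t w(t), the increment of [fat] is g geo(w) / (m g(0) w^m). This
    expression is continuous at t = 0 with value 1, the factors t^m having cancelled. *)
Lemma fat_step : exists rho, rho > 0 /\ forall z, z <> z0 -> Cmod (z - z0) < rho ->
  F z <> z0 /\ Cmod (fat (F z) - fat z - 1) <= 1 / 4.
Proof.
  set (w := fun t : C => (1 + pw t m * g t)%C).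
  set (Phi := fun t : C => (g t * geo (w t) m * / (INR m * g 0 * pw (w t) m))%C).
  assert (wc : forall t, cts w t).
  { intros t. apply cwi_plus; [apply cwi_const|]. apply cwi_mult; auto. apply cts_pw. apply cts_id. }
  assert (w0 : w 0%C = 1%C) by (unfold w; rewrite pw_0; auto; ring).
  assert (Pc : cts Phi 0%C).
  { apply cwi_mult; [apply cwi_mult; [auto|apply cts_geo; auto]|]. apply cwi_inv.
    - apply cwi_mult; [apply cwi_const|apply cts_pw; auto].
    - rewrite w0, pw_1. apply Cmult_neq_0; [apply Cmult_neq_0; [apply mC|exact g0]|apply C1_nz]. }
  assert (P0 : Phi 0%C = 1%C).
  { unfold Phi. rewrite w0, pw_1, geo_1. field. split; [exact g0|exact mC]. }
  destruct (wc 0%C (1 / 2)) as [d1 [hd1 H1]]; [lra|].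
  destruct (Pc (1 / 4)) as [d2 [hd2 H2]]; [lra|].
  exists (Rmin d1 d2). split; [apply Rmin_pos; auto|]. intros z nz hz.
  set (t := (z - z0)%C). assert (nt : t <> 0%C) by (apply Csub_neq_0; auto).
  assert (t1 : dC t 0%C < d1). { unfold dC. replace (t - 0)%C with t by ring. apply Rlt_le_trans with (1 := hz), Rmin_l. }
  assert (t2 : dC t 0%C < d2). { unfold dC. replace (t - 0)%C with t by ring. apply Rlt_le_trans with (1 := hz), Rmin_r. }
  specialize (H1 t I t1). specialize (H2 t I t2). rewrite w0 in H1. rewrite P0 in H2.
  assert (nw : w t <> 0%C).
  { intros Z. rewrite Z in H1. replace (0 - 1)%C with (- (1))%C in H1 by ring. rewrite Cmod_opp, Cmod_1 in H1. lra. }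
  assert (EF : (F z - z0)%C = (t * w t)%C).
  { replace z with (z0 + t)%C at 1 by (unfold t; ring). rewrite hF. unfold w. cbn [pw]. ring. }
  split.
  - intros Z. rewrite Z in EF. assert (k : (t * w t)%C <> 0%C) by (apply Cmult_neq_0; auto). apply k. rewrite <- EF. ring.
  - replace (fat (F z) - fat z - 1)%C with (Phi t - 1)%C; [lra|]. f_equal.
    unfold fat, Phi. rewrite EF. fold t. rewrite pw_mult.
    assert (gs := geo_spec (w t) m). replace (w t - 1)%C with (pw t m * g t)%C in gs by (unfold w; ring).
    assert (nW : pw (w t) m <> 0%C) by (apply pw_neq_0; auto). assert (nT : pw t m <> 0%C) by (apply pw_neq_0; auto).
    assert (nm := mC).
    transitivity ((pw t m * g t * geo (w t) m) / (INR m * g 0 * pw (w t) m * pw t m))%C.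
    + field. repeat split; auto.
    + rewrite gs. field. repeat split; auto.
Qed.

Lemma fat_mod z : z <> z0 -> Cmod (fat z) * (Cmod (INR m * g 0) * Cmod (z - z0) ^ m) = 1.
Proof.
  intros n. assert (d := fat_den z n). unfold fat. rewrite Cmod_opp, Cmod_inv by auto.
  rewrite <- Cmod_pw, <- Cmod_mult. apply Rinv_l. apply Rgt_not_eq, Cmod_gt_0. auto.
Qed.

Lemma fat_A : 0 < Cmod (INR m * g 0)%C.
Proof. apply Cmod_gt_0. apply Cmult_neq_0; [apply mC|exact g0]. Qed.

Lemma fat_large_near r : r > 0 -> exists K, forall z, z <> z0 -> K <= Cmod (fat z) -> Cmod (z - z0) < r.
Proof.
  intros hr. set (A := Cmod (INR m * g 0)%C). assert (pA : 0 < A) by apply fat_A.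
  assert (pr : 0 < A * r ^ m) by (apply Rmult_lt_0_compat; [auto|apply pow_lt; lra]).
  exists (/ (A * r ^ m) + 1). intros z n hK. apply Rnot_le_lt. intros l.
  assert (e := fat_mod z n). fold A in e.
  assert (le : r ^ m <= Cmod (z - z0) ^ m) by (apply pow_incr; lra).
  assert (k : (/ (A * r ^ m) + 1) * (A * r ^ m) <= 1).
  { rewrite <- e. apply Rmult_le_compat; try lra.
    - assert (0 < / (A * r ^ m)) by (apply Rinv_0_lt_compat; auto). lra.
    - apply Rmult_le_compat_l; lra. }
  rewrite Rmult_plus_distr_r, Rinv_l in k by lra. lra.
Qed.

Lemma fat_near_large K : exists r, r > 0 /\ forall z, z <> z0 -> Cmod (z - z0) < r -> K < Cmod (fat z).
Proof.
  set (A := Cmod (INR m * g 0)%C). assert (pA : 0 < A) by apply fat_A.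
  pose proof (Rabs_pos K). pose proof (Rle_abs K).
  assert (pK : 0 < A * (Rabs K + 1)) by nra.
  exists (Rmin 1 (/ (A * (Rabs K + 1)))). split; [apply Rmin_pos; [lra|apply Rinv_0_lt_compat; auto]|].
  intros z n hz. assert (h1 := Rlt_le_trans _ _ _ hz (Rmin_l _ _)). assert (h2 := Rlt_le_trans _ _ _ hz (Rmin_r _ _)).
  assert (e := fat_mod z n). fold A in e. apply Rnot_le_lt. intros l.
  set (t := Cmod (z - z0)) in *. assert (t0 : 0 <= t) by apply Cmod_ge_0.
  assert (tm : t ^ m <= t).
  { destruct m as [|k]; [lia|]. simpl. assert (t ^ k <= 1) by (rewrite <- (pow1 k); apply pow_incr; lra). nra. }
  assert (tm0 : 0 <= t ^ m) by (apply pow_le; auto).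
  apply Rmult_lt_compat_r with (r := A * (Rabs K + 1)) in h2; auto. rewrite Rinv_l in h2 by lra.
  pose proof (Cmod_ge_0 (fat z)).
  assert (Cmod (fat z) * (A * t ^ m) <= (Rabs K + 1) * (A * t)).
  { apply Rmult_le_compat; try nra. }
  lra.
Qed.

(** An m-th root of 1 / (b m g(0)), taken through the exponential, gives [fat] the value -b. *)
Lemma fat_left c : exists z, z <> z0 /\ fst (fat z) < - c.
Proof.
  set (b := Rabs c + 1). assert (hb : 0 < b) by (unfold b; pose proof (Rabs_pos c); lra).
  assert (nb : RtoC b <> 0%C) by (intros Z; apply RtoC_inj in Z; lra).
  destruct (Cexp_surj (/ (b * (INR m * g 0)))%C) as [w hw].
  { intros Z. assert (k : (b * (INR m * g 0))%C <> 0%C).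
    { apply Cmult_neq_0; auto. apply Cmult_neq_0; [apply mC|exact g0]. }
    apply (C1_nz). rewrite <- (Cinv_l _ k), Z. ring. }
  assert (nm := mC). exists (z0 + Cexp (w / INR m))%C. split.
  - intros Z. apply (Cexp_neq_0 (w / INR m)). transitivity ((z0 + Cexp (w / INR m)) - z0)%C; [ring|]. rewrite Z. ring.
  - unfold fat. replace (z0 + Cexp (w / INR m) - z0)%C with (Cexp (w / INR m)) by ring.
    rewrite pw_Cexp. replace (INR m * (w / INR m))%C with w by (field; auto). rewrite hw.
    replace (- / (INR m * g 0 * / (b * (INR m * g 0))))%C with (RtoC (- b)).
    + simpl. unfold b. pose proof (Rle_abs c). lra.
    + rewrite RtoC_opp. field. auto.
Qed.
End Fatou.

(** * From a Fatou coordinate to a repelling sector *)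

Section Petal.
Context (f f' : C -> C) (z0 : C) (q : nat) (u : C -> C) (rho : R).
Context (Hf : is_deriv f f') (fz0 : f z0 = z0) (hq : (1 <= q)%nat) (hrho : rho > 0).
Context (ustep : forall z, z <> z0 -> Cmod (z - z0) < rho -> iter q f z <> z0 /\ Cmod (u (iter q f z) - u z - 1) <= 1 / 4)
  (ularge : forall r, r > 0 -> exists K, forall z, z <> z0 -> K <= Cmod (u z) -> Cmod (z - z0) < r)
  (unear : forall K, exists r, r > 0 /\ forall z, z <> z0 -> Cmod (z - z0) < r -> K < Cmod (u z))
  (ucts : forall z, z <> z0 -> cts u z)
  (uleft : forall c, exists z, z <> z0 /\ fst (u z) < - c)
  (inv : forall d, d > 0 -> exists r, r > 0 /\ forall z, Cmod (z - z0) < r -> exists v, Cmod (v - z0) < d /\ iter q f v = z).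

Lemma ustep_parts z : z <> z0 -> Cmod (z - z0) < rho ->
  fst (u z) + 3 / 4 <= fst (u (iter q f z)) <= fst (u z) + 5 / 4 /\
  Rabs (snd (u (iter q f z))) <= Rabs (snd (u z)) + 1 / 4 /\ Rabs (snd (u z)) <= Rabs (snd (u (iter q f z))) + 1 / 4.
Proof.
  intros n h. destruct (ustep z n h) as [_ e].
  pose proof (Rabs_fst_le (u (iter q f z) - u z - 1)%C) as a. pose proof (Rabs_snd_le (u (iter q f z) - u z - 1)%C) as b.
  simpl in a, b. set (x := u (iter q f z)) in *. set (y := u z) in *.
  replace (snd x + - snd y + - 0) with (snd x - snd y) in b by ring.
  assert (a' : Rabs (fst x + - fst y + - (1)) <= 1 / 4) by lra. apply Rabs_le_between in a'.
  assert (b' : Rabs (snd x - snd y) <= 1 / 4) by lra. 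
  split; [lra|]. split.
  - replace (snd x) with ((snd x - snd y) + snd y) by ring. eapply Rle_trans; [apply Rabs_triang|]. lra.
  - replace (snd y) with (- (snd x - snd y) + snd x) at 1 by ring. eapply Rle_trans; [apply Rabs_triang|].
    rewrite Rabs_Ropp. lra.
Qed.

(** Q is the region Re u < -C. An orbit leaving it far up or down enters the region of [stay] and
    never gets away from z0; the remaining exit points have bounded u, hence a definite distance
    from z0, and compactness provides the margin. *)
Lemma parabolic_sector rho0 : rho0 > 0 ->
  (exists q Q r1 delta, sector f z0 q Q r1 delta /\ r1 <= rho0) /\ unbounded_back f z0.
Proof.
  intros hrho0. set (F := iter q f) in *.
  set (r1 := Rmin rho0 (Rmin rho 1)).
  assert (hr1 : 0 < r1) by (repeat apply Rmin_pos; lra).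
  assert (r1a : r1 <= rho0) by apply Rmin_l.
  assert (r1b : r1 <= rho) by (unfold r1; eapply Rle_trans; [apply Rmin_r|apply Rmin_l]).
  assert (r1c : r1 <= 1) by (unfold r1; eapply Rle_trans; [apply Rmin_r|apply Rmin_r]).
  destruct (iter_near f f' z0 q (r1 / 2) Hf fz0) as [r2 [hr2 Hr2]]; [lra|].
  destruct (ularge (Rmin r2 rho)) as [C0 HC0]; [apply Rmin_pos; lra|].
  destruct (inv rho hrho) as [r3 [hr3 Hr3]]. destruct (ularge r3 hr3) as [K HK].
  set (C := Rmax (Rmax C0 K) 1). assert (C1 : 1 <= C) by apply Rmax_r.
  assert (CK : K <= C) by (eapply Rle_trans; [apply Rmax_r|apply Rmax_l]).
  assert (CC0 : C0 <= C) by (eapply Rle_trans; [apply Rmax_l|apply Rmax_l]).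
  assert (HC : forall z, z <> z0 -> C <= Cmod (u z) -> Cmod (z - z0) < r2 /\ Cmod (z - z0) < rho).
  { intros z n h. assert (k := HC0 z n ltac:(lra)).
    split; eapply Rlt_le_trans; [exact k|apply Rmin_l|exact k|apply Rmin_r]. }
  set (Q := fun z => z <> z0 /\ fst (u z) < - C).
  assert (Qr : forall z, Q z -> Cmod (z - z0) < r2 /\ Cmod (z - z0) < rho).
  { intros z [n h]. apply HC; auto. pose proof (Rabs_fst_le (u z)). pose proof (Rle_abs (- fst (u z))) as k.
    rewrite Rabs_Ropp in k. lra. }
  assert (back : forall z, Cmod (z - z0) < rho -> Q (F z) -> Q z /\ fst (u z) <= fst (u (F z)) - 3 / 4).
  { intros z hz [n h]. assert (nz : z <> z0).
    { intros ->. apply n. apply iter_fix. auto. }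
    destruct (ustep_parts z nz hz) as [p _]. fold F in p. split; [split; auto; lra|lra]. }
  (* Each step gains at least 3/4 in Re u and loses at most 1/4 in |Im u|, so the region Re u + |Im
     u| >= 2 C is forward invariant; in it |u| >= C, which means nearness to z0. *)
  assert (stay : forall z, z <> z0 -> 2 * C <= fst (u z) + Rabs (snd (u z)) ->
     forall n, Cmod (iter n f z - z0) < r1 / 2).
  { assert (st : forall k z, z <> z0 -> 2 * C <= fst (u z) + Rabs (snd (u z)) -> Cmod (iter k F z - z0) < r2).
    { induction k as [|k IH]; intros z n h.
      - simpl. apply HC; auto.
        pose proof (Rabs_fst_le (u z)). pose proof (Rabs_snd_le (u z)). pose proof (Rle_abs (fst (u z))). lra.
      - rewrite iter_S_in.
        assert (hz : Cmod (z - z0) < rho).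
        { apply HC; auto. pose proof (Rabs_fst_le (u z)). pose proof (Rabs_snd_le (u z)). pose proof (Rle_abs (fst (u z))). lra. }
        destruct (ustep_parts z n hz) as [p1 p2]. fold F in p1, p2. apply IH; [apply ustep; auto|]. lra. }
    intros z n h k. assert (dm := Nat.div_mod_eq k q). assert (um := Nat.mod_upper_bound k q ltac:(lia)).
    replace k with (k mod q + (k / q) * q)%nat by lia. rewrite iter_add, <- iter_mul. apply Hr2; [lia|].
    apply st; auto. }
  assert (Qback : forall z, Q z -> z <> z0 -> exists x, backorbit f x /\ tends x z0 /\ x 0%nat = z).
  { intros z hz _.
    assert (pre : forall y, exists v, Q y -> Q v /\ fst (u v) <= fst (u y) - 3 / 4 /\ F v = y).
    { intros y. destruct (classic (Q y)) as [hy|n]; [|exists y; contradiction]. destruct (Hr3 y) as [v [hv Ev]].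
      - apply HK; [apply hy|]. destruct hy as [_ hy]. pose proof (Rabs_fst_le (u y)). pose proof (Rle_abs (- fst (u y))) as k.
        rewrite Rabs_Ropp in k. lra.
      - exists v. intros _. change (F v = y) in Ev. rewrite <- Ev in hy. destruct (back v hv hy) as [b1 b2]. rewrite Ev in b2. auto. }
    set (pr := fun y => proj1_sig (constructive_indefinite_description _ (pre y))).
    assert (hpr : forall y, Q y -> Q (pr y) /\ fst (u (pr y)) <= fst (u y) - 3 / 4 /\ F (pr y) = y).
    { intros y. unfold pr. destruct constructive_indefinite_description. auto. }
    set (v := fun n => iter n pr z).
    assert (hv : forall n, Q (v n) /\ fst (u (v n)) <= - INR n * (3 / 4)).
    { induction n as [|n [h1 h2]].
      - split; [exact hz|]. change (v 0%nat) with z. simpl. destruct hz as [_ hz']. lra.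
      - destruct (hpr (v n) h1) as (k1 & k2 & _). rewrite S_INR. split; [exact k1|]. change (v (S n)) with (pr (v n)). lra. }
    destruct (backorbit_of_power f f' z0 q v Hf fz0 hq) as (x & bx & tx & x0).
    - intros n. apply (hpr (v n)). apply hv.
    - intros e he. destruct (ularge e he) as [K2 HK2]. destruct (INR_unbounded (2 * Rabs K2)) as [N HN].
      exists N. intros n hn. apply HK2; [apply hv|]. destruct (hv n) as [_ h].
      apply le_INR in hn. pose proof (Rabs_fst_le (u (v n))). pose proof (Rle_abs (- fst (u (v n)))) as k.
      rewrite Rabs_Ropp in k. pose proof (Rle_abs K2). pose proof (Rabs_pos K2). lra.
    - exists x. auto. }
  split.
  - set (B := 10 * C). 
    assert (near : exists r, r > 0 /\ forall z, z <> z0 -> Cmod (u z) <= B -> r <= Cmod (z - z0)).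
    { destruct (unear B) as [r [hr Hr]]. exists r. split; auto. intros z n h. apply Rnot_lt_le. intros l.
      specialize (Hr z n l). lra. }
    destruct near as [r [hr Hr]].
    (* By compactness of the annulus: a variation of u by 1/8 on each side of a cluster point does
       not use up the room of 3/4 in Re u. *)
    assert (unif : exists delta, delta > 0 /\ forall z, r <= Cmod (z - z0) -> Cmod (z - z0) <= r1 -> fst (u z) <= - C - 3 / 4 ->
       forall v, Cmod (v - z) < delta -> Q v).
    { apply NNPP. intros no.
      assert (ex : forall k : nat, exists z, r <= Cmod (z - z0) /\ Cmod (z - z0) <= r1 /\ fst (u z) <= - C - 3 / 4 /\
         exists v, Cmod (v - z) < / (INR k + 1) /\ ~ Q v).
      { intros k. apply NNPP. intros n1. apply no. exists (/ (INR k + 1)). split.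
        - apply Rinv_0_lt_compat. pose proof (pos_INR k). lra.
        - intros z h1 h2 h3 v hv. apply NNPP. intros nq. apply n1. exists z. repeat split; auto. exists v. auto. }
      set (s := fun k => proj1_sig (constructive_indefinite_description _ (ex k))).
      assert (hs : forall k, r <= Cmod (s k - z0) /\ Cmod (s k - z0) <= r1 /\ fst (u (s k)) <= - C - 3 / 4 /\
         exists v, Cmod (v - s k) < / (INR k + 1) /\ ~ Q v).
      { intros k. unfold s. destruct constructive_indefinite_description. auto. }
      destruct (bounded_cluster s (r1 + Cmod z0)) as [l Hl].
      { intros k. destruct (hs k) as (_ & h & _). pose proof (Cmod_le_add (s k) z0). lra. }
      assert (nl : l <> z0).
      { intros ->. destruct (Hl r 0%nat hr) as [k [_ hk]]. destruct (hs k) as (h & _). lra. }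
      destruct (ucts l nl (1 / 8)) as [d [hd Hd]]; [lra|].
      assert (pl := Cmod_sub_pos _ _ nl).
      set (e := Rmin d (Cmod (l - z0)) / 2). assert (he : e > 0) by (unfold e; assert (0 < Rmin d (Cmod (l - z0))) by (apply Rmin_pos; lra); lra).
      assert (e1 : 2 * e <= d) by (unfold e; pose proof (Rmin_l d (Cmod (l - z0))); lra).
      assert (e2 : 2 * e <= Cmod (l - z0)) by (unfold e; pose proof (Rmin_r d (Cmod (l - z0))); lra).
      destruct (archimed_cor1 e he) as [N [hN hN']].
      destruct (Hl e N he) as [k [hk Hk]]. destruct (hs k) as (h1 & h2 & h3 & v & hv & nq).
      assert (k1 : / (INR k + 1) <= / INR N).
      { apply Rinv_le_contravar; [apply lt_0_INR; lia|]. assert (INR N <= INR k) by (apply le_INR; lia). lra. }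
      assert (a1 : dC (s k) l < d) by (unfold dC; lra).
      assert (vl : Cmod (v - l) < 2 * e) by (pose proof (Cmod_tri v (s k) l); lra).
      assert (a2 : dC v l < d) by (unfold dC; lra).
      assert (b1 := Hd _ I a1). assert (b2 := Hd _ I a2).
      apply nq. split.
      - intros ->. rewrite Cmod_sym in vl. lra.
      - pose proof (Rabs_fst_le (u (s k) - u l)) as c1. pose proof (Rabs_fst_le (u v - u l)) as c2. simpl in c1, c2.
        assert (c1' : Rabs (fst (u (s k)) + - fst (u l)) <= 1 / 8) by lra.
        assert (c2' : Rabs (fst (u v) + - fst (u l)) <= 1 / 8) by lra.
        apply Rabs_le_between in c1'. apply Rabs_le_between in c2'. lra. }
    destruct unif as [delta [hdelta Hdelta]].
    exists q, Q, r1, delta. split; [|auto]. split; [auto|]. split; [auto|]. split; [auto|]. split; [|split; [|split]].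
    + intros z hz i hi. apply Hr2; auto. apply Qr. auto.
    + intros z hz hQ. apply back; auto. assert (k := hz 0%nat ltac:(lia)). simpl in k. lra.
    + intros z hz hQ nQ [n far]. change (Q (F z)) in hQ. rewrite iter_add in nQ. change (~ Q (F (F z))) in nQ.
      assert (hz0 := hz 0%nat ltac:(lia)). simpl in hz0. assert (hz0' : Cmod (z - z0) < rho) by lra.
      destruct (back z hz0' hQ) as [qz lz]. assert (nz : z <> z0) by apply qz.
      assert (nFz : F z <> z0) by apply hQ.
      destruct (ustep_parts (F z) nFz (proj2 (Qr _ hQ))) as [p1 p2]. fold F in p1, p2.
      destruct (ustep_parts z nz hz0') as [p3 p4]. fold F in p3, p4.
      assert (l1 : - C <= fst (u (F (F z)))).
      { apply Rnot_lt_le. intros l. apply nQ. split; auto. apply (ustep (F z) nFz). apply Qr. auto. }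
      assert (l2 : fst (u z) + Rabs (snd (u z)) < 2 * C).
      { apply Rnot_le_lt. intros l. assert (k := stay z nz l n). lra. }
      destruct hQ as [_ hQ2]. apply Hdelta; [|lra|lra].
      apply Hr; auto. eapply Rle_trans; [apply Cmod_le_abs|]. rewrite Rabs_left by lra. unfold B. lra.
    + intros x bx tx nx N. destruct (tx rho hrho) as [N1 HN1].
      destruct (INR_unbounded (2 * (Rabs (fst (u (x N1))) + C))) as [k hk].
      exists (N1 + (N + k) * q)%nat. split; [nia|].
      assert (st : forall j, fst (u (x (N1 + j * q)%nat)) <= fst (u (x N1)) - INR j * (3 / 4)).
      { induction j as [|j IH]; [simpl; rewrite Nat.add_0_r; lra|].
        set (y := x (N1 + S j * q)%nat).
        assert (Ey : F y = x (N1 + j * q)%nat).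
        { unfold F, y. replace (N1 + S j * q)%nat with (q + (N1 + j * q))%nat by lia. apply backorbit_iter. auto. }
        destruct (ustep_parts y (nx _) (HN1 (N1 + S j * q)%nat ltac:(lia))) as [p _]. fold F in p. rewrite Ey in p. rewrite S_INR. lra. }
      split; [apply nx|]. specialize (st (N + k)%nat). rewrite plus_INR in st. pose proof (pos_INR N).
      pose proof (Rle_abs (fst (u (x N1)))). pose proof (Rabs_pos (fst (u (x N1)))). lra.
  - intros M. revert M. refine (expelled_orbit f f' z0 Q Hf fz0 _ Qback _).
    + destruct (uleft C) as [z [h1 h2]]. exists z. split; auto. split; auto.
    + intros M hM HM. destruct (unear (4 * C)) as [r [hr Hr]]. exists r. split; auto. intros k v hv.
      destruct (classic (v = z0)) as [->|nv]; [rewrite iter_fix, Cmod_sub_eq by auto; lra|].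
      destruct (Rlt_dec (fst (u v)) (- C)) as [l|l]; [apply HM; split; auto|].
      (* Outside Q and with |u| > 4 C, the point lies in the invariant region of [stay], so only
         starting points in Q could have large iterates. *)
      assert (k2 := Hr v nv hv). assert (k3 := stay v nv). assert (2 * C <= fst (u v) + Rabs (snd (u v))).
      { pose proof (Cmod_le_abs (u v)). destruct (Rle_dec 0 (fst (u v))) as [p|p].
        - rewrite (Rabs_pos_eq _ p) in H. lra.
        - rewrite (Rabs_left (fst (u v))) in H by lra. lra. }
      specialize (k3 H k). lra.
Qed.
End Petal.

(** * Recurrence of backward orbits *)

Lemma itd_fix f f' z0 n : f z0 = z0 -> itd f f' n z0 = pw (f' z0) n.
Proof. intros E. induction n as [|n IH]; cbn [itd pw]; auto. rewrite IH, iter_fix by auto. auto. Qed.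

(** At a parabolic point the iterate f^q with multiplier 1 is used; as it is not the identity, its
    expansion has a first nonlinear term, from which [fat] is built. *)
Lemma local_sector f f' z0 : is_deriv f f' -> repelling_fixed_point f z0 \/ parabolic_fixed_point f z0 ->
  (forall q, (1 <= q)%nat -> exists z, iter q f z <> z) ->
  f z0 = z0 /\ f' z0 <> 0%C /\ unbounded_back f z0 /\
  forall rho0, rho0 > 0 -> exists q Q r1 delta, sector f z0 q Q r1 delta /\ r1 <= rho0.
Proof.
  intros H hz nid.
  assert (der : forall L, has_cderiv f z0 L -> L = f' z0).
  { intros L hL. apply has_cderiv_cd in hL. exact (cd_unique _ _ _ _ hL (H z0)). }
  destruct hz as [[E [L [hL L1]]]|[E [L [hL [q [hq Lq]]]]]]; rewrite (der L hL) in *; split; auto.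
  - change (Cmod (f' z0) > 1) in L1. split; [|split].
    + intros Z. rewrite Z, Cmod_0 in L1. lra.
    + exact (proj2 (repelling_sector f f' z0 1 H E L1 ltac:(lra))).
    + intros rho0 hr. exact (proj1 (repelling_sector f f' z0 rho0 H E L1 hr)).
  - change (pw (f' z0) q = 1%C) in Lq.
    assert (n0 : f' z0 <> 0%C).
    { intros Z. rewrite Z, pw_0 in Lq by lia. apply C1_nz. auto. }
    assert (HF := is_deriv_iter f f' q H).
    assert (EF := iter_fix f q z0 E).
    assert (dF : itd f f' q z0 = 1%C) by (rewrite itd_fix; auto).
    destruct (parabolic_expansion _ _ z0 HF EF dF (nid q hq)) as (m & g & g' & hm & hg & g0 & hgF).
    assert (gc := is_deriv_cts _ _ hg).
    destruct (fat_step (iter q f) g z0 m hm gc g0 hgF) as [rho [hrho Hrho]].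
    assert (inv : forall d, d > 0 -> exists r, r > 0 /\ forall z, Cmod (z - z0) < r -> exists v, Cmod (v - z0) < d /\ iter q f v = z).
    { intros d hd. destruct (inverse_function _ _ z0 d HF (deriv_cts _ _ HF)) as (d' & r & k & hd' & hr & _ & inv); auto.
      { rewrite dF. apply C1_nz. }
      rewrite EF in inv. exists r. split; auto. intros z hz. destruct (inv z hz). exists (k z). split; auto. lra. }
    assert (P := fun rho0 => parabolic_sector f f' z0 q (fat g z0 m) rho H E hq hrho Hrho
      (fat_large_near g z0 m hm g0) (fat_near_large (iter q f) g z0 m hm g0 hgF) (fat_cts g z0 m hm g0) (fat_left g z0 m hm g0) inv rho0).
    split; auto. split; [exact (proj2 (P 1 ltac:(lra)))|]. intros rho0 hr. exact (proj1 (P rho0 hr)).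
Qed.

Lemma least_nat (P : nat -> Prop) n : P n -> exists k, P k /\ (k <= n)%nat /\ forall j, P j -> (k <= j)%nat.
Proof.
  induction n as [n IH] using (well_founded_induction lt_wf). intros h.
  destruct (classic (exists j, (j < n)%nat /\ P j)) as [[j [hj pj]]|no].
  - destruct (IH j hj pj) as (k & k1 & k2 & k3). exists k. split; [exact k1|]. split; [apply Nat.le_trans with j; auto; apply Nat.lt_le_incl; auto|exact k3].
  - exists n. split; [exact h|]. split; [auto|]. intros j pj. apply Nat.nlt_ge. intros l. apply no. eauto.
Qed.

(** * Repeated moves of the first entry outwards *)

Section Seq.
Context (f f' : C -> C) (p0 z0 : C) (R R' R'' : R).
Context (Hf : is_deriv f f') (hR : 1 <= R) (hP : forall z, R < Cmod (z - p0) -> ~ P_f f z)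
  (hR' : 2 * R <= R') (hR'' : R' <= R'') (fz0 : f z0 = z0) (hz0 : Cmod (z0 - p0) <= R)
  (pull : forall z, R'' < Cmod (f z - p0) -> R' < Cmod (z - p0)).
Context (q : nat) (Q : C -> Prop) (r1 delta rhoi : Rdefinitions.R).
Context (sec : sector f z0 q Q r1 delta) (hr1 : r1 <= 1) (hri : Kd * r1 <= rhoi)
  (inj : forall u v, Cmod (u - z0) < rhoi -> Cmod (v - z0) < rhoi -> f u = f v -> u = v).
Context (y : C) (N0 : nat) (hy : R' < Cmod (y - p0)) (esc : forall m, (N0 <= m)%nat -> ~ Cmod (iter m f y - y) < R).

Definition XO (x : nat -> C) : Prop := backorbit f x /\ tends x z0 /\ R' < Cmod (x 0%nat - p0).

(** The tower [T] continues the orbit x over the half-plane; w' has the height of w and lies beyond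
    R''. Reading [T (S n)] at w' drops the first entry. Unless nothing moves, both ends have bounded
    modulus, as [tower_shrink] requires. *)
Definition stepdata (x x' : nat -> C) (T : nat -> C -> C) (w w' : C) : Prop :=
  towerR f p0 R T /\ HR R' w /\ HR R'' w' /\ (forall n, T n w = x n) /\ (forall n, T (S n) w' = x' n) /\
  snd w' = snd w /\ (w' = w \/ exp (fst w) <= R'' + 1 /\ exp (fst w') <= R'' + 1).

Definition Step (x x' : nat -> C) : Prop := exists T w w', stepdata x x' T w w'.

(** The new first entry lies beyond R' by [pull], because its image p0 + e^w' lies beyond R''; so
    the step can be repeated. *)
Lemma step_exists x : XO x -> exists x', Step x x' /\ XO x'.
Proof.
  intros (bx & tx & fx). assert (R0 : 0 < R) by lra.
  destruct (Cexp_surj (x 0%nat - p0)%C) as [w hw].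
  { apply Csub_neq_0. intros E. rewrite E, Cmod_sub_eq in fx. lra. }
  assert (ew : expp p0 w = x 0%nat) by (unfold expp; rewrite hw; ring).
  assert (hw' : HR R' w) by (apply (expp_far p0); [lra|rewrite ew; auto]).
  assert (hwR : HR R w) by (apply (HR_mono p0 R R'); auto; lra).
  destruct (towerR_exists f f' p0 R Hf R0 hP x w bx hwR) as [T [tT ET]]; auto.
  assert (ex : exists w', HR R'' w' /\ snd w' = snd w /\ (w' = w \/ exp (fst w) <= R'' + 1 /\ exp (fst w') <= R'' + 1)).
  { destruct (Rlt_dec R'' (exp (fst w))) as [l|l].
    - exists w. split; [|auto]. apply (expp_far p0); [lra|]. rewrite expp_mod. auto.
    - exists (ln (R'' + 1), snd w). simpl. rewrite exp_ln by lra. split; [|split; auto; right; lra].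
      unfold HR. simpl. apply ln_increasing; lra. }
  destruct ex as (w' & h1 & h2 & h3).
  assert (h1R : HR R w') by (apply (HR_mono p0 R R''); auto; lra).
  assert (h1R' : HR R' w') by (apply (HR_mono p0 R' R''); auto; lra).
  exists (fun n => T (S n) w'). split; [exists T, w, w'; repeat split; auto; apply tT; auto|].
  split; [|split].
  - intros n. apply tT. auto.
  - intros e he. destruct (towerR_conv f f' p0 z0 R R' Hf R0 hP hR' fz0 hz0 T w w' tT hw' h1R') with e as [N HN]; auto.
    { intros e' he'. destruct (tx e' he') as [N HN]. exists N. intros n hn. rewrite ET. auto. }
    exists N. intros n hn. apply HN. lia.
  - apply pull. assert (k := proj2 (proj2 tT 0%nat w' h1R)). rewrite k, (proj1 tT w' h1R).
    apply expp_far; auto. lra.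
Qed.

Lemma step_close e : e > 0 -> exists N, forall x x' n, (N <= n)%nat -> Step x x' -> Cmod (x (S n) - z0) <= 1 ->
  Cmod (x' n - x (S n)) <= e.
Proof.
  intros he. assert (R0 : 0 < R) by lra.
  destruct (tower_shrink f f' p0 z0 R R' Hf R0 hP hR' fz0 hz0 y N0 (R'' + 1) e hy esc he) as [N HN].
  exists N. intros x x' n hn (T & w & w' & tT & h1 & h2 & h3 & h4 & h5 & h6) hx.
  rewrite <- h4, <- h3. destruct h6 as [->|[h6 h7]]; [rewrite Cmod_sub_eq; lra|].
  apply HN; auto; try lia.
  - apply (HR_mono p0 R' R''); auto; lra.
  - rewrite h3. auto.
Qed.

(** The whole tail must remain near z0: only then do entries beyond n belong to Q as well, at
    multiples of q. *)
Definition good (x : nat -> C) (n : nat) : Prop := Q (x n) /\ forall m, (n <= m)%nat -> Cmod (x m - z0) < r1.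

Lemma far_z0 x : XO x -> 1 <= Cmod (x 0%nat - z0).
Proof. intros (_ & _ & h). pose proof (Cmod_tri (x 0%nat) z0 p0). lra. Qed.

Lemma XO_iter x n i : XO x -> (i <= n)%nat -> iter i f (x n) = x (n - i)%nat.
Proof. intros (b & _) h. replace n with (i + (n - i))%nat at 1 by lia. apply backorbit_iter. auto. Qed.

Lemma good_exists x : XO x -> exists n, good x n.
Proof.
  intros hx. destruct sec as (hq & p1 & p2 & _ & _ & _ & P5). destruct hx as (bx & tx & fx).
  destruct (tx r1 p1) as [N HN].
  destruct (P5 x bx tx) with N as [n [hn hQ]].
  - intros n E. assert (k := XO_iter x n n (conj bx (conj tx fx)) (Nat.le_refl _)). rewrite Nat.sub_diag in k.
    rewrite E, iter_fix in k by auto. assert (k2 := far_z0 x (conj bx (conj tx fx))). rewrite <- k, Cmod_sub_eq in k2. lra.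
  - exists n. split; auto. intros m hm. apply HN. lia.
Qed.

Lemma good_shift x n k : XO x -> good x n -> Q (x (n + k * q)%nat).
Proof.
  intros hx [hQ hm]. destruct sec as (hq & p1 & p2 & _ & P2 & _ & _).
  induction k as [|k IH]; [simpl; rewrite Nat.add_0_r; auto|].
  apply P2.
  - intros i hi. rewrite XO_iter by (auto; lia). apply hm. lia.
  - rewrite XO_iter by (auto; lia). replace (n + S k * q - q)%nat with (n + k * q)%nat by lia. auto.
Qed.

Lemma good_half x n m : XO x -> good x n -> (n <= m)%nat -> Cmod (x m - z0) < r1 / 2.
Proof.
  intros hx hg hm. destruct sec as (hq & p1 & p2 & P1 & _).
  set (k := S ((m - n) / q)). assert (hk := good_shift x n k hx hg).
  assert (dm := Nat.div_mod_eq (m - n) q). assert (um := Nat.mod_upper_bound (m - n) q ltac:(lia)).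
  assert (e : (n + k * q - m <= q)%nat /\ (m <= n + k * q)%nat) by (unfold k; nia).
  assert (h := P1 _ hk (n + k * q - m)%nat (proj1 e)).
  rewrite XO_iter in h by (auto; lia). replace (n + k * q - (n + k * q - m))%nat with m in h by lia. auto.
Qed.

(** After q steps entry n + q of the first orbit has become entry n of the last, displaced by less
    than [b]. Since n is least, x (n + q) is an exit point of the sector, and the margin there
    absorbs the displacement. One takes q steps together because the sector conditions concern
    f^q. *)
Lemma macro_step : exists N, forall (Y : nat -> nat -> C) n, (forall i, XO (Y i)) -> (forall i, Step (Y i) (Y (S i))) ->
  (N <= n)%nat -> good (Y 0%nat) n -> (forall j, good (Y 0%nat) j -> (n <= j)%nat) -> good (Y q) n.
Proof.
  destruct sec as (hq & p1 & p2 & P1 & P2 & P3 & P5).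
  set (b := Rmin delta (r1 / 2)). assert (hb : 0 < b) by (apply Rmin_pos; lra).
  assert (pq : 0 < INR q) by (apply lt_0_INR; lia).
  set (e := b / (2 * INR q)). assert (he : e > 0) by (apply Rdiv_lt_0_compat; lra).
  destruct (step_close e he) as [N HN].
  exists (N + q)%nat. intros Y n hY hS hn hg hmin. set (x := Y 0%nat) in *.
  assert (hx : XO x) by apply hY.
  assert (cl : forall i, (i <= q)%nat -> forall m, (n <= m)%nat -> Cmod (Y i (m + q - i)%nat - x (m + q)%nat) <= INR i * e).
  { induction i as [|i IH]; intros hi m hm.
    - rewrite Nat.sub_0_r. fold x. rewrite Cmod_sub_eq. simpl. lra.
    - specialize (IH ltac:(lia) m hm). 
      assert (ie : INR i * e <= b / 2).
      { apply Rle_trans with (INR q * e).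
        - apply Rmult_le_compat_r; [lra|]. apply le_INR. lia.
        - right. unfold e. field. lra. }
      replace (m + q - i)%nat with (S (m + q - S i))%nat in IH by lia.
      assert (st := HN (Y i) (Y (S i)) (m + q - S i)%nat ltac:(lia) (hS i)).
      assert (h := good_half x n (m + q)%nat hx hg ltac:(lia)).
      assert (br : b <= r1 / 2) by apply Rmin_r.
      pose proof (Cmod_tri (Y i (S (m + q - S i))) (x (m + q)%nat) z0).
      specialize (st ltac:(lra)). rewrite S_INR.
      pose proof (Cmod_tri (Y (S i) (m + q - S i)%nat) (Y i (S (m + q - S i))) (x (m + q)%nat)). lra. }
  assert (cl2 : forall m, (n <= m)%nat -> Cmod (Y q m - x (m + q)%nat) < b).
  { intros m hm. assert (k := cl q (Nat.le_refl _) m hm). replace (m + q - q)%nat with m in k by lia.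
    replace (INR q * e) with (b / 2) in k by (unfold e; field; lra). lra. }
  destruct hg as [hQ hm]. split.
  - apply (P3 (x (n + q)%nat)).
    + intros i hi. rewrite XO_iter by (auto; lia). apply hm. lia.
    + rewrite XO_iter by (auto; lia). replace (n + q - q)%nat with n by lia. auto.
    (* If x (n - q) were in Q, the index n - q would already be good, the entries between being
       controlled by the forward condition on Q. *)
    + intros hQ2. rewrite XO_iter in hQ2 by (auto; lia). replace (n + q - (q + q))%nat with (n - q)%nat in hQ2 by lia.
      assert (k := hmin (n - q)%nat). enough (n <= n - q)%nat by lia. apply k. split; auto.
      intros m hm2. destruct (le_lt_dec n m) as [l|l]; [apply hm; auto|].
      assert (k2 := P1 _ hQ (n - m)%nat ltac:(lia)). rewrite XO_iter in k2 by (auto; lia).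
      replace (n - (n - m))%nat with m in k2 by lia. lra.
    + exists (n + q)%nat. rewrite XO_iter by (auto; lia). rewrite Nat.sub_diag. apply far_z0. auto.
    + eapply Rlt_le_trans; [apply cl2; auto|apply Rmin_l].
  - intros m hm2. assert (k := cl2 m hm2). assert (k2 := good_half x n (m + q)%nat hx (conj hQ hm) ltac:(lia)).
    assert (br : b <= r1 / 2) by apply Rmin_r. pose proof (Cmod_tri (Y q m) (x (m + q)%nat) z0). lra.
Qed.

Context (X : nat -> nat -> C) (hX : forall k, XO (X k)) (hS : forall k, Step (X k) (X (S k))).

(** If indices up to N eventually cease to be good, [macro_step] applies from then on and a good
    index at most [n0] persists along every q-th orbit; then [n0] is itself a bound. *)
Lemma good_bounded : exists B, forall K, exists k, (K <= k)%nat /\ exists n, (n <= B)%nat /\ good (X k) n.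
Proof.
  destruct macro_step as [N HN]. destruct sec as (hq & _).
  assert (nb : forall B, ~ (forall K, exists k, (K <= k)%nat /\ exists n, (n <= B)%nat /\ good (X k) n) ->
     exists K, forall k n, (K <= k)%nat -> good (X k) n -> (B < n)%nat).
  { intros B h. apply not_all_ex_not in h. destruct h as [K h]. exists K. intros k n hk hg.
    apply Nat.nle_gt. intros l. apply h. exists k. split; auto. exists n. auto. }
  apply NNPP. intros no.
  destruct (nb N) as [K HK]; [intros h; apply no; eauto|].
  destruct (good_exists (X K) (hX K)) as [n0 hn0].
  assert (st : forall j, exists n, (n <= n0)%nat /\ good (X (K + j * q)%nat) n).
  { induction j as [|j [n [hn hg]]].
    - exists n0. split; auto. simpl. rewrite Nat.add_0_r. auto.
    - destruct (least_nat _ n hg) as (n1 & g1 & l1 & min1). exists n1. split; [lia|].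
      assert (k := HN (fun i => X (K + j * q + i)%nat) n1). cbv beta in k.
      replace (K + S j * q)%nat with (K + j * q + q)%nat by lia. apply k; auto.
      + intros i. replace (K + j * q + S i)%nat with (S (K + j * q + i)) by lia. apply hS.
      + assert (N < n1)%nat by (apply (HK (K + j * q)%nat); auto; lia). lia.
      + rewrite Nat.add_0_r. auto.
      + rewrite Nat.add_0_r. auto. }
  destruct (nb n0) as [K2 HK2]; [intros h; apply no; eauto|].
  destruct (st K2) as [n [hn hg]]. assert (n0 < n)%nat by (apply (HK2 (K + K2 * q)%nat); auto; nia). lia.
Qed.

(** The entries [X k B] near z0 cluster at a point [ze], and yy = f^B ze. The orbits i and j come so
    close to it that one local inverse of f^B at yy gives entry B of both; this places orbit j in
    the tower of orbit i over a logarithm near that of X i 0. *)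
Lemma recurrence : exists yy, R' <= Cmod (yy - p0) /\ R'' <= Cmod (f yy - p0) /\ forall rho, rho > 0 ->
  exists i j, (i < j)%nat /\ forall T w, towerR f p0 R T -> HR R' w -> (forall n, T n w = X i n) ->
    exists w1, HR R' w1 /\ (forall n, T n w1 = X j n) /\
      (forall t, 0 <= t <= 1 -> Cmod (expp p0 (seg w w1 t) - yy) < rho).
Proof.
  assert (R0 : 0 < R) by lra.
  destruct good_bounded as [B HB].
  assert (ex : forall K, exists k, (S K <= k)%nat /\ forall m, (B <= m)%nat -> Cmod (X k m - z0) < r1).
  { intros K. destruct (HB (S K)) as (k & hk & n & hn & _ & h). exists k. split; auto. intros m hm. apply h. lia. }
  set (kk := fun K => proj1_sig (constructive_indefinite_description _ (ex K))).
  assert (hkk : forall K, (S K <= kk K)%nat /\ forall m, (B <= m)%nat -> Cmod (X (kk K) m - z0) < r1).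
  { intros K. unfold kk. destruct constructive_indefinite_description. auto. }
  destruct (bounded_cluster (fun K => X (kk K) B) (r1 + Cmod z0)) as [ze Hze].
  { intros K. destruct (hkk K) as [_ h]. specialize (h B (Nat.le_refl _)). pose proof (Cmod_le_add (X (kk K) B) z0). lra. }
  set (yy := iter B f ze).
  assert (fB : forall k, iter B f (X k B) = X k 0%nat).
  { intros k. rewrite XO_iter by auto. rewrite Nat.sub_diag. auto. }
  assert (cB := iter_cts f f' B Hf ze). assert (cB1 := iter_cts f f' (S B) Hf ze).
  assert (appr : forall e, e > 0 -> forall K, exists k, (K <= k)%nat /\ Cmod (X (kk k) 0%nat - yy) < e /\
     Cmod (f (X (kk k) 0%nat) - f yy) < e /\ Cmod (X (kk k) B - ze) < e).
  { intros e he K. destruct (cB e he) as [d1 [hd1 H1]]. destruct (cB1 e he) as [d2 [hd2 H2]].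
    destruct (Hze (Rmin e (Rmin d1 d2)) K) as [k [hk Hk]]; [repeat apply Rmin_pos; auto|].
    assert (a1 := Rlt_le_trans _ _ _ Hk (Rmin_l _ _)). assert (a2 := Rlt_le_trans _ _ _ Hk (Rmin_r _ _)).
    assert (a3 := Rlt_le_trans _ _ _ a2 (Rmin_l _ _)). assert (a4 := Rlt_le_trans _ _ _ a2 (Rmin_r _ _)).
    exists k. split; auto. rewrite <- (fB (kk k)). split; [apply (H1 _ I a3)|]. split; [apply (H2 _ I a4)|auto]. }
  assert (farX : forall k, R'' < Cmod (f (X (S k) 0%nat) - p0)).
  { intros k. destruct (hS k) as (T & w & w' & tT & h1 & h2 & h3 & h4 & _).
    assert (hw : HR R w') by (apply (HR_mono p0 R R''); auto; lra).
    rewrite <- h4, (proj2 (proj2 tT 0%nat w' hw)), (proj1 tT w' hw). apply expp_far; auto. lra. }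
  assert (yR : R' <= Cmod (yy - p0)).
  { apply Rnot_lt_le. intros l. destruct (appr (R' - Cmod (yy - p0)) ltac:(lra) 0%nat) as (k & _ & h & _).
    destruct (hX (kk k)) as (_ & _ & hf). pose proof (Cmod_tri (X (kk k) 0%nat) yy p0). lra. }
  exists yy. split; [auto|]. split.
  { apply Rnot_lt_le. intros l. destruct (appr (R'' - Cmod (f yy - p0)) ltac:(lra) 0%nat) as (k & _ & _ & h & _).
    destruct (hkk k) as [hk _]. assert (hf := farX (kk k - 1)%nat). replace (S (kk k - 1)) with (kk k) in hf by lia.
    pose proof (Cmod_tri (f (X (kk k) 0%nat)) (f yy) p0). lra. }
  assert (nz : itd f f' B ze <> 0%C).
  { apply itd_neq_0; auto. apply hP. fold yy. lra. }
  destruct (local_section (iter B f) (itd f f' B) ze 1 (is_deriv_iter f f' B Hf) nz ltac:(lra))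
    as (d & rh & kf & hd & hrh & inj2 & Hk). fold yy in Hk.
  intros rho hrho.
  (* [R / 40] keeps the displacement of the logarithm below [lrad], which needs 24 e < R; [rho / 20]
     allows for 12 e along the segment and e at its start; [d] and [rh] are the radii of the local
     inverse. *)
  set (e := Rmin (Rmin (rho / 20) (R / 40)) (Rmin d rh)).
  assert (he : e > 0) by (repeat apply Rmin_pos; lra).
  assert (e1 : e <= rho / 20) by (unfold e; eapply Rle_trans; [apply Rmin_l|apply Rmin_l]).
  assert (e2 : e <= R / 40) by (unfold e; eapply Rle_trans; [apply Rmin_l|apply Rmin_r]).
  assert (e3 : e <= d) by (unfold e; eapply Rle_trans; [apply Rmin_r|apply Rmin_l]).
  assert (e4 : e <= rh) by (unfold e; eapply Rle_trans; [apply Rmin_r|apply Rmin_r]).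
  destruct (appr e he 0%nat) as (a & _ & a1 & _ & a2).
  destruct (appr e he (kk a)) as (b & hb & b1 & _ & b2).
  exists (kk a), (kk b). split; [destruct (hkk b); lia|].
  intros T w tT hw Ew. set (i := kk a) in *. set (j := kk b) in *.
  assert (hwR : HR R w) by (apply (HR_mono p0 R R'); auto; lra).
  assert (ew : expp p0 w = X i 0%nat) by (rewrite <- Ew; symmetry; apply tT; auto).
  assert (mw := expp_mod p0 w). assert (fw := hw). apply (expp_far p0) in fw; [|lra]. rewrite mw in fw.
  assert (dij : Cmod (X j 0%nat - X i 0%nat) < 2 * e).
  { pose proof (Cmod_tri (X j 0%nat) yy (X i 0%nat)). rewrite (Cmod_sym yy (X i 0%nat)) in H. lra. }
  set (s := ((X j 0%nat - X i 0%nat) / Cexp w)%C). assert (nw := Cexp_neq_0 w).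
  assert (sw : Cmod s * exp (fst w) = Cmod (X j 0%nat - X i 0%nat)).
  { unfold s. rewrite Cmod_div, Cmod_Cexp by auto. field. apply Rgt_not_eq, exp_pos. }
  pose proof (Cmod_ge_0 s) as s0.
  assert (hs : Cmod s <= 1 / 2) by nra.
  destruct (log_near_1 s hs) as [t [Et ht]].
  assert (tw : Cmod t * exp (fst w) < 4 * e) by nra.
  assert (ew1 : expp p0 (w + t)%C = X j 0%nat).
  { assert (k : (s * Cexp w = X j 0%nat - X i 0%nat)%C) by (unfold s; field; auto).
    unfold expp in *. rewrite Cexp_plus, Et.
    replace (p0 + Cexp w * (1 + s))%C with ((p0 + Cexp w) + s * Cexp w)%C by ring. rewrite k, ew. ring. }
  assert (ltw : Cmod (w + t - w) < lrad R w).
  { replace (w + t - w)%C with t by ring. unfold lrad. pose proof (exp_pos (fst w)).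
    apply Rmult_lt_reg_r with (6 * exp (fst w)); [lra|].
    replace (R / (6 * exp (fst w)) * (6 * exp (fst w))) with R by (field; lra). lra. }
  exists (w + t)%C. split; [apply (expp_far p0); [lra|]; rewrite ew1; apply hX|]. split.
  - set (h := tdisc f f' p0 z0 R T w).
    assert (hsp := disc_spec f f' p0 z0 R R' Hf R0 hP hR' fz0 hz0 T w tT hw). fold h in hsp.
    assert (hc : forall n, h n (X i 0%nat) = X i n).
    { intros n. rewrite <- ew, <- Ew. apply (disc_center f f' p0 z0 R R' Hf R0 hP hR' fz0 hz0 T w n tT hw). }
    assert (hT : forall n, T n (w + t)%C = h n (X j 0%nat)).
    { intros n. destruct (hsp n) as (_ & _ & _ & E). rewrite <- (E _ ltw), ew1. auto. }
    assert (bo : backorbit f (fun n => h n (X j 0%nat))).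
    { intros n. rewrite <- !hT. apply tT. apply (expp_far p0); [lra|]. rewrite ew1. destruct (hX j) as (_ & _ & k). lra. }
    assert (atB : h B (X j 0%nat) = X j B).
    { destruct (hsp B) as (bs & bn & _ & _). rewrite ew in bs, bn.
      assert (kX : forall k, Cmod (X k B - ze) < e -> Cmod (X k 0%nat - yy) < e -> kf (X k 0%nat) = X k B).
      { intros k k1 k2. destruct (Hk (X k 0%nat) ltac:(lra)) as (k3 & k4 & _). apply inj2; [lra|lra|]. rewrite fB. auto. }
      rewrite <- (kX j b2 b1).
      apply (section_unique (iter B f) (itd f f' B) (ballC yy e) (X i 0%nat) (h B) kf).
      - apply is_deriv_iter. auto.
      - apply convex_ball.
      - exact a1.
      - intros v hv. apply cts_cwi. apply bs. unfold ballC in hv. pose proof (Cmod_tri v yy (X i 0%nat)).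
        rewrite (Cmod_sym yy (X i 0%nat)) in H. lra.
      - intros v hv. apply cts_cwi. apply Hk. unfold ballC in hv. lra.
      - intros v hv. unfold ballC in hv. rewrite (proj1 (proj2 (Hk v ltac:(lra)))). apply bs.
        pose proof (Cmod_tri v yy (X i 0%nat)). rewrite (Cmod_sym yy (X i 0%nat)) in H. lra.
      - intros v hv. apply bn. unfold ballC in hv. pose proof (Cmod_tri v yy (X i 0%nat)).
        rewrite (Cmod_sym yy (X i 0%nat)) in H. lra.
      - rewrite hc. symmetry. apply kX; auto.
      - exact b1. }
    (* Beyond B both candidates lie in the disc where f is injective, by growth with factor [Kd],
       and agree one entry after another; below B the entries are images of entry B. *)
    intros n. rewrite hT. destruct (le_lt_dec B n) as [l|l].
    + replace n with ((n - B) + B)%nat by lia. induction (n - B)%nat as [|m IH]; [simpl; auto|].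
      assert (ri : r1 <= rhoi).
      { destruct sec as (_ & p1 & _). pose proof Kd_ge_1. nra. }
      apply inj.
      * assert (g := growth (iter (S m + B) f) (itd f f' (S m + B)) (expp p0 w) R (h (S m + B)%nat) z0
          (is_deriv_iter f f' _ Hf) R0 (proj1 (hsp _)) (proj1 (proj2 (hsp _))) (proj1 (proj2 (proj2 (hsp _)))) (X j 0%nat)).
        rewrite ew, hc in g. assert (h5 : Cmod (X i (S m + B)%nat - z0) < r1) by (apply hkk; lia).
        pose proof Kd_ge_1. specialize (g ltac:(lra)). nra.
      * assert (h5 : Cmod (X j (S m + B)%nat - z0) < r1) by (apply hkk; lia). lra.
      * assert (k := bo (m + B)%nat). cbv beta in k. change (S (m + B)) with (S m + B)%nat in k. rewrite k, IH.
        symmetry. apply (hX j).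
    + assert (k1 := XO_iter (X j) B (B - n) (hX j) ltac:(lia)). replace (B - (B - n))%nat with n in k1 by lia.
      assert (k2 := backorbit_iter f (fun n => h n (X j 0%nat)) (B - n) n bo). cbv beta in k2.
      replace (B - n + n)%nat with B in k2 by lia. rewrite atB in k2. rewrite <- k1, <- k2. auto.
  - intros tt htt. unfold seg. replace (w + tt * (w + t - w))%C with (w + tt * t)%C by ring.
    assert (tl : Cmod (tt * t) <= Cmod t).
    { rewrite Cmod_mult, Cmod_R, Rabs_pos_eq by lra. pose proof (Cmod_ge_0 t). nra. }
    assert (mv : Cmod (expp p0 (w + tt * t) - X i 0%nat) <= 3 * (Cmod t * exp (fst w))).
    { rewrite <- ew. replace (expp p0 (w + tt * t) - expp p0 w)%C with (Cexp w * (Cexp (tt * t) - 1))%C.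
      2:{ unfold expp. rewrite Cexp_plus. ring. }
      rewrite Cmod_mult, Cmod_Cexp. pose proof (exp_pos (fst w)).
      assert (Cmod (Cexp (tt * t) - 1) <= 3 * Cmod (tt * t)) by (apply Cexp_minus_1; lra).
      rewrite Rmult_comm. apply Rle_trans with (3 * Cmod t * exp (fst w)); [|lra].
      apply Rmult_le_compat_r; lra. }
    pose proof (Cmod_tri (expp p0 (w + tt * t)) (X i 0%nat) yy). lra.
Qed.
End Seq.

(** * The ray with a recurrent address *)

Lemma linked_seg (U : C -> Prop) a b : (forall t, 0 <= t <= 1 -> U (seg a b t)) -> linked U a b.
Proof.
  intros h. exists (fun z => exists t, 0 <= t <= 1 /\ z = seg a b t). split; [|split; [|split]].
  - apply connected_convex. intros x y t [s1 [h1 ->]] [s2 [h2 ->]] ht. exists (s1 + t * (s2 - s1)).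
    split; [split; nra|]. unfold seg. rewrite RtoC_plus, RtoC_mult, RtoC_minus. ring.
  - intros z [t [ht ->]]. auto.
  - exists 0. split; [lra|]. rewrite seg_0. auto.
  - exists 1. split; [lra|]. rewrite seg_1. auto.
Qed.

Lemma iter_bounded f f' p0 M n : is_deriv f f' ->
  exists B, forall i z, (i <= n)%nat -> Cmod (z - p0) <= M -> Cmod (iter i f z) <= B.
Proof.
  intros H. induction n as [|n [B HB]].
  - exists (M + Cmod p0). intros i z hi hz. replace i with 0%nat by lia. simpl. pose proof (Cmod_le_add z p0). lra.
  - destruct (cts_bounded (iter (S n) f) p0 M (iter_cts f f' (S n) H)) as [B2 HB2].
    exists (Rmax B B2). intros i z hi hz. destruct (Nat.eq_dec i (S n)) as [->|ne].
    + eapply Rle_trans; [apply HB2; auto|apply Rmax_r].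
    + eapply Rle_trans; [apply HB; auto; lia|apply Rmax_l].
Qed.

Lemma ray_double f n (g : R -> C) : (forall t, t > 0 -> g (2 * t) = iter n f (g t)) ->
  forall k t, t > 0 -> iter (k * n) f (g t) = g (2 ^ k * t).
Proof.
  intros h k. induction k as [|k IH]; intros t ht.
  - simpl. f_equal. ring.
  - replace (S k * n)%nat with (n + k * n)%nat by lia. rewrite iter_add, IH by auto.
    rewrite <- h; [f_equal; simpl; ring|]. apply Rmult_lt_0_compat; auto. apply pow_lt. lra.
Qed.

(** At most n further iterations carry f^m (g t) to a point g (2^k t) with k >= 1, which is far out;
    iterates of bounded order of a bounded set are bounded. The estimate is uniform in m. *)
Lemma ray_far f f' p0 n (g : R -> C) M : is_deriv f f' -> (1 <= n)%nat -> tends_to_infty g ->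
  (forall t, t > 0 -> g (2 * t) = iter n f (g t)) ->
  exists t1, t1 > 0 /\ forall t m, t1 <= t -> M < Cmod (iter m f (g t) - p0).
Proof.
  intros H hn inf h. destruct (iter_bounded f f' p0 M n H) as [B HB].
  destruct (inf B) as [T HT]. exists (Rmax T 1). split; [pose proof (Rmax_r T 1); lra|].
  intros t m ht. assert (h1 := Rmax_l T 1). assert (h2 := Rmax_r T 1).
  apply Rnot_le_lt. intros l.
  assert (dm := Nat.div_mod_eq m n). assert (um := Nat.mod_upper_bound m n ltac:(lia)).
  assert (e : iter (n - m mod n) f (iter m f (g t)) = g (2 ^ (S (m / n)) * t)).
  { rewrite <- iter_add, <- (ray_double f n g h) by lra. f_equal. nia. }
  assert (b := HB (n - m mod n)%nat _ ltac:(lia) l). rewrite e in b.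
  assert (p2 : 1 <= 2 ^ (S (m / n))) by (apply pow_R1_Rle; lra).
  assert (far := HT (2 ^ (S (m / n)) * t) ltac:(nra)).
  change (Cmod (g (2 ^ S (m / n) * t)) > B) in far. lra.
Qed.

Section Fund.
Context (f : C -> C) (D : C -> Prop) (alpha : R -> C).

(** The fundamental domain through [y], provided that [f y] lies in the exterior and off alpha. *)
Definition fdom (y : C) : C -> Prop :=
  comp (fun z => comp (fun w => outer D (f w)) y z /\ ~ exists t, t >= 0 /\ f z = alpha t) y.

Lemma fdom_base y : Aal D alpha (f y) ->
  comp (fun w => outer D (f w)) y y /\ ~ exists t, t >= 0 /\ f y = alpha t.
Proof.
  intros [o a]. split; [apply comp_self; auto|]. intros [t [ht e]]. apply (a t ht e).
Qed.

Lemma fdom_fundamental y : Aal D alpha (f y) -> fundamental_domain f D alpha (fdom y).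
Proof.
  intros h. exists (comp (fun w => outer D (f w)) y). split.
  - exists y. split; [apply h|]. intros z. split; auto.
  - exists y. split; [apply fdom_base; auto|]. intros z. split; auto.
Qed.

Lemma fdom_self y : Aal D alpha (f y) -> fdom y y.
Proof. intros h. apply comp_self. apply fdom_base. auto. Qed.

Lemma fdom_connected y : Aal D alpha (f y) -> connected (fdom y).
Proof. intros h. apply comp_connected. apply fdom_base. auto. Qed.

Lemma fdom_sub y z : fdom y z -> Aal D alpha (f z).
Proof.
  intros h. apply comp_sub in h. destruct h as [h1 h2]. apply comp_sub in h1. split; auto.
  intros t ht e. apply h2. eauto.
Qed.
End Fund.

Lemma icc_bounded a b (h : R -> C) : a <= b -> (forall t, icc a b t -> cwi dR (icc a b) h t) ->
  exists M, forall t, icc a b t -> Cmod (h t) <= M.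
Proof.
  intros hab Hc.
  apply (interval_clopen a b (fun u => exists M, forall t, a <= t <= u -> Cmod (h t) <= M)) with a; try lra.
  - intros s hs. destruct (Hc s hs 1) as [d [hd Hd]]; [lra|]. exists d. split; auto.
    intros s1 s2 h1 h2 k1 k2 [M HM]. exists (Rmax M (Cmod (h s) + 1)). intros t ht.
    destruct (Rle_dec t s1) as [l|l].
    + eapply Rle_trans; [apply HM; lra|apply Rmax_l].
    + eapply Rle_trans; [|apply Rmax_r]. apply Rabs_def2 in k1. apply Rabs_def2 in k2.
      assert (k : dR t s < d) by (unfold dR; apply Rabs_def1; lra).
      assert (it : icc a b t) by (unfold icc in *; lra).
      specialize (Hd t it k). pose proof (Cmod_le_add (h t) (h s)). lra.
  - exists (Cmod (h a)). intros t ht. replace t with a by lra. lra.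
Qed.

(** * A periodic cycle of towers and the ray with its address *)

Section Cycle.
Context (f f' : C -> C) (D : C -> Prop) (alpha : R -> C) (p0 : C) (RD : R).
Context (Hf : is_deriv f f') (Dopen : open_set D) (Dconn : connected D) (Dp0 : D p0)
  (Dbd : forall z, D z -> Cmod (z - p0) < RD) (hPD : forall z, P_f f z -> D z)
  (halpha : admissible_alpha f D alpha).
Context (z0 : C) (R R' : Rdefinitions.R) (hRD : 3 * RD <= R) (hR' : 2 * R <= R') (fz0 : f z0 = z0) (hz0 : Cmod (z0 - p0) <= R).
Context (p : nat) (T : nat -> nat -> C -> C) (w : nat -> C).
Context (hp : (1 <= p)%nat) (hT : forall r, towerR f p0 R (T r)) (hw : forall r, HR R' (w r))
  (wL : forall r, Lam D alpha p0 (w r)) (perT : forall r, T (r + p)%nat = T r) (perw : forall r, w (r + p)%nat = w r)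
  (hxi : forall r v, HR R' v -> exists v', expp p0 v' = T r 1%nat v /\
     (forall n, T (S r) n v' = T r (S n) v) /\ linked (Lam D alpha p0) (w (S r)) v')
  (conv : tends (fun n => T 0%nat n (w 0%nat)) z0).

Lemma posR : 0 < R.
Proof. pose proof (RD_pos D p0 RD Dp0 Dbd). lra. Qed.

Lemma far_notP z : R < Cmod (z - p0) -> ~ P_f f z.
Proof.
  intros h. pose proof (RD_pos D p0 RD Dp0 Dbd).
  apply (outer_notP f D hPD), (outer_far D p0 RD Dbd). lra.
Qed.

Lemma HR_R v : HR R' v -> HR R v.
Proof. apply (HR_mono p0 R R'); pose proof posR; lra. Qed.

Lemma per_mul k r : T (r + k * p)%nat = T r /\ w (r + k * p)%nat = w r.
Proof.
  induction k as [|k [IH1 IH2]]; [simpl; rewrite Nat.add_0_r; auto|].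
  replace (r + S k * p)%nat with (r + k * p + p)%nat by lia. rewrite perT, perw. auto.
Qed.

Definition Fr (r : nat) : C -> Prop := fdom f D alpha (T r 1%nat (w r)).

Lemma f_T1 r v : HR R v -> f (T r 1%nat v) = expp p0 v.
Proof. intros h. rewrite (proj2 (proj2 (hT r) 0%nat v h)). apply (hT r). auto. Qed.

Lemma Fr_base r : Aal D alpha (f (T r 1%nat (w r))).
Proof. rewrite f_T1 by (apply HR_R; auto). apply wL. Qed.

(** Towers are numbered backwards in time and addresses forwards, hence the reversal within each
    period. *)
Definition addr (n : nat) : C -> Prop := Fr (p - 1 - n mod p).

Lemma addr_external : external_address f D alpha addr.
Proof. intros n. apply fdom_fundamental. apply Fr_base. Qed.

Lemma addr_periodic : periodic_address addr.
Proof.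
  exists p. split; [lia|]. intros k z. unfold addr.
  replace (k + p)%nat with (k + 1 * p)%nat by lia. rewrite Nat.Div0.mod_add. split; auto.
Qed.

Lemma addr_rev M r : (r < M * p)%nat -> addr (M * p - 1 - r) = Fr r.
Proof.
  intros h. unfold addr. set (m := (M * p - 1 - r)%nat).
  assert (dm := Nat.div_mod_eq m p). assert (um := Nat.mod_upper_bound m p ltac:(lia)).
  set (c := (m mod p)%nat) in *. set (a := (m / p)%nat) in *.
  assert (e : exists k, r = (p - 1 - c + k * p)%nat).
  { exists (M - 1 - a)%nat. unfold m in dm. assert (a < M)%nat by nia. 
    replace M with (a + 1 + (M - 1 - a))%nat in dm, h by lia. set (b := (M - 1 - a)%nat) in *. nia. }
  destruct e as [k e]. unfold Fr. destruct (per_mul k (p - 1 - c)) as [e1 e2]. rewrite <- e in e1, e2. rewrite e1, e2. auto.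
Qed.

(** Two logarithms of one point differ by a multiple of 2 pi i, and [log_unlink] excludes a nonzero
    multiple within one component of [Lam]. *)
Lemma linked_expp a b c : linked (Lam D alpha p0) c a -> linked (Lam D alpha p0) c b -> expp p0 a = expp p0 b -> a = b.
Proof.
  intros h1 h2 e. destruct (Cexp_inj a b) as [k ek].
  { transitivity (expp p0 a - p0)%C; [unfold expp; ring|]. rewrite e. unfold expp. ring. }
  assert (k0 : k = 0%Z).
  { apply (log_unlink f D alpha p0 Dopen Dconn Dp0 halpha b k). rewrite <- ek.
    apply linked_trans with c; auto. apply linked_sym. auto. }
  rewrite ek, k0. unfold twopii. apply injective_projections; simpl; ring.
Qed.

Lemma Fr_param r y : Fr r y -> R < Cmod (f y - p0) ->
  exists b, HR R b /\ T r 1%nat b = y /\ linked (Lam D alpha p0) (w r) b.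
Proof.
  intros hy far. apply (tract_param f f' D alpha p0 RD Hf Dopen Dconn Dp0 Dbd hPD halpha R (T r 1%nat) (w r) y (Fr r)); auto.
  - apply HR_R; auto.
  - intros v hv. split; [apply (hT r); auto|]. apply f_T1. auto.
  - apply fdom_connected, Fr_base.
  - intros z hz. eapply fdom_sub. exact hz.
  - apply fdom_self, Fr_base.
Qed.

Context (g : Rdefinitions.R -> C) (n : nat) (t1 : Rdefinitions.R) (hn : (1 <= n)%nat) (ht1 : t1 > 0)
  (gcts : forall t, t > 0 -> forall a b, a > 0 -> icc a b t -> cwi dR (icc a b) g t)
  (gdouble : forall t, t > 0 -> g (2 * t) = iter n f (g t))
  (gaddr : forall m t, t1 <= t -> addr m (iter m f (g t)))
  (gfar : forall t m, t1 <= t -> R' < Cmod (iter m f (g t) - p0)).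

(** Among the logarithms of [g t], the one in the component of [w 0]; the component makes it
    unique. *)
Definition blog (t : Rdefinitions.R) (b : C) : Prop := expp p0 b = g t /\ linked (Lam D alpha p0) (w 0%nat) b.

(** A common period: f^N maps g t to g (lam t), and N is a multiple of the period p of the
    towers. *)
Let N := (n * p)%nat.
Let lam := 2 ^ p.

Lemma lam_ge : 2 <= lam.
Proof. unfold lam. destruct p as [|k]; [lia|]. simpl. assert (1 <= 2 ^ k) by (apply pow_R1_Rle; lra). lra. Qed.

Lemma iter_N k t : t > 0 -> iter (k * N) f (g t) = g (lam ^ k * t).
Proof.
  intros ht. replace (k * N)%nat with ((p * k) * n)%nat by (unfold N; lia). rewrite (ray_double f n g gdouble) by auto.
  f_equal. unfold lam. rewrite pow_mult. auto.
Qed.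

Lemma blog_unique t b b' : blog t b -> blog t b' -> b = b'.
Proof. intros [h1 h2] [h3 h4]. apply linked_expp with (w 0%nat); auto. rewrite h1, h3. auto. Qed.

Lemma blog_exists t : t1 <= t -> exists b, blog (lam * t) b.
Proof.
  intros ht. assert (h := gaddr (N - 1)%nat t ht). assert (hN : (1 <= N)%nat) by (unfold N; nia).
  replace (N - 1)%nat with (n * p - 1 - 0)%nat in h by (unfold N; lia). rewrite addr_rev in h by nia.
  assert (fN : f (iter (n * p - 1 - 0) f (g t)) = g (lam * t)).
  { change (iter (S (n * p - 1 - 0)) f (g t) = g (lam * t)). replace (S (n * p - 1 - 0)) with (1 * N)%nat by (unfold N in *; lia).
    rewrite iter_N by lra. f_equal. ring. }
  destruct (Fr_param 0 _ h) as (b & b1 & b2 & b3).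
  { rewrite fN. assert (k := gfar (lam * t) 0%nat). simpl in k. pose proof lam_ge. pose proof posR. specialize (k ltac:(nra)). lra. }
  exists b. split; auto. rewrite <- fN, <- b2. rewrite f_T1; auto.
Qed.

(* Going down the ray: the points f^{N-r}(g t) are the successive entries of one backward orbit. *)
Lemma descend t b : t1 <= t -> blog (lam * t) b -> forall r, (r <= N)%nat ->
  exists v, expp p0 v = iter (N - r) f (g t) /\ linked (Lam D alpha p0) (w r) v /\ forall k, T r k v = T 0%nat (r + k)%nat b.
Proof.
  intros ht [e hb]. induction r as [|r IH]; intros hr.
  - exists b. split; [|auto]. rewrite Nat.sub_0_r, e. replace N with (1 * N)%nat by lia. rewrite iter_N by lra. f_equal. ring.
  - destruct (IH ltac:(lia)) as (v & v1 & v2 & v3).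
    assert (hv : HR R' v).
    { apply (expp_far p0); [pose proof posR; lra|]. rewrite v1. apply gfar. auto. }
    assert (h := gaddr (N - 1 - r)%nat t ht). unfold N in h at 1. rewrite addr_rev in h by (unfold N in hr; lia).
    replace (N - 1 - r)%nat with (N - S r)%nat in h by lia.
    assert (fy : f (iter (N - S r) f (g t)) = expp p0 v).
    { rewrite v1. replace (N - r)%nat with (S (N - S r)) by lia. auto. }
    destruct (Fr_param r _ h) as (u & u1 & u2 & u3).
    { rewrite fy. apply expp_far; [apply posR|]. apply HR_R. auto. }
    assert (uv : u = v).
    { apply linked_expp with (w r); auto. rewrite <- fy, <- u2. symmetry. apply f_T1. auto. }
    subst u. destruct (hxi r v hv) as (v' & x1 & x2 & x3). exists v'. split; [|split].
    + rewrite x1, u2. auto.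
    + auto.
    + intros k. rewrite x2, v3. f_equal. lia.
Qed.

Lemma shift_N t b : t1 <= t -> blog (lam * t) b -> exists b', blog t b' /\ forall k, T 0%nat k b' = T 0%nat (N + k)%nat b.
Proof.
  intros ht hb. destruct (descend t b ht hb N (Nat.le_refl _)) as (v & v1 & v2 & v3).
  rewrite Nat.sub_diag in v1. destruct (per_mul n 0) as [e1 e2]. simpl in e1, e2.
  exists v. fold N in e1, e2. rewrite e1 in v3. rewrite e2 in v2. split; [split; auto|]. auto.
Qed.

Let t2 := lam * t1.

Definition bl (t : Rdefinitions.R) : C := epsilon (inhabits (RtoC 0)) (blog t).

Lemma bl_spec t : t2 <= t -> blog t (bl t).
Proof.
  intros ht. refine (epsilon_spec (inhabits (RtoC 0)) (blog t) _). pose proof lam_ge. unfold t2 in ht.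
  destruct (blog_exists (t / lam)) as [b hb].
  - apply Rmult_le_reg_l with lam; [lra|]. replace (lam * (t / lam)) with t by (field; lra). auto.
  - exists b. replace (lam * (t / lam)) with t in hb by (field; lra). auto.
Qed.

Lemma t2_pos : t1 <= t2 /\ 0 < t2.
Proof. pose proof lam_ge. unfold t2. split; nra. Qed.

Lemma bl_HR t : t2 <= t -> HR R' (bl t).
Proof.
  intros ht. apply (expp_far p0); [pose proof posR; lra|]. rewrite (proj1 (bl_spec t ht)).
  apply (gfar t 0%nat). pose proof t2_pos. lra.
Qed.

(** A short change of logarithm stays in the open set [Lam], hence in the same component, so it
    leads to the chosen logarithm of the neighbouring point. *)
Lemma bl_cts a b t : t2 <= a -> icc a b t -> cwi dR (icc a b) bl t.
Proof.
  intros ha ht e he. assert (ht2 : t2 <= t) by (unfold icc in ht; lra).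
  destruct (bl_spec t ht2) as [e1 l1].
  assert (Lb : Lam D alpha p0 (bl t)) by (destruct l1 as (B & _ & s & _ & k); auto).
  destruct (open_Lam f D alpha p0 halpha _ Lb) as [eta [heta Heta]].
  assert (pe := exp_pos (fst (bl t))). set (E := exp (fst (bl t))) in *.
  set (d := Rmin (Rmin eta e) 1 / 4 * E).
  assert (m0 : 0 < Rmin (Rmin eta e) 1) by (repeat apply Rmin_pos; lra).
  assert (hd : d > 0) by (unfold d; nra).
  assert (tp : t > 0) by (pose proof t2_pos; lra). assert (ap : a > 0) by (pose proof t2_pos; lra).
  destruct (gcts t tp a b ap ht d hd) as [r [hr Hr]]. exists r. split; auto. intros s hs hst.
  specialize (Hr s hs hst). assert (hs2 : t2 <= s) by (unfold icc in hs; lra).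
  assert (nw := Cexp_neq_0 (bl t)). set (x := ((g s - g t) / Cexp (bl t))%C).
  assert (hx : Cmod x * E = Cmod (g s - g t)).
  { unfold x. rewrite Cmod_div, Cmod_Cexp by auto. fold E. field. lra. }
  assert (hx2 : Cmod x < Rmin (Rmin eta e) 1 / 4).
  { apply Rmult_lt_reg_r with E; auto. rewrite hx. exact Hr. }
  assert (m1 : Rmin (Rmin eta e) 1 <= 1) by apply Rmin_r.
  assert (m2 : Rmin (Rmin eta e) 1 <= Rmin eta e) by apply Rmin_l.
  assert (m3 := Rmin_l eta e). assert (m4 := Rmin_r eta e).
  destruct (log_near_1 x) as [y [Ey hy]]; [lra|].
  assert (E2 : (bl t + y)%C = bl s).
  { apply (blog_unique s); [|apply bl_spec; auto]. split.
    - assert (k : (x * Cexp (bl t) = g s - g t)%C) by (unfold x; field; auto).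
      unfold expp in *. rewrite Cexp_plus, Ey.
      replace (p0 + Cexp (bl t) * (1 + x))%C with ((p0 + Cexp (bl t)) + x * Cexp (bl t))%C by ring. rewrite k, e1. ring.
    - apply linked_trans with (bl t); auto. apply linked_seg. intros tt htt. apply Heta.
      change (Cmod (seg (bl t) (bl t + y) tt - bl t) < eta). unfold seg.
      replace (bl t + tt * (bl t + y - bl t) - bl t)%C with (tt * y)%C by ring.
      rewrite Cmod_mult, Cmod_R, Rabs_pos_eq by lra. pose proof (Cmod_ge_0 y). nra. }
  rewrite <- E2. replace (bl t + y - bl t)%C with y by ring. lra.
Qed.

Lemma shift_mul k t : t1 <= t -> t2 <= lam ^ k * t -> (k = 0%nat \/ t2 <= t) ->
  forall m, T 0%nat (k * N + m)%nat (bl (lam ^ k * t)) = T 0%nat m (bl t).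
Proof.
  revert t. induction k as [|k IH]; intros t h1 h2 h3 m.
  - simpl. rewrite Rmult_1_l. auto.
  - destruct h3 as [h3|h3]; [lia|]. pose proof lam_ge. pose proof t2_pos.
    assert (pk : 1 <= lam ^ k) by (apply pow_R1_Rle; lra).
    assert (h4 : t2 <= lam ^ k * (lam * t)).
    { assert (t <= lam * t) by nra. assert (lam * t <= lam ^ k * (lam * t)) by nra. lra. }
    replace (lam ^ S k * t) with (lam ^ k * (lam * t)) by (simpl; ring).
    replace (S k * N + m)%nat with (k * N + (N + m))%nat by lia.
    rewrite IH; [|nra|auto|right; nra].
    destruct (shift_N t (bl (lam * t)) h1) as [b' [hb Hb]]; [apply bl_spec; nra|].
    rewrite <- Hb. rewrite (blog_unique t b' (bl t) hb (bl_spec t h3)). auto.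
Qed.

(* Both sides lift the ray through f^{kN}; they agree for large t, hence for all t. *)
Lemma orbit_is_ray k t : t2 <= t -> T 0%nat (k * N)%nat (bl t) = g (t / lam ^ k).
Proof.
  intros ht. pose proof lam_ge as l2. pose proof t2_pos as [tp1 tp2].
  assert (pk : 1 <= lam ^ k) by (apply pow_R1_Rle; lra).
  set (b := lam ^ k * t).
  assert (tb : t <= b) by (unfold b; nra).
  apply (path_unique (iter (k * N) f) (itd f f' (k * N)) t b (fun s => T 0%nat (k * N)%nat (bl s)) (fun s => g (s / lam ^ k)) b).
  - apply is_deriv_iter. auto.
  - intros s hs. assert (hs2 : t2 <= s) by (unfold icc in hs; lra).
    assert (HRs := HR_R _ (bl_HR s hs2)). assert (bs := proj1 (bl_spec s hs2)).
    assert (it : iter (k * N) f (T 0%nat (k * N)%nat (bl s)) = g s).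
    { rewrite <- bs. apply (tower_iter f (HR R) (expp p0) (T 0%nat) (k * N) (bl s) (hT 0%nat) HRs). }
    split; [|split; [|split]].
    + apply (cwi_comp dR dC _ (HR R)).
      * intros e he. destruct (bl_cts t b s ht hs e he) as [r [hr Hr]]. exists r. split; auto.
      * intros u hu. apply HR_R, bl_HR. unfold icc in hu. lra.
      * apply (hT 0%nat). auto.
    + assert (pl : 0 < t / lam ^ k) by (apply Rdiv_lt_0_compat; lra).
      assert (mono : forall u, icc t b u -> icc (t / lam ^ k) (b / lam ^ k) (u / lam ^ k)).
      { intros u hu. unfold icc in *. unfold Rdiv. assert (0 < / lam ^ k) by (apply Rinv_0_lt_compat; lra).
        split; apply Rmult_le_compat_r; lra. }
      apply (cwi_comp dR dR _ (icc (t / lam ^ k) (b / lam ^ k)) (fun s => s / lam ^ k) g).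
      * intros e he. exists e. split; auto. intros u _ hu. unfold dR in *.
        replace (u / lam ^ k - s / lam ^ k) with ((u - s) * / lam ^ k) by (field; lra).
        rewrite Rabs_mult, (Rabs_pos_eq (/ lam ^ k)) by (left; apply Rinv_0_lt_compat; lra).
        assert (/ lam ^ k <= 1) by (rewrite <- Rinv_1; apply Rinv_le_contravar; lra).
        assert (0 < / lam ^ k) by (apply Rinv_0_lt_compat; lra).
        pose proof (Rabs_pos (u - s)). nra.
      * exact mono.
      * apply gcts; auto. assert (k1 := mono s hs). unfold icc in k1. lra.
    + rewrite it. assert (0 < s / lam ^ k) by (apply Rdiv_lt_0_compat; lra). rewrite iter_N by auto.
      f_equal. field. lra.
    + apply itd_neq_0; auto. rewrite it. apply far_notP. assert (h := gfar s 0%nat ltac:(lra)). simpl in h. pose proof posR. lra.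
  - unfold icc. lra.
  - replace (b / lam ^ k) with t by (unfold b; field; lra).
    assert (e := shift_mul k t ltac:(lra) ltac:(fold b; lra) ltac:(right; lra) 0%nat). rewrite Nat.add_0_r in e.
    fold b in e. rewrite e. rewrite (proj1 (hT 0%nat) _ (HR_R _ (bl_HR t ht))). apply bl_spec. auto.
  - unfold icc. lra.
Qed.

(** Every small parameter is t / lam^k with t in the fundamental interval [t2, lam t2]. The
    logarithms over that interval form a bounded set, where the growth factor relative to [w 0] is
    uniform, so convergence at [w 0] gives uniform convergence. *)
Lemma ray_lands : lands_at g z0.
Proof.
  intros e he. pose proof lam_ge as l2. pose proof t2_pos as [tp1 tp2]. assert (R0 := posR).
  set (b := lam * t2). assert (tb : t2 <= b) by (unfold b; nra).
  destruct (icc_bounded t2 b bl tb) as [M HM].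
  { intros t ht. apply bl_cts; auto. lra. }
  set (E := exp (Rmax M (fst (w 0%nat)))).
  destruct (reach_exists R R' R0 E (M + Cmod (w 0%nat))) as [m hm].
  destruct (growth_reach f f' p0 z0 R R' Hf R0 far_notP hR' fz0 hz0 m E) as [c [c1 Hc]].
  destruct (conv (e / c)) as [K HK]; [apply Rdiv_lt_0_compat; lra|].
  assert (uni : forall k t, (K <= k)%nat -> icc t2 b t -> Cmod (g (t / lam ^ k) - z0) < e).
  { intros k t hk ht. assert (ht2 : t2 <= t) by (unfold icc in ht; lra). rewrite <- (orbit_is_ray k t ht2).
    assert (hN : (1 <= N)%nat) by (unfold N; nia).
    eapply Rle_lt_trans.
    - apply (Hc (T 0%nat) (k * N)%nat (w 0%nat) (bl t)); auto. apply hm; auto.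
      + apply bl_HR. auto.
      + apply exp_le_mono, Rmax_r.
      + apply exp_le_mono. eapply Rle_trans; [|apply Rmax_l]. specialize (HM t ht).
        pose proof (Rabs_fst_le (bl t)). pose proof (Rle_abs (fst (bl t))). lra.
      + specialize (HM t ht). unfold Cminus. eapply Rle_trans; [apply Cmod_triangle|]. rewrite Cmod_opp. lra.
    - specialize (HK (k * N)%nat ltac:(nia)). apply Rmult_lt_compat_l with (r := c) in HK; [|lra].
      replace (c * (e / c)) with e in HK by (field; lra). exact HK. }
  exists (t2 / lam ^ K). assert (pK : forall k, 1 <= lam ^ k) by (intros k; apply pow_R1_Rle; lra).
  split; [apply Rdiv_lt_0_compat; [lra|specialize (pK K); lra]|]. intros s [s0 s1].
  assert (ex : exists k, t2 <= lam ^ k * s).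
  { destruct (Pow_x_infinity lam) with (b := t2 / s) as [k hk].
    - rewrite Rabs_pos_eq; lra.
    - exists k. specialize (hk k (Nat.le_refl _)). rewrite Rabs_pos_eq in hk by (specialize (pK k); lra).
      apply Rge_le in hk. apply Rmult_le_compat_r with (r := s) in hk; [|lra].
      replace (t2 / s * s) with t2 in hk by (field; lra). auto. }
  destruct ex as [k0 hk0]. destruct (least_nat (fun k => t2 <= lam ^ k * s) k0 hk0) as (k & hk & _ & mk).
  assert (s1' : lam ^ K * s < t2).
  { specialize (pK K). apply Rmult_lt_compat_l with (r := lam ^ K) in s1; [|lra].
    replace (lam ^ K * (t2 / lam ^ K)) with t2 in s1 by (field; lra). auto. }
  assert (Kk : (K < k)%nat).
  { apply Nat.nle_gt. intros l. assert (lam ^ k <= lam ^ K) by (apply Rle_pow; [lra|auto]). 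
    assert (lam ^ k * s <= lam ^ K * s) by (apply Rmult_le_compat_r; lra). lra. }
  destruct k as [|k]; [lia|].
  assert (up : lam ^ k * s < t2).
  { apply Rnot_le_lt. intros l. specialize (mk k l). lia. }
  replace s with (lam ^ S k * s / lam ^ S k).
  2:{ field. specialize (pK (S k)). lra. }
  apply uni; [lia|]. unfold icc. split; auto. simpl. unfold b. nra.
Qed.
End Cycle.

(** * Conclusion *)

Lemma connected_ext (A B : C -> Prop) : (forall z, A z <-> B z) -> connected A -> connected B.
Proof.
  intros h cA (O1 & O2 & h1 & h2 & cov & dis & [y1 [k1 a1]] & [y2 [k2 a2]]). apply cA.
  exists O1, O2. split; [exact h1|]. split; [exact h2|]. split; [intros z hz; apply cov, h; auto|].
  split; [intros z hz; apply dis, h; auto|]. split; [exists y1|exists y2]; split; auto; apply h; auto.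
Qed.

(** The boundary curve is compact, so its complement is open, and D is a component of that
    complement. *)
Lemma jordan_region (D : C -> Prop) : jordan_domain D -> open_set D /\ connected D /\ exists p0, D p0.
Proof.
  intros (gam & gc & _ & _ & [x [Ax HD]] & _).
  set (A := fun z => ~ exists t, 0 <= t <= 1 /\ z = gam t) in *.
  assert (oA : open_set A).
  { intros z hz. destruct (closed_image_avoid gam 1 z) as [r [hr Hr]]; [lra| | |].
    - intros t ht e he. destruct (gc t ht e he) as [d [hd Hd]]. exists d. split; [exact hd|exact Hd].
    - intros t ht e. apply hz. exists t. auto.
    - exists r. split; auto. intros w hw [t [ht ->]]. specialize (Hr t ht).
      change (Cmod (gam t - z) < r) in hw. lra. }
  split; [|split].
  - intros z hz. destruct (comp_open A x oA z) as [r [hr Hr]]; [apply HD; auto|]. exists r. split; auto.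
    intros w hw. apply HD. auto.
  - apply connected_ext with (comp A x); [|apply comp_connected; auto]. intros z. symmetry. apply HD.
  - exists x. apply HD. apply comp_self. auto.
Qed.

Section Main.
Context (f f' : C -> C) (D : C -> Prop) (alpha : R -> C) (p0 : C) (RD : R).
Context (Hf : is_deriv f f') (Dopen : open_set D) (Dconn : connected D) (Dp0 : D p0)
  (Dbd : forall z, D z -> Cmod (z - p0) < RD) (hPD : forall z, P_f f z -> D z)
  (halpha : admissible_alpha f D alpha).

(* Since f is bounded on the unbounded curve alpha, no iterate of f is the identity. *)
Lemma iter_not_id q : (1 <= q)%nat -> exists z, iter q f z <> z.
Proof.
  intros hq. apply NNPP. intros no.
  assert (id : forall z, iter q f z = z).
  { intros z. apply NNPP. intros n. apply no. eauto. }
  destruct (iter_bounded f f' p0 RD q Hf) as [B HB].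
  destruct halpha as (_ & _ & _ & _ & inf & na). destruct (inf B) as [T HT].
  set (t := Rmax T 0). assert (t0 : t >= 0) by apply Rle_ge, Rmax_r.
  assert (h := HT t (Rle_ge _ _ (Rmax_l _ _))). change (Cmod (alpha t) > B) in h.
  assert (b : Cmod (iter (q - 1) f (f (alpha t))) <= B).
  { apply HB; [lia|]. apply (closure_bound D p0 RD Dbd). apply NNPP. apply (na t t0). }
  rewrite <- iter_S_in in b. replace (S (q - 1)) with q in b by lia. rewrite id in b. lra.
Qed.

(** As alpha avoids all tracts, f maps it off the exterior of D; a point with far image is therefore
    not on alpha. *)
Lemma Aal_of_far z : RD < Cmod (z - p0) -> RD < Cmod (f z - p0) -> Aal D alpha z.
Proof.
  intros h1 h2. split; [apply (outer_far D p0 RD Dbd); auto|]. intros t ht ->.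
  destruct halpha as (_ & _ & _ & _ & _ & na). apply (na t ht). apply (outer_far D p0 RD Dbd). auto.
Qed.

Lemma preimage_far (M : R) : exists M', forall z, M' < Cmod (f z - p0) -> M < Cmod (z - p0).
Proof.
  destruct (cts_bounded (fun z => f z - p0)%C p0 M) as [B HB].
  { intros z. apply cwi_minus; [apply (is_deriv_cts _ _ Hf)|apply cwi_const]. }
  exists B. intros z h. apply Rnot_le_lt. intros l. specialize (HB z l). lra.
Qed.

Context (hrays : forall s : nat -> CSet, external_address f D alpha s -> periodic_address s ->
      exists g, periodic_ray f g /\ ray_has_address f g s).

(** The constant address of the fundamental domain through [z] is periodic. Any point far out on its
    ray escapes, by the doubling relation and [ray_far]. *)
Lemma escaping_point z r M : Aal D alpha (f z) -> exists y N, M < Cmod (y - p0) /\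
  forall m, (N <= m)%nat -> ~ Cmod (iter m f y - y) < r.
Proof.
  intros hz. destruct (hrays (fun _ => fdom f D alpha z)) as (g & (gc & gi & inf & n & hn & gd) & _).
  - intros _. apply fdom_fundamental. auto.
  - exists 1%nat. split; [lia|]. intros k w. tauto.
  - destruct (ray_far f f' p0 n g M Hf hn inf gd) as [t1 [ht1 H1]].
    destruct (ray_far f f' p0 n g (Cmod (g t1 - p0) + r) Hf hn inf gd) as [t2 [ht2 H2]].
    destruct (Pow_x_infinity 2) with (b := t2 / t1) as [k hk]; [rewrite Rabs_pos_eq; lra|].
    specialize (hk k (Nat.le_refl _)). assert (pk : 0 < 2 ^ k) by (apply pow_lt; lra).
    rewrite Rabs_pos_eq in hk by lra.
    exists (g t1), (k * n)%nat. split; [apply (H1 t1 0%nat); lra|]. intros m hm l.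
    assert (e : iter m f (g t1) = iter (m - k * n) f (g (2 ^ k * t1))).
    { rewrite <- (ray_double f n g gd k t1 ht1), <- iter_add. f_equal. lia. }
    rewrite e in l. assert (h := H2 (2 ^ k * t1) (m - k * n)%nat).
    assert (t2 <= 2 ^ k * t1).
    { apply Rge_le in hk. apply Rmult_le_compat_r with (r := t1) in hk; [|lra].
      replace (t2 / t1 * t1) with t2 in hk by (field; lra). auto. }
    specialize (h H). pose proof (Cmod_tri (iter (m - k * n) f (g (2 ^ k * t1))) (g t1) p0). lra.
Qed.

(** [xi] is the first branch [T1 1] in logarithmic coordinates. The branches of T2 after [xi] and
    the shifted branches of T1 invert the same iterates and agree at w', hence everywhere; the image
    of the half-plane under [xi] is a connected subset of [Lam]. *)
Lemma transfer ra rb T1 T2 w' v : 3 * RD <= ra -> 2 * ra <= rb ->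
  (forall z, rb < Cmod (f z - p0) -> ra < Cmod (z - p0)) -> towerR f p0 ra T1 -> towerR f p0 ra T2 -> HR rb w' ->
  expp p0 v = T1 1%nat w' -> (forall n, T2 n v = T1 (S n) w') -> forall u, HR rb u ->
  exists u', expp p0 u' = T1 1%nat u /\ (forall n, T2 n u' = T1 (S n) u) /\ linked (Lam D alpha p0) v u'.
Proof.
  intros hra hrb pull t1 t2 hw' ev E u hu. assert (prd := RD_pos D p0 RD Dp0 Dbd).
  assert (mono : forall x, HR rb x -> HR ra x) by (intros x; apply (HR_mono p0); lra).
  assert (fT : forall x, HR rb x -> f (T1 1%nat x) = expp p0 x).
  { intros x hx. rewrite (proj2 (proj2 t1 0%nat x (mono x hx))). apply t1. auto. }
  assert (far : forall x, HR rb x -> ra < Cmod (T1 1%nat x - p0)).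
  { intros x hx. apply pull. rewrite fT by auto. apply expp_far; auto. lra. }
  destruct (convex_lift Cexp Cexp (HR rb) (fun x => T1 1%nat x - p0)%C w' v is_deriv_Cexp (convex_HR rb) hw') as [xi [x0 Hx]].
  - intros x hx. apply cwi_minus; [|apply cwi_const]. eapply cwi_sub; [exact mono|]. apply t1. auto.
  - intros x hx. apply nonsing_Cexp. intros Z. specialize (far x hx). rewrite Z, Cmod_0 in far. lra.
  - rewrite <- ev. unfold expp. ring.
  - assert (ex : forall x, HR rb x -> expp p0 (xi x) = T1 1%nat x).
    { intros x hx. unfold expp. rewrite (proj2 (Hx x hx)). ring. }
    assert (hxi : forall x, HR rb x -> HR ra (xi x)).
    { intros x hx. apply (expp_far p0); [lra|]. rewrite ex; auto. }
    exists (xi u). split; [auto|]. split.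
    + intros n.
      assert (it1 : forall x, HR rb x -> iter n f (T1 (S n) x) = T1 1%nat x).
      { intros x hx. replace (S n) with (n + 1)%nat by lia.
        apply (backorbit_iter f (fun n => T1 n x) n 1). exact (tower_backorbit _ _ _ _ _ t1 (mono x hx)). }
      assert (it2 : forall x, HR rb x -> iter n f (T2 n (xi x)) = T1 1%nat x).
      { intros x hx. rewrite <- ex by auto. apply (tower_iter f (HR ra) (expp p0) T2 n _ t2). auto. }
      apply (section_unique (iter n f) (itd f f' n) (HR rb) w' (fun x => T2 n (xi x)) (T1 (S n))); auto using is_deriv_iter, convex_HR.
      * intros x hx. apply (cwi_comp dC dC _ (HR ra)); auto.
        -- apply (Hx x hx).
        -- apply t2. auto.
      * intros x hx. eapply cwi_sub; [exact mono|]. apply t1. auto.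
      * intros x hx. rewrite it1, it2; auto.
      * intros x hx. apply itd_neq_0; auto. rewrite it2 by auto.
        apply (outer_notP f D hPD), (outer_far D p0 RD Dbd). specialize (far x hx). lra.
      * rewrite x0. auto.
    + exists (fun y => exists x, HR rb x /\ y = xi x). split; [|split; [|split]].
      * apply connected_image_convex; [apply convex_HR|]. intros x hx. apply Hx. auto.
      * intros y [x [hx ->]]. change (Aal D alpha (expp p0 (xi x))). rewrite ex by auto. apply Aal_of_far.
        -- specialize (far x hx). lra.
        -- rewrite fT by auto. apply (expp_far p0) in hx; lra.
      * exists w'. split; auto.
      * exists u. split; auto.
Qed.

Lemma landing_ray z0 : repelling_fixed_point f z0 \/ parabolic_fixed_point f z0 ->
  exists g, periodic_ray f g /\ lands_at g z0.
Proof.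
  intros hz. assert (prd := RD_pos D p0 RD Dp0 Dbd).
  destruct (local_sector f f' z0 Hf hz iter_not_id) as (fz0 & d0 & unb & secs).
  (* [3 * RD] is the margin of [tract_param], 1 gives first entries distance at least 1 from z0, and
     the last term makes z0 an omitted value. *)
  set (ra := Rmax (3 * RD) (Rmax 1 (Cmod (z0 - p0)))).
  assert (ra1 : 3 * RD <= ra) by apply Rmax_l.
  assert (ra2 : 1 <= ra) by (eapply Rle_trans; [apply Rmax_l|apply Rmax_r]).
  assert (ra3 : Cmod (z0 - p0) <= ra) by (eapply Rle_trans; [apply Rmax_r|apply Rmax_r]).
  assert (hP : forall z, ra < Cmod (z - p0) -> ~ P_f f z).
  { intros z h. apply (outer_notP f D hPD), (outer_far D p0 RD Dbd). lra. }
  (* Discs of radius ra about points beyond rb stay beyond ra, and one preimage costs one level: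
     from beyond rc to beyond rb, from beyond rb to beyond ra. *)
  destruct (preimage_far ra) as [m1 hm1]. set (rb := Rmax (2 * ra) m1).
  assert (rb1 : 2 * ra <= rb) by apply Rmax_l. assert (rb2 : m1 <= rb) by apply Rmax_r.
  assert (pull1 : forall z, rb < Cmod (f z - p0) -> ra < Cmod (z - p0)) by (intros z h; apply hm1; lra).
  destruct (preimage_far rb) as [m2 hm2]. set (rc := Rmax rb m2).
  assert (rc1 : rb <= rc) by apply Rmax_l. assert (rc2 : m2 <= rc) by apply Rmax_r.
  assert (pull2 : forall z, rc < Cmod (f z - p0) -> rb < Cmod (z - p0)) by (intros z h; apply hm2; lra).
  destruct (inverse_function f f' z0 1 Hf (deriv_cts f f' Hf) d0) as (rhoi & rr & kk & hrhoi & _ & low & _); [lra|].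
  assert (inj : forall u v, Cmod (u - z0) < rhoi -> Cmod (v - z0) < rhoi -> f u = f v -> u = v).
  { intros u v hu hv e. specialize (low u v hu hv). rewrite e, Cmod_sub_eq in low.
    apply Cmod_sub_0. assert (0 < Cmod (f' z0)) by (apply Cmod_gt_0; auto). pose proof (Cmod_ge_0 (u - v)). nra. }
  pose proof Kd_ge_1 as K1.
  (* Divided by [Kd] so that growth within a disc does not lead out of the disc where f is
     injective. *)
  destruct (secs (Rmin 1 (rhoi / Kd))) as (q & Q & r1 & delta & sec & hr1).
  { apply Rmin_pos; [lra|apply Rdiv_lt_0_compat; lra]. }
  assert (r11 : r1 <= 1) by (eapply Rle_trans; [exact hr1|apply Rmin_l]).
  assert (r12 : Kd * r1 <= rhoi).
  { assert (h : r1 <= rhoi / Kd) by (eapply Rle_trans; [exact hr1|apply Rmin_r]).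
    apply Rmult_le_compat_l with (r := Kd) in h; [|lra]. replace (Kd * (rhoi / Kd)) with rhoi in h by (field; lra). auto. }
  (* Distances in [unbounded_back] are measured from z0, so |z0 - p0| is added to bring the first
     entry beyond rc. *)
  destruct (unb (rc + Cmod (z0 - p0))) as (x & bx & tx & fx).
  assert (fx0 : rc < Cmod (x 0%nat - p0)).
  { pose proof (Cmod_tri (x 0%nat) p0 z0). rewrite (Cmod_sym p0 z0) in H. lra. }
  assert (fx1 : rb < Cmod (x 1%nat - p0)) by (apply pull2; rewrite bx; auto).
  destruct (escaping_point (x 2%nat) ra rb) as (y & N0 & hy & esc).
  { rewrite bx. apply Aal_of_far; [lra|]. rewrite bx. lra. }
  assert (XOx : XO f p0 z0 rb x) by (split; [auto|split; [auto|lra]]).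
  assert (se := step_exists f f' p0 z0 ra rb rc Hf ra2 hP rb1 rc1 fz0 ra3 pull2).
  assert (se' : forall x, exists x', XO f p0 z0 rb x -> Step f p0 ra rb rc x x' /\ XO f p0 z0 rb x').
  { intros v. destruct (classic (XO f p0 z0 rb v)) as [h|h]; [|exists v; contradiction].
    destruct (se v h) as [v' hv']. exists v'. auto. }
  set (nx := fun x => proj1_sig (constructive_indefinite_description _ (se' x))).
  assert (hnx : forall x, XO f p0 z0 rb x -> Step f p0 ra rb rc x (nx x) /\ XO f p0 z0 rb (nx x)).
  { intros v. unfold nx. destruct constructive_indefinite_description. auto. }
  set (Y := fix Y k := match k with O => x | S k => nx (Y k) end).
  assert (hY : forall k, XO f p0 z0 rb (Y k)).
  { induction k as [|k IH]; [exact XOx|]. apply (hnx (Y k) IH). }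
  (* The initial orbit is left out: every [X k] results from a step, so f (X k 0) lies beyond rc and
     X k 0 is off alpha. *)
  set (X := fun k => Y (S k)).
  assert (hX : forall k, XO f p0 z0 rb (X k)) by (intros k; apply hY).
  assert (hS : forall k, Step f p0 ra rb rc (X k) (X (S k))) by (intros k; apply (hnx (Y (S k)) (hY (S k)))).
  assert (XA : forall k, Aal D alpha (X k 0%nat)).
  { intros k. destruct (proj1 (hnx (Y k) (hY k))) as (T & w & w' & tT & h1 & h2 & h3 & h4 & _).
    change (nx (Y k)) with (X k) in h4. assert (hw : HR ra w') by (apply (HR_mono p0 ra rc); auto; lra).
    assert (e : f (X k 0%nat) = expp p0 w').
    { rewrite <- h4, (proj2 (proj2 tT 0%nat w' hw)). apply tT. auto. }
    apply Aal_of_far; [destruct (hX k) as (_ & _ & h); lra|]. rewrite e. apply (expp_far p0) in h2; lra. }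
  destruct (recurrence f f' p0 z0 ra rb rc Hf ra2 hP rb1 rc1 fz0 ra3 q Q r1 delta rhoi sec r11 r12 inj y N0 hy esc X hX hS)
    as (yy & y1 & y2 & rec).
  assert (Ay : Aal D alpha yy) by (apply Aal_of_far; lra).
  (* The recurrence is required inside a disc contained in [Aal], so that the segment between the
     two logarithms lies in [Lam]. *)
  destruct (open_Aal f D alpha halpha yy Ay) as [rho [hrho Hrho]].
  destruct (rec rho hrho) as (i & j & ij & Hij).
  assert (hS' : forall k, exists a : (nat -> C -> C) * C * C, stepdata f p0 ra rb rc (X k) (X (S k)) (fst (fst a)) (snd (fst a)) (snd a)).
  { intros k. destruct (hS k) as (T & w & w' & h). exists (T, w, w'). exact h. }
  set (dat := fun k => proj1_sig (constructive_indefinite_description _ (hS' k))).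
  assert (hdat : forall k, stepdata f p0 ra rb rc (X k) (X (S k)) (fst (fst (dat k))) (snd (fst (dat k))) (snd (dat k))).
  { intros k. unfold dat. destruct constructive_indefinite_description. auto. }
  set (Tk := fun k => fst (fst (dat k))) in *. set (wk := fun k => snd (fst (dat k))) in *. set (wk' := fun k => snd (dat k)) in *.
  assert (hd : forall k, stepdata f p0 ra rb rc (X k) (X (S k)) (Tk k) (wk k) (wk' k)) by exact hdat.
  clearbody Tk wk wk'.
  assert (tT : forall k, towerR f p0 ra (Tk k)) by (intros k; apply hd).
  assert (hwk : forall k, HR rb (wk k)) by (intros k; apply hd).
  assert (hwk' : forall k, HR rb (wk' k)).
  { intros k. apply (HR_mono p0 rb rc); [lra|lra|]. apply hd. }
  assert (Tw : forall k n, Tk k n (wk k) = X k n) by (intros k; apply hd).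
  assert (Tw' : forall k n, Tk k (S n) (wk' k) = X (S k) n) by (intros k; apply hd).
  assert (toa : forall v, HR rb v -> HR ra v) by (intros v; apply (HR_mono p0); lra).
  assert (ew : forall k, expp p0 (wk k) = X k 0%nat).
  { intros k. rewrite <- Tw. symmetry. apply (tT k). auto. }
  destruct (Hij (Tk i) (wk i) (tT i) (hwk i) (Tw i)) as (w1 & hw1 & E1 & sg).
  assert (lk1 : linked (Lam D alpha p0) (wk i) w1).
  { apply linked_seg. intros t ht. apply Hrho. exact (sg t ht). }
  assert (ew1 : expp p0 w1 = X j 0%nat).
  { rewrite <- E1. symmetry. apply (tT i). auto. }
  (* The towers of the orbits i, ..., j - 1 are repeated periodically; the tower of orbit j is
     replaced by that of orbit i, which contains orbit j over [w1]. *)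
  set (p := (j - i)%nat). assert (hp : (1 <= p)%nat) by (unfold p; lia).
  set (T := fun r => Tk (i + r mod p)%nat). set (w := fun r => wk (i + r mod p)%nat).
  assert (md : forall r, ((r + p) mod p = r mod p)%nat).
  { intros r. replace (r + p)%nat with (r + 1 * p)%nat by lia. apply Nat.Div0.mod_add. }
  assert (hxi : forall r v, HR rb v -> exists v', expp p0 v' = T r 1%nat v /\
     (forall n, T (S r) n v' = T r (S n) v) /\ linked (Lam D alpha p0) (w (S r)) v').
  { intros r v hv. set (c := (r mod p)%nat). assert (cp : (c < p)%nat) by (apply Nat.mod_upper_bound; lia).
    assert (Sm : (S r mod p = S c mod p)%nat).
    { unfold c. replace (S r) with (r + 1)%nat by lia. replace (S (r mod p)) with (r mod p + 1)%nat by lia.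
      symmetry. apply Nat.Div0.add_mod_idemp_l. }
    unfold T, w. rewrite Sm. fold c. destruct (Nat.eq_dec (S c) p) as [e|ne].
    - rewrite e, Nat.Div0.mod_same, Nat.add_0_r.
      assert (ej : S (i + c) = j) by (unfold p in e; lia).
      destruct (transfer ra rb (Tk (i + c)%nat) (Tk i) (wk' (i + c)%nat) w1 ra1 rb1 pull1 (tT _) (tT _) (hwk' _)) with (u := v)
        as (u' & u1 & u2 & u3); auto.
      + rewrite ew1, Tw', ej. auto.
      + intros n. rewrite E1, Tw', ej. auto.
      + exists u'. split; auto. split; auto. apply linked_trans with w1; auto.
    - rewrite (Nat.mod_small (S c) p) by lia. rewrite Nat.add_succ_r.
      apply (transfer ra rb (Tk (i + c)%nat) (Tk (S (i + c))) (wk' (i + c)%nat) (wk (S (i + c)))); auto.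
      + rewrite ew, Tw'. auto.
      + intros n. rewrite Tw, Tw'. auto. }
  assert (wL : forall r, Lam D alpha p0 (w r)).
  { intros r. change (Aal D alpha (expp p0 (w r))). unfold w. rewrite ew. apply XA. }
  assert (hTr : forall r, towerR f p0 ra (T r)) by (intros r; apply tT).
  assert (hwr : forall r, HR rb (w r)) by (intros r; apply hwk).
  destruct (hrays (addr f D alpha p T w)) as (g & pr & [t0 [ht0 ad]]).
  - apply (addr_external f D alpha p0 RD Dp0 Dbd ra rb ra1 rb1 p T w hTr hwr wL).
  - apply addr_periodic. auto.
  - exists g. split; auto. destruct pr as (gc & gi & inf & n & hn & gd).
    destruct (ray_far f f' p0 n g rb Hf hn inf gd) as [t1 [ht1 H1]].
    assert (m3 := Rmax_l t0 t1). assert (m4 := Rmax_r t0 t1).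
    apply (ray_lands f f' D alpha p0 RD Hf Dopen Dconn Dp0 Dbd hPD halpha z0 ra rb ra1 rb1 fz0 ra3 p T w hp hTr hwr wL)
      with (n := n) (t1 := Rmax t0 t1); auto.
    + intros r. unfold T. rewrite md. auto.
    + intros r. unfold w. rewrite md. auto.
    + destruct (hX (i + 0 mod p)%nat) as (_ & tX & _). intros e he. destruct (tX e he) as [N HN]. exists N.
      intros m hm. unfold T, w. rewrite Tw. auto.
    + lra.
    + intros t ht a b ha htab e he. destruct (gc t ht e he) as [d [hd' Hd]]. exists d. split; [exact hd'|].
      intros s hs hst. apply Hd; [unfold icc in hs; lra|exact hst].
    + intros m t ht. apply ad. lra.
    + intros t m ht. apply H1. lra.
Qed.
End Main.

Theorem mainTheorem11 (f : Cplx -> Cplx) (z0 : Cplx) (U : CSet)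
  (hf : transcendental_entire f)
  (hz0 : repelling_fixed_point f z0 \/ parabolic_fixed_point f z0)
  (hU : admissible_expansion_domain f z0 U)
  (D : CSet) (alpha : R -> Cplx)
  (hD : jordan_domain D) (hPD : forall z, P_f f z -> D z)
  (halpha : admissible_alpha f D alpha)
  (hrays : forall s : nat -> CSet, external_address f D alpha s -> periodic_address s ->
      exists g, periodic_ray f g /\ ray_has_address f g s) :
  exists g, periodic_ray f g /\ lands_at g z0.
Proof.
  destruct hf as [ent _]. destruct (entire_deriv f ent) as [f' Hf].
  destruct (jordan_region D hD) as (Dopen & Dconn & [p0 Dp0]).
  destruct hD as (gam & _ & _ & _ & _ & [M HM]).
  apply (landing_ray f f' D alpha p0 (M + Cmod p0 + 1)); auto.
  intros z hz. specialize (HM z hz). change (Cmod z <= M) in HM.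
  unfold Cminus. eapply Rle_lt_trans; [apply Cmod_triangle|]. rewrite Cmod_opp. lra.
Qed.
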